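(* Let $s>3/2$, and fix $\psi\in H^s(\mathbb{T})$ and $\gamma\in\mathbb{R}$. Then the map $$G(\cdot,\cdot,\gamma)(\psi):\ \{(\eta,\beta)\in H^s(\mathbb{T})\times H^s(\mathbb{T}) : \exists\, h_0>0 \text{ such that } h-\beta(x)+\eta(x)\ge h_0\ \ \forall x\in\mathbb{T}\}\ \to\ H^{s-1}(\mathbb{T}),\qquad (\eta,\beta)\mapsto G(\eta,\beta,\gamma)(\psi),$$ is analytic.
   Context: $\mathbb{T}=\mathbb{R}/(2\pi\mathbb{Z})$; $h>0$ is a fixed depth; $H^s(\mathbb{T})$ is the usual ($2\pi$-periodic) Sobolev space. For $\eta,\beta:\mathbb{T}\to\mathbb{R}$ put $D_{\eta,\beta}=\{(x,y)\in\mathbb{T}\times\mathbb{R}: -h+\beta(x)<y<\eta(x)\}$. Given $\psi:\mathbb{T}\to\mathbb{R}$ and $\gamma\in\mathbb{R}$ let $\varphi$ be the solution of the elliptic boundary value problem $$\Delta\varphi=0 \text{ in } D_{\eta,\beta},\qquad \varphi=\psi \text{ at } y=\eta,\qquad \gamma\, y\,\beta_x-\varphi_x\beta_x+\varphi_y=0 \text{ at } y=-h+\beta .$$ The operator $G(\eta,\beta,\gamma)$ is defined by $$G(\eta,\beta,\gamma)(\psi)=\nabla\varphi\cdot \mathbf{N}\,|_{y=\eta(x)},\qquad \mathbf{N}=(-\eta_x,1)^T .$$ (It is affine in $\psi$; for $\gamma=0$ it is the classical Dirichlet--Neumann operator.) *)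

(* Defs.v *)
From HB Require Import structures.
From mathcomp Require Import all_boot all_order all_algebra perm.
From mathcomp Require Import ring lra.
From mathcomp Require Import all_classical all_reals all_analysis.

Set Implicit Arguments.
Unset Strict Implicit.
Unset Printing Implicit Defensive.

Import Order.TTheory GRing.Theory Num.Theory.
Import numFieldNormedType.Exports.

Local Open Scope classical_set_scope.
Local Open Scope ring_scope.

Section Fourier.
Context {R : realType}.
Implicit Types (f g : R -> R) (k : int) (s : R).

Notation mu := (@lebesgue_measure R).
Notation D := (`[0, pi *+ 2]%classic : set R).

Definition fourier_cos f k : R :=
  (pi *+ 2)^-1 * \int[mu]_(x in D) (f x * cos (k%:~R * x)).
Definition fourier_sin f k : R :=
  (pi *+ 2)^-1 * \int[mu]_(x in D) (f x * sin (k%:~R * x)).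

(* |c_k|^2 for c_k = (2 pi)^-1 \int_0^{2 pi} f(x) e^{-ikx} dx, f real-valued. *)
Definition fourier_sqnorm f k : R := fourier_cos f k ^+ 2 + fourier_sin f k ^+ 2.

Lemma twopi_gt0 : 0 < pi *+ 2 :> R.
Proof. by rewrite mulrn_wgt0// pi_gt0. Qed.

Lemma continuous_integrable f : continuous f -> mu.-integrable D (EFin \o f).
Proof.
move=> cf; apply: continuous_compact_integrable; first exact: segment_compact.
exact: continuous_subspaceT.
Qed.

Lemma continuous_cosk (a : R) : continuous (fun x : R => cos (a * x)).
Proof.
move=> x; apply: (@continuous_comp _ _ _ ( *%R a) cos); last exact: continuous_cos.
exact: mulrl_continuous.
Qed.

Lemma continuous_sink (a : R) : continuous (fun x : R => sin (a * x)).
Proof.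
move=> x; apply: (@continuous_comp _ _ _ ( *%R a) sin); last exact: continuous_sin.
exact: mulrl_continuous.
Qed.

Lemma continuous_mulf f g : continuous f -> continuous g ->
  continuous (fun x => f x * g x).
Proof. by move=> cf cg x; apply: continuousM; [exact: cf|exact: cg]. Qed.

Lemma RintegralDf f g (h : R -> R) : continuous f -> continuous g -> continuous h ->
  forall a, \int[mu]_(x in D) ((a * f x + g x) * h x) =
  a * \int[mu]_(x in D) (f x * h x) + \int[mu]_(x in D) (g x * h x).
Proof.
move=> cf cg ch a.
have c1 := continuous_mulf cf ch; have c2 := continuous_mulf cg ch.
rewrite -RintegralZl//; last exact: continuous_integrable.
rewrite -RintegralD//.
- by apply: eq_Rintegral => x _; ring.
- exact: continuous_integrable (continuous_mulf (@cst_continuous _ _ a) c1).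
- exact: continuous_integrable.
Qed.

Lemma fourier_cosP f g k (a : R) : continuous f -> continuous g ->
  fourier_cos (a *: f + g) k = a * fourier_cos f k + fourier_cos g k.
Proof.
move=> cf cg; rewrite /fourier_cos.
rewrite [X in _ * X](_ : _ = \int[mu]_(x in D) ((a * f x + g x) * cos (k%:~R * x)))//.
rewrite RintegralDf//; last exact: continuous_cosk.
by ring.
Qed.

Lemma fourier_sinP f g k (a : R) : continuous f -> continuous g ->
  fourier_sin (a *: f + g) k = a * fourier_sin f k + fourier_sin g k.
Proof.
move=> cf cg; rewrite /fourier_sin.
rewrite [X in _ * X](_ : _ = \int[mu]_(x in D) ((a * f x + g x) * sin (k%:~R * x)))//.
rewrite RintegralDf//; last exact: continuous_sink.
by ring.
Qed.

Lemma continuous_addf f g : continuous f -> continuous g ->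
  continuous (fun x => f x + g x).
Proof. by move=> cf cg x; apply: continuousD; [exact: cf|exact: cg]. Qed.

Lemma continuous_cosB (x0 : R) : continuous (fun x : R => cos (x - x0)).
Proof.
move=> x; apply: (@continuous_comp _ _ _ (fun x => x - x0) cos); last exact: continuous_cos.
by apply: continuousB; [exact: cvg_id|exact: cst_continuous].
Qed.

Lemma Rintegral_lin3 f g h (a b : R) : continuous f -> continuous g -> continuous h ->
  \int[mu]_(x in D) (f x + a * g x + b * h x) =
  \int[mu]_(x in D) f x + a * \int[mu]_(x in D) g x + b * \int[mu]_(x in D) h x.
Proof.
move=> cf cg ch.
have cag := continuous_mulf (@cst_continuous _ _ a) cg.
have cbh := continuous_mulf (@cst_continuous _ _ b) ch.
have cfg : continuous (fun x => f x + a * g x).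
  exact: continuous_addf.
rewrite RintegralD ?RintegralD ?RintegralZl//; exact: continuous_integrable.
Qed.

Lemma fourier_kernel f x0 :
  continuous f ->
  (forall k, \int[mu]_(x in D) (f x * cos (k%:~R * x)) = 0) ->
  (forall k, \int[mu]_(x in D) (f x * sin (k%:~R * x)) = 0) ->
  forall n, \int[mu]_(x in D) (f x * (1 + cos (x - x0)) ^+ n) = 0.
Proof.
move=> cf f0 g0 n.
pose T x : R := 1 + cos (x - x0).
have cT : continuous T.
  rewrite /T; apply: continuous_addf; [exact: cst_continuous|exact: continuous_cosB].
have cTn m : continuous (fun x => f x * T x ^+ m).
  elim: m => [|m ih].
    by under eq_fun do rewrite expr0 mulr1.
  by under eq_fun do rewrite exprSr mulrA; exact: continuous_mulf.
have cc m (j : int) := continuous_mulf (cTn m) (continuous_cosk (a := j%:~R)).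
have cs m (j : int) := continuous_mulf (cTn m) (continuous_sink (a := j%:~R)).
suff H : forall k, \int[mu]_(x in D) (f x * T x ^+ n * cos (k%:~R * x)) = 0 /\
    \int[mu]_(x in D) (f x * T x ^+ n * sin (k%:~R * x)) = 0.
  rewrite -[RHS](H 0).1; apply: eq_Rintegral => x _.
  by rewrite mul0r cos0 mulr1.
elim: n => [k|n ih k].
  by split; [rewrite -[RHS](f0 k)|rewrite -[RHS](g0 k)];
    apply: eq_Rintegral => x _; rewrite expr0 mulr1.
have E1 x : ((k + 1)%:~R : R) * x = k%:~R * x + x by rewrite intrD mulrDl mul1r.
have E2 x : ((k - 1)%:~R : R) * x = k%:~R * x - x by rewrite intrB mulrBl mul1r.
split.
- transitivity (\int[mu]_(x in D) (f x * T x ^+ n * cos (k%:~R * x) +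
      2^-1 * (f x * T x ^+ n * cos ((k + 1)%:~R * x) * cos x0
        + f x * T x ^+ n * sin ((k + 1)%:~R * x) * sin x0)
    + 2^-1 * (f x * T x ^+ n * cos ((k - 1)%:~R * x) * cos x0
        - f x * T x ^+ n * sin ((k - 1)%:~R * x) * sin x0))).
    apply: eq_Rintegral => x _; rewrite exprSr {2}/T E1 E2 !cosD !sinD !cosN !sinN.
    by field.
  have i1 (c : R) a j : \int[mu]_(x in D) (f x * T x ^+ n * cos (j%:~R * x) * c
        + a * (f x * T x ^+ n * sin (j%:~R * x))) = 0.
    rewrite RintegralD//; last 2 first.
    - exact: continuous_integrable (continuous_mulf (cc n j) (@cst_continuous _ _ c)).
    - exact: continuous_integrable (continuous_mulf (@cst_continuous _ _ a) (cs n j)).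
    rewrite RintegralZr ?RintegralZl//; [|exact: continuous_integrable..].
    by rewrite (ih j).1 (ih j).2 mul0r mulr0 addr0.
  have cp (c : R) a j : continuous (fun x => f x * T x ^+ n * cos (j%:~R * x) * c
        + a * (f x * T x ^+ n * sin (j%:~R * x))).
    apply: continuous_addf.
      exact: (continuous_mulf (cc n j) (@cst_continuous _ _ c)).
    exact: (continuous_mulf (@cst_continuous _ _ a) (cs n j)).
  have := Rintegral_lin3 2^-1 2^-1 (cc n k) (cp (cos x0) (sin x0) (k + 1))
    (cp (cos x0) (- sin x0) (k - 1)).
  rewrite (ih k).1 !i1 !mulr0 !addr0 => E; rewrite -[RHS]E.
  by apply: eq_Rintegral => x _; ring.
- transitivity (\int[mu]_(x in D) (f x * T x ^+ n * sin (k%:~R * x) +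
      2^-1 * (f x * T x ^+ n * cos ((k + 1)%:~R * x) * - sin x0
        + cos x0 * (f x * T x ^+ n * sin ((k + 1)%:~R * x)))
    + 2^-1 * (f x * T x ^+ n * cos ((k - 1)%:~R * x) * sin x0
        + cos x0 * (f x * T x ^+ n * sin ((k - 1)%:~R * x))))).
    apply: eq_Rintegral => x _; rewrite exprSr {2}/T E1 E2 !cosD !sinD !cosN !sinN.
    by field.
  have i1 (c : R) a j : \int[mu]_(x in D) (f x * T x ^+ n * cos (j%:~R * x) * c
        + a * (f x * T x ^+ n * sin (j%:~R * x))) = 0.
    rewrite RintegralD//; last 2 first.
    - exact: continuous_integrable (continuous_mulf (cc n j) (@cst_continuous _ _ c)).
    - exact: continuous_integrable (continuous_mulf (@cst_continuous _ _ a) (cs n j)).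
    rewrite RintegralZr ?RintegralZl//; [|exact: continuous_integrable..].
    by rewrite (ih j).1 (ih j).2 mul0r mulr0 addr0.
  have cp (c : R) a j : continuous (fun x => f x * T x ^+ n * cos (j%:~R * x) * c
        + a * (f x * T x ^+ n * sin (j%:~R * x))).
    apply: continuous_addf.
      exact: (continuous_mulf (cc n j) (@cst_continuous _ _ c)).
    exact: (continuous_mulf (@cst_continuous _ _ a) (cs n j)).
  have := Rintegral_lin3 2^-1 2^-1 (cs n k) (cp (- sin x0) (cos x0) (k + 1))
    (cp (sin x0) (cos x0) (k - 1)).
  by rewrite (ih k).2 !i1 !mulr0 !addr0 => E; rewrite -[RHS]E.
Qed.

Lemma cos_le_away (d t : R) : 0 < d -> d <= 1 -> d <= `|t| -> `|t| <= pi *+ 2 - d ->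
  cos t <= cos d.
Proof.
move=> d0 d1 dt td; rewrite -cos_norm; move: dt td; set u := `|t| => dt td.
have pi2 : 2 <= pi :> R := pi_ge2 R.
have mono (a b : R) : 0 <= b -> b <= a -> a <= pi -> cos a <= cos b.
  move=> b0 ba api; move: ba; rewrite le_eqVlt => /predU1P[->//|ba].
  by rewrite ltW// ltr_cos// in_itv/=; apply/andP; split; lra.
have [upi|piu] := leP u pi; first by apply: mono => //; lra.
rewrite -[cos u]cosN -cosD2pi; apply: mono; lra.
Qed.

Lemma fourier_peak f x0 : continuous f -> 0 < x0 < pi *+ 2 -> 0 < f x0 ->
  (forall n, \int[mu]_(x in D) (f x * (1 + cos (x - x0)) ^+ n) = 0) -> False.
Proof.
move=> cf /andP[x00 x0pi] fx0 H.
pose T x : R := 1 + cos (x - x0).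
have cT : continuous T.
  by rewrite /T; apply: continuous_addf; [exact: cst_continuous|exact: continuous_cosB].
have cTn m : continuous (fun x => f x * T x ^+ m).
  elim: m => [|m ih].
    by under eq_fun do rewrite expr0 mulr1.
  by under eq_fun do rewrite exprSr mulrA; exact: continuous_mulf.
pose c := f x0 / 2.
have c0 : 0 < c by rewrite /c; lra.
have : \forall x \near x0, c < f x.
  by apply: (cvgr_gt _ (cf x0)); rewrite /c; lra.
move=> /nbhs_ballP[e /= e0 He].
pose d := Num.min (e / 2) (Num.min x0 (Num.min (pi *+ 2 - x0) 1)).
have [d0 de dx0 dpi d1] : [/\ 0 < d, d < e, d <= x0, d <= pi *+ 2 - x0 & d <= 1].
  have e2 : d <= e / 2 by rewrite /d ge_min lexx.
  split; [|lra|..]; rewrite /d ?lt_min ?ge_min ?lexx ?orbT//.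
  by apply/andP; split; [lra|]; apply/and3P; split; lra.
have fc x : `|x - x0| <= d -> c <= f x.
  by move=> xd; apply/ltW/He; rewrite /ball/= distrC; exact: le_lt_trans de.
have twopi0 : (0 : R) < pi *+ 2 by exact: twopi_gt0.
have [m mD fm] : exists2 m, m \in `[0, pi *+ 2] & forall t, t \in `[0, pi *+ 2] -> f m <= f t.
  by apply: EVT_min; [exact: ltW|exact: continuous_subspaceT].
pose M := `|f m| + 1.
have M0 : 0 < M by rewrite /M ltr_wpDl.
have fM x : D x -> - M <= f x.
  move=> Dx; apply: le_trans (fm x _); last by [].
  have := ler_norm (- f m); rewrite normrN /M; lra.
pose p : R := 1 + cos (d / 2); pose q : R := 1 + cos d.
have pi2 : 2 <= pi :> R := pi_ge2 R.
have qp : q < p by rewrite /q /p ltrD2l ltr_cos ?in_itv/=; [lra|apply/andP; split; lra..].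
have q0 : 0 < q.
  have : cos pi < cos d by rewrite ltr_cos ?in_itv/=; [lra|apply/andP; split; lra..].
  rewrite cospi /q; lra.
have T0 x : 0 <= T x by have := cos_geN1 (x - x0); rewrite /T; lra.
have Dle x : D x -> `|x - x0| <= pi *+ 2 - d.
  rewrite /= in_itv/= => /andP[? ?]; rewrite ler_norml; apply/andP; split; lra.
have Tq x : D x -> d <= `|x - x0| -> T x <= q.
  by move=> Dx xd; rewrite /T /q lerD2l; apply: cos_le_away => //; exact: Dle.
have Tp x : `|x - x0| <= d / 2 -> p <= T x.
  move=> xd; rewrite /T /p lerD2l -[leRHS]cos_norm.
  have := normr_ge0 (x - x0); move: xd; set u := `|x - x0|.
  rewrite le_eqVlt => /predU1P[->//|xd] u0.
  by apply/ltW; rewrite ltr_cos ?in_itv/=; [lra|apply/andP; split; lra..].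
pose g n x := f x * T x ^+ n + M * q ^+ n.
have cg n : continuous (g n).
  by apply: continuous_addf; [exact: cTn|exact: cst_continuous].
have g0 n x : D x -> 0 <= g n x.
  move=> Dx; have Mq : 0 < M * q ^+ n by rewrite mulr_gt0// exprn_gt0.
  have [xd|/ltW xd] := leP `|x - x0| d.
    rewrite /g addr_ge0 ?mulr_ge0 ?exprn_ge0//; last by rewrite ltW.
      exact: ltW (lt_le_trans c0 (fc _ xd)).
    exact: ltW.
  rewrite /g -lerBlDr sub0r -mulNr.
  apply: (@le_trans _ _ (- M * T x ^+ n)).
    rewrite !mulNr lerN2 ler_pM2l// lerXn2r ?nnegrE//; [exact: ltW|exact: Tq].
  by rewrite ler_wpM2r ?exprn_ge0//; exact: fM.
have gA n x : `|x - x0| <= d / 2 -> c * p ^+ n <= g n x.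
  move=> xd; rewrite /g -[leLHS]addr0 lerD//; last first.
    by rewrite mulr_ge0 ?exprn_ge0// ltW.
  have p0 : 0 <= p by rewrite ltW// (lt_trans q0).
  apply: ler_pM => //; [exact: ltW|exact: exprn_ge0|apply: fc; lra|].
  by rewrite lerXn2r ?nnegrE//; exact: Tp.
pose A : set R := `[x0 - d / 2, x0 + d / 2]%classic.
have AD : A `<=` D.
  by move=> x; rewrite /A/= !in_itv/= => /andP[? ?]; apply/andP; split; lra.
have mA : measurable A by exact: measurable_itv.
have Adist x : A x -> `|x - x0| <= d / 2.
  by rewrite /A/= in_itv/= => /andP[? ?]; rewrite ler_norml; apply/andP; split; lra.
have muA : mu A = d%:E.
  rewrite /A lebesgue_measure_itv/= lte_fin ifT; last lra.
  by rewrite -EFinD; congr EFin; field.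
have muD : mu D = (pi *+ 2)%:E.
  by rewrite lebesgue_measure_itv/= lte_fin twopi0 oppr0 adde0.
have key n : c * p ^+ n * d <= M * q ^+ n * (pi *+ 2).
  have -> : M * q ^+ n * (pi *+ 2) = \int[mu]_(x in D) g n x.
    rewrite /g RintegralD//; last 2 first.
    - exact: continuous_integrable (cTn n).
    - by apply: continuous_integrable; exact: cst_continuous.
    rewrite H add0r Rintegral_cst//; congr (_ * _); exact: (esym (congr1 fine muD)).
  have ig := continuous_integrable (cg n).
  rewrite -lee_fin /Rintegral fineK; last exact: integrable_fin_num.
  apply: (@le_trans _ _ (\int[mu]_(x in A) (g n x)%:E)%E); last apply: ge0_subset_integral => //.
  - have -> : (c * p ^+ n * d)%:E = (\int[mu]_(x in A) (c * p ^+ n)%:E)%E.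
      rewrite integral_cst; last exact: measurable_itv.
      by transitivity ((c * p ^+ n)%:E * d%:E)%E; [rewrite EFinM|congr mule; exact: (esym muA)].
    apply: ge0_le_integral => //.
    + move=> x _; rewrite lee_fin mulr_ge0 ?exprn_ge0//; first exact: ltW.
      by rewrite ltW// (lt_trans q0).
    + by apply: measurable_funS (measurable_int _ ig).
    + by move=> x /Adist xA; rewrite lee_fin gA.
  - exact: measurable_int ig.
  - by move=> x /g0; rewrite lee_fin.
have r1 : 1 < p / q by rewrite ltr_pdivlMr// mul1r.
pose a := p / q - 1.
have a0 : 0 < a by rewrite /a; lra.
have bern n : 1 + a *+ n <= (p / q) ^+ n.
  elim: n => [|n ih]; first by rewrite mulr0n addr0 expr0.
  have -> : p / q = 1 + a by rewrite /a; ring.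
  have {}ih : 1 + a *+ n <= (1 + a) ^+ n by rewrite (_ : 1 + a = p / q)// /a; ring.
  have an0 : 0 <= a *+ n by rewrite mulrn_wge0// ltW.
  rewrite exprS mulrS; move: an0 ih; set b := a *+ n; set r := (1 + a) ^+ n => b0 ih.
  have ab0 := mulr_ge0 (ltW a0) b0.
  have : (1 + a) * (1 + b) <= (1 + a) * r by rewrite ler_pM2l//; lra.
  lra.
pose K := M * (pi *+ 2) / (c * d).
have key2 n : (p / q) ^+ n <= K.
  rewrite /K ler_pdivlMr ?mulr_gt0// expr_div_n.
  rewrite [leLHS](_ : _ = (c * p ^+ n * d) / q ^+ n); last by ring.
  rewrite ler_pdivrMr ?exprn_gt0//; have := key n; rewrite [leRHS]mulrAC => /le_trans; apply.
  by rewrite le_eqVlt; apply/orP; left; apply/eqP; ring.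
have K0 : 0 <= K / a.
  by rewrite /K !divr_ge0 ?mulr_ge0// ltW// mulr_gt0.
have := archi_boundP K0; set N := Num.bound _ => hN.
have := le_trans (bern N) (key2 N).
have : K < a *+ N by rewrite -mulr_natl -ltr_pdivrMr.
lra.
Qed.

Lemma fourier_uniq f : continuous f -> periodic f (pi *+ 2) ->
  (forall k, fourier_sqnorm f k = 0) -> f = cst 0.
Proof.
move=> cf pf f0.
have twopi0 : (0 : R) < pi *+ 2 by exact: twopi_gt0.
have fk k : fourier_cos f k = 0 /\ fourier_sin f k = 0.
  have /eqP := f0 k; rewrite /fourier_sqnorm paddr_eq0 ?sqr_ge0// !sqrf_eq0.
  by move=> /andP[/eqP -> /eqP ->].
have H1 k : \int[mu]_(x in D) (f x * cos (k%:~R * x)) = 0.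
  have /eqP := (fk k).1; rewrite /fourier_cos mulf_eq0 invr_eq0 gt_eqF//=.
  by move/eqP.
have H2 k : \int[mu]_(x in D) (f x * sin (k%:~R * x)) = 0.
  have /eqP := (fk k).2; rewrite /fourier_sin mulf_eq0 invr_eq0 gt_eqF//=.
  by move/eqP.
have zero_in x : 0 < x < pi *+ 2 -> f x = 0.
  move=> xD; apply/eqP/negPn/negP => fx0.
  have [fxp|fxn|/eqP] := ltgtP (f x) 0; last by rewrite (negbTE fx0).
    pose g y := (-1) * f y.
    have cg : continuous g.
      by apply: continuous_mulf => //; exact: cst_continuous.
    apply: (@fourier_peak g x cg xD).
      by rewrite /g mulN1r oppr_gt0.
    apply: fourier_kernel => // k.
    - under eq_Rintegral do rewrite /g -mulrA.
      rewrite RintegralZl ?H1 ?mulr0//; apply: continuous_integrable.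
      by apply: continuous_mulf => //; exact: continuous_cosk.
    - under eq_Rintegral do rewrite /g -mulrA.
      rewrite RintegralZl ?H2 ?mulr0//; apply: continuous_integrable.
      by apply: continuous_mulf => //; exact: continuous_sink.
  apply: (@fourier_peak f x cf xD fxn).
  by apply: fourier_kernel.
have zero0 : f 0 = 0.
  have c1 : f x @[x --> (0:R)^'+] --> f 0 by apply: cvg_at_right_filter; exact: cf.
  have c2 : f x @[x --> (0:R)^'+] --> (0 : R).
    apply: cvg_near_cst; near=> x; apply: zero_in; apply/andP; split.
    + by near: x; exact: nbhs_right_gt.
    + by near: x; exact: nbhs_right_lt.
  by rewrite -(cvg_lim _ c1)// (cvg_lim _ c2).
have fper (x : R) (n : int) : f (x - n%:~R * (pi *+ 2)) = f x.
  case: n => n.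
    rewrite -[X in _ = f X](subrK (pi *+ 2 *+ n) x) (periodicn pf).
    by rewrite -pmulrn mulr_natl.
  by rewrite NegzE mulrNz mulNr opprK -pmulrn mulr_natl (periodicn pf).
apply/funext => x /=; rewrite -(fper x (Num.floor (x / (pi *+ 2)))).
set y := x - _.
have /andP[y0 y1] : 0 <= y < pi *+ 2.
  have /andP[h1 h2] := mem_rg1_floor (x / (pi *+ 2)).
  rewrite /y subr_ge0 -ler_pdivlMr// h1/= ltrBlDl.
  by move: h2; rewrite ltr_pdivrMr// mulrDl mul1r.
move: y0; rewrite le_eqVlt => /predU1P[<-//|y0].
by apply: zero_in; rewrite y0.
Unshelve. all: by end_near. Qed.

Definition sobolev_weight s k : R := (1 + k%:~R ^+ 2) `^ s.

Definition sobolev_sqnorm s f : \bar R :=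
  \esum_(k in [set: int]) (sobolev_weight s k * fourier_sqnorm f k)%:E.

Definition sobolev_fun s : {pred R -> R} :=
  mem [set f | [/\ continuous f, periodic f (pi *+ 2)
                 & (sobolev_sqnorm s f < +oo)%E]].

Lemma fourier_sqnorm_ge0 f k : 0 <= fourier_sqnorm f k.
Proof. by rewrite addr_ge0 ?sqr_ge0. Qed.

Lemma sobolev_weight_gt0 s k : 0 < sobolev_weight s k.
Proof. by rewrite powR_gt0// ltr_pwDl// sqr_ge0. Qed.

Lemma sobolev_term_ge0 s f k :
  (0 <= (sobolev_weight s k * fourier_sqnorm f k)%:E)%E.
Proof. by rewrite lee_fin mulr_ge0 ?fourier_sqnorm_ge0// ltW// sobolev_weight_gt0. Qed.

Lemma sobolev_sqnorm_ge0 s f : (0 <= sobolev_sqnorm s f)%E.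
Proof. by apply: esum_ge0 => k _; exact: sobolev_term_ge0. Qed.

Lemma fourier_sqnormZ (a : R) f k : continuous f ->
  fourier_sqnorm (a *: f) k = a ^+ 2 * fourier_sqnorm f k.
Proof.
move=> cf; have c0 : continuous (0 : R -> R) by exact: cst_continuous.
have E0 (h : R -> R) : \int[mu]_(x in D) ((0 : R -> R) x * h x) = 0.
  by under eq_Rintegral do rewrite mul0r; rewrite Rintegral_cst// mul0r.
have := fourier_cosP k a cf c0; have := fourier_sinP k a cf c0.
rewrite /fourier_sqnorm !addr0 => -> ->.
by rewrite /fourier_cos /fourier_sin !E0; ring.
Qed.

Lemma fourier_sqnormD (t : R) f g k : 0 < t < 1 -> continuous f -> continuous g ->
  fourier_sqnorm (f + g) k <= t^-1 * fourier_sqnorm f k + (1 - t)^-1 * fourier_sqnorm g k.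
Proof.
move=> /andP[t0 t1] cf cg.
have := fourier_cosP k 1 cf cg; have := fourier_sinP k 1 cf cg.
rewrite /fourier_sqnorm scale1r !mul1r => -> ->.
have cvx (a b : R) : (a + b) ^+ 2 <= t^-1 * a ^+ 2 + (1 - t)^-1 * b ^+ 2.
  rewrite -subr_ge0.
  rewrite [leRHS](_ : _ = ((1 - t) * a - t * b) ^+ 2 / (t * (1 - t))).
    by rewrite divr_ge0 ?sqr_ge0// mulr_ge0; lra.
  by field; apply/andP; split; lra.
have := cvx (fourier_cos f k) (fourier_cos g k).
have := cvx (fourier_sin f k) (fourier_sin g k).
rewrite !mulrDr; lra.
Qed.

Lemma le_esumZ (a : R) (u : int -> \bar R) : 0 <= a -> (forall k, 0 <= u k)%E ->
  (\esum_(k in [set: int]) (a%:E * u k) <= a%:E * \esum_(k in [set: int]) u k)%E.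
Proof.
move=> a0 u0; apply: ub_ereal_sup => _ [A hA <-].
rewrite -ge0_mule_fsumr//; apply: lee_wpmul2l; first by rewrite lee_fin.
by apply: esum_ge; exists A.
Qed.

Lemma sobolev_sqnormZ_le s (a : R) f : continuous f ->
  (sobolev_sqnorm s (a *: f) <= (a ^+ 2)%:E * sobolev_sqnorm s f)%E.
Proof.
move=> cf; rewrite /sobolev_sqnorm.
under eq_esum do rewrite fourier_sqnormZ// mulrCA EFinM.
by apply: le_esumZ; [exact: sqr_ge0|exact: sobolev_term_ge0].
Qed.

Lemma sobolev_sqnormD_le s (t : R) f g : 0 < t < 1 -> continuous f -> continuous g ->
  (sobolev_sqnorm s (f + g)%R <=
   t^-1%:E * sobolev_sqnorm s f + (1 - t)^-1%:E * sobolev_sqnorm s g)%E.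
Proof.
move=> t01 cf cg; have /andP[t0 t1] := t01.
have ti0 : 0 <= t^-1 by rewrite invr_ge0 ltW.
have si0 : 0 <= (1 - t)^-1 by rewrite invr_ge0; lra.
apply: (@le_trans _ _ (\esum_(k in [set: int])
   (t^-1%:E * (sobolev_weight s k * fourier_sqnorm f k)%:E
   + (1 - t)^-1%:E * (sobolev_weight s k * fourier_sqnorm g k)%:E))%E).
  apply: le_esum => k _; rewrite -!EFinM -EFinD lee_fin.
  rewrite [leRHS](_ : _ = sobolev_weight s k *
    (t^-1 * fourier_sqnorm f k + (1 - t)^-1 * fourier_sqnorm g k)); last by ring.
  rewrite ler_pM2l ?sobolev_weight_gt0//.
  exact: fourier_sqnormD.
rewrite esumD; last 2 first.
- by move=> k _; apply: mule_ge0; [rewrite lee_fin|exact: sobolev_term_ge0].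
- by move=> k _; apply: mule_ge0; [rewrite lee_fin|exact: sobolev_term_ge0].
by apply: leeD; apply: le_esumZ => //; exact: sobolev_term_ge0.
Qed.

Lemma sobolev_submod_closed s : submod_closed (sobolev_fun s).
Proof.
have Z (a : R) f : f \in sobolev_fun s -> a *: f \in sobolev_fun s.
  move=> /set_mem[cf pf nf]; apply/mem_set; split.
  - by apply: continuous_mulf => //; exact: cst_continuous.
  - by move=> x /=; rewrite /GRing.scale/= pf.
  - apply: le_lt_trans (sobolev_sqnormZ_le s a cf) _.
    by apply: lte_mul_pinfty => //; rewrite lee_fin sqr_ge0.
have A f g : f \in sobolev_fun s -> g \in sobolev_fun s -> f + g \in sobolev_fun s.
  move=> /set_mem[cf pf nf] /set_mem[cg pg ng]; apply/mem_set; split.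
  - exact: continuous_addf.
  - by move=> x /=; rewrite /GRing.add/= pf pg.
  - have h : ((0 : R) < 2^-1) && ((2^-1 : R) < 1) by apply/andP; split; lra.
    apply: le_lt_trans (@sobolev_sqnormD_le s 2^-1 f g h cf cg) _.
    apply: lte_add_pinfty; apply: lte_mul_pinfty => //; rewrite lee_fin invr_ge0; lra.
split; last by move=> a f g fS gS; exact: A _ _ (Z a f fS) gS.
apply/mem_set; split; [exact: cst_continuous|by []|].
rewrite /sobolev_sqnorm esum1// => k _.
have := fourier_sqnormZ 0 k (@cst_continuous R R 0); rewrite scale0r => ->.
by rewrite expr0n/= mul0r mulr0.
Qed.

Lemma weighted_sqr_le (a b n : R) : 0 < a -> 0 < b -> 0 <= n ->
  ((0 < a / (a + b)) && (a / (a + b) < 1) -> n ^+ 2 <=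
    (a / (a + b))^-1 * a ^+ 2 + (1 - a / (a + b))^-1 * b ^+ 2) -> n <= a + b.
Proof.
move=> a0 b0 n0 H; have ab : 0 < a + b by rewrite addr_gt0.
rewrite -(@ler_pXn2r _ 2)// ?nnegrE; last exact: ltW.
apply: le_trans (H _) _; first by rewrite divr_gt0//= ltr_pdivrMr// mul1r ltrDl.
rewrite le_eqVlt; apply/orP; left; apply/eqP; field; rewrite !gt_eqF//.
by rewrite (_ : _ - _ = b)//; ring.
Qed.

Lemma scaled_sqr_le (a m n : R) : 0 <= m -> 0 <= n ->
  n ^+ 2 <= a ^+ 2 * m ^+ 2 -> n <= `|a| * m.
Proof.
move=> m0 n0 H; rewrite -(@ler_pXn2r _ 2)// ?nnegrE ?mulr_ge0//.
by rewrite exprMn real_normK ?num_real.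
Qed.

End Fourier.

HB.instance Definition _ (R : realType) (s : R) :=
  GRing.isSubmodClosed.Build R (R -> R) (sobolev_fun s) (@sobolev_submod_closed R s).

(* H^s(T; R) for s > 1/2: each class has exactly one continuous representative,
   which stands for it. The norm is (\sum_(k in Z) (1 + k^2)^s |c_k|^2)^(1/2).
   For s <= 1/2 this is only the subspace of the continuous elements of H^s. *)
Record sobolev (R : realType) (s : R) :=
  Sobolev { sobolev_val :> R -> R; _ : sobolev_val \in sobolev_fun s }.

HB.instance Definition _ (R : realType) (s : R) := [isSub for @sobolev_val R s].
HB.instance Definition _ (R : realType) (s : R) := [Choice of sobolev s by <:].
HB.instance Definition _ (R : realType) (s : R) :=
  [SubChoice_isSubLmodule of sobolev s by <:].

Section SobolevNorm.
Context {R : realType} (s : R).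
Implicit Types u v : sobolev s.

Definition sobolev_norm u : R := Num.sqrt (fine (sobolev_sqnorm s u)).

Lemma sobolevP u :
  [/\ continuous u, periodic u (pi *+ 2) & (sobolev_sqnorm s u < +oo)%E].
Proof. by have := valP u; rewrite inE. Qed.

Lemma sobolev_normK u : (sobolev_norm u ^+ 2)%:E = sobolev_sqnorm s u.
Proof.
have [_ _ u1] := sobolevP u; have u0 := sobolev_sqnorm_ge0 s u.
by rewrite sqr_sqrtr ?fine_ge0// fineK// ge0_fin_numE.
Qed.

Lemma sobolev_norm_ge0 u : 0 <= sobolev_norm u.
Proof. exact: sqrtr_ge0. Qed.

Lemma sobolev_norm0_eq0 u : sobolev_norm u = 0 -> u = 0.
Proof.
move=> u0; have [cu pu _] := sobolevP u.
apply/val_inj => /=; apply: fourier_uniq => // k.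
have : (sobolev_sqnorm s u <= 0)%E by rewrite -sobolev_normK u0 expr0n.
have : ((sobolev_weight s k * fourier_sqnorm u k)%:E <= sobolev_sqnorm s u)%E.
  apply: esum_ge; exists [set k]; first by split.
  by rewrite fsbig_set1.
move=> /le_trans/[apply]; rewrite lee_fin pmulr_rle0 ?sobolev_weight_gt0// => h.
by apply/eqP; rewrite eq_le h fourier_sqnorm_ge0.
Qed.

Lemma sobolev_normZ_le (a : R) u : sobolev_norm (a *: u) <= `|a| * sobolev_norm u.
Proof.
have [cu _ _] := sobolevP u.
apply: scaled_sqr_le; [exact: sobolev_norm_ge0|exact: sobolev_norm_ge0|].
have := sobolev_sqnormZ_le s a cu.
rewrite (_ : sobolev_sqnorm s _ = sobolev_sqnorm s (a *: u)); last by [].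
by rewrite -2!sobolev_normK -EFinM lee_fin.
Qed.

Lemma sobolev_normZ (a : R) u : sobolev_norm (a *: u) = `|a| * sobolev_norm u.
Proof.
apply/eqP; rewrite eq_le sobolev_normZ_le/=.
have [->|a0] := eqVneq a 0; first by rewrite normr0 mul0r sobolev_norm_ge0.
have := sobolev_normZ_le a^-1 (a *: u); rewrite scalerA mulVf// scale1r normfV.
by rewrite ler_pdivlMl// normr_gt0.
Qed.

Lemma sobolev_normD u v : sobolev_norm (u + v) <= sobolev_norm u + sobolev_norm v.
Proof.
have [u0|u0] := eqVneq (sobolev_norm u) 0.
  by rewrite (sobolev_norm0_eq0 u0) add0r lerDr sobolev_norm_ge0.
have [v0|v0] := eqVneq (sobolev_norm v) 0.
  by rewrite (sobolev_norm0_eq0 v0) addr0 lerDl sobolev_norm_ge0.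
have {}u0 : 0 < sobolev_norm u by rewrite lt_neqAle eq_sym u0 sobolev_norm_ge0.
have {}v0 : 0 < sobolev_norm v by rewrite lt_neqAle eq_sym v0 sobolev_norm_ge0.
have [cu _ _] := sobolevP u; have [cv _ _] := sobolevP v.
apply: weighted_sqr_le; [exact: u0|exact: v0|exact: sobolev_norm_ge0|move=> t01].
have := sobolev_sqnormD_le s t01 cu cv.
rewrite (_ : sobolev_sqnorm s _ = sobolev_sqnorm s (u + v)%R); last by [].
by rewrite -3!sobolev_normK -!EFinM -EFinD lee_fin.
Qed.

End SobolevNorm.

HB.instance Definition _ (R : realType) (s : R) :=
  Lmodule_isNormed.Build R (sobolev s) (@sobolev_normD R s) (@sobolev_normZ R s)
    (@sobolev_norm0_eq0 R s).

Section Analytic.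
Context {K : numFieldType} {V W : normedModType K}.

Definition multilinear_map k (A : ('I_k -> V) -> W) :=
  forall (i : 'I_k) (v : 'I_k -> V) (a : K) (x y : V),
    A [eta v with i |-> a *: x + y] =
    a *: A [eta v with i |-> x] + A [eta v with i |-> y].

Definition symmetric_map k (A : ('I_k -> V) -> W) :=
  forall (sigma : 'S_k) (v : 'I_k -> V), A (v \o sigma) = A v.

(* f is the sum, near u, of a power series of bounded symmetric multilinear
   maps with positive radius of convergence. *)
Definition analytic_at (f : V -> W) (u : V) :=
  exists (A : forall k, ('I_k -> V) -> W) (C rho : K),
    [/\ forall k, multilinear_map (A k),
        forall k, symmetric_map (A k),
        forall k v, `|A k v| <= C * rho ^+ k * \prod_(i < k) `|v i|
      & \forall x \near (0 : V),
          series (fun k => A k (fun=> x)) @ \oo --> f (u + x)].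

(* Meant for U open; values of f outside U are then irrelevant. *)
Definition analytic_on (U : set V) (f : V -> W) :=
  forall u, U u -> analytic_at f u.

End Analytic.

Section Potential.
Context {R : realType}.
Implicit Types (Omega : set (R * R)) (phi : R * R -> R) (eta beta psi : R -> R).

Definition partial_x phi (z : R * R) : R := 'D_((1, 0) : R * R) phi z.
Definition partial_y phi (z : R * R) : R := 'D_((0, 1) : R * R) phi z.

Definition C1_on Omega phi := forall z, Omega z ->
  [/\ derivable phi z ((1, 0) : R * R), derivable phi z ((0, 1) : R * R),
      {for z, continuous (partial_x phi)} & {for z, continuous (partial_y phi)}].

Definition C2_on Omega phi :=
  [/\ C1_on Omega phi, C1_on Omega (partial_x phi) & C1_on Omega (partial_y phi)].

Definition laplacian phi (z : R * R) : R :=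
  partial_x (partial_x phi) z + partial_y (partial_y phi) z.

(* Value at a point of the closure of Omega of the continuous extension of a
   function given on Omega. *)
Definition trace Omega phi (z : R * R) : R := lim (phi w @[w --> within Omega (nbhs z)]).

Definition extends_to_closure Omega phi := forall z, closure Omega z ->
  cvg (phi w @[w --> within Omega (nbhs z)]).

Definition fluid_domain (h : R) eta beta : set (R * R) :=
  [set z | - h + beta z.1 < z.2 < eta z.1].

(* Classical solutions: phi is C^2 in the fluid domain and C^1 up to its boundary.
   For eta, beta, psi in H^s with s > 3/2 (hence C^{1,a} for some a > 0) the
   variational solution has this regularity, and solutions of this kind are unique
   on the fluid domain. The values of phi outside the domain are irrelevant. *)
Record is_potential (h : R) eta beta (gamma : R) psi phi : Prop := {
  potential_periodic : forall z, fluid_domain h eta beta z ->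
    phi (z.1 + pi *+ 2, z.2) = phi z ;
  potential_C2 : C2_on (fluid_domain h eta beta) phi ;
  potential_harmonic : forall z, fluid_domain h eta beta z -> laplacian phi z = 0 ;
  potential_closure : [/\ extends_to_closure (fluid_domain h eta beta) phi,
    extends_to_closure (fluid_domain h eta beta) (partial_x phi)
    & extends_to_closure (fluid_domain h eta beta) (partial_y phi)] ;
  potential_surface : forall x,
    trace (fluid_domain h eta beta) phi (x, eta x) = psi x ;
  potential_bottom : forall x, let y := - h + beta x in
    gamma * y * derive1 beta x
    - trace (fluid_domain h eta beta) (partial_x phi) (x, y) * derive1 beta x
    + trace (fluid_domain h eta beta) (partial_y phi) (x, y) = 0
}.

Definition normal_trace (h : R) eta beta phi (x : R) : R :=
  trace (fluid_domain h eta beta) (partial_x phi) (x, eta x) * - derive1 eta x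
  + trace (fluid_domain h eta beta) (partial_y phi) (x, eta x).

(* The boundary value problem is solvable, and g = G(eta, beta, gamma)(psi) is the
   normal trace of any of its solutions. *)
Definition is_DN (h : R) eta beta (gamma : R) psi (g : R -> R) :=
  (exists phi, is_potential h eta beta gamma psi phi) /\
  forall phi, is_potential h eta beta gamma psi phi ->
    forall x, g x = normal_trace h eta beta phi x.

End Potential.

Definition admissible (R : realType) (h s : R) : set (sobolev s * sobolev s) :=
  [set p : sobolev s * sobolev s | exists2 h0 : R, 0 < h0 & forall x : R, h0 <= h - p.2 x + p.1 x].

(* Main.v *)
(* Let theta be a harmonic conjugate of phi. The bottom condition says that
   theta - gamma y^2 / 2 is constant along the bottom, and G(eta, beta, gamma)(psi) is
   minus the derivative of x |-> theta(x, eta(x)). Straighten the domain by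
   y = Y(x, z), 0 <= z <= 1, where Y is affine in (eta, beta) and its boundary values are
   smoothed by the multipliers exp(-dl (1 - z) |k|) and exp(-dl z |k|). With c = Y_x and
   d = Y_z the Cauchy-Riemann equations become
     c phi_z + theta_z = d phi_x,   c theta_z - phi_z = d theta_x.
   In a Banach algebra of functions on the strip (continuous in z with values in H^(s-1),
   square integrable in z with values in H^(s-1/2)) this system, with phi given at z = 1 and
   theta at z = 0, is invertible: commutator estimates and the fact that the null form
   phi_x theta_z - phi_z theta_x integrates to zero give an a priori bound, and the case
   c = 0, d = 1 is explicit, so the continuity method applies. The operator and the data
   depend polynomially on (eta, beta), so near a base point the state X of the system solves
   X = X0 + B(x) X with B linear in the perturbation x, and the Neumann series of X is the
   power series of G.
   Undoing the straightening yields a classical solution: a pair solving the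
   Cauchy-Riemann equations is a power series inside discs, by its Fourier expansion on
   circles. The maximum principle, with phi perturbed by e ((2 M + 1) y + y^2) to make the
   inward normal derivative at the bottom and the Laplacian positive, gives uniqueness. *)

Require Import Defs.
From HB Require Import structures.
From mathcomp Require Import all_boot all_order all_algebra fingroup perm.
From mathcomp Require Import complex.
From mathcomp Require Import ring lra zify.
From mathcomp Require Import all_classical all_reals all_analysis.

Set Implicit Arguments.
Unset Strict Implicit.
Unset Printing Implicit Defensive.

Import Order.TTheory GRing.Theory Num.Theory.
Import numFieldNormedType.Exports.

Local Open Scope classical_set_scope.
Local Open Scope ring_scope.
Local Notation Re := complex.Re.
Local Notation Im := complex.Im.

(** * Complex moduli and finite sums *)

(** Regularity is the obstacle: [eta] and [beta] have only [s] derivatives, so the coefficients [c]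
    and [d] lie in $H^{s-1}$ and must never be differentiated. A first-order system only multiplies
    by them, and $H^{s-1}$ is an algebra since $s-1>1/2$. Passing from integrals in [z] to a
    supremum in [z] costs half a derivative, hence the second norm, in $H^{s-1/2}$; smoothing with
    [dl > 0] is what puts the lifted data into it. On the other hand $d$ is $h+\eta-\beta$ up to
    $O(dl)$, so [dl] has to be small in terms of the base point. The null form is useful because it
    integrates to zero in each Fourier mode separately. It therefore survives every multiplier
    $(1+|k|)^t$, and the commutators with these multipliers involve strictly fewer derivatives of
    the unknown, which interpolation absorbs. Pointwise ellipticity reaches the Fourier coefficients
    by sampling trigonometric polynomials on a grid. The unknown is not the pair (phi, theta) but
    its residual in the flat system; the operator for c = 0, d = 1 is then the identity. *)

Section ComplexModulus.
Context {R : realType}.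
Notation C := (Rcomplex R).
Implicit Types (z w : C) (a b : R).

Fact sqmod_key : unit. Proof. exact: tt. Qed.

Definition sqmod z : R := locked_with sqmod_key (Re z ^+ 2 + Im z ^+ 2).

Lemma sqmodE z : sqmod z = Re z ^+ 2 + Im z ^+ 2.
Proof. by rewrite /sqmod unlock. Qed.

Lemma sqmod_ge0 z : 0 <= sqmod z.
Proof. by rewrite sqmodE addr_ge0 ?sqr_ge0. Qed.

Definition cmod z : R := Num.sqrt (sqmod z).

Lemma cmod_ge0 z : 0 <= cmod z. Proof. exact: sqrtr_ge0. Qed.

Lemma cmod2 z : cmod z ^+ 2 = sqmod z.
Proof. by rewrite sqr_sqrtr ?sqmod_ge0. Qed.

Lemma cmod_le z a : 0 <= a -> sqmod z <= a ^+ 2 -> cmod z <= a.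
Proof. by move=> a0; rewrite -cmod2 ler_pXn2r// nnegrE ?cmod_ge0. Qed.

Lemma ReD z w : Re (z + w) = Re z + Re w. Proof. by case: z; case: w. Qed.
Lemma ImD z w : Im (z + w) = Im z + Im w. Proof. by case: z; case: w. Qed.
Lemma ReN z : Re (- z) = - Re z. Proof. by case: z. Qed.
Lemma ImN z : Im (- z) = - Im z. Proof. by case: z. Qed.
Lemma ReZ a z : Re (a *: z) = a * Re z. Proof. by case: z. Qed.
Lemma ImZ a z : Im (a *: z) = a * Im z. Proof. by case: z. Qed.
Lemma ReM z w : Re (z * w) = Re z * Re w - Im z * Im w.
Proof. by case: z; case: w. Qed.
Lemma ImM z w : Im (z * w) = Re z * Im w + Im z * Re w.
Proof. by case: z; case: w. Qed.
Lemma Re0 : Re (0 : C) = 0. Proof. by []. Qed.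
Lemma Im0 : Im (0 : C) = 0. Proof. by []. Qed.
Lemma Re_conj z : Re (conjc z) = Re z. Proof. by case: z. Qed.
Lemma Im_conj z : Im (conjc z) = - Im z. Proof. by case: z. Qed.

Definition ReImE := (ReD, ImD, ReN, ImN, ReZ, ImZ, ReM, ImM, Re_conj, Im_conj, Re0, Im0).

Lemma C_eq z w : Re z = Re w -> Im z = Im w -> z = w.
Proof. by case: z => a b; case: w => c d /= -> ->. Qed.

Lemma Re_sum I (r : seq I) (P : pred I) (F : I -> C) :
  Re (\sum_(i <- r | P i) F i) = \sum_(i <- r | P i) Re (F i).
Proof. by elim/big_rec2: _ => // i y x _ <-; rewrite ReD. Qed.

Lemma Im_sum I (r : seq I) (P : pred I) (F : I -> C) :
  Im (\sum_(i <- r | P i) F i) = \sum_(i <- r | P i) Im (F i).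
Proof. by elim/big_rec2: _ => // i y x _ <-; rewrite ImD. Qed.

Lemma sqmodM z w : sqmod (z * w) = sqmod z * sqmod w.
Proof. by rewrite ?sqmodE !ReImE; ring. Qed.

Lemma cmodM z w : cmod (z * w) = cmod z * cmod w.
Proof. by rewrite /cmod sqmodM sqrtrM// sqmod_ge0. Qed.

Lemma sqmodZ a z : sqmod (a *: z) = a ^+ 2 * sqmod z.
Proof. by rewrite ?sqmodE !ReImE; ring. Qed.

Lemma sqmodN z : sqmod (- z) = sqmod z.
Proof. by rewrite ?sqmodE !ReImE; ring. Qed.

Lemma sqmod0 : sqmod 0 = 0.
Proof. by rewrite ?sqmodE !ReImE; ring. Qed.

Lemma sqmodD z w : sqmod (z + w) <= 2 * (sqmod z + sqmod w).
Proof.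
rewrite ?sqmodE !ReImE.
have := sqr_ge0 (Re z - Re w); have := sqr_ge0 (Im z - Im w); nra.
Qed.

Lemma Re_le_cmod z : `|Re z| <= cmod z.
Proof.
rewrite -(@ler_pXn2r _ 2)// ?nnegrE ?cmod_ge0// cmod2 real_normK ?num_real//.
by rewrite ?sqmodE lerDl sqr_ge0.
Qed.

Lemma Im_le_cmod z : `|Im z| <= cmod z.
Proof.
rewrite -(@ler_pXn2r _ 2)// ?nnegrE ?cmod_ge0// cmod2 real_normK ?num_real//.
by rewrite ?sqmodE lerDr sqr_ge0.
Qed.

Lemma cmodD z w : cmod (z + w) <= cmod z + cmod w.
Proof.
apply: cmod_le; first by rewrite addr_ge0 ?cmod_ge0.
have : Re z * Re w + Im z * Im w <= cmod z * cmod w.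
  apply: le_trans (ler_norm _) _; rewrite -(@ler_pXn2r _ 2)// ?nnegrE ?mulr_ge0 ?cmod_ge0//.
  rewrite exprMn !cmod2 real_normK ?num_real// ?sqmodE.
  (* Lagrange's identity: this square is $|z|^2|w|^2-(\mathrm{Re}\, z\bar w)^2$. *)
  have := sqr_ge0 (Re z * Im w - Im z * Re w); nra.
rewrite sqrrD !cmod2 ?sqmodE !ReImE; nra.
Qed.

Lemma cmod0 : cmod 0 = 0. Proof. by rewrite /cmod sqmod0 sqrtr0. Qed.

Lemma cmod_sum I (r : seq I) (P : pred I) (F : I -> C) :
  cmod (\sum_(i <- r | P i) F i) <= \sum_(i <- r | P i) cmod (F i).
Proof.
elim/big_rec2: _ => [|i y x _ h]; first by rewrite cmod0.
by apply: le_trans (cmodD _ _) _; rewrite lerD2l.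
Qed.

Lemma cmod_le_ReIm z : cmod z <= `|Re z| + `|Im z|.
Proof.
apply: cmod_le; first by rewrite addr_ge0.
rewrite ?sqmodE sqrrD !real_normK ?num_real// -addrA lerD2l lerDr.
by rewrite mulrn_wge0// mulr_ge0.
Qed.

Definition realC a : C := Complex a 0.
Definition imagC a : C := Complex 0 a.

Lemma conj_sum I (r : seq I) (P : pred I) (F : I -> C) :
  conjc (\sum_(i <- r | P i) F i) = \sum_(i <- r | P i) (conjc (F i) : C).
Proof.
by apply: C_eq; rewrite !(Re_conj, Im_conj, Re_sum, Im_sum) -?sumrN;
  apply: eq_bigr => i _; rewrite !(Re_conj, Im_conj).
Qed.

Lemma sqmod_conj z : sqmod (conjc z) = sqmod z.
Proof. by rewrite ?sqmodE !ReImE sqrrN. Qed.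

Lemma cmodZ a z : cmod (a *: z) = `|a| * cmod z.
Proof. by rewrite /cmod sqmodZ sqrtrM ?sqr_ge0// sqrtr_sqr. Qed.

Lemma scaleCE a z : a *: z = realC a * z.
Proof. by apply: C_eq; rewrite !ReImE /=; ring. Qed.

Lemma scaleCAl a z w : a *: (z * w) = (a *: z) * w.
Proof. by rewrite !scaleCE mulrA. Qed.
Lemma scaleCAr a z w : a *: (z * w) = z * (a *: w).
Proof. by rewrite !scaleCE mulrCA. Qed.

End ComplexModulus.

(** * Symmetric finite sums over the integers, Cauchy-Schwarz and Young inequalities *)

Section IntRange.
Context {R : realType}.

Fact rng_key : unit. Proof. exact: tt. Qed.

Definition rng (n : nat) : seq int :=
  locked_with rng_key [seq (i%:Z - n%:Z)%R | i <- iota 0 (n.*2.+1)].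

Lemma mem_rng n k : (k \in rng n) = (absz k <= n)%N.
Proof.
rewrite /rng unlock; apply/mapP/idP => [[j]|kn].
  by rewrite mem_iota => /andP[_ ?] ->; lia.
by exists (absz (k + n%:Z)); [rewrite mem_iota; lia|lia].
Qed.

Lemma rng_uniq n : uniq (rng n).
Proof. by rewrite /rng unlock map_inj_uniq ?iota_uniq// => i j; lia. Qed.

Lemma ler_sum_subseq (T : eqType) (r1 r2 : seq T) (f : T -> R) :
  uniq r1 -> {subset r1 <= r2} -> (forall i, 0 <= f i) ->
  \sum_(i <- r1) f i <= \sum_(i <- r2) f i.
Proof.
elim: r1 r2 => [|x r1 ih] r2; first by move=> _ _ f0; rewrite big_nil sumr_ge0.
move=> /= /andP[xr1 ur1] sub f0.
have xr2 : x \in r2 by apply: sub; rewrite inE eqxx.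
rewrite big_cons (perm_big _ (perm_to_rem xr2)) big_cons lerD2l.
apply: ih => // y yr1; have yr2 : y \in r2 by apply: sub; rewrite inE yr1 orbT.
have yx : y != x by apply: contraNneq xr1 => <-.
by have := yr2; rewrite (perm_mem (perm_to_rem xr2)) inE (negbTE yx).
Qed.

Lemma sum_rng_mono m n (f : int -> R) : (m <= n)%N -> (forall i, 0 <= f i) ->
  \sum_(i <- rng m) f i <= \sum_(i <- rng n) f i.
Proof.
move=> mn f0; apply: ler_sum_subseq => //; first exact: rng_uniq.
by move=> k; rewrite !mem_rng => /leq_trans; apply.
Qed.

Lemma term_le_sum_rng n (f : int -> R) k : k \in rng n -> (forall i, 0 <= f i) ->
  f k <= \sum_(i <- rng n) f i.
Proof.
move=> kn f0; have := @ler_sum_subseq _ [:: k] (rng n) f.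
rewrite big_seq1; apply => //.
by move=> y; rewrite inE => /eqP->.
Qed.

Lemma sum_rng_shift N l (f : int -> R) : (forall i, 0 <= f i) ->
  \sum_(k <- rng N) f (k - l) <= \sum_(k <- rng (N + absz l)) f k.
Proof.
move=> f0; rewrite -(big_map (fun k => k - l) xpredT f); apply: ler_sum_subseq => //.
  by rewrite map_inj_uniq ?rng_uniq// => x y /addIr.
by move=> y /mapP[x]; rewrite !mem_rng => ? ->; lia.
Qed.

Lemma sum_rng_reflect N l (f : int -> R) : (forall i, 0 <= f i) ->
  \sum_(k <- rng N) f (l - k) <= \sum_(k <- rng (N + absz l)) f k.
Proof.
move=> f0; rewrite -(big_map (fun k => l - k) xpredT f); apply: ler_sum_subseq => //.
  by rewrite map_inj_uniq ?rng_uniq// => x y; lia.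
by move=> y /mapP[x]; rewrite !mem_rng => ? ->; lia.
Qed.

Lemma sum_rng_supp (V : zmodType) m n (f : int -> V) : (m <= n)%N ->
  (forall k, k \notin rng m -> f k = 0) -> \sum_(k <- rng n) f k = \sum_(k <- rng m) f k.
Proof.
move=> mn f0; rewrite (bigID (mem (rng m)))/= [X in _ + X]big1 ?addr0; last first.
  by move=> k /f0.
rewrite -big_filter; apply: perm_big; apply: uniq_perm.
- by rewrite filter_uniq// rng_uniq.
- exact: rng_uniq.
- move=> k; rewrite mem_filter; case: (boolP (k \in rng m)) => //= km.
  by move: km; rewrite !mem_rng => /leq_trans; apply.
Qed.

Lemma cauchy_schwarz_sum (T : Type) (r : seq T) (x y : T -> R) :
  (\sum_(i <- r) x i * y i) ^+ 2 <= (\sum_(i <- r) x i ^+ 2) * (\sum_(i <- r) y i ^+ 2).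
Proof.
elim: r => [|i r ih]; first by rewrite !big_nil expr2 !mulr0.
rewrite !big_cons.
have X0 : 0 <= \sum_(j <- r) x j ^+ 2 by rewrite sumr_ge0// => ? _; exact: sqr_ge0.
have Y0 : 0 <= \sum_(j <- r) y j ^+ 2 by rewrite sumr_ge0// => ? _; exact: sqr_ge0.
move: X0 Y0 ih; set X := \sum_(j <- r) _; set Y := \sum_(j <- r) _.
set A := \sum_(j <- r) _; move: (x i) (y i) => a b X0 Y0 ih.
suff : 2 * (A * (a * b)) <= X * b ^+ 2 + Y * a ^+ 2 by nra.
have [ab|ab] := leP (A * (a * b)) 0.
  by have := sqr_ge0 a; have := sqr_ge0 b; nra.
have p0 : 0 <= 2 * (A * (a * b)) by rewrite mulr_ge0// ltW.
have q0 : 0 <= X * b ^+ 2 + Y * a ^+ 2 by apply: addr_ge0; apply: mulr_ge0 => //; exact: sqr_ge0.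
rewrite -(@ler_pXn2r _ 2)// ?nnegrE//.
(* The difference $(Xb^2+Ya^2)^2-4XYa^2b^2$ is this square, and $A^2\le XY$ is the induction
   hypothesis. *)
have h1 := sqr_ge0 (X * b ^+ 2 - Y * a ^+ 2).
have h2 : A ^+ 2 * (a * b) ^+ 2 <= X * Y * (a * b) ^+ 2 by rewrite ler_wpM2r ?sqr_ge0.
apply: (@le_trans _ _ (4 * (X * Y * (a * b) ^+ 2))).
  have -> : (2 * (A * (a * b))) ^+ 2 = 4 * (A ^+ 2 * (a * b) ^+ 2) by ring.
  by rewrite ler_pM2l.
rewrite -subr_ge0; apply: le_trans h1 _; rewrite le_eqVlt; apply/orP; left; apply/eqP; ring.
Qed.

Lemma cauchy_schwarz_wsum (T : Type) (r : seq T) (x w : T -> R) :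
  (forall i, 0 <= w i) ->
  (\sum_(i <- r) x i * w i) ^+ 2 <= (\sum_(i <- r) w i) * (\sum_(i <- r) x i ^+ 2 * w i).
Proof.
move=> w0; have := cauchy_schwarz_sum r (fun i => Num.sqrt (w i))
  (fun i => x i * Num.sqrt (w i)).
under eq_bigr do rewrite mulrCA -expr2 sqr_sqrtr//.
under [X in _ <= X * _ -> _]eq_bigr do rewrite sqr_sqrtr//.
by under [X in _ <= _ * X -> _]eq_bigr do rewrite exprMn sqr_sqrtr//.
Qed.

(** Young's inequality $\ell^2*\ell^1\to\ell^2$: Cauchy-Schwarz with weight [b], then exchange of
    sums and translation of [a]. Working with bounds on all partial sums avoids infinite series. *)
Lemma young21 (a b : int -> R) (A B : R) :
  (forall k, 0 <= a k) -> (forall k, 0 <= b k) ->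
  (forall n, \sum_(k <- rng n) a k ^+ 2 <= A) -> (forall n, \sum_(k <- rng n) b k <= B) ->
  forall N n, \sum_(k <- rng N) (\sum_(l <- rng n) a (k - l) * b l) ^+ 2 <= A * B ^+ 2.
Proof.
move=> a0 b0 aA bB N n.
have B0 : 0 <= B by rewrite (le_trans _ (bB 0%N))// sumr_ge0.
apply: (@le_trans _ _ (\sum_(k <- rng N) (B * \sum_(l <- rng n) a (k - l) ^+ 2 * b l))).
  apply: ler_sum => k _; apply: le_trans (cauchy_schwarz_wsum _ _ b0) _.
  by rewrite ler_wpM2r// sumr_ge0// => l _; rewrite mulr_ge0 ?sqr_ge0.
rewrite -mulr_sumr exchange_big/= (_ : A * B ^+ 2 = B * (A * B)); last by ring.
rewrite ler_wpM2l// (@le_trans _ _ (\sum_(l <- rng n) A * b l))//.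
  apply: ler_sum => l _; rewrite -mulr_suml ler_wpM2r//.
  apply: le_trans (aA (N + absz l)%N).
  exact: (@sum_rng_shift N l (fun k => a k ^+ 2) (fun k => sqr_ge0 _)).
rewrite -mulr_sumr ler_wpM2l//.
by rewrite (le_trans _ (aA 0%N))// sumr_ge0// => ? _; exact: sqr_ge0.
Qed.

(** Now the kernel [a] is the summable factor and serves as the weight; its sum over [l] is bounded
    after a reflection of the range. *)
Lemma young12 (a b : int -> R) (A B : R) :
  (forall k, 0 <= a k) -> (forall k, 0 <= b k) ->
  (forall n, \sum_(k <- rng n) a k <= A) -> (forall n, \sum_(k <- rng n) b k ^+ 2 <= B) ->
  forall N n, \sum_(k <- rng N) (\sum_(l <- rng n) a (k - l) * b l) ^+ 2 <= A ^+ 2 * B.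
Proof.
move=> a0 b0 aA bB N n.
have A0 : 0 <= A by rewrite (le_trans _ (aA 0%N))// sumr_ge0.
apply: (@le_trans _ _ (\sum_(k <- rng N) (A * \sum_(l <- rng n) b l ^+ 2 * a (k - l)))).
  apply: ler_sum => k _.
  under eq_bigr do rewrite mulrC.
  apply: le_trans (cauchy_schwarz_wsum _ _ _) _ => //.
  rewrite ler_wpM2r//; first by rewrite sumr_ge0// => l _; rewrite mulr_ge0 ?sqr_ge0.
  exact: le_trans (@sum_rng_reflect n k a a0) (aA _).
rewrite -mulr_sumr exchange_big/= (_ : A ^+ 2 * B = A * (A * B)); last by ring.
rewrite ler_wpM2l// (@le_trans _ _ (\sum_(l <- rng n) A * b l ^+ 2))//.
  apply: ler_sum => l _; rewrite -mulr_sumr mulrC ler_wpM2r ?sqr_ge0//.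
  exact: le_trans (@sum_rng_shift N l a a0) (aA _).
by rewrite -mulr_sumr ler_wpM2l.
Qed.

End IntRange.

(** * The two-point problem on [0, 1] *)

Section UnitIntegral.
Context {R : realType}.
Notation mu := (@lebesgue_measure R).
Implicit Types f g : R -> R.

Definition J f : R := \int[mu]_(z in `[0, 1]) f z.

Lemma continuous_segment_integrable f (a b : R) : continuous f ->
  mu.-integrable `[a, b] (EFin \o f).
Proof.
move=> cf; apply: continuous_compact_integrable; first exact: segment_compact.
exact: continuous_subspaceT.
Qed.

Lemma is_derive_within_continuous (F f : R -> R) (a b : R) :
  (forall z : R, a <= z <= b -> is_derive z 1 F (f z)) -> {within `[a, b], continuous F}.
Proof.
move=> dF; apply: derivable_within_continuous => z; rewrite in_itv/= => zab.
by have [] := dF z zab.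
Qed.

Lemma is_derive1_continuous (F : R -> R) (z d : R) :
  is_derive z 1 F d -> {for z, continuous F}.
Proof. by move=> [/derivable1_diffP/differentiable_continuous]. Qed.

Lemma is_deriveDf (f g : R -> R) (z df dg : R) : is_derive z 1 f df -> is_derive z 1 g dg ->
  is_derive z 1 (fun t => f t + g t) (df + dg).
Proof. exact: is_deriveD. Qed.

Lemma is_deriveBf (f g : R -> R) (z df dg : R) : is_derive z 1 f df -> is_derive z 1 g dg ->
  is_derive z 1 (fun t => f t - g t) (df - dg).
Proof. exact: is_deriveB. Qed.

Lemma is_deriveZf (a : R) (f : R -> R) (z df : R) : is_derive z 1 f df ->
  is_derive z 1 (fun t => a * f t) (a * df).
Proof. exact: is_deriveZ. Qed.

Lemma is_deriveMf (f g : R -> R) (z df dg : R) : is_derive z 1 f df -> is_derive z 1 g dg ->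
  is_derive z 1 (fun t => f t * g t) (df * g z + f z * dg).
Proof.
move=> h1 h2; have h := is_deriveM h1 h2; apply: is_derive_eq h _.
by rewrite /GRing.scale/=; ring.
Qed.

(** Derivatives are taken on an open neighbourhood of [0, 1], so that no one-sided derivative occurs
    at the ends. *)
Lemma J_FTC (F f : R -> R) : continuous f ->
  (forall z : R, -1 < z < 2 -> is_derive z 1 F (f z)) -> J f = F 1 - F 0.
Proof.
move=> cf dF.
have dF' (z : R) : 0 <= z <= 1 -> is_derive z 1 F (f z).
  by move=> /andP[? ?]; apply: dF; apply/andP; split; lra.
have ctF (z : R) : 0 <= z <= 1 -> {for z, continuous F}.
  by move=> /dF'; exact: is_derive1_continuous.
rewrite /J /Rintegral (@continuous_FTC2 _ f F)//.
- exact: continuous_subspaceT.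
- split.
  + move=> z; rewrite in_itv/= => /andP[z0 z1].
    by have [|] := dF' z; first by rewrite !ltW.
  + by apply/cvg_at_right_filter/ctF; rewrite lexx ler01.
  + by apply/cvg_at_left_filter/ctF; rewrite lexx ler01.
- move=> z; rewrite in_itv/= => /andP[z0 z1].
  rewrite derive1E; apply: derive_val; apply: dF'; by rewrite !ltW.
Qed.

Lemma primitive_exists f : continuous f ->
  exists W : R -> R, W 0 = 0 /\ forall z : R, -1 < z < 2 -> is_derive z 1 W (f z).
Proof.
(* Integrating from -1, with 3 as outer bound, makes every point of (-1, 2) interior. *)
move=> cf; pose W z := \int[mu]_(t in [set` `[-1, z]]) f t.
exists (fun z => W z - W 0); split; first by rewrite subrr.
move=> z /andP[z0 z1].
have [dW W'] := @continuous_FTC1_closed R f (-1) z 3 (lt_trans z1 (ltr_nat _ 2 3))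
  (continuous_segment_integrable (-1) 3 cf) z0 (cf z).
have h : is_derive z 1 W (f z).
  by split; [exact: dW|rewrite -derive1E W'].
by rewrite -[f z]subr0; exact: is_deriveB.
Qed.

Lemma JD f g : continuous f -> continuous g -> J (fun z => f z + g z) = J f + J g.
Proof. by move=> cf cg; rewrite /J RintegralD//; exact: continuous_segment_integrable. Qed.

Lemma JZ (a : R) f : continuous f -> J (fun z => a * f z) = a * J f.
Proof. by move=> cf; rewrite /J RintegralZl//; exact: continuous_segment_integrable. Qed.

Lemma J_cst (a : R) : J (fun=> a) = a.
Proof.
rewrite /J Rintegral_cst//; transitivity (a * 1); last by rewrite mulr1.
have mu1 : mu `[0, 1] = 1%:E by rewrite lebesgue_measure_itv/= lte_fin ltr01 oppr0 adde0.
by congr (_ * _); exact: (congr1 fine mu1).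
Qed.

Lemma J_le f g : continuous f -> continuous g ->
  (forall z : R, 0 <= z <= 1 -> f z <= g z) -> J f <= J g.
Proof.
move=> cf cg fg; apply: le_Rintegral => //; first exact: continuous_segment_integrable.
exact: continuous_segment_integrable.
Qed.

Lemma J_ge0 f : (forall z : R, 0 <= z <= 1 -> 0 <= f z) -> 0 <= J f.
Proof. by move=> f0; apply: Rintegral_ge0 => z; rewrite /= in_itv/= => /f0. Qed.

Lemma eq_J f g : (forall z : R, 0 <= z <= 1 -> f z = g z) -> J f = J g.
Proof. by move=> fg; apply: eq_Rintegral => z; rewrite inE/= in_itv/= => /fg. Qed.

Lemma continuous_addR f g : continuous f -> continuous g -> continuous (fun z => f z + g z).
Proof. by move=> cf cg z; apply: continuousD; [exact: cf|exact: cg]. Qed.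

Lemma continuous_mulR f g : continuous f -> continuous g -> continuous (fun z => f z * g z).
Proof. by move=> cf cg z; apply: continuousM; [exact: cf|exact: cg]. Qed.

Lemma continuous_oppR f : continuous f -> continuous (fun z => - f z).
Proof. by move=> cf z; apply: continuousN; exact: cf. Qed.

Lemma continuous_sumR I (r : seq I) (P : pred I) (F : I -> R -> R) :
  (forall i, continuous (F i)) -> continuous (fun z => \sum_(i <- r | P i) F i z).
Proof.
move=> cF; elim: r => [|i r ih].
  have -> : (fun z => \sum_(i <- [::] | P i) F i z) = cst 0.
    by apply/funext => z; rewrite big_nil.
  exact: cst_continuous.
have -> : (fun z => \sum_(i <- i :: r | P i) F i z) =
    (fun z => if P i then F i z + \sum_(i <- r | P i) F i z else \sum_(i <- r | P i) F i z).
  by apply/funext => z; rewrite big_cons.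
by case: (P i) => //; exact: continuous_addR.
Qed.

Lemma J_sum I (r : seq I) (P : pred I) (F : I -> R -> R) : (forall i, continuous (F i)) ->
  J (fun z => \sum_(i <- r | P i) F i z) = \sum_(i <- r | P i) J (F i).
Proof.
move=> cF; elim: r => [|i r ih].
  by under eq_J do rewrite big_nil; rewrite J_cst big_nil.
rewrite big_cons; under eq_J do rewrite big_cons; case: ifP => _; last exact: ih.
by rewrite JD ?ih//; exact: continuous_sumR.
Qed.

Lemma continuous_comp1 (f g : R -> R) : continuous f -> continuous g -> continuous (f \o g).
Proof. by move=> cf cg z; apply: continuous_comp; [exact: cg|exact: cf]. Qed.

Lemma continuous_expRM (k : R) : continuous (fun z : R => expR (k * z)).
Proof.
apply: (@continuous_comp1 expR ( *%R k)); first exact: continuous_expR.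
exact: mulrl_continuous.
Qed.

Lemma is_derive_expRM (k z : R) : is_derive z 1 (fun z : R => expR (k * z)) (k * expR (k * z)).
Proof.
have h : is_derive z 1 (fun z : R => k * z) k.
  by rewrite -[X in is_derive _ _ _ X]mulr1; apply: is_deriveZ.
rewrite mulrC; exact: (@is_derive1_comp _ expR (fun z : R => k * z)).
Qed.

(* The two-point problem p' = l q + a, q' = l p + b, p(1) = 0 = q(0), through the
   decoupled unknowns p + q and p - q. *)
Lemma two_point_problem (l : R) (a b : R -> R) : continuous a -> continuous b ->
  exists p q : R -> R, [/\ p 1 = 0, q 0 = 0,
    forall z : R, -1 < z < 2 -> is_derive z 1 p (l * q z + a z) &
    forall z : R, -1 < z < 2 -> is_derive z 1 q (l * p z + b z)].
Proof.
move=> ca cb.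
have cE : continuous (fun z => expR (- l * z) * (a z + b z)).
  by apply: continuous_mulR; [exact: continuous_expRM|exact: continuous_addR].
have cM : continuous (fun z => expR (l * z) * (a z - b z)).
  apply: continuous_mulR; [exact: continuous_expRM|].
  by apply: continuous_addR => //; exact: continuous_oppR.
have [We [We0 dWe]] := primitive_exists cE.
have [Wm [Wm0 dWm]] := primitive_exists cM.
(* Both [E] and [M] start from [al] at 0, which is q(0) = 0; this value makes E(1) + M(1) = 2 p(1)
   vanish. The denominator is 2 cosh l, so no mode is resonant. *)
pose al := - (expR l * We 1 + expR (- l) * Wm 1) / (expR l + expR (- l)).
pose E z := expR (l * z) * (al + We z).
pose M z := expR (- l * z) * (al + Wm z).
have ee z : expR (l * z) * expR (- l * z) = 1 by rewrite mulNr expRxMexpNx_1.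
have dE (z : R) : -1 < z < 2 -> is_derive z 1 E (l * E z + (a z + b z)).
  move=> z12; have h1 := is_derive_expRM l z; have h2 := dWe z z12.
  have h3 : is_derive z 1 (fun z => al + We z) (expR (- l * z) * (a z + b z)).
    by rewrite -[X in is_derive _ _ _ X]add0r; apply: is_deriveD.
  have h := is_deriveMf h1 h3; apply: is_derive_eq h _.
  by rewrite /E [_ * (_ * (a z + b z))]mulrA ee; ring.
have dM (z : R) : -1 < z < 2 -> is_derive z 1 M (- l * M z + (a z - b z)).
  move=> z12; have h1 := is_derive_expRM (- l) z; have h2 := dWm z z12.
  have h3 : is_derive z 1 (fun z => al + Wm z) (expR (l * z) * (a z - b z)).
    by rewrite -[X in is_derive _ _ _ X]add0r; apply: is_deriveD.
  have h := is_deriveMf h1 h3; apply: is_derive_eq h _.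
  by rewrite /M [_ * (_ * (a z - b z))]mulrA [expR (- l * z) * expR _]mulrC ee; ring.
exists (fun z => 2^-1 * (E z + M z)), (fun z => 2^-1 * (E z - M z)); split.
- rewrite /E /M !mulr1 /al; have := expR_gt0 l; have := expR_gt0 (- l) => ? ?.
  field; apply/eqP; lra.
- by rewrite /E /M !mulr0 We0 Wm0 subrr mulr0.
- move=> z z12; have h1 := dE z z12; have h2 := dM z z12.
  have h := is_deriveZf 2^-1 (is_deriveDf h1 h2); apply: is_derive_eq h _.
  by field.
- move=> z z12; have h1 := dE z z12; have h2 := dM z z12.
  have h := is_deriveZf 2^-1 (is_deriveBf h1 h2); apply: is_derive_eq h _.
  by field.
Qed.

(** For a primitive [W] of [w], both W - H and W + H are nondecreasing; one of them is used
    according to the end at which [H] vanishes. *)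
Lemma sup_le_J (H h w : R -> R) : continuous w ->
  (forall z : R, -1 < z < 2 -> is_derive z 1 H (h z)) ->
  (forall z : R, 0 <= z <= 1 -> `|h z| <= w z) -> H 0 = 0 \/ H 1 = 0 ->
  forall z : R, 0 <= z <= 1 -> H z <= J w.
Proof.
move=> cw dH hw H01.
have [W [W0 dW]] := primitive_exists cw; rewrite (J_FTC cw dW).
have mono (F f : R -> R) : (forall z : R, -1 < z < 2 -> is_derive z 1 F (f z)) ->
    (forall z : R, 0 <= z <= 1 -> 0 <= f z) ->
    forall x y, 0 <= x -> x <= y -> y <= 1 -> F x <= F y.
  move=> dF f0 x y x0 xy y1; rewrite -subr_ge0.
  have [] := @MVT_segment R F f x y xy.
  - by move=> z; rewrite in_itv/= => /andP[? ?]; apply: dF; apply/andP; split; lra.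
  - apply: (@is_derive_within_continuous _ f) => z /andP[? ?].
    by apply: dF; apply/andP; split; lra.
  - move=> c; rewrite in_itv/= => /andP[? ?] ->.
    by rewrite mulr_ge0 ?subr_ge0// f0//; apply/andP; split; lra.
have h1 := mono (fun z => W z - H z) (fun z => w z - h z).
have {}h1 := h1 (fun z zz => is_deriveB (dW z zz) (dH z zz)).
have h2 := mono (fun z => W z + H z) (fun z => w z + h z).
have {}h2 := h2 (fun z zz => is_deriveD (dW z zz) (dH z zz)).
have h3 := mono W w dW.
have {}h1 : forall x y : R, 0 <= x -> x <= y -> y <= 1 -> W x - H x <= W y - H y.
  by apply: h1 => z /hw; rewrite ler_norml => /andP[? ?]; lra.
have {}h2 : forall x y : R, 0 <= x -> x <= y -> y <= 1 -> W x + H x <= W y + H y.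
  by apply: h2 => z /hw; rewrite ler_norml => /andP[? ?]; lra.
have {}h3 : forall x y : R, 0 <= x -> x <= y -> y <= 1 -> W x <= W y.
  by apply: h3 => z /hw; have := normr_ge0 (h z); lra.
move=> z /andP[z0 z1]; case: H01 => HH.
- have := h1 0 z (lexx 0) z0 z1; have := h3 z 1 z0 z1 (lexx 1); lra.
- have := h2 z 1 z0 z1 (lexx 1); have := h3 0 z (lexx 0) z0 z1; lra.
Qed.

End UnitIntegral.

(** * Weights and commutators *)

Section Weights.
Context {R : realType}.
Implicit Types (k l : int) (p q t e : R).

(** This weight replaces $(1+k^2)^{1/2}$ because it is subadditive and Lipschitz;
    [sobolev_weight_le] and [le_sobolev_weight] compare the two. *)
Definition jb k : R := 1 + (absz k)%:R.
Definition W p k : R := jb k `^ p.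

Lemma powRDp (x p q : R) : 0 < x -> x `^ (p + q) = x `^ p * x `^ q.
Proof. by move=> x0; rewrite powRD//; apply/implyP => _; rewrite gt_eqF. Qed.

Lemma jb_ge1 k : 1 <= jb k. Proof. by rewrite /jb lerDl. Qed.
Lemma jb_gt0 k : 0 < jb k. Proof. exact: lt_le_trans (jb_ge1 k). Qed.
Lemma jb_ge0 k : 0 <= jb k. Proof. exact: ltW (jb_gt0 k). Qed.
Lemma W_gt0 p k : 0 < W p k. Proof. by rewrite powR_gt0// jb_gt0. Qed.
Lemma W_ge0 p k : 0 <= W p k. Proof. exact: ltW (W_gt0 p k). Qed.
Lemma WD p q k : W (p + q) k = W p k * W q k.
Proof. by rewrite /W powRDp// jb_gt0. Qed.
Lemma W0 k : W 0 k = 1. Proof. by rewrite /W powRr0. Qed.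
Lemma W1 k : W 1 k = jb k. Proof. by rewrite /W powRr1// jb_ge0. Qed.
Lemma WN p k : W (- p) k = (W p k)^-1. Proof. by rewrite /W powRN. Qed.
Lemma W_le p q k : p <= q -> W p k <= W q k.
Proof. by move=> pq; rewrite /W ler_powR// jb_ge1. Qed.
Lemma W_sqr p k : W p k ^+ 2 = W (2 * p) k.
Proof. by rewrite expr2 -WD; congr W; ring. Qed.
Lemma W_opp p k : W p (- k) = W p k.
Proof. by rewrite /W /jb abszN. Qed.

Lemma jb_sub k l : jb k <= jb (k - l) + jb l - 1.
Proof.
rewrite /jb -addrA [X in _ <= X](_ : _ = 1 + ((absz (k - l))%:R + (absz l)%:R)); last by ring.
by rewrite lerD2l -natrD ler_nat; lia.
Qed.

Lemma jb_lip k l : `|jb k - jb l| <= jb (k - l).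
Proof.
have h1 := jb_sub k l; have h2 := jb_sub l k.
have E : jb (l - k) = jb (k - l) by rewrite /jb -opprB abszN.
by rewrite ler_norml; apply/andP; split; lra.
Qed.

Lemma powR_add_le (x y t : R) : 0 <= x -> 0 <= y -> 0 <= t ->
  (x + y) `^ t <= 2 `^ t * (x `^ t + y `^ t).
Proof.
wlog xy : x y / x <= y.
  move=> H x0 y0 t0; have [xy|/ltW yx] := leP x y; first exact: H.
  by rewrite addrC [x `^ t + _]addrC; exact: H.
move=> x0 y0 t0; apply: (@le_trans _ _ ((2 * y) `^ t)).
  by apply: ge0_ler_powR; rewrite ?nnegrE ?addr_ge0 ?mulr_ge0//; lra.
by rewrite powRM// ler_pM2l ?powR_gt0// lerDr powR_ge0.
Qed.

(** A sum instead of the customary product of weights: the [t] derivatives fall on one factor at a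
    time, which keeps the product estimates tame. *)
Lemma W_peetre t k l : 0 <= t -> W t k <= 2 `^ t * (W t (k - l) + W t l).
Proof.
move=> t0; apply: le_trans (powR_add_le (jb_ge0 _) (jb_ge0 _) t0).
apply: ge0_ler_powR; rewrite ?nnegrE ?addr_ge0 ?jb_ge0//.
by have := jb_sub k l; lra.
Qed.

(** By homogeneity only r = y / x matters. With an integer N above t, $1-r^t\le 1-r^N\le N(1-r)$ by
    Bernoulli, and $1-r\le(1-r)^e$ as the base is at most 1. *)
Lemma powR_diff_le (x y t e : R) : 0 < y -> y <= x -> 0 < t -> 0 <= e -> e <= 1 ->
  x `^ t - y `^ t <= (Num.bound t)%:R * ((x - y) `^ e * x `^ (t - e)).
Proof.
move=> y0 yx t0 e0 e1; have x0 : 0 < x by exact: lt_le_trans yx.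
set N := Num.bound t.
have tN : t <= N%:R by apply/ltW/archi_boundP/ltW.
have [->|xy] := eqVneq x y.
  by rewrite subrr mulr_ge0// mulr_ge0// powR_ge0.
have {}yx : y < x by rewrite lt_neqAle eq_sym xy.
pose r := y / x; have r0 : 0 < r by rewrite divr_gt0.
have r1 : r < 1 by rewrite ltr_pdivrMr// mul1r.
have yE : y = x * r by rewrite /r mulrC divfK// gt_eqF.
have bern : 1 - r ^+ N <= N%:R * (1 - r).
  elim: (N) => [|m ih]; first by rewrite expr0 subrr mul0r.
  rewrite exprS -natr1 mulrDl mul1r.
  have : r * (1 - r ^+ m) <= 1 - r ^+ m.
    by rewrite ler_piMl ?(ltW r1)// subr_ge0 exprn_ile1 ?ltW.
  have -> : r * (1 - r ^+ m) = r - r * r ^+ m by ring.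
  lra.
have h : 1 - r `^ t <= N%:R * (1 - r) `^ e.
  apply: (@le_trans _ _ (N%:R * (1 - r))).
    apply: le_trans bern; rewrite lerD2l lerN2 -powR_mulrn ?(ltW r0)//.
    by apply: ger_powR => //; rewrite r0 ltW.
  rewrite ler_wpM2l//; apply: ger1_powR => //.
  by apply/andP; split; lra.
have xyE : x - y = x * (1 - r) by rewrite yE; ring.
have r1' : 0 <= 1 - r by lra.
rewrite xyE {1}yE (@powRM _ x r t (ltW x0) (ltW r0)) (@powRM _ x (1 - r) e (ltW x0) r1').
have -> : x `^ t = x `^ e * x `^ (t - e).
  by rewrite -powRDp//; congr powR; ring.
have -> : x `^ e * x `^ (t - e) - x `^ e * x `^ (t - e) * r `^ t =
  (x `^ e * x `^ (t - e)) * (1 - r `^ t) by ring.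
have -> : N%:R * (x `^ e * (1 - r) `^ e * x `^ (t - e)) =
  (x `^ e * x `^ (t - e)) * (N%:R * (1 - r) `^ e) by ring.
by rewrite ler_wpM2l// mulr_ge0// powR_ge0.
Qed.

(** [W t l - W t k] is the kernel of the commutator of the multiplier [W t] with a multiplication.
    Either all [t] derivatives fall on the coefficient, or [e] of them do and only [t - e] remain on
    the other factor. *)
Lemma W_commutator t e : 0 < t -> 0 <= e -> e <= 1 -> e <= t ->
  exists2 K : R, 0 <= K & forall k l,
    `|W t l - W t k| <= K * (W t (k - l) + W e (k - l) * W (t - e) l).
Proof.
move=> t0 e0 e1 et; pose N : R := (Num.bound t)%:R.
have N0 : 0 <= N by rewrite /N.
exists (N * (2 `^ (t - e))); first by rewrite mulr_ge0// powR_ge0.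
(* The second inequality serves the case [jb k <= jb l]: there the roles of k and l are exchanged,
   and the bound must still carry [W (t - e) l]. *)
suff H k l : jb l <= jb k -> W t k - W t l <=
    N * 2 `^ (t - e) * (W t (k - l) + W e (k - l) * W (t - e) l) /\
    W t k - W t l <=
    N * 2 `^ (t - e) * (W t (k - l) + W e (k - l) * W (t - e) k).
  move=> k l; rewrite ler_norml; have [lk|/ltW kl] := leP (jb l) (jb k).
    have [h _] := H k l lk; apply/andP; split; first by lra.
    have : W t l <= W t k by apply: ge0_ler_powR; rewrite ?nnegrE ?jb_ge0// ltW.
    have : 0 <= N * 2 `^ (t - e) * (W t (k - l) + W e (k - l) * W (t - e) l).
      by rewrite mulr_ge0 ?addr_ge0 ?mulr_ge0 ?W_ge0 ?powR_ge0.
    lra.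
  have [_ h] := H l k kl; have E p : W p (l - k) = W p (k - l).
    by rewrite -[LHS]W_opp opprB.
  rewrite !E in h; apply/andP; split; last by lra.
  have : W t k <= W t l by apply: ge0_ler_powR; rewrite ?nnegrE ?jb_ge0// ltW.
  have : 0 <= N * 2 `^ (t - e) * (W t (k - l) + W e (k - l) * W (t - e) l).
    by rewrite mulr_ge0 ?addr_ge0 ?mulr_ge0 ?W_ge0 ?powR_ge0.
  lra.
move=> lk; have h := powR_diff_le (jb_gt0 l) lk t0 e0 e1.
have te0 : 0 <= t - e by lra.
have d1 : (jb k - jb l) `^ e <= W e (k - l).
  apply: ge0_ler_powR => //; rewrite ?nnegrE ?subr_ge0 ?jb_ge0//.
  exact: le_trans (ler_norm _) (jb_lip k l).
have d2 := W_peetre k l te0.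
have E : W t (k - l) = W e (k - l) * W (t - e) (k - l).
  by rewrite -WD; congr W; ring.
have key q : W (t - e) k <= 2 `^ (t - e) * (W (t - e) (k - l) + q) ->
    W t k - W t l <= N * 2 `^ (t - e) * (W t (k - l) + W e (k - l) * q).
  move=> hq; apply: le_trans h _; rewrite -/N E -mulrDr.
  have -> : N * 2 `^ (t - e) * (W e (k - l) * (W (t - e) (k - l) + q)) =
     N * (W e (k - l) * (2 `^ (t - e) * (W (t - e) (k - l) + q))) by ring.
  by rewrite ler_wpM2l// ler_pM ?powR_ge0.
split; apply: key => //.
rewrite mulrDr -[leLHS]add0r lerD// ?mulr_ge0 ?powR_ge0//.
rewrite ler_peMl ?W_ge0// -[X in X <= _](powRr0 2); apply: ler_powR => //.
by rewrite ler1n.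
Qed.

Lemma W_interp p q (eps : R) : p < q -> 0 < eps ->
  exists2 K : R, 0 <= K & forall k, W p k <= eps * W q k + K.
Proof.
(* [L] solves $\varepsilon L^{q-p}=1$: above this frequency the term with [W q] dominates, below it
   the constant does. *)
move=> pq e0; pose L := eps `^ (- (q - p)^-1).
have L0 : 0 < L by rewrite powR_gt0.
exists (Num.max 1 L `^ `|p|); first exact: powR_ge0.
move=> k; have [kL|/ltW Lk] := leP (jb k) L.
  apply: (@le_trans _ _ (Num.max 1 L `^ `|p|)); last first.
    by rewrite lerDr mulr_ge0 ?W_ge0// ltW.
  apply: (@le_trans _ _ (W `|p| k)); first by rewrite W_le// ler_norm.
  apply: ge0_ler_powR; rewrite ?nnegrE ?jb_ge0// ?le_max ?ler01 ?kL ?orbT//.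
rewrite -[leLHS]addr0 lerD ?powR_ge0//.
have -> : W q k = W p k * W (q - p) k by rewrite -WD; congr W; ring.
rewrite mulrCA ler_peMr ?W_ge0//.
have -> : (1 : R) = eps * L `^ (q - p).
  rewrite /L -powRrM mulNr mulVf ?subr_eq0 ?gt_eqF// powR_inv1 ?ltW//.
  by rewrite mulfV// gt_eqF.
by rewrite ler_pM2l//; apply: ge0_ler_powR; rewrite ?nnegrE ?jb_ge0 ?subr_ge0// ltW.
Qed.

Lemma sum_rngS (V : nmodType) n (f : int -> V) :
  \sum_(k <- rng n.+1) f k = f n.+1%:Z + f (- n.+1%:Z) + \sum_(k <- rng n) f k.
Proof.
have -> : \sum_(k <- rng n.+1) f k = \sum_(k <- n.+1%:Z :: - n.+1%:Z :: rng n) f k.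
  apply: perm_big; apply: uniq_perm; first exact: rng_uniq.
    apply/and3P; split; [rewrite inE mem_rng; lia|rewrite mem_rng; lia|exact: rng_uniq].
  move=> k; rewrite mem_rng [RHS]in_cons [X in _ || X]in_cons mem_rng; lia.
by rewrite !big_cons addrA.
Qed.

Lemma rng0 (V : nmodType) (f : int -> V) : \sum_(k <- rng 0) f k = f 0.
Proof.
have E : rng 0 = [:: 0] :> seq int by rewrite /rng unlock.
by rewrite E big_cons big_nil addr0.
Qed.

Lemma sum_W_bounded p : 1 < p ->
  exists2 K : R, 0 <= K & forall n, \sum_(k <- rng n) W (- p) k <= K.
Proof.
move=> p1; pose q := p - 1; have q0 : 0 < q by rewrite /q; lra.
exists (1 + 2 / q); first by rewrite addr_ge0// divr_ge0// ltW.
(* The subtracted term makes the induction telescope: $x^{-q}-(x+1)^{-q}\ge q(x+1)^{-p}$, and each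
   step adds the two frequencies n+1 and -(n+1). *)
suff H n : \sum_(k <- rng n) W (- p) k <= 1 + 2 / q - 2 / q * (n.+1%:R `^ (- q)).
  move=> n; apply: le_trans (H n) _.
  by rewrite gerBl mulr_ge0 ?powR_ge0// divr_ge0// ltW.
elim: n => [|n ih].
  by rewrite rng0 /W /jb /= addr0 !powR1 mulr1; lra.
rewrite sum_rngS W_opp.
have -> : W (- p) n.+1%:Z = n.+2%:R `^ (- p) by rewrite /W /jb /= nat1r.
pose x : R := n.+1%:R; have x0 : 0 < x by rewrite ltr0n.
have xE : n.+2%:R = x + 1 by rewrite /x natr1.
suff : q * (x + 1) `^ (- p) <= x `^ (- q) - (x + 1) `^ (- q).
  move=> h; apply: le_trans (lerD (lexx _) ih) _; rewrite xE -/x.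
  have : 2 / q * (q * (x + 1) `^ (- p)) <= 2 / q * (x `^ (- q) - (x + 1) `^ (- q)).
    by rewrite ler_wpM2l// divr_ge0// ltW.
  have -> : 2 / q * (q * (x + 1) `^ (- p)) = 2 * (x + 1) `^ (- p).
    by rewrite mulrA divfK// gt_eqF.
  lra.
have x10 : 0 < x + 1 by lra.
have r0 : 0 < x / (x + 1) by rewrite divr_gt0.
have -> : x `^ (- q) = (x + 1) `^ (- q) * (x / (x + 1)) `^ (- q).
  rewrite -powRM ?ltW//; congr powR; field; lra.
have -> : (x + 1) `^ (- p) = (x + 1) `^ (- q) * (x + 1)^-1.
  rewrite -powR_inv1 ?ltW// -powRDp//; congr powR; rewrite /q; ring.
suff : 1 + q * (x + 1)^-1 <= (x / (x + 1)) `^ (- q).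
  move=> h; rewrite mulrCA -[X in _ <= _ - X]mulr1 -mulrBr ler_wpM2l ?powR_ge0//; lra.
rewrite /powR gt_eqF//; apply: le_trans (expR_ge1Dx _); rewrite lerD2l mulNr -mulrN.
apply: ler_wpM2l; first exact: ltW.
rewrite lerNr; have := @le_ln1Dx R (- (x + 1)^-1).
have i1 : (x + 1)^-1 < 1 by rewrite invf_lt1//; lra.
have -> : 1 + - (x + 1)^-1 = x / (x + 1) by field; lra.
by apply; lra.
Qed.

(** The embedding of $H^p$ into absolutely summable coefficients for p > 1/2: Cauchy-Schwarz against
    [W (- p)]. *)
Lemma l1_le_weighted p : 1 < 2 * p -> exists2 K : R, 0 <= K &
  forall (u : int -> R) (U : R), (forall k, 0 <= u k) ->
    (forall n, \sum_(k <- rng n) W (2 * p) k * u k ^+ 2 <= U) ->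
    forall n, \sum_(k <- rng n) u k <= Num.sqrt (K * U).
Proof.
move=> p1; have [K K0 hK] := sum_W_bounded p1; exists K => // u U u0 hU n.
have U0 : 0 <= U.
  by apply: le_trans (hU 0%N); rewrite rng0 mulr_ge0 ?W_ge0 ?sqr_ge0.
have s0 : 0 <= \sum_(k <- rng n) u k by rewrite sumr_ge0.
rewrite -(@ler_pXn2r _ 2)// ?nnegrE ?sqrtr_ge0// sqr_sqrtr ?mulr_ge0//.
have := cauchy_schwarz_sum (rng n) (fun k => W (- p) k) (fun k => W p k * u k).
have -> : \sum_(i <- rng n) W (- p) i * (W p i * u i) = \sum_(i <- rng n) u i.
  by apply: eq_bigr => k _; rewrite mulrA -WD addNr W0 mul1r.
move=> /le_trans; apply; apply: ler_pM.
- by rewrite sumr_ge0// => k _; exact: sqr_ge0.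
- by rewrite sumr_ge0// => k _; exact: sqr_ge0.
- apply: le_trans (hK n); apply: ler_sum => k _.
  by rewrite W_sqr mulrN.
- apply: le_trans (hU n); apply: ler_sum => k _.
  by rewrite exprMn W_sqr.
Qed.

(** The two terms of the kernel call for opposite Young inequalities. In the first, [u] is summable,
    at the price of level [rho]; in the second, [W e] times [c] is summable, at the price of level
    [sg]. *)
Lemma weighted_conv_bound (sg rho e : R) : 1 < 2 * rho -> 1 < 2 * (sg - e) ->
  exists2 K : R, 0 <= K & forall t (c u : int -> R) (Ct Cs Ur Ue : R),
    (forall k, 0 <= c k) -> (forall k, 0 <= u k) ->
    (forall n, \sum_(k <- rng n) W (2 * t) k * c k ^+ 2 <= Ct) ->
    (forall n, \sum_(k <- rng n) W (2 * sg) k * c k ^+ 2 <= Cs) ->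
    (forall n, \sum_(k <- rng n) W (2 * rho) k * u k ^+ 2 <= Ur) ->
    (forall n, \sum_(k <- rng n) W (2 * (t - e)) k * u k ^+ 2 <= Ue) ->
    forall N n, \sum_(k <- rng N) (\sum_(l <- rng n)
      (W t (k - l) + W e (k - l) * W (t - e) l) * (c (k - l) * u l)) ^+ 2
      <= K * (Ct * Ur + Cs * Ue).
Proof.
move=> r1 s1; have [K1 K10 h1] := l1_le_weighted r1.
have [K2 K20 h2] := l1_le_weighted s1.
exists (2 * (K1 + K2)); first by rewrite mulr_ge0// addr_ge0.
move=> t c u Ct Cs Ur Ue c0 u0 hCt hCs hUr hUe N n.
have nn (v : int -> R) p B : (forall m, \sum_(k <- rng m) W p k * v k ^+ 2 <= B) -> 0 <= B.
  by move=> hB; apply: le_trans (hB 0%N); rewrite rng0 mulr_ge0 ?W_ge0 ?sqr_ge0.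
have Ct0 := nn _ _ _ hCt; have Cs0 := nn _ _ _ hCs.
have Ur0 := nn _ _ _ hUr; have Ue0 := nn _ _ _ hUe.
have y1 := @young21 R (fun k => W t k * c k) u Ct (Num.sqrt (K1 * Ur))
  (fun k => mulr_ge0 (W_ge0 _ _) (c0 k)) u0.
have {}y1 : forall N n, \sum_(k <- rng N) (\sum_(l <- rng n) W t (k - l) * c (k - l) * u l) ^+ 2
    <= Ct * (K1 * Ur).
  move=> N' n'; rewrite -[X in _ * X]sqr_sqrtr ?mulr_ge0//.
  apply: y1 => [m|]; last exact: h1.
  by apply: le_trans (hCt m); apply: ler_sum => k _; rewrite exprMn W_sqr.
have y2 := @young12 R (fun k => W e k * c k) (fun l => W (t - e) l * u l)
  (Num.sqrt (K2 * Cs)) Ue (fun k => mulr_ge0 (W_ge0 _ _) (c0 k))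
  (fun k => mulr_ge0 (W_ge0 _ _) (u0 k)).
have {}y2 : forall N n, \sum_(k <- rng N) (\sum_(l <- rng n)
    W e (k - l) * c (k - l) * (W (t - e) l * u l)) ^+ 2 <= (K2 * Cs) * Ue.
  move=> N' n'; rewrite -[X in X * _]sqr_sqrtr ?mulr_ge0//.
  apply: y2 => m; last first.
    by apply: le_trans (hUe m); apply: ler_sum => k _; rewrite exprMn W_sqr.
  apply: h2 => [k|m']; first by rewrite mulr_ge0 ?W_ge0.
  apply: le_trans (hCs m'); apply: ler_sum => k _.
  by rewrite exprMn W_sqr mulrA -WD; rewrite (_ : _ + _ = 2 * sg)//; ring.
apply: (@le_trans _ _ (\sum_(k <- rng N)
   2 * ((\sum_(l <- rng n) W t (k - l) * c (k - l) * u l) ^+ 2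
   + (\sum_(l <- rng n) W e (k - l) * c (k - l) * (W (t - e) l * u l)) ^+ 2))).
  apply: ler_sum => k _.
  have -> : \sum_(l <- rng n) (W t (k - l) + W e (k - l) * W (t - e) l) * (c (k - l) * u l) =
    \sum_(l <- rng n) W t (k - l) * c (k - l) * u l +
    \sum_(l <- rng n) W e (k - l) * c (k - l) * (W (t - e) l * u l).
    by rewrite -big_split/=; apply: eq_bigr => l _; ring.
  have := sqr_ge0 (\sum_(l <- rng n) W t (k - l) * c (k - l) * u l -
    \sum_(l <- rng n) W e (k - l) * c (k - l) * (W (t - e) l * u l)); nra.
rewrite -mulr_sumr big_split/=.
have := y1 N n; have := y2 N n => z1 z2.
rewrite -mulrA ler_wpM2l// (le_trans (lerD z2 z1))//.
have p1 := mulr_ge0 (mulr_ge0 K10 Cs0) Ue0; have p2 := mulr_ge0 (mulr_ge0 K20 Ct0) Ur0.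
have p3 := mulr_ge0 K10 (mulr_ge0 Cs0 Ue0); have p4 := mulr_ge0 K20 (mulr_ge0 Ct0 Ur0).
nra.
Qed.

End Weights.

(** * Spaces of functions on the strip *)

Section StripSequences.
Context {R : realType}.
Notation C := (Rcomplex R).
Implicit Types (u v : int -> R -> C) (f g : R -> C) (s z a t : R) (n : nat).

Definition continuousC f := continuous (fun z => Re (f z)) /\ continuous (fun z => Im (f z)).

Lemma continuousC0 : continuousC (fun=> 0).
Proof. by split; exact: cst_continuous. Qed.

Lemma continuousC_cst (c : C) : continuousC (fun=> c).
Proof. by split; exact: cst_continuous. Qed.

Lemma continuousCD f g : continuousC f -> continuousC g -> continuousC (fun z => f z + g z).
Proof.
move=> [f1 f2] [g1 g2]; split.
  by under eq_fun do rewrite ReD; exact: continuous_addR.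
by under eq_fun do rewrite ImD; exact: continuous_addR.
Qed.

Lemma continuousCM f g : continuousC f -> continuousC g -> continuousC (fun z => f z * g z).
Proof.
move=> [f1 f2] [g1 g2]; split.
  under eq_fun do rewrite ReM; apply: continuous_addR; first exact: continuous_mulR.
  by apply: continuous_oppR; exact: continuous_mulR.
by under eq_fun do rewrite ImM; apply: continuous_addR; exact: continuous_mulR.
Qed.

Lemma continuousCN f : continuousC f -> continuousC (fun z => - f z).
Proof.
move=> [f1 f2]; split.
  by under eq_fun do rewrite ReN; exact: continuous_oppR.
by under eq_fun do rewrite ImN; exact: continuous_oppR.
Qed.

Lemma continuousCB f g : continuousC f -> continuousC g -> continuousC (fun z => f z - g z).
Proof. by move=> cf cg; apply: continuousCD => //; exact: continuousCN. Qed.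

Lemma continuousCZ (h : R -> R) f : continuous h -> continuousC f ->
  continuousC (fun z => h z *: f z).
Proof.
move=> ch [f1 f2]; split.
  by under eq_fun do rewrite ReZ; exact: continuous_mulR.
by under eq_fun do rewrite ImZ; exact: continuous_mulR.
Qed.

Lemma continuousC_conj f : continuousC f -> continuousC (fun z => conjc (f z)).
Proof.
move=> [f1 f2]; split; first by under eq_fun do rewrite Re_conj.
by under eq_fun do rewrite Im_conj; exact: continuous_oppR.
Qed.

Lemma continuousC_sum I (r : seq I) (P : pred I) (F : I -> R -> C) :
  (forall i, continuousC (F i)) -> continuousC (fun z => \sum_(i <- r | P i) F i z).
Proof.
move=> cF; split.
  under eq_fun do rewrite Re_sum; apply: continuous_sumR => i; exact: (cF i).1.
under eq_fun do rewrite Im_sum; apply: continuous_sumR => i; exact: (cF i).2.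
Qed.

Lemma continuous_sqmod f : continuousC f -> continuous (fun z => sqmod (f z)).
Proof.
move=> [f1 f2]; under eq_fun do rewrite sqmodE.
by apply: continuous_addR; exact: continuous_mulR.
Qed.

(** A function on [0, 1] is stored as a function on all of R, constant beyond the ends. Equality on
    the interval is then equality of functions, and continuity has no one-sided cases. *)
Definition clampz z : R := Num.max 0 (Num.min z 1).

Lemma clampz_id z : 0 <= z <= 1 -> clampz z = z.
Proof. by move=> /andP[z0 z1]; rewrite /clampz (min_idPl z1) (max_idPr z0). Qed.

Lemma clampz_itv z : 0 <= clampz z <= 1.
Proof. by rewrite /clampz le_max lexx/= ge_max ler01 ge_min lexx orbT. Qed.

Lemma clampzK z : clampz (clampz z) = clampz z.
Proof. exact: clampz_id (clampz_itv z). Qed.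

Lemma continuous_clampz : continuous clampz.
Proof.
move=> z; apply: (@continuous_max _ _ (cst 0) (fun z => Num.min z 1)).
  exact: cst_continuous.
by apply: (@continuous_min _ _ id (cst 1)); [exact: cvg_id|exact: cst_continuous].
Qed.

Definition sqJ f : R := J (fun z => sqmod (f z)).

Lemma sqJ_ge0 f : 0 <= sqJ f. Proof. by apply: J_ge0 => z _; exact: sqmod_ge0. Qed.

(* The square norm of the first Fourier modes in H^s at height z, plus that in
   L^2(0, 1; H^(s + 1/2)). *)
Definition sqn s n z u : R :=
  \sum_(k <- rng n) W (2 * s) k * (sqmod (u k z) + jb k * sqJ (u k)).

Lemma sqn_term_ge0 s z u k : 0 <= W (2 * s) k * (sqmod (u k z) + jb k * sqJ (u k)).
Proof. by rewrite mulr_ge0 ?W_ge0// addr_ge0 ?sqmod_ge0 ?mulr_ge0 ?jb_ge0 ?sqJ_ge0. Qed.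

Lemma sqn_ge0 s n z u : 0 <= sqn s n z u.
Proof. by apply: sumr_ge0 => k _; exact: sqn_term_ge0. Qed.

(** The weight [t] is left free: optimising it gives the sharp triangle inequality for the norm,
    where t = 1/2 would lose a factor. *)
Lemma sqmod_convex (t : R) (x y : C) : 0 < t < 1 ->
  sqmod (x + y) <= t^-1 * sqmod x + (1 - t)^-1 * sqmod y.
Proof.
move=> /andP[t0 t1].
have cvx (a b : R) : (a + b) ^+ 2 <= t^-1 * a ^+ 2 + (1 - t)^-1 * b ^+ 2.
  rewrite -subr_ge0.
  rewrite [leRHS](_ : _ = ((1 - t) * a - t * b) ^+ 2 / (t * (1 - t))).
    by rewrite divr_ge0 ?sqr_ge0// mulr_ge0; lra.
  by field; apply/andP; split; lra.
have := cvx (Re x) (Re y); have := cvx (Im x) (Im y).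
by rewrite ?sqmodE !ReImE !mulrDr; lra.
Qed.

Lemma sqJ_convex (t : R) f g : 0 < t < 1 -> continuousC f -> continuousC g ->
  sqJ (fun z => f z + g z) <= t^-1 * sqJ f + (1 - t)^-1 * sqJ g.
Proof.
move=> t01 cf cg; rewrite /sqJ.
have c1 := continuous_sqmod cf; have c2 := continuous_sqmod cg.
rewrite -!JZ// -JD; last 2 first.
- by apply: continuous_mulR => //; exact: cst_continuous.
- by apply: continuous_mulR => //; exact: cst_continuous.
apply: J_le.
- by apply: continuous_sqmod; exact: continuousCD.
- by apply: continuous_addR; apply: continuous_mulR => //; exact: cst_continuous.
- by move=> z _; exact: sqmod_convex.
Qed.

Lemma sqJZ (a : R) f : continuousC f -> sqJ (fun z => a *: f z) = a ^+ 2 * sqJ f.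
Proof.
move=> cf; rewrite /sqJ -JZ; last exact: continuous_sqmod.
by apply: eq_J => z _; rewrite sqmodZ.
Qed.

Lemma sqn_convex s n z (t : R) u v : 0 < t < 1 -> (forall k, continuousC (u k)) ->
  (forall k, continuousC (v k)) ->
  sqn s n z (fun k z => u k z + v k z) <= t^-1 * sqn s n z u + (1 - t)^-1 * sqn s n z v.
Proof.
move=> t01 cu cv; rewrite /sqn !mulr_sumr -big_split/=; apply: ler_sum => k _.
have h1 := sqmod_convex (u k z) (v k z) t01.
have h2 := sqJ_convex t01 (cu k) (cv k).
apply: le_trans (_ : W (2 * s) k * ((t^-1 * sqmod (u k z) + (1 - t)^-1 * sqmod (v k z)) +
   jb k * (t^-1 * sqJ (u k) + (1 - t)^-1 * sqJ (v k))) <= _).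
  by rewrite ler_wpM2l ?W_ge0// lerD// ler_wpM2l ?jb_ge0.
by rewrite le_eqVlt; apply/orP; left; apply/eqP; ring.
Qed.

Lemma sqnD s n z u v : (forall k, continuousC (u k)) -> (forall k, continuousC (v k)) ->
  sqn s n z (fun k z => u k z + v k z) <= 2 * (sqn s n z u + sqn s n z v).
Proof.
move=> cu cv; have t01 : ((0 : R) < 2^-1) && ((2^-1 : R) < 1) by apply/andP; split; lra.
have := sqn_convex s n z t01 cu cv; rewrite invrK (_ : 1 - 2^-1 = 2^-1 :> R) ?invrK; lra.
Qed.

Lemma sqnZ s n z (a : R) u : (forall k, continuousC (u k)) ->
  sqn s n z (fun k z => a *: u k z) = a ^+ 2 * sqn s n z u.
Proof.
move=> cu; rewrite /sqn mulr_sumr; apply: eq_bigr => k _.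
by rewrite sqmodZ sqJZ//; ring.
Qed.

Definition trunc n u : int -> R -> C := fun k z => if k \in rng n then u k z else 0.

Lemma continuousC_trunc n u : (forall k, continuousC (u k)) ->
  forall k, continuousC (trunc n u k).
Proof. by move=> cu k; rewrite /trunc; case: (k \in rng n); [exact: cu|exact: continuousC0]. Qed.

Lemma sqJ0 : sqJ (fun=> 0) = 0.
Proof. by rewrite /sqJ; under eq_J do rewrite sqmod0; rewrite J_cst. Qed.

Lemma eq_sqJ f g : (forall z, f z = g z) -> sqJ f = sqJ g.
Proof. by move=> fg; apply: eq_J => z _; rewrite fg. Qed.

Lemma sqn_le_term s n z u v : (forall k, sqmod (u k z) <= sqmod (v k z)) ->
  (forall k, sqJ (u k) <= sqJ (v k)) -> sqn s n z u <= sqn s n z v.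
Proof.
move=> h1 h2; apply: ler_sum => k _; rewrite ler_wpM2l ?W_ge0// lerD//.
by rewrite ler_wpM2l ?jb_ge0.
Qed.

Lemma sqn_mono s m n z u : (m <= n)%N -> sqn s m z u <= sqn s n z u.
Proof. by move=> mn; apply: sum_rng_mono => // k; exact: sqn_term_ge0. Qed.

Definition tailz n u : int -> R -> C := fun k z => if k \in rng n then 0 else u k z.

Lemma tailzE n u k z : tailz n u k z = u k z - trunc n u k z.
Proof. by rewrite /tailz /trunc; case: ifP; rewrite ?subrr ?subr0. Qed.

Lemma continuousC_tailz n u : (forall k, continuousC (u k)) ->
  forall k, continuousC (tailz n u k).
Proof. by move=> cu k; rewrite /tailz; case: (k \in rng n); [exact: continuousC0|exact: cu]. Qed.

Lemma sqn_tail_le s n m z u : sqn s n z (tailz m u) <= sqn s n z u.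
Proof.
by apply: sqn_le_term => k; rewrite /tailz; case: (k \in rng m);
  rewrite ?sqmod0 ?sqmod_ge0 ?sqJ0 ?sqJ_ge0.
Qed.

Lemma sqn_tail_anti s n m m' z u : (m <= m')%N ->
  sqn s n z (tailz m' u) <= sqn s n z (tailz m u).
Proof.
move=> mm; have sub k : k \notin rng m' -> (k \in rng m) = false.
  by move=> h; apply/negbTE; apply: contra h; rewrite !mem_rng => /leq_trans; apply.
apply: sqn_le_term => k; rewrite /tailz; case: (boolP (k \in rng m')) => [_|/sub->] //.
  by rewrite sqmod0 sqmod_ge0.
by rewrite sqJ0 sqJ_ge0.
Qed.

Lemma sqn_trunc_le s n m z u : sqn s n z (trunc m u) <= sqn s n z u.
Proof.
by apply: sqn_le_term => k; rewrite /trunc; case: (k \in rng m);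
  rewrite ?sqmod0 ?sqmod_ge0 ?sqJ0 ?sqJ_ge0.
Qed.

(** The last clause asks for tails that are small uniformly in z. Boundedness alone would not give
    convergence of truncations in norm, on which all density arguments below rest. *)
Definition strip_fun s : {pred int -> R -> C} :=
  mem [set u : int -> R -> C | [/\ forall k, continuousC (u k),
    forall k z, u k (clampz z) = u k z,
    exists M, forall n z, sqn s n z u <= M &
    forall e : R, 0 < e -> exists m, forall n z, sqn s n z (tailz m u) <= e]].

Lemma eq_sqn s n z u v : (forall k z, u k z = v k z) -> sqn s n z u = sqn s n z v.
Proof. by move=> uv; apply: eq_bigr => k _; rewrite uv (eq_sqJ (uv k)). Qed.

Lemma tailzD n u v k z : tailz n (fun k z => u k z + v k z) k z = tailz n u k z + tailz n v k z.
Proof. by rewrite /tailz; case: ifP; rewrite ?addr0. Qed.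

Lemma tailzZ n a u k z : tailz n (fun k z => a *: u k z) k z = a *: tailz n u k z.
Proof. by rewrite /tailz; case: ifP; rewrite ?scaler0. Qed.

Lemma strip_submod_closed s : submod_closed (strip_fun s).
Proof.
have Z (a : R) u : u \in strip_fun s -> a *: u \in strip_fun s.
  move=> /set_mem[cu ku [M hM] tu]; apply/mem_set; split.
  - by move=> k; apply: (@continuousCZ (cst a)) => //; exact: cst_continuous.
  - by move=> k z; rewrite -[LHS]/(a *: u k (clampz z)) ku.
  - exists (a ^+ 2 * M) => n z; rewrite (_ : sqn _ _ _ _ = a ^+ 2 * sqn s n z u).
      by rewrite ler_wpM2l ?sqr_ge0.
    exact: sqnZ.
  - move=> e e0; have [|m hm] := tu (e / (a ^+ 2 + 1)).
      by rewrite divr_gt0// ltr_wpDl// sqr_ge0.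
    exists m => n z; rewrite (@eq_sqn _ _ _ _ _ (tailzZ m a u)) sqnZ; last first.
      exact: continuousC_tailz.
    have := hm n z; rewrite ler_pdivlMr ?ltr_wpDl ?sqr_ge0//; apply: le_trans.
    by rewrite mulrC ler_wpM2l ?sqn_ge0// lerDl.
have A u v : u \in strip_fun s -> v \in strip_fun s -> u + v \in strip_fun s.
  move=> /set_mem[cu ku [M hM] tu] /set_mem[cv kv [N hN] tv]; apply/mem_set; split.
  - by move=> k; apply: continuousCD.
  - by move=> k z; rewrite -[LHS]/(u k (clampz z) + v k (clampz z)) ku kv.
  - exists (2 * (M + N)) => n z; apply: le_trans (sqnD s n z cu cv) _.
    by rewrite ler_wpM2l// lerD.
  - move=> e e0; have e4 : 0 < e / 4 by rewrite divr_gt0.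
    have [m1 h1] := tu _ e4; have [m2 h2] := tv _ e4.
    exists (maxn m1 m2) => n z; rewrite (@eq_sqn _ _ _ _ _ (tailzD _ u v)).
    apply: le_trans (sqnD s n z (continuousC_tailz _ cu) (continuousC_tailz _ cv)) _.
    have := le_trans (sqn_tail_anti s n z u (leq_maxl m1 m2)) (h1 n z).
    have := le_trans (sqn_tail_anti s n z v (leq_maxr m1 m2)) (h2 n z).
    lra.
split; last by move=> a f g fS gS; exact: A _ _ (Z a f fS) gS.
have E n z : sqn s n z 0 = 0.
  by rewrite /sqn big1// => k _; rewrite sqmod0 (_ : sqJ _ = 0) ?mulr0 ?addr0 ?mulr0// sqJ0.
apply/mem_set; split => //; first by move=> k; exact: continuousC0.
  by exists 0 => n z; rewrite E.
by move=> e e0; exists 0%N => n z; apply: le_trans (sqn_tail_le _ _ _ _ _) _; rewrite E ltW.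
Qed.

End StripSequences.

HB.instance Definition _ (R : realType) (s : R) :=
  GRing.isSubmodClosed.Build R (int -> R -> Rcomplex R) (strip_fun s) (@strip_submod_closed R s).

(* Functions on T x [0, 1], by their Fourier coefficients in x, in the closure of the
   trigonometric polynomials in C([0, 1]; H^s) and L^2(0, 1; H^(s + 1/2)). *)
Record strip (R : realType) (s : R) :=
  Strip { strip_val :> int -> R -> Rcomplex R; _ : strip_val \in strip_fun s }.

HB.instance Definition _ (R : realType) (s : R) := [isSub for @strip_val R s].
HB.instance Definition _ (R : realType) (s : R) := [Choice of strip s by <:].
HB.instance Definition _ (R : realType) (s : R) :=
  [SubChoice_isSubLmodule of strip s by <:].

Section StripNorm.
Context {R : realType} (s : R).
Notation C := (Rcomplex R).
Implicit Types u v : strip s.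

Definition strip_set u : set R := [set sqn s nz.1 nz.2 u | nz in [set: nat * R]].
Definition strip_norm u : R := Num.sqrt (sup (strip_set u)).

Lemma stripP u : [/\ forall k, continuousC (u k),
    forall k z, u k (clampz z) = u k z,
    exists M, forall n z, sqn s n z u <= M &
    forall e : R, 0 < e -> exists m, forall n z, sqn s n z (tailz m u) <= e].
Proof. by have := valP u; rewrite inE. Qed.

Lemma strip_has_sup u : has_sup (strip_set u).
Proof.
split; first by exists (sqn s 0 0 u); exists (0%N, 0).
have [_ _ [M hM] _] := stripP u; exists M => _ [[n z] _ <-]; exact: hM.
Qed.

Lemma sqn_le_norm u n z : sqn s n z u <= strip_norm u ^+ 2.
Proof.
have h : sqn s n z u <= sup (strip_set u).
  by apply: sup_upper_bound; [exact: strip_has_sup|exists (n, z)].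
by rewrite sqr_sqrtr// (le_trans _ h)// sqn_ge0.
Qed.

Lemma strip_norm_ge0 u : 0 <= strip_norm u. Proof. exact: sqrtr_ge0. Qed.

Lemma strip_norm_le u (M : R) : 0 <= M -> (forall n z, sqn s n z u <= M ^+ 2) ->
  strip_norm u <= M.
Proof.
move=> M0 hM; rewrite -(@ger0_norm _ M)// -sqrtr_sqr ler_wsqrtr//.
by apply: sup_le_ub; [exists (sqn s 0 0 u); exists (0%N, 0)|move=> _ [[n z] _ <-]; exact: hM].
Qed.

Lemma sqmod_le_strip_norm u k z : W (2 * s) k * sqmod (u k z) <= strip_norm u ^+ 2.
Proof.
apply: le_trans (sqn_le_norm u (absz k) z).
apply: le_trans (term_le_sum_rng (n := absz k) (k := k) _ (@sqn_term_ge0 _ s z u)).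
  by rewrite ler_wpM2l ?W_ge0// lerDl mulr_ge0 ?jb_ge0 ?sqJ_ge0.
by rewrite mem_rng.
Qed.

Lemma strip_norm0_eq0 u : strip_norm u = 0 -> u = 0.
Proof.
move=> u0; apply/val_inj => /=; apply/funext => k; apply/funext => z.
have := sqmod_le_strip_norm u k z; rewrite u0 expr0n/= pmulr_rle0 ?W_gt0// => h.
have {h} : sqmod (u k z) == 0 by rewrite eq_le h sqmod_ge0.
rewrite sqmodE paddr_eq0 ?sqr_ge0// !sqrf_eq0 => /andP[/eqP r0 /eqP i0].
exact: C_eq.
Qed.

Lemma strip_normZ_le (a : R) u : strip_norm (a *: u) <= `|a| * strip_norm u.
Proof.
have [cu _ _ _] := stripP u.
apply: strip_norm_le; first by rewrite mulr_ge0 ?strip_norm_ge0.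
move=> n z; rewrite (_ : sqn _ _ _ _ = a ^+ 2 * sqn s n z u); last exact: sqnZ.
by rewrite exprMn real_normK ?num_real// ler_wpM2l ?sqr_ge0// sqn_le_norm.
Qed.

Lemma strip_normZ (a : R) u : strip_norm (a *: u) = `|a| * strip_norm u.
Proof.
apply/eqP; rewrite eq_le strip_normZ_le/=.
have [->|a0] := eqVneq a 0; first by rewrite normr0 mul0r strip_norm_ge0.
have := strip_normZ_le a^-1 (a *: u); rewrite scalerA mulVf// scale1r normfV.
by rewrite ler_pdivlMl// normr_gt0.
Qed.

Lemma strip_normD u v : strip_norm (u + v) <= strip_norm u + strip_norm v.
Proof.
have [u0|u0] := eqVneq (strip_norm u) 0.
  by rewrite (strip_norm0_eq0 u0) add0r lerDr strip_norm_ge0.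
have [v0|v0] := eqVneq (strip_norm v) 0.
  by rewrite (strip_norm0_eq0 v0) addr0 lerDl strip_norm_ge0.
have {}u0 : 0 < strip_norm u by rewrite lt_neqAle eq_sym u0 strip_norm_ge0.
have {}v0 : 0 < strip_norm v by rewrite lt_neqAle eq_sym v0 strip_norm_ge0.
have [cu _ _ _] := stripP u; have [cv _ _ _] := stripP v.
apply: strip_norm_le; first exact: addr_ge0 (ltW u0) (ltW v0).
move=> n z.
have -> : sqn s n z (u + v) = sqn s n z (fun k z => u k z + v k z) by [].
have key (t : R) (t01 : 0 < t < 1) := sqn_convex s n z t01 cu cv.
move: key (sqn_ge0 s n z (fun k z => u k z + v k z)); set q := sqn _ _ _ _ => key q0.
have q0' : 0 <= Num.sqrt q by exact: sqrtr_ge0.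
suff h : Num.sqrt q <= strip_norm u + strip_norm v.
  by rewrite -[q]sqr_sqrtr// ler_pXn2r ?nnegrE// (le_trans q0' h).
apply: (weighted_sqr_le u0 v0 q0') => t01; rewrite sqr_sqrtr//.
apply: le_trans (key _ t01) _; have /andP[t0 t1] := t01.
by apply: lerD; (apply: ler_wpM2l; last exact: sqn_le_norm); rewrite invr_ge0 ?subr_ge0 ltW.
Qed.

End StripNorm.

HB.instance Definition _ (R : realType) (s : R) :=
  Lmodule_isNormed.Build R (strip s) (@strip_normD R s) (@strip_normZ R s)
    (@strip_norm0_eq0 R s).

(** * Truncation and completeness of the strip space *)

Section StripComplete.
Context {R : realType} (s : R).
Notation C := (Rcomplex R).
Implicit Types u v : strip s.

Lemma sqn_le_normr u n z : sqn s n z u <= `|u| ^+ 2.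
Proof. exact: sqn_le_norm. Qed.

Lemma normr_strip_le u (M : R) : 0 <= M -> (forall n z, sqn s n z u <= M ^+ 2) -> `|u| <= M.
Proof. exact: strip_norm_le. Qed.

Lemma strip_clamp_norm_le u (M : R) : 0 <= M ->
  (forall n z, 0 <= z <= 1 -> sqn s n z u <= M ^+ 2) -> `|u| <= M.
Proof.
move=> M0 h; apply: normr_strip_le => // n z.
have [_ ku _ _] := stripP u.
have -> : sqn s n z u = sqn s n (clampz z) u by apply: eq_bigr => k _; rewrite ku.
exact/h/clampz_itv.
Qed.

Lemma sqmod_le_normr u k z : sqmod (u k z) <= (W (2 * s) k)^-1 * `|u| ^+ 2.
Proof. by rewrite ler_pdivlMl ?W_gt0//; exact: sqmod_le_strip_norm. Qed.

Lemma cmod_le_normr u k z : cmod (u k z) <= W (- s) k * `|u|.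
Proof.
apply: cmod_le; first by rewrite mulr_ge0 ?W_ge0.
by rewrite exprMn W_sqr mulrN WN sqmod_le_normr.
Qed.

Lemma trunc_strip u n : trunc n u \in strip_fun s.
Proof.
have [cu ku [M hM] tu] := stripP u; apply/mem_set; split.
- exact: continuousC_trunc.
- by move=> k z; rewrite /trunc ku.
- by exists M => m z; apply: le_trans (sqn_trunc_le _ _ _ _ _) (hM m z).
- move=> e e0; exists n => m z; rewrite (@eq_sqn _ _ _ _ _ (fun _ _ => 0)).
    by rewrite /sqn big1 ?ltW// => k _; rewrite sqmod0 sqJ0 mulr0 addr0 mulr0.
  by move=> k t; rewrite /tailz /trunc; case: (k \in rng n).
Qed.

Definition truncA n u : strip s := Strip (trunc_strip u n).

Lemma truncA_cvg u (e : R) : 0 < e -> exists N, forall n, (N <= n)%N -> `|u - truncA n u| <= e.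
Proof.
move=> e0; have [_ _ _ tu] := stripP u.
have [|N hN] := tu (e ^+ 2); first by rewrite exprn_gt0.
exists N => n Nn; apply: normr_strip_le => [|m z]; first exact: ltW.
apply: le_trans (hN m z); apply: le_trans (sqn_tail_anti _ _ _ _ Nn).
by rewrite le_eqVlt; apply/orP; left; apply/eqP/eq_sqn => k t; rewrite tailzE.
Qed.

Lemma truncA_norm u n : `|truncA n u| <= `|u|.
Proof.
apply: normr_strip_le => // m z; exact: le_trans (sqn_trunc_le _ _ _ _ _) (sqn_le_normr _ _ _).
Qed.

Lemma cauchy_real_cvg (x : nat -> R) :
  (forall e : R, 0 < e -> exists N, forall m n, (N <= m)%N -> (N <= n)%N -> `|x m - x n| <= e) ->
  exists l, forall e : R, 0 < e -> exists N, forall n, (N <= n)%N -> `|x n - l| <= e.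
Proof.
move=> cx; suff /cvg_ex[l hl] : cvgn x.
  exists l => e e0; have /cvgrPdist_le/(_ _ e0)[N _ hN] := hl.
  by exists N => n /hN; rewrite distrC.
apply/cauchy_cvgP/cauchy_exP => e e0.
have e2 : 0 < e / 2 by rewrite divr_gt0.
have [N hN] := cx _ e2; exists (x N); exists N => // n /= Nn.
apply: le_lt_trans (hN N n (leqnn N) Nn) _; lra.
Qed.

Lemma cauchy_bound_limit (x : nat -> R) (l e : R) N :
  (forall e : R, 0 < e -> exists N, forall n, (N <= n)%N -> `|x n - l| <= e) ->
  (forall m n, (N <= m)%N -> (N <= n)%N -> `|x m - x n| <= e) ->
  forall n, (N <= n)%N -> `|x n - l| <= e.
Proof.
move=> hl hx n Nn; rewrite leNgt; apply/negP => h.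
have d0 : 0 < (`|x n - l| - e) / 2 by rewrite divr_gt0// subr_gt0.
have [M hM] := hl _ d0.
have h1 := hM _ (leq_maxl M N); have h2 := hx n _ Nn (leq_maxr M N).
have := ler_distD (x (maxn M N)) (x n) l; lra.
Qed.

Lemma continuous_uniform_limit (f : nat -> R -> R) (g : R -> R) :
  (forall n, continuous (f n)) ->
  (forall e : R, 0 < e -> exists n, forall z, `|f n z - g z| <= e) -> continuous g.
Proof.
move=> cf fg z; apply/cvgrPdist_le => e e0.
have e3 : 0 < e / 3 by rewrite divr_gt0.
have [n hn] := fg _ e3; have /cvgrPdist_le/(_ _ e3) h := cf n z.
near=> t; have h1 := hn z; have h2 := hn t.
have h3 : `|f n z - f n t| <= e / 3 by near: t.
have -> : g z - g t = (f n z - f n t) - (f n z - g z) + (f n t - g t) by ring.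
apply: le_trans (ler_normD _ _) _.
have := ler_normB (f n z - f n t) (f n z - g z); lra.
Unshelve. all: by end_near. Qed.

(** Real and imaginary parts of each coefficient converge uniformly in z, which defines the limit.
    Norm convergence then follows on finitely many modes with bounds independent of their number. *)
Lemma strip_complete (u : nat -> strip s) :
  (forall e : R, 0 < e -> exists N, forall m n, (N <= m)%N -> (N <= n)%N -> `|u m - u n| <= e) ->
  exists v : strip s, forall e : R, 0 < e -> exists N, forall n, (N <= n)%N -> `|u n - v| <= e.
Proof.
move=> cu.
have unif (F : C -> R) k : (forall x y, `|F x - F y| <= cmod (x - y)) ->
    exists l : R -> R, forall e : R, 0 < e ->
    exists N, forall n z, (N <= n)%N -> `|F (u n k z) - l z| <= e.
  move=> hF.
  have cau (e : R) : 0 < e -> exists N, forall z m n, (N <= m)%N -> (N <= n)%N ->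
      `|F (u m k z) - F (u n k z)| <= e.
    move=> e0; have [|N hN] := cu (e / W (- s) k); first by rewrite divr_gt0 ?W_gt0.
    exists N => z m n Nm Nn; apply: le_trans (hF _ _) _.
    apply: le_trans (cmod_le_normr (u m - u n) k z) _.
    by rewrite mulrC -ler_pdivlMr ?W_gt0// hN.
  have lz z : exists l, forall e : R, 0 < e -> exists N, forall n, (N <= n)%N ->
      `|F (u n k z) - l| <= e.
    apply: cauchy_real_cvg => e /cau[N hN]; exists N => m n; exact: hN.
  exists (fun z => projT1 (cid (lz z))) => e /cau[N hN]; exists N => n z Nn.
  have h := projT2 (cid (lz z)).
  exact: (cauchy_bound_limit (x := fun n => F (u n k z)) h (hN z)).
have hRe (x y : C) : `|Re x - Re y| <= cmod (x - y).
  by rewrite -ReN -ReD; exact: Re_le_cmod.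
have hIm (x y : C) : `|Im x - Im y| <= cmod (x - y).
  by rewrite -ImN -ImD; exact: Im_le_cmod.
pose lR k := projT1 (cid (unif _ k hRe)); pose lI k := projT1 (cid (unif _ k hIm)).
have hlR k := projT2 (cid (unif _ k hRe)); have hlI k := projT2 (cid (unif _ k hIm)).
pose v0 k z : C := Complex (lR k z) (lI k z).
pose d n : int -> R -> C := fun k z => v0 k z - u n k z.
have cun n k : continuousC (u n k) by have [h _ _ _] := stripP (u n); exact: h.
have cv0 k : continuousC (v0 k).
  split.
    apply: (@continuous_uniform_limit (fun n z => Re (u n k z))) => [n|e].
      exact: (cun n k).1.
    by move=> /(hlR k)[N hN]; exists N => z; exact: hN.
  apply: (@continuous_uniform_limit (fun n z => Im (u n k z))) => [n|e].
    exact: (cun n k).2.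
  by move=> /(hlI k)[N hN]; exists N => z; exact: hN.
have cd n k : continuousC (d n k) by exact: continuousCB.
have dsmall k (e : R) : 0 < e -> exists N, forall n z, (N <= n)%N -> sqmod (d n k z) <= e.
  move=> e0; pose t := Num.sqrt (e / 2).
  have e2 : 0 < e / 2 by rewrite divr_gt0.
  have t0 : 0 < t by rewrite sqrtr_gt0.
  have [N1 h1] := hlR k _ t0; have [N2 h2] := hlI k _ t0.
  exists (maxn N1 N2) => n z; rewrite geq_max => /andP[/(h1 n z) r1 /(h2 n z) r2].
  rewrite ?sqmodE /d !ReImE -[e](_ : e / 2 + e / 2 = e); last by field.
  have tE : e / 2 = t ^+ 2 by rewrite sqr_sqrtr// ltW.
  rewrite tE; apply: lerD; rewrite -real_normK ?num_real// ler_pXn2r ?nnegrE ?(ltW t0)//.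
    by rewrite distrC.
  by rewrite distrC.
have dfin n (e : R) : 0 < e -> exists N, forall m, (N <= m)%N -> forall z, sqn s n z (d m) <= e.
  move=> e0; pose K := \sum_(k <- rng n) W (2 * s) k * (1 + jb k).
  have K0 : 0 <= K.
    by apply: sumr_ge0 => k _; rewrite mulr_ge0 ?W_ge0// addr_ge0 ?jb_ge0.
  pose de := e / (K + 1); have de0 : 0 < de by rewrite divr_gt0// ltr_wpDl.
  have [N hN] : exists N, forall k, k \in rng n -> forall m z, (N <= m)%N ->
      sqmod (d m k z) <= de.
    elim: (rng n) => [|k r [N hN]]; first by exists 0%N.
    have [M hM] := dsmall k _ de0; exists (maxn M N) => j.
    rewrite inE => /orP[/eqP->|jr] m z; rewrite geq_max => /andP[h1 h2].
      exact: hM.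
    exact: hN.
  exists N => m Nm z.
  apply: (@le_trans _ _ (\sum_(k <- rng n) W (2 * s) k * (1 + jb k) * de)).
    rewrite /sqn big_seq [X in _ <= X]big_seq; apply: ler_sum => k kn.
    rewrite -mulrA; apply: ler_wpM2l; first exact: W_ge0.
    rewrite [X in _ <= X]mulrDl mul1r; apply: lerD; first exact: hN.
    rewrite ler_wpM2l ?jb_ge0// -[X in _ <= X]J_cst; apply: J_le.
    - exact: continuous_sqmod.
    - exact: cst_continuous.
    - by move=> t _; exact: hN.
  rewrite -mulr_suml -/K /de mulrA ler_pdivrMr ?ltr_wpDl//.
  by rewrite mulrC ler_wpM2l ?(ltW e0)// lerDl.
(* The first m modes are compared with a later term [u p] that is already close to the limit on
   those modes. The index p depends on m, but the bound does not. *)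
have dall (e : R) : 0 < e -> exists N, forall n, (N <= n)%N -> forall m z, sqn s m z (d n) <= e.
  move=> e0; have e4 : 0 < e / 4 by rewrite divr_gt0.
  have [|N hN] := cu (Num.sqrt (e / 4)); first by rewrite sqrtr_gt0.
  exists N => n Nn m z; have [M hM] := dfin m _ e4.
  pose p := maxn N M.
  have h1 := hN p n (leq_maxl _ _) Nn.
  have -> : sqn s m z (d n) = sqn s m z (fun k z => (u p - u n) k z + d p k z).
    apply: eq_sqn => k t; rewrite -[(u p - u n) k t]/(u p k t - u n k t) /d; ring.
  apply: le_trans (sqnD _ _ _ _ (cd p)) _.
    by have [h _ _ _] := stripP (u p - u n).
  have h2 := hM p (leq_maxr _ _) z.
  have : sqn s m z (u p - u n) <= e / 4.
    apply: le_trans (sqn_le_normr (u p - u n) m z) _.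
    by rewrite -[X in _ <= X]sqr_sqrtr ?(ltW e4)// ler_pXn2r ?nnegrE ?sqrtr_ge0.
  lra.
have v0E n : v0 = fun k z => u n k z + d n k z.
  by apply/funext => k; apply/funext => z; rewrite /d addrC subrK.
have v0S : v0 \in strip_fun s.
  apply/mem_set; split => //.
  - move=> k z; have kz n : u n k (clampz z) = u n k z.
      by have [_ h _ _] := stripP (u n); exact: h.
    apply/eqP; rewrite -subr_eq0; apply/eqP.
    suff /eqP : sqmod (v0 k (clampz z) - v0 k z) = 0.
      by rewrite sqmodE paddr_eq0 ?sqr_ge0// !sqrf_eq0 => /andP[/eqP ? /eqP ?]; exact: C_eq.
    apply/eqP; rewrite eq_le sqmod_ge0 andbT; apply/ler_addgt0Pr => e e0; rewrite add0r.
    have e4 : 0 < e / 4 by rewrite divr_gt0.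
    have [N hN] := dsmall k _ e4.
    have -> : v0 k (clampz z) - v0 k z = d N k (clampz z) + - d N k z.
      by rewrite /d kz; ring.
    have := sqmodD (d N k (clampz z)) (- d N k z); rewrite sqmodN.
    have := hN N z (leqnn N); have := hN N (clampz z) (leqnn N); lra.
  - have [N hN] := dall _ (@ltr01 R); have [_ _ [M hM] _] := stripP (u N).
    exists (2 * (M + 1)) => n z; rewrite (v0E N); apply: le_trans (sqnD _ _ _ _ _) _ => //.
    by rewrite ler_wpM2l// lerD// hN.
  - move=> e e0; have e4 : 0 < e / 4 by rewrite divr_gt0.
    have [N hN] := dall _ e4; have [_ _ _ tN] := stripP (u N).
    have [m hm] := tN _ e4; exists m => n z.
    rewrite (v0E N) (@eq_sqn _ _ _ _ _ _ (tailzD m (u N) (d N))).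
    apply: le_trans (sqnD s n z (continuousC_tailz m (cun N)) (continuousC_tailz m (cd N))) _.
    have := hm n z; have := hN N (leqnn N) n z; have := sqn_tail_le s n m z (d N); lra.
exists (Strip v0S) => e e0.
have [|N hN] := dall (e ^+ 2); first by rewrite exprn_gt0.
exists N => n Nn; rewrite distrC; apply: normr_strip_le; first exact: ltW.
by move=> m z; exact: (hN n Nn m z).
Qed.

End StripComplete.

(** * Products on the strip *)

Section KernelBounds.
Context {R : realType}.
Notation C := (Rcomplex R).
Implicit Types (c u : int -> R -> C) (p s t e z : R) (n N : nat).

Definition hsn p n z u : R := \sum_(k <- rng n) W (2 * p) k * sqmod (u k z).

Lemma hsn_ge0 p n z u : 0 <= hsn p n z u.
Proof. by apply: sumr_ge0 => k _; rewrite mulr_ge0 ?W_ge0 ?sqmod_ge0. Qed.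

Lemma hsn_le p q n z u : p <= q -> hsn p n z u <= hsn q n z u.
Proof.
by move=> pq; apply: ler_sum => k _; rewrite ler_wpM2r ?sqmod_ge0// W_le// ler_pM2l.
Qed.

Lemma continuous_hsn p n u : (forall k, continuousC (u k)) -> continuous (fun z => hsn p n z u).
Proof.
move=> cu; apply: continuous_sumR => k; apply: continuous_mulR; first exact: cst_continuous.
exact: continuous_sqmod.
Qed.

Lemma J_hsn p n u : (forall k, continuousC (u k)) ->
  J (fun z => hsn p n z u) = \sum_(k <- rng n) W (2 * p) k * sqJ (u k).
Proof.
move=> cu; have cs k := continuous_sqmod (cu k).
rewrite J_sum; last first.
  by move=> k; apply: continuous_mulR => //; exact: cst_continuous.
by apply: eq_bigr => k _; rewrite JZ.
Qed.

Lemma W_half s k : W (2 * s) k * jb k = W (2 * (s + 2^-1)) k :> R.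
Proof. by rewrite -(W1 k) -WD; congr W; field. Qed.

Lemma sqnE s n z u : (forall k, continuousC (u k)) ->
  sqn s n z u = hsn s n z u + J (fun z => hsn (s + 2^-1) n z u).
Proof.
move=> cu; rewrite J_hsn// -big_split/=; apply: eq_bigr => k _.
by rewrite mulrDr mulrA W_half.
Qed.

Lemma hsn_trunc p n N z u : hsn p N z (trunc n u) <= hsn p n z u.
Proof.
have -> : hsn p n z u = hsn p n z (trunc n u).
  by rewrite /hsn big_seq [RHS]big_seq; apply: eq_bigr => k kn; rewrite /trunc kn.
have le m : hsn p N z (trunc n u) <= hsn p (N + m) z (trunc n u).
  by apply: sum_rng_mono; [exact: leq_addr|move=> k; rewrite mulr_ge0 ?W_ge0 ?sqmod_ge0].
apply: le_trans (le n) _; rewrite /hsn (@sum_rng_supp _ n (N + n))//; first exact: leq_addl.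
by move=> k kn; rewrite /trunc (negbTE kn) sqmod0 mulr0.
Qed.

Lemma trunc_in n u k z : k \in rng n -> trunc n u k z = u k z.
Proof. by rewrite /trunc => ->. Qed.

Lemma trunc_out n u k z : k \notin rng n -> trunc n u k z = 0.
Proof. by rewrite /trunc => /negbTE->. Qed.

(** One estimate for two uses: with [kap k l = W t k] and e = 0 it bounds products, with
    [kap k l = W t l - W t k] it bounds commutators. *)
Lemma kernel_bound (s rho e : R) : 1 < 2 * rho -> 1 < 2 * (s - e) ->
  exists2 K : R, 0 <= K & forall t K0 (kap : int -> int -> R) c u z (Ct Cs Ur Ue : R),
    0 <= K0 ->
    (forall k l, `|kap k l| <= K0 * (W t (k - l) + W e (k - l) * W (t - e) l)) ->
    (forall n, hsn t n z c <= Ct) -> (forall n, hsn s n z c <= Cs) ->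
    (forall n, hsn rho n z u <= Ur) -> (forall n, hsn (t - e) n z u <= Ue) ->
    forall N n, \sum_(k <- rng N) sqmod (\sum_(l <- rng n) kap k l *: (c (k - l) z * u l z))
      <= K0 ^+ 2 * (K * (Ct * Ur + Cs * Ue)).
Proof.
move=> r1 s1; have [K K_ge0 hK] := weighted_conv_bound r1 s1; exists K => //.
move=> t K0 kap c u z Ct Cs Ur Ue K00 hkap hCt hCs hUr hUe N n.
have cm (v : int -> R -> C) p B : (forall m, hsn p m z v <= B) ->
    forall m, \sum_(k <- rng m) W (2 * p) k * cmod (v k z) ^+ 2 <= B.
  by move=> h m; under eq_bigr do rewrite cmod2; exact: h.
have := hK t (fun k => cmod (c k z)) (fun k => cmod (u k z)) Ct Cs Ur Ue
  (fun k => cmod_ge0 _) (fun k => cmod_ge0 _) (cm _ _ _ hCt) (cm _ _ _ hCs)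
  (cm _ _ _ hUr) (cm _ _ _ hUe) N n.
move=> /(ler_wpM2l (sqr_ge0 K0)); apply: le_trans; rewrite mulr_sumr.
apply: ler_sum => k _; rewrite -exprMn -cmod2 ler_pXn2r ?nnegrE ?cmod_ge0//; last first.
  by rewrite mulr_ge0// sumr_ge0// => l _; rewrite mulr_ge0 ?addr_ge0 ?mulr_ge0 ?W_ge0 ?cmod_ge0.
apply: le_trans (cmod_sum _ _ _) _; rewrite mulr_sumr; apply: ler_sum => l _.
rewrite cmodZ cmodM [X in _ <= X]mulrA; apply: ler_wpM2r => //.
by apply: mulr_ge0; exact: cmod_ge0.
Qed.

(** Both factors are cut to modes of size at most n (the range of the sum cuts [u]), so this is the
    exact product of two trigonometric polynomials and has degree at most 2n. *)
Definition conv n c u : int -> R -> C :=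
  fun k z => \sum_(l <- rng n) trunc n c (k - l) z * u l z.

Lemma continuousC_conv n c u : (forall k, continuousC (c k)) -> (forall k, continuousC (u k)) ->
  forall k, continuousC (conv n c u k).
Proof.
move=> cc cu k; apply: continuousC_sum => l; apply: continuousCM => //.
exact: continuousC_trunc.
Qed.

Lemma conv_supp n c u k z : k \notin rng (n + n) -> conv n c u k z = 0.
Proof.
rewrite mem_rng => kn; rewrite /conv big_seq big1// => l; rewrite mem_rng => ln.
rewrite /trunc ifF ?mul0r//; apply/negbTE; rewrite mem_rng; lia.
Qed.

Lemma conv_trunc n m N c u k z : (n <= N)%N -> (m <= N)%N ->
  conv N (trunc n c) (trunc m u) k z = \sum_(l <- rng m) trunc n c (k - l) z * u l z.
Proof.
move=> nN mN; rewrite /conv (@sum_rng_supp _ m N)//; last first.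
  by move=> l lm; rewrite [trunc m u l z]trunc_out// mulr0.
rewrite big_seq [RHS]big_seq; apply: eq_bigr => l lm; rewrite [trunc m u l z]trunc_in//.
congr (_ * _); case: (boolP (k - l \in rng N)) => h; first by rewrite trunc_in.
rewrite !trunc_out//; apply: contra h; rewrite !mem_rng => h; exact: leq_trans nN.
Qed.

Lemma convDl n c c' u k z :
  conv n (fun k z => c k z + c' k z) u k z = conv n c u k z + conv n c' u k z.
Proof.
rewrite /conv -big_split/=; apply: eq_bigr => l _; rewrite -mulrDl; congr (_ * _).
by rewrite /trunc; case: ifP; rewrite ?addr0.
Qed.

Lemma convDr n c u u' k z :
  conv n c (fun k z => u k z + u' k z) k z = conv n c u k z + conv n c u' k z.
Proof. by rewrite /conv -big_split/=; apply: eq_bigr => l _; rewrite -mulrDr. Qed.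

Lemma convZl n (a : R) c u k z : conv n (fun k z => a *: c k z) u k z = a *: conv n c u k z.
Proof.
rewrite /conv scaler_sumr; apply: eq_bigr => l _; rewrite scaleCAl; congr (_ * _).
by rewrite /trunc; case: ifP; rewrite ?scaler0.
Qed.

Lemma convZr n (a : R) c u k z : conv n c (fun k z => a *: u k z) k z = a *: conv n c u k z.
Proof. by rewrite /conv scaler_sumr; apply: eq_bigr => l _; rewrite scaleCAr. Qed.

(** Level [s] is estimated at each height, level s + 1/2 after integration in z. Since only one
    factor at a time carries the extra half derivative, its integral meets a supremum of the other
    factor. *)
Lemma conv_sqn_bound s : 1 < 2 * s -> exists2 K : R, 0 <= K &
  forall c u A B, (forall k, continuousC (c k)) -> (forall k, continuousC (u k)) ->
    (forall n z, sqn s n z c <= A) -> (forall n z, sqn s n z u <= B) ->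
    forall n N z, sqn s N z (conv n c u) <= K * A * B.
Proof.
move=> s1; have s1' : 1 < 2 * (s - 0) by rewrite subr0.
have s0 : 0 <= s by lra.
have [K K_ge0 hK] := @kernel_bound s s 0 s1 s1'.
pose th := s + 2^-1; have th0 : 0 <= th by rewrite /th; lra.
pose K1 := (2 `^ s) ^+ 2 * (K * 2); pose K2 := (2 `^ th) ^+ 2 * K.
have K10 : 0 <= K1 by rewrite !mulr_ge0 ?sqr_ge0.
have K20 : 0 <= K2 by rewrite !mulr_ge0 ?sqr_ge0.
exists (K1 + K2 * 2); first by rewrite addr_ge0// mulr_ge0.
move=> c u A B cc cu hA hB n N z.
have cv := continuousC_conv n cc cu.
have A0 : 0 <= A by exact: le_trans (sqn_ge0 _ _ _ _) (hA 0%N 0).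
have B0 : 0 <= B by exact: le_trans (sqn_ge0 _ _ _ _) (hB 0%N 0).
have cs v m : 0 <= J (fun z => hsn th m z v).
  by apply: J_ge0 => y _; exact: hsn_ge0.
have hs v D m x : (forall k, continuousC (v k)) -> (forall n z, sqn s n z v <= D) ->
    hsn s m x v <= D.
  by move=> hv h; apply: le_trans (h m x); rewrite sqnE// lerDl cs.
have hJ v D m : (forall k, continuousC (v k)) -> (forall n z, sqn s n z v <= D) ->
    J (fun z => hsn th m z v) <= D.
  by move=> hv h; apply: le_trans (h m 0); rewrite sqnE// lerDr hsn_ge0.
have ker t x (Ct Ue : R) : 0 <= t -> hsn t n x c <= Ct -> hsn t n x u <= Ue ->
    hsn t N x (conv n c u) <= (2 `^ t) ^+ 2 * (K * (Ct * B + A * Ue)).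
  move=> t0 hCt hUe.
  have := hK t (2 `^ t) (fun k _ => W t k) (trunc n c) (trunc n u) x Ct A B Ue (powR_ge0 _ _).
  move=> /(_ _ _ _ _ _ N n) H; apply: le_trans (H _ _ _ _ _).
  - apply: ler_sum => k _; rewrite -scaler_sumr sqmodZ W_sqr ler_wpM2l ?W_ge0//.
    rewrite le_eqVlt; apply/orP; left; apply/eqP; congr sqmod.
    by rewrite /conv big_seq [RHS]big_seq; apply: eq_bigr => l ln; rewrite [trunc n u l x]trunc_in.
  - move=> k l; rewrite ger0_norm ?W_ge0// W0 mul1r subr0; exact: W_peetre.
  - by move=> m; apply: le_trans (hsn_trunc _ _ _ _ _) hCt.
  - by move=> m; apply: le_trans (hsn_trunc _ _ _ _ _) (hs _ _ _ _ cc hA).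
  - by move=> m; apply: le_trans (hsn_trunc _ _ _ _ _) (hs _ _ _ _ cu hB).
  - by move=> m; rewrite subr0; apply: le_trans (hsn_trunc _ _ _ _ _) hUe.
rewrite sqnE// -/th [X in _ <= X](_ : _ = K1 * A * B + K2 * 2 * A * B); last by ring.
apply: lerD.
  apply: le_trans (ker s z A B s0 (hs _ _ _ _ cc hA) (hs _ _ _ _ cu hB)) _.
  by rewrite le_eqVlt; apply/orP; left; apply/eqP; rewrite /K1; ring.
have c1 : continuous (fun z => hsn th n z c) by exact: continuous_hsn.
have c2 : continuous (fun z => hsn th n z u) by exact: continuous_hsn.
have c1' : continuous (fun z => (K2 * B) * hsn th n z c).
  by apply: continuous_mulR => //; exact: cst_continuous.
have c2' : continuous (fun z => (K2 * A) * hsn th n z u).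
  by apply: continuous_mulR => //; exact: cst_continuous.
apply: (@le_trans _ _ (J (fun z => (K2 * B) * hsn th n z c + (K2 * A) * hsn th n z u))).
  apply: J_le; [exact: continuous_hsn|exact: continuous_addR|move=> x _].
  apply: le_trans (ker th x _ _ th0 (lexx _) (lexx _)) _.
  by rewrite le_eqVlt; apply/orP; left; apply/eqP; rewrite /K2; ring.
rewrite JD// !JZ//.
rewrite [X in _ <= X](_ : _ = K2 * B * A + K2 * A * B); last by ring.
by apply: lerD; apply: ler_wpM2l; rewrite ?mulr_ge0// hJ.
Qed.

End KernelBounds.

(** * The product as a limit of products of truncations *)

Section StripProduct.
Context {R : realType} (s : R) (s_gt : 1 < 2 * s).
Notation C := (Rcomplex R).
Implicit Types c u : strip s.

Lemma strip_continuous u k : continuousC (u k).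
Proof. by have [h _ _ _] := stripP u; exact: h. Qed.

Lemma conv_strip n c u : conv n c u \in strip_fun s.
Proof.
have [cc kc _ _] := stripP c; have [cu ku _ _] := stripP u.
have [K K0 hK] := conv_sqn_bound s_gt.
apply/mem_set; split.
- exact: continuousC_conv.
- by move=> k z; apply: eq_bigr => l _; rewrite ku /trunc kc.
- exists (K * `|c| ^+ 2 * `|u| ^+ 2) => N z.
  by apply: hK => // m x; exact: sqn_le_normr.
- move=> e e0; exists (n + n)%N => N z; rewrite /sqn big1 ?ltW// => k _.
  suff E x : tailz (n + n) (conv n c u) k x = 0.
    by rewrite E sqmod0 (eq_sqJ E) sqJ0 mulr0 addr0 mulr0.
  by rewrite /tailz; case: ifPn => // /conv_supp->.
Qed.

Definition convA n c u : strip s := Strip (conv_strip n c u).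

Lemma strip_eq (u v : strip s) : (forall k z, u k z = v k z) -> u = v.
Proof. by move=> uv; apply/val_inj/funext => k; apply/funext => z; exact: uv. Qed.

Lemma convA_norm : exists2 K : R, 0 <= K & forall n c u, `|convA n c u| <= K * (`|c| * `|u|).
Proof.
have [K K0 hK] := conv_sqn_bound s_gt; exists (Num.sqrt K); first exact: sqrtr_ge0.
move=> n c u; apply: normr_strip_le; first by rewrite !mulr_ge0 ?sqrtr_ge0.
move=> N z; rewrite !exprMn sqr_sqrtr// mulrA.
by apply: hK => [k|k|m x|m x]; [exact: strip_continuous|exact: strip_continuous|
  exact: sqn_le_normr|exact: sqn_le_normr].
Qed.

Lemma convA_trunc n m N c u : (n <= N)%N -> (m <= N)%N ->
  convA N (truncA n c) (truncA m u) = convA (maxn n m) (truncA n c) (truncA m u).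
Proof.
move=> nN mN; apply: strip_eq => k z.
by rewrite /= !conv_trunc// ?leq_maxl ?leq_maxr.
Qed.

Lemma convA_truncE n c u : convA n c u = convA n (truncA n c) (truncA n u).
Proof.
apply: strip_eq => k z; rewrite /= conv_trunc//.
Qed.

Lemma convADl n c c' u : convA n (c + c') u = convA n c u + convA n c' u.
Proof. apply: strip_eq => k z; exact: convDl. Qed.
Lemma convADr n c u u' : convA n c (u + u') = convA n c u + convA n c u'.
Proof. apply: strip_eq => k z; exact: convDr. Qed.
Lemma convAZl n a c u : convA n (a *: c) u = a *: convA n c u.
Proof. apply: strip_eq => k z; exact: convZl. Qed.
Lemma convAZr n a c u : convA n c (a *: u) = a *: convA n c u.
Proof. apply: strip_eq => k z; exact: convZr. Qed.

Lemma convANl n c u : convA n (- c) u = - convA n c u.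
Proof. by rewrite -scaleN1r convAZl scaleN1r. Qed.
Lemma convANr n c u : convA n c (- u) = - convA n c u.
Proof. by rewrite -scaleN1r convAZr scaleN1r. Qed.

Lemma convA_bilinear_le n c u c' u' (K : R) :
  (forall n c u, `|convA n c u| <= K * (`|c| * `|u|)) ->
  `|convA n c u - convA n c' u'| <= K * (`|c - c'| * `|u| + `|c'| * `|u - u'|).
Proof.
move=> hK; have -> : convA n c u - convA n c' u' = convA n (c - c') u + convA n c' (u - u').
  by rewrite convADl convADr convANl convANr addrA subrK.
by apply: le_trans (ler_normD _ _) _; rewrite mulrDr lerD.
Qed.

(** Once the factors are truncated, the degree of the convolution can be raised to a common value
    without changing it; bilinearity then reduces the difference to tails of the two factors. *)
Lemma convA_cauchy c u (e : R) : 0 < e -> exists N, forall m n, (N <= m)%N -> (N <= n)%N ->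
  `|convA m c u - convA n c u| <= e.
Proof.
move=> e0; have [K K0 hK] := convA_norm.
pose M := K * (`|c| + `|u|) + 1.
have M0 : 0 < M by rewrite ltr_wpDl// mulr_ge0// addr_ge0.
have d0 : 0 < e / (2 * M) by rewrite divr_gt0// mulr_gt0.
have [N1 h1] := truncA_cvg c d0; have [N2 h2] := truncA_cvg u d0.
exists (maxn N1 N2) => m n; rewrite !geq_max => /andP[m1 m2] /andP[n1 n2].
have tri (v : strip s) N : (forall n, (N <= n)%N -> `|v - truncA n v| <= e / (2 * M)) ->
    (N <= m)%N -> (N <= n)%N -> `|truncA m v - truncA n v| <= e / M.
  move=> h hm hn; have -> : truncA m v - truncA n v = (v - truncA n v) - (v - truncA m v).
    by rewrite opprB [RHS]addrC addrA subrK.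
  apply: le_trans (ler_normB _ _) _; apply: le_trans (lerD (h _ hn) (h _ hm)) _.
  rewrite le_eqVlt; apply/orP; left; apply/eqP; field; exact: lt0r_neq0.
rewrite (convA_truncE m) (convA_truncE n).
have -> : convA m (truncA m c) (truncA m u) = convA (maxn m n) (truncA m c) (truncA m u).
  by rewrite (@convA_trunc m m (maxn m n)) ?leq_maxl// maxnn.
have -> : convA n (truncA n c) (truncA n u) = convA (maxn m n) (truncA n c) (truncA n u).
  by rewrite (@convA_trunc n n (maxn m n)) ?leq_maxr// maxnn.
apply: le_trans (convA_bilinear_le _ _ _ _ _ hK) _.
apply: (@le_trans _ _ (K * (e / M * `|u| + `|c| * (e / M)))).
  apply: ler_wpM2l => //; apply: lerD.
    by apply: ler_pM; [exact: normr_ge0|exact: normr_ge0|exact: (tri c N1)|exact: truncA_norm].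
  by apply: ler_pM; [exact: normr_ge0|exact: normr_ge0|exact: truncA_norm|exact: (tri u N2)].
have -> : K * (e / M * `|u| + `|c| * (e / M)) = e * ((K * (`|c| + `|u|)) / M).
  by clearbody M; move: `|u| `|c| => nu nc; ring.
rewrite ler_piMr ?(ltW e0)// ler_pdivrMr// mul1r /M lerDl//.
Qed.

Lemma convA_is_cvg c u : exists v : strip s, convA n c u @[n --> \oo] --> v.
Proof.
have [v hv] := strip_complete (convA_cauchy c u); exists v.
apply/cvgrPdist_le => e e0.
have [N hN] := hv e e0.
exists N; first by [].
move=> n /= Nn.
rewrite distrC.
exact: hN.
Qed.

Definition mulS c u : strip s := projT1 (cid (convA_is_cvg c u)).

Lemma mulS_cvg c u : convA n c u @[n --> \oo] --> mulS c u.
Proof. exact: projT2 (cid (convA_is_cvg c u)). Qed.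

Lemma mulS_eq c u v : convA n c u @[n --> \oo] --> v -> mulS c u = v.
Proof. by move=> h; rewrite -(cvg_lim (@norm_hausdorff _ _) (@mulS_cvg c u)); exact: (cvg_lim (@norm_hausdorff _ _) h). Qed.

Lemma mulSDl c c' u : mulS (c + c') u = mulS c u + mulS c' u.
Proof.
apply: mulS_eq; under eq_fun do rewrite convADl.
by apply: cvgD; exact: mulS_cvg.
Qed.

Lemma mulSDr c u u' : mulS c (u + u') = mulS c u + mulS c u'.
Proof.
apply: mulS_eq; under eq_fun do rewrite convADr.
by apply: cvgD; exact: mulS_cvg.
Qed.

Lemma mulSZl (a : R) c u : mulS (a *: c) u = a *: mulS c u.
Proof.
apply: mulS_eq; under eq_fun do rewrite convAZl.
by apply: cvgZr; exact: mulS_cvg.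
Qed.

Lemma mulSZr (a : R) c u : mulS c (a *: u) = a *: mulS c u.
Proof.
apply: mulS_eq; under eq_fun do rewrite convAZr.
by apply: cvgZr; exact: mulS_cvg.
Qed.

Lemma mulS_norm : exists2 K : R, 0 <= K & forall c u, `|mulS c u| <= K * (`|c| * `|u|).
Proof.
have [K K0 hK] := convA_norm; exists K => // c u.
have h : (fun n => `|convA n c u|) @ \oo --> `|mulS c u| by exact: cvg_norm (@mulS_cvg c u).
rewrite -(cvg_lim _ h)//; apply: limr_le; first by apply/cvg_ex; eexists; exact: h.
by near=> n; exact: hK.
Unshelve. all: by end_near. Qed.

Lemma mulS_trunc n c u : mulS (truncA n c) (truncA n u) = convA n c u.
Proof.
apply: mulS_eq; apply: cvg_near_cst; near=> N.
have nN : (n <= N)%N by near: N; exact: nbhs_infty_ge.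
by rewrite (convA_trunc c u nN nN) maxnn -convA_truncE.
Unshelve. all: by end_near. Qed.

End StripProduct.

(** * The flat Cauchy-Riemann system *)

Section FlatProblem.
Context {R : realType}.
Notation C := (Rcomplex R).
Implicit Types (k : int) (phi theta : R -> C).

Lemma J_FTC_interior (F f : R -> R) : continuous f ->
  (forall z : R, 0 < z < 1 -> is_derive z 1 F (f z)) ->
  (forall z : R, 0 <= z <= 1 -> {for z, continuous F}) -> J f = F 1 - F 0.
Proof.
move=> cf dF ctF; rewrite /J /Rintegral (@continuous_FTC2 _ f F)//.
- exact: continuous_subspaceT.
- split.
  + by move=> z; rewrite in_itv/= => z01; have [] := dF z z01.
  + by apply/cvg_at_right_filter/ctF; rewrite lexx ler01.
  + by apply/cvg_at_left_filter/ctF; rewrite lexx ler01.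
- by move=> z; rewrite in_itv/= => z01; rewrite derive1E; apply: derive_val; exact: dF.
Qed.

Definition is_deriveC (f : R -> C) (z : R) (d : C) :=
  is_derive z 1 (fun t => Re (f t)) (Re d) /\ is_derive z 1 (fun t => Im (f t)) (Im d).

Lemma is_deriveCD (f g : R -> C) z (df dg : C) : is_deriveC f z df -> is_deriveC g z dg ->
  is_deriveC (fun t => f t + g t) z (df + dg).
Proof.
move=> [f1 f2] [h1 h2]; split; rewrite !ReImE; under eq_fun do rewrite !ReImE.
  exact: is_deriveDf.
exact: is_deriveDf.
Qed.

Lemma is_deriveCZ (a : R) (f : R -> C) z (df : C) : is_deriveC f z df ->
  is_deriveC (fun t => a *: f t) z (a *: df).
Proof.
move=> [f1 f2]; split; rewrite !ReImE; under eq_fun do rewrite !ReImE; exact: is_deriveZf.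
Qed.

Definition ikC k : C := imagC k%:~R.

Lemma sqmod_ikC k : sqmod (ikC k : C) = (k%:~R) ^+ 2.
Proof. by rewrite ?sqmodE /ikC /= expr0n add0r. Qed.

Lemma normr_int_jb k : `|k%:~R : R| <= jb k.
Proof. by rewrite /jb natr_absz intr_norm lerDr. Qed.

(** One Fourier mode of the system with c = 0, d = 1. The data are its residuals: g1 is theta_z -
    phi_x and g2 is - phi_z - theta_x. *)
Definition flat_sol k (g1 g2 : R -> C) phi theta := [/\ phi 1 = 0, theta 0 = 0,
  forall z : R, -1 < z < 2 -> is_deriveC theta z (ikC k * phi z + g1 z) &
  forall z : R, -1 < z < 2 -> is_deriveC phi z (- (ikC k * theta z) - g2 z)].

(** Real and imaginary parts decouple into the pairs (Re phi, Im theta) and (Im phi, Re theta), each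
    a real two-point problem, with rates k and -k. *)
Lemma flat_sol_exists k (g1 g2 : R -> C) : continuousC g1 -> continuousC g2 ->
  exists phi theta, flat_sol k g1 g2 phi theta.
Proof.
move=> [c1r c1i] [c2r c2i]; pose K : R := k%:~R.
have [p1 [q1 [p10 q10 dp1 dq1]]] := two_point_problem K (continuous_oppR c2r) c1i.
have [p2 [q2 [p20 q20 dp2 dq2]]] := two_point_problem (- K) (continuous_oppR c2i) c1r.
exists (fun z => Complex (p1 z) (p2 z)), (fun z => Complex (q2 z) (q1 z)); split.
- by rewrite p10 p20.
- by rewrite q10 q20.
- move=> z z12; split.
  + apply: is_derive_eq (dq2 z z12) _; rewrite !ReImE /ikC /=; rewrite -/K; ring.
  + apply: is_derive_eq (dq1 z z12) _; rewrite !ReImE /ikC /=; rewrite -/K; ring.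
- move=> z z12; split.
  + apply: is_derive_eq (dp1 z z12) _; rewrite !ReImE /ikC /=; rewrite -/K; ring.
  + apply: is_derive_eq (dp2 z z12) _; rewrite !ReImE /ikC /=; rewrite -/K; ring.
Qed.

Lemma flat_sol_lin k (a : R) (g1 g2 phi theta g1' g2' phi' theta' : R -> C) :
  flat_sol k g1 g2 phi theta -> flat_sol k g1' g2' phi' theta' ->
  flat_sol k (fun z => a *: g1 z + g1' z) (fun z => a *: g2 z + g2' z)
    (fun z => a *: phi z + phi' z) (fun z => a *: theta z + theta' z).
Proof.
move=> [p t dt dp] [p' t' dt' dp']; split.
- by rewrite p p' scaler0 addr0.
- by rewrite t t' scaler0 addr0.
- move=> z z12; have := is_deriveCD (is_deriveCZ a (dt z z12)) (dt' z z12).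
  by congr is_deriveC; apply: C_eq; rewrite !ReImE; ring.
- move=> z z12; have := is_deriveCD (is_deriveCZ a (dp z z12)) (dp' z z12).
  by congr is_deriveC; apply: C_eq; rewrite !ReImE; ring.
Qed.

Lemma continuous_clamp (f : R -> R) : (forall z : R, 0 <= z <= 1 -> {for z, continuous f}) ->
  continuous (fun z => f (clampz z)).
Proof.
move=> cf z; apply: (@continuous_comp _ _ _ clampz f); first exact: continuous_clampz.
exact/cf/clampz_itv.
Qed.

Lemma unit_in_itv (z : R) : 0 <= z <= 1 -> -1 < z < 2.
Proof. by move=> /andP[? ?]; apply/andP; split; lra. Qed.

Lemma continuousC_clamp_deriv (f d : R -> C) : (forall z : R, -1 < z < 2 -> is_deriveC f z (d z)) ->
  continuousC (fun z => f (clampz z)).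
Proof.
move=> df; split.
  apply: (@continuous_clamp (fun z => Re (f z))) => z /unit_in_itv/df[h _].
  exact: is_derive1_continuous h.
apply: (@continuous_clamp (fun z => Im (f z))) => z /unit_in_itv/df[_ h].
exact: is_derive1_continuous h.
Qed.

Section Estimates.
Variables (k : int) (g1 g2 phi theta : R -> C).
Hypotheses (c1 : continuousC g1) (c2 : continuousC g2) (sol : flat_sol k g1 g2 phi theta).

Let X1 z : C := ikC k * phi (clampz z).
Let X2 z : C := ikC k * theta (clampz z).
Let Z1 z : C := - X2 z - g2 z.
Let Z2 z : C := X1 z + g1 z.

Let cphi : continuousC (fun z => phi (clampz z)).
Proof. by have [_ _ _ dp] := sol; exact: continuousC_clamp_deriv dp. Qed.
Let ctheta : continuousC (fun z => theta (clampz z)).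
Proof. by have [_ _ dt _] := sol; exact: continuousC_clamp_deriv dt. Qed.

Lemma flat_cX1 : continuousC X1.
Proof. by apply: continuousCM => //; exact: continuousC_cst. Qed.
Lemma flat_cX2 : continuousC X2.
Proof. by apply: continuousCM => //; exact: continuousC_cst. Qed.
Lemma flat_cZ1 : continuousC Z1.
Proof. by apply: continuousCB => //; apply: continuousCN; exact: flat_cX2. Qed.
Lemma flat_cZ2 : continuousC Z2.
Proof. by apply: continuousCD => //; exact: flat_cX1. Qed.

Lemma flat_derivs (z : R) : 0 <= z <= 1 -> is_deriveC phi z (Z1 z) /\ is_deriveC theta z (Z2 z).
Proof.
have [_ _ dt dp] := sol; move=> z01; have z12 := unit_in_itv z01.
by rewrite /Z1 /Z2 /X1 /X2 (clampz_id z01); split; [exact: dp|exact: dt].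
Qed.

Fact null_form_key : unit. Proof. exact: tt. Qed.

(** The Fourier side of the Jacobian phi_x theta_z - phi_z theta_x, for one mode. *)
Definition null_form (x1 z1 x2 z2 : C) : R :=
  locked_with null_form_key (Re (x1 * conjc z2) - Re (z1 * conjc x2)).

Lemma null_formE x1 z1 x2 z2 :
  null_form x1 z1 x2 z2 = Re (x1 * conjc z2) - Re (z1 * conjc x2).
Proof. by rewrite /null_form unlock. Qed.

Lemma continuous_null_form (f1 f2 f3 f4 : R -> C) : continuousC f1 -> continuousC f2 ->
  continuousC f3 -> continuousC f4 -> continuous (fun z => null_form (f1 z) (f2 z) (f3 z) (f4 z)).
Proof.
move=> h1 h2 h3 h4; under eq_fun do rewrite null_formE.
apply: continuous_addR.
  exact: (continuousCM h1 (continuousC_conj h4)).1.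
by apply: continuous_oppR; exact: (continuousCM h2 (continuousC_conj h3)).1.
Qed.

(* The null form is an exact derivative which integrates to zero because phi
   vanishes at the top and theta at the bottom. *)
Lemma flat_null_form : J (fun z => null_form (X1 z) (Z1 z) (X2 z) (Z2 z)) = 0.
Proof.
pose K : R := k%:~R.
have c := continuous_null_form flat_cX1 flat_cZ1 flat_cX2 flat_cZ2.
pose F z := K * (Re (phi z) * Im (theta z) - Im (phi z) * Re (theta z)).
have dF (z : R) : 0 <= z <= 1 -> is_derive z 1 F (null_form (X1 z) (Z1 z) (X2 z) (Z2 z)).
  move=> z01; have [[p1 p2] [t1 t2]] := flat_derivs z01.
  have h := is_deriveZf K (is_deriveBf (is_deriveMf p1 t2) (is_deriveMf p2 t1)).
  apply: is_derive_eq h _.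
  rewrite ?null_formE /X1 /X2 /= !ReImE /ikC /= !mul0r !sub0r !add0r (clampz_id z01) -/K.
  by ring.
transitivity (F 1 - F 0); last by have [p t _ _] := sol; rewrite /F p t !ReImE; ring.
apply: (J_FTC_interior c).
- by move=> z /andP[z0 z1]; apply: dF; rewrite !ltW.
- by move=> z /dF; exact: is_derive1_continuous.
Qed.

(** After substitution of [Z1] and [Z2], twice the null form equals
    $|X_1|^2+|X_2|^2+|X_1+g_1|^2+|X_2+g_2|^2-|g_1|^2-|g_2|^2$, and its integral is zero. *)
Lemma flat_energy : sqJ X1 + sqJ X2 <= sqJ g1 + sqJ g2.
Proof.
have cs1 := continuous_sqmod flat_cX1; have cs2 := continuous_sqmod flat_cX2.
have cg1 := continuous_sqmod c1; have cg2 := continuous_sqmod c2.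
have cn := continuous_null_form flat_cX1 flat_cZ1 flat_cX2 flat_cZ2.
have h : J (fun z => sqmod (X1 z) + sqmod (X2 z)) <=
    J (fun z => (sqmod (g1 z) + sqmod (g2 z)) + 2 * null_form (X1 z) (Z1 z) (X2 z) (Z2 z)).
  apply: J_le.
  - exact: continuous_addR.
  - apply: continuous_addR; first exact: continuous_addR.
    by apply: continuous_mulR => //; exact: cst_continuous.
  - move=> z _; rewrite ?null_formE /Z1 /Z2.
    move: (X1 z) (X2 z) (g1 z) (g2 z) => x y p q; rewrite ?sqmodE !ReImE.
    have := sqr_ge0 (Re x + Re p); have := sqr_ge0 (Im x + Im p).
    have := sqr_ge0 (Re y + Re q); have := sqr_ge0 (Im y + Im q).
    nra.
have cn2 : continuous (fun z => 2 * null_form (X1 z) (Z1 z) (X2 z) (Z2 z)).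
  by apply: continuous_mulR => //; exact: cst_continuous.
move: h; rewrite (JD cs1 cs2) (JD (continuous_addR cg1 cg2) cn2) (JD cg1 cg2) (JZ _ cn).
by rewrite flat_null_form mulr0 addr0.
Qed.

(** The quantity $k^2|\phi|^2$ vanishes at the top and its z-derivative is at most
    $|k|(|X_1|^2+|Z_1|^2)$. The supremum thus costs one power of k in mean square, that is half a
    derivative. *)
Lemma flat_sup1 (z : R) : 0 <= z <= 1 -> sqmod (X1 z) <= jb k * (sqJ X1 + sqJ Z1).
Proof.
pose K : R := k%:~R.
have cs1 := continuous_sqmod flat_cX1; have cs2 := continuous_sqmod flat_cZ1.
pose H z := K ^+ 2 * (Re (phi z) * Re (phi z) + Im (phi z) * Im (phi z)).
pose d z := - (ikC k * theta z) - g2 z.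
have [p1 _ _ dp] := sol.
have dH (t : R) : -1 < t < 2 -> is_derive t 1 H
    (K ^+ 2 * ((Re (d t) * Re (phi t) + Re (phi t) * Re (d t)) +
               (Im (d t) * Im (phi t) + Im (phi t) * Im (d t)))).
  move=> t12; have [h1 h2] := dp t t12.
  exact: (is_deriveZf (K ^+ 2) (is_deriveDf (is_deriveMf h1 h1) (is_deriveMf h2 h2))).
have cw : continuous (fun z => jb k * (sqmod (X1 z) + sqmod (Z1 z))).
  by apply: continuous_mulR; [exact: cst_continuous|exact: continuous_addR].
move=> z01; have := sup_le_J cw dH _ _ z01.
rewrite (JZ _ (continuous_addR cs1 cs2)) (JD cs1 cs2).
have -> : H z = sqmod (X1 z).
  by rewrite /X1 clampz_id// sqmodM sqmod_ikC /H ?sqmodE !expr2.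
apply; last by right; rewrite /H p1 !ReImE; ring.
move=> t t01; have -> : d t = Z1 t by rewrite /Z1 /X2 clampz_id.
rewrite /X1 clampz_id// sqmodM sqmod_ikC -/K; move: (phi t) (Z1 t) => x y.
have Kj : `|K| <= jb k := normr_int_jb k.
have -> : K ^+ 2 * (Re y * Re x + Re x * Re y + (Im y * Im x + Im x * Im y)) =
   K * (2 * (Re y * (K * Re x) + Im y * (K * Im x))) by ring.
rewrite normrM; apply: ler_pM => //; rewrite ?sqmodE.
rewrite ler_norml; apply/andP; split.
  have := sqr_ge0 (Re y + K * Re x); have := sqr_ge0 (Im y + K * Im x); nra.
have := sqr_ge0 (Re y - K * Re x); have := sqr_ge0 (Im y - K * Im x); nra.
Qed.

Lemma flat_sup2 (z : R) : 0 <= z <= 1 -> sqmod (X2 z) <= jb k * (sqJ X2 + sqJ Z2).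
Proof.
pose K : R := k%:~R.
have cs1 := continuous_sqmod flat_cX2; have cs2 := continuous_sqmod flat_cZ2.
pose H z := K ^+ 2 * (Re (theta z) * Re (theta z) + Im (theta z) * Im (theta z)).
pose d z := ikC k * phi z + g1 z.
have [_ t0 dt _] := sol.
have dH (t : R) : -1 < t < 2 -> is_derive t 1 H
    (K ^+ 2 * ((Re (d t) * Re (theta t) + Re (theta t) * Re (d t)) +
               (Im (d t) * Im (theta t) + Im (theta t) * Im (d t)))).
  move=> t12; have [h1 h2] := dt t t12.
  exact: (is_deriveZf (K ^+ 2) (is_deriveDf (is_deriveMf h1 h1) (is_deriveMf h2 h2))).
have cw : continuous (fun z => jb k * (sqmod (X2 z) + sqmod (Z2 z))).
  by apply: continuous_mulR; [exact: cst_continuous|exact: continuous_addR].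
move=> z01; have := sup_le_J cw dH _ _ z01.
rewrite (JZ _ (continuous_addR cs1 cs2)) (JD cs1 cs2).
have -> : H z = sqmod (X2 z).
  by rewrite /X2 clampz_id// sqmodM sqmod_ikC /H ?sqmodE !expr2.
apply; last by left; rewrite /H t0 !ReImE; ring.
move=> t t01; have -> : d t = Z2 t by rewrite /Z2 /X1 clampz_id.
rewrite /X2 clampz_id// sqmodM sqmod_ikC -/K; move: (theta t) (Z2 t) => x y.
have Kj : `|K| <= jb k := normr_int_jb k.
have -> : K ^+ 2 * (Re y * Re x + Re x * Re y + (Im y * Im x + Im x * Im y)) =
   K * (2 * (Re y * (K * Re x) + Im y * (K * Im x))) by ring.
rewrite normrM; apply: ler_pM => //; rewrite ?sqmodE.
rewrite ler_norml; apply/andP; split.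
  have := sqr_ge0 (Re y + K * Re x); have := sqr_ge0 (Im y + K * Im x); nra.
have := sqr_ge0 (Re y - K * Re x); have := sqr_ge0 (Im y - K * Im x); nra.
Qed.

Lemma sqJD_le (f g : R -> C) : continuousC f -> continuousC g ->
  sqJ (fun z => f z + g z) <= 2 * (sqJ f + sqJ g).
Proof.
move=> cf cg; have t01 : ((0 : R) < 2^-1) && ((2^-1 : R) < 1) by apply/andP; split; lra.
have := sqJ_convex t01 cf cg; rewrite invrK (_ : 1 - 2^-1 = 2^-1 :> R) ?invrK; lra.
Qed.

Lemma sqJN (f : R -> C) : sqJ (fun z => - f z) = sqJ f.
Proof. by apply: eq_J => z _; rewrite sqmodN. Qed.

Lemma flat_term_bound (z : R) : 0 <= z <= 1 ->
  sqmod (X1 z) + jb k * sqJ X1 <= 6 * (jb k * (sqJ g1 + sqJ g2)) /\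
  sqmod (X2 z) + jb k * sqJ X2 <= 6 * (jb k * (sqJ g1 + sqJ g2)).
Proof.
move=> z01; have := flat_sup1 z01; have := flat_sup2 z01; have := flat_energy.
have := sqJD_le flat_cX1 c1; have := sqJD_le (continuousCN flat_cX2) (continuousCN c2).
rewrite !sqJN -/Z1 -/Z2.
move: (sqJ_ge0 X1) (sqJ_ge0 X2) (sqJ_ge0 g1) (sqJ_ge0 g2) (@jb_ge0 R k).
set a := sqJ X1; set b := sqJ X2; set c := sqJ g1; set d := sqJ g2; set e := jb k.
set x := sqmod _; set y := sqmod _; set p := sqJ Z1; set q := sqJ Z2.
move=> a0 b0 cc0 d0 e0 h1 h2 h3 h4 h5.
have m1 : e * (b + q) <= e * (5 * (c + d)) by rewrite ler_wpM2l//; lra.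
have m2 : e * (a + p) <= e * (5 * (c + d)) by rewrite ler_wpM2l//; lra.
have m3 : e * a <= e * (c + d) by rewrite ler_wpM2l//; lra.
have m4 : e * b <= e * (c + d) by rewrite ler_wpM2l//; lra.
split; lra.
Qed.

End Estimates.

(** A choice is made because solutions are not unique as functions on R: nothing constrains them
    outside (-1, 2). *)
Definition flat_pair k (g1 g2 : R -> C) : (R -> C) * (R -> C) :=
  xget ((fun=> 0), (fun=> 0)) [set pt | flat_sol k g1 g2 pt.1 pt.2].

Lemma flat_pairP k (g1 g2 : R -> C) : continuousC g1 -> continuousC g2 ->
  flat_sol k g1 g2 (flat_pair k g1 g2).1 (flat_pair k g1 g2).2.
Proof.
move=> c1 c2; have [p [t h]] := flat_sol_exists k c1 c2.
exact: (@xgetPex _ _ [set pt | flat_sol k g1 g2 pt.1 pt.2] (ex_intro _ (p, t) h)).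
Qed.

End FlatProblem.

Lemma norm_fst_le (R : realType) (V V' : normedModType R) (x : V * V') : `|x.1| <= `|x|.
Proof. by rewrite prod_normE le_max lexx. Qed.

Lemma norm_snd_le (R : realType) (V V' : normedModType R) (x : V * V') : `|x.2| <= `|x|.
Proof. by rewrite prod_normE le_max lexx orbT. Qed.

(** * The flat solver as a bounded linear map *)

Section FlatSolver.
Context {R : realType} (s : R).
Notation C := (Rcomplex R).
Implicit Types g : strip s * strip s.

Definition flat_phi g k := (flat_pair k (g.1 k) (g.2 k)).1.
Definition flat_theta g k := (flat_pair k (g.1 k) (g.2 k)).2.

Lemma flat_solP g k : flat_sol k (g.1 k) (g.2 k) (flat_phi g k) (flat_theta g k).
Proof. by apply: flat_pairP; exact: strip_continuous. Qed.

Definition flatX1 g k z : C := ikC k * flat_phi g k (clampz z).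
Definition flatX2 g k z : C := ikC k * flat_theta g k (clampz z).

Lemma flatX_strip_of g (X : int -> R -> C) : (forall k, continuousC (X k)) ->
  (forall k z, X k (clampz z) = X k z) ->
  (forall k (z : R), 0 <= z <= 1 ->
     sqmod (X k z) + jb k * sqJ (X k) <= 6 * (jb k * (sqJ (g.1 k) + sqJ (g.2 k)))) ->
  X \in strip_fun s /\ forall n z, sqn s n z X <= 12 * `|g| ^+ 2.
Proof.
move=> cX kX hX.
have term k z : sqmod (X k z) + jb k * sqJ (X k) <=
    6 * ((sqmod (g.1 k z) + jb k * sqJ (g.1 k)) + (sqmod (g.2 k z) + jb k * sqJ (g.2 k))).
  rewrite -kX; apply: le_trans (hX k _ (clampz_itv z)) _.
  by have := sqmod_ge0 (g.1 k z); have := sqmod_ge0 (g.2 k z); lra.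
have h n z : sqn s n z X <= 6 * (sqn s n z g.1 + sqn s n z g.2).
  rewrite /sqn -big_split/= mulr_sumr; apply: ler_sum => k _.
  by rewrite -mulrDr mulrCA ler_wpM2l ?W_ge0.
have ht m n z : sqn s n z (tailz m X) <= 6 * (sqn s n z (tailz m g.1) + sqn s n z (tailz m g.2)).
  rewrite /sqn -big_split/= mulr_sumr; apply: ler_sum => k _.
  rewrite -mulrDr mulrCA ler_wpM2l ?W_ge0// /tailz; case: (k \in rng m); last exact: term.
  by rewrite sqmod0 sqJ0; lra.
have [_ _ [M1 hM1] t1] := stripP g.1; have [_ _ [M2 hM2] t2] := stripP g.2.
split; last first.
  move=> n z; apply: le_trans (h n z) _.
  have b1 : sqn s n z g.1 <= `|g| ^+ 2.
    apply: le_trans (sqn_le_normr _ _ _) _.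
    rewrite ler_pXn2r; [exact: norm_fst_le|by []|exact: normr_ge0|exact: normr_ge0].
  have b2 : sqn s n z g.2 <= `|g| ^+ 2.
    apply: le_trans (sqn_le_normr _ _ _) _.
    rewrite ler_pXn2r; [exact: norm_snd_le|by []|exact: normr_ge0|exact: normr_ge0].
  by lra.
apply/mem_set; split => //.
  exists (6 * (M1 + M2)) => n z; apply: le_trans (h n z) _.
  by rewrite ler_wpM2l// lerD.
move=> e e0; have e12 : 0 < e / 12 by rewrite divr_gt0.
have [m1 h1] := t1 _ e12; have [m2 h2] := t2 _ e12.
exists (maxn m1 m2) => n z; apply: le_trans (ht _ n z) _.
have := le_trans (sqn_tail_anti s n z g.1 (leq_maxl m1 m2)) (h1 n z).
have := le_trans (sqn_tail_anti s n z g.2 (leq_maxr m1 m2)) (h2 n z).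
lra.
Qed.

Lemma flatX1_strip g : flatX1 g \in strip_fun s /\
  forall n z, sqn s n z (flatX1 g) <= 12 * `|g| ^+ 2.
Proof.
apply: flatX_strip_of => [k|k z|k z z01].
- exact: flat_cX1 (flat_solP g k).
- by rewrite /flatX1 clampzK.
- by have [h _] := flat_term_bound (strip_continuous g.1 k) (strip_continuous g.2 k)
    (flat_solP g k) z01.
Qed.

Lemma flatX2_strip g : flatX2 g \in strip_fun s /\
  forall n z, sqn s n z (flatX2 g) <= 12 * `|g| ^+ 2.
Proof.
apply: flatX_strip_of => [k|k z|k z z01].
- exact: flat_cX2 (flat_solP g k).
- by rewrite /flatX2 clampzK.
- by have [_ h] := flat_term_bound (strip_continuous g.1 k) (strip_continuous g.2 k)
    (flat_solP g k) z01.
Qed.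

(** [SX1], [SX2], [SZ1], [SZ2] are phi_x, theta_x, phi_z, theta_z of the flat solution with residual
    [g]. All four are bounded by [g] in the same norm, so [g] can serve as the unknown of the full
    problem. *)
Definition SX1 g : strip s := Strip (flatX1_strip g).1.
Definition SX2 g : strip s := Strip (flatX2_strip g).1.
Definition SZ1 g : strip s := - SX2 g - g.2.
Definition SZ2 g : strip s := SX1 g + g.1.

Lemma SX1_norm g : `|SX1 g| <= 4 * `|g|.
Proof.
apply: normr_strip_le; first by rewrite mulr_ge0.
move=> n z; apply: le_trans ((flatX1_strip g).2 n z) _.
by rewrite exprMn; have := sqr_ge0 `|g|; lra.
Qed.

Lemma SX2_norm g : `|SX2 g| <= 4 * `|g|.
Proof.
apply: normr_strip_le; first by rewrite mulr_ge0.
move=> n z; apply: le_trans ((flatX2_strip g).2 n z) _.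
by rewrite exprMn; have := sqr_ge0 `|g|; lra.
Qed.

(** The difference has zero data and is removed by [flat_term_bound]. Only ik phi and ik theta are
    compared, the quantities that [SX1] and [SX2] are made of; in mode 0 they vanish. *)
Lemma flat_unique k (g1 g2 phi theta phi' theta' : R -> C) : continuousC g1 -> continuousC g2 ->
  flat_sol k g1 g2 phi theta -> flat_sol k g1 g2 phi' theta' ->
  forall z : R, 0 <= z <= 1 -> ikC k * phi z = ikC k * phi' z /\ ikC k * theta z = ikC k * theta' z.
Proof.
move=> c1 c2 s1 s2 z z01.
have := flat_sol_lin (-1) s1 s2; set h1 := (fun z => _); set h2 := (fun z => _) => sol.
have h10 : h1 = fun=> 0 by apply/funext => t; rewrite /h1 scaleN1r addNr.
have h20 : h2 = fun=> 0 by apply/funext => t; rewrite /h2 scaleN1r addNr.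
rewrite h10 h20 in sol; have c0 := @continuousC0 R.
have [b1 b2] := flat_term_bound c0 c0 sol z01.
move: b1 b2; rewrite !clampz_id// !sqJ0 addr0 !mulr0.
have zero (x p q : C) (j : R) : 0 <= j -> sqmod (x * (-1 *: p + q)) + j <= 0 -> x * p = x * q.
  move=> j0 h; have h0 : sqmod (x * (-1 *: p + q)) = 0.
    by apply/eqP; rewrite eq_le sqmod_ge0 andbT (le_trans _ h)// lerDl.
  move/eqP : h0; rewrite sqmodE paddr_eq0 ?sqr_ge0// !sqrf_eq0 => /andP[/eqP r0 /eqP i0].
  move: r0 i0; rewrite !ReImE => r0 i0.
  by apply: C_eq; rewrite !ReImE; apply/eqP; rewrite -subr_eq0; apply/eqP; lra.
by move=> b1 b2; split; apply: zero; [|exact: b1| |exact: b2];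
  rewrite mulr_ge0 ?jb_ge0 ?sqJ_ge0.
Qed.

Lemma SX_lin (a : R) g g' : SX1 (a *: g + g') = a *: SX1 g + SX1 g' /\
  SX2 (a *: g + g') = a *: SX2 g + SX2 g'.
Proof.
have h k z := flat_unique (strip_continuous (a *: g + g').1 k) (strip_continuous (a *: g + g').2 k)
  (flat_solP (a *: g + g') k) (flat_sol_lin a (flat_solP g k) (flat_solP g' k)) (clampz_itv z).
split; apply: strip_eq => k z.
  rewrite -[RHS]/(a *: flatX1 g k z + flatX1 g' k z) /flatX1.
  rewrite -[LHS]/(ikC k * flat_phi (a *: g + g') k (clampz z)).
  have [-> _] := h k z; apply: C_eq; rewrite !ReImE; ring.
rewrite -[RHS]/(a *: flatX2 g k z + flatX2 g' k z) /flatX2.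
rewrite -[LHS]/(ikC k * flat_theta (a *: g + g') k (clampz z)).
have [_ ->] := h k z; apply: C_eq; rewrite !ReImE; ring.
Qed.

End FlatSolver.

(** * The a priori estimate *)

Section TrigPolynomials.
Context {R : realType}.
Notation C := (Rcomplex R).
Implicit Types (k l : int) (x z : R) (u v c : int -> R -> C) (n N : nat).

Definition expi (t : R) : C := Complex (cos t) (sin t).

Lemma expiD a b : expi (a + b) = expi a * expi b.
Proof. by apply: C_eq; rewrite !ReImE /= ?cosD ?sinD; ring. Qed.

Lemma expi0 : expi 0 = 1. Proof. by rewrite /expi cos0 sin0. Qed.

Lemma sqmod_expi t : sqmod (expi t) = 1.
Proof. by rewrite ?sqmodE /= cos2Dsin2. Qed.

Lemma expi_conj t : conjc (expi t) = expi (- t).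
Proof. by rewrite /expi cosN sinN. Qed.

Definition ek k x : C := expi (k%:~R * x).

Lemma ekD k l x : ek (k + l) x = ek k x * ek l x.
Proof. by rewrite /ek intrD mulrDl expiD. Qed.

Lemma ekN k x : ek (- k) x = conjc (ek k x).
Proof. by rewrite /ek mulrNz mulNr expi_conj. Qed.

Lemma ekMn k x N : ek k (x *+ N) = ek k x ^+ N.
Proof.
rewrite /ek; elim: N => [|N ih]; first by rewrite mulr0n mulr0 expi0 expr0.
by rewrite mulrS mulrDr expiD ih exprS.
Qed.

Lemma cos_eq1 (t : R) : 0 < t < pi *+ 2 -> cos t != 1.
Proof.
move=> /andP[t0 t2]; apply/eqP => ct.
have h : cos t = 1 - 2 * sin (t / 2) ^+ 2.
  have {1}-> : t = t / 2 + t / 2 by field.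
  by rewrite cosD -!expr2; have := cos2Dsin2 (t / 2); lra.
have s0 : 0 < sin (t / 2).
  apply: sin_gt0_pi; apply/andP; split; first by rewrite divr_gt0.
  by rewrite ltr_pdivrMr// mulr_natr.
have := exprn_gt0 2 s0; lra.
Qed.

Lemma expi_2pi_int (j : int) : expi (j%:~R * (pi *+ 2)) = 1.
Proof.
have nat (m : nat) : expi (m%:R * (pi *+ 2)) = 1.
  elim: m => [|m ih]; first by rewrite mul0r expi0.
  by rewrite -natr1 mulrDl mul1r expiD ih mul1r /expi cos2pi sin2pi.
case: j => m; first exact: nat.
rewrite NegzE mulrNz mulNr -expi_conj.
by have -> : (m.+1%:~R : R) = m.+1%:R by []; rewrite nat; apply: C_eq; rewrite !ReImE/= ?oppr0.
Qed.

(** Equispaced nodes: an inequality that holds at every x becomes one between Fourier coefficients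
    by a finite sum, without integration in x. *)
Definition grid N (j : nat) : R := (pi *+ 2) / N%:R *+ j.

(** A geometric sum over the powers of an N-th root of unity, which is not 1 because 0 < |k| < N. *)
Lemma sum_ek_grid N k : (absz k < N)%N -> k != 0 -> \sum_(j < N) ek k (grid N j) = 0.
Proof.
move=> kN k0; have N0 : (0 < N)%N by exact: leq_ltn_trans kN.
have NR0 : (N%:R : R) != 0 by rewrite pnatr_eq0 -lt0n.
pose w := ek k ((pi *+ 2) / N%:R).
have -> : \sum_(j < N) ek k (grid N j) = \sum_(j < N) w ^+ j.
  by apply: eq_bigr => j _; rewrite /grid ekMn.
have wN : w ^+ N = 1.
  rewrite -ekMn; have -> : pi *+ 2 / N%:R *+ N = pi *+ 2 :> R by rewrite -[LHS]mulr_natr divfK.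
  have := expi_2pi_int k; by rewrite /ek.
have w1 : w - 1 != 0.
  rewrite subr_eq0; apply/negP => /eqP w1.
  have : ek `|k|%N%:Z ((pi *+ 2) / N%:R) = 1.
    case/orP: (le_total 0 k) => h; first by rewrite gez0_abs.
    by rewrite lez0_abs// ekN -/w w1; apply: C_eq; rewrite !ReImE/= ?oppr0.
  move=> /(congr1 (@complex.Re R)) /= /eqP; apply/negP; apply: cos_eq1.
  have k0' : (0 < absz k)%N by rewrite absz_gt0.
  have pp : 0 < pi *+ 2 :> R := twopi_gt0.
  rewrite mulrC mulr_gt0 ?divr_gt0 ?ltr0n//=.
  by rewrite mulrAC ltr_pdivrMr ?ltr0n// ltr_pM2l// ltr_nat.
have := subrX1 w N; rewrite wN subrr => /eqP; rewrite eq_sym mulf_eq0 (negbTE w1)/=.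
by move/eqP.
Qed.

Definition ev n u x z : C := \sum_(k <- rng n) u k z * ek k x.

(** With N > 2n nodes there is no aliasing: frequency differences k - l are smaller than N in
    absolute value. *)
Lemma parseval n N u v z : (n + n < N)%N ->
  \sum_(j < N) ev n u (grid N j) z * conjc (ev n v (grid N j) z) =
  N%:R *: \sum_(k <- rng n) u k z * conjc (v k z).
Proof.
move=> nN.
transitivity (\sum_(k <- rng n) \sum_(l <- rng n)
    (u k z * conjc (v l z)) * \sum_(j < N) ek (k - l) (grid N j)).
  rewrite [RHS](_ : _ = \sum_(k <- rng n) \sum_(j < N) \sum_(l <- rng n)
      (u k z * conjc (v l z)) * ek (k - l) (grid N j)); last first.
    apply: eq_bigr => k _; rewrite exchange_big; apply: eq_bigr => l _.
    by rewrite mulr_sumr.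
  rewrite exchange_big/=; apply: eq_bigr => j _; rewrite /ev mulr_suml.
  apply: eq_bigr => k _; rewrite conj_sum mulr_sumr; apply: eq_bigr => l _.
  rewrite ekD ekN; apply: C_eq; rewrite !ReImE; ring.
rewrite scaler_sumr big_seq [RHS]big_seq; apply: eq_bigr => k kn.
rewrite (bigD1_seq k) ?rng_uniq//= [X in _ + X]big1_seq ?addr0; last first.
  move=> l /andP[lk ln]; rewrite sum_ek_grid ?mulr0// ?subr_eq0 1?eq_sym//.
  by move: kn ln; rewrite !mem_rng; lia.
rewrite subrr; have -> : \sum_(j < N) ek 0 (grid N j) = realC N%:R.
  rewrite (eq_bigr (fun=> 1)) ?sumr_const ?card_ord; last first.
    by move=> j _; rewrite /ek mul0r expi0.
  elim: (N) => [|m ih]; first by rewrite mulr0n.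
  by rewrite mulrS ih; apply: C_eq; rewrite !ReImE /= ?addr0// nat1r.
by rewrite scaleCE mulrC.
Qed.

Lemma ReM_conj (a : C) : Re (a * conjc a) = sqmod a.
Proof. by rewrite ?sqmodE !ReImE; ring. Qed.

Lemma parseval_sqmod n N u z : (n + n < N)%N ->
  \sum_(j < N) sqmod (ev n u (grid N j) z) = N%:R * \sum_(k <- rng n) sqmod (u k z).
Proof.
move=> nN; have /(congr1 (@complex.Re R)) := parseval u u z nN.
rewrite Re_sum ReZ Re_sum; under eq_bigr do rewrite ReM_conj.
by under [X in _ = _ * X -> _]eq_bigr do rewrite ReM_conj.
Qed.

Lemma parseval_null n N (u1 v1 u2 v2 : int -> R -> C) z : (n + n < N)%N ->
  \sum_(j < N) null_form (ev n u1 (grid N j) z) (ev n v1 (grid N j) z)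
     (ev n u2 (grid N j) z) (ev n v2 (grid N j) z) =
  N%:R * \sum_(k <- rng n) null_form (u1 k z) (v1 k z) (u2 k z) (v2 k z).
Proof.
move=> nN; under eq_bigr do rewrite null_formE.
under [X in _ = _ * X]eq_bigr do rewrite null_formE.
have /(congr1 (@complex.Re R)) := parseval u1 v2 z nN.
have /(congr1 (@complex.Re R)) := parseval v1 u2 z nN.
rewrite !Re_sum !ReZ !Re_sum !sumrB mulrBr => -> ->.
by [].
Qed.

Lemma sum_rng_shift_supp (V : zmodType) n M l (f : int -> V) : (n + absz l <= M)%N ->
  (forall k, k \notin rng n -> f k = 0) -> \sum_(k <- rng M) f (k - l) = \sum_(k <- rng n) f k.
Proof.
move=> nM f0; rewrite -(big_map (fun k => k - l) xpredT f).
rewrite (bigID (mem (rng n)))/= [X in _ + X]big1 ?addr0; last by move=> k /f0.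
rewrite -big_filter; apply: perm_big; apply: uniq_perm.
- by rewrite filter_uniq// map_inj_uniq ?rng_uniq// => a b; lia.
- exact: rng_uniq.
- move=> k; rewrite mem_filter; case: (boolP (k \in rng n)) => //= kn.
  apply/mapP; exists (k + l); last by lia.
  by move: kn; rewrite !mem_rng; lia.
Qed.

Lemma ev_conv n c u x z : ev (n + n) (conv n c u) x z = ev n c x z * ev n u x z.
Proof.
rewrite /ev /conv.
transitivity (\sum_(l <- rng n) \sum_(k <- rng (n + n))
    (trunc n c (k - l) z * ek (k - l) x) * (u l z * ek l x)).
  rewrite exchange_big/=; apply: eq_bigr => k _; rewrite mulr_suml; apply: eq_bigr => l _.
  have -> : ek k x = ek (k - l) x * ek l x by rewrite -ekD subrK.
  by rewrite mulrACA mulrA.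
rewrite mulr_sumr big_seq [RHS]big_seq; apply: eq_bigr => l ln.
rewrite -mulr_suml; congr (_ * _).
rewrite (@sum_rng_shift_supp _ n _ _ (fun k => trunc n c k z * ek k x)).
- by rewrite big_seq [RHS]big_seq; apply: eq_bigr => k kn; rewrite trunc_in.
- by move: ln; rewrite mem_rng; lia.
- by move=> k kn; rewrite trunc_out// mul0r.
Qed.

Lemma ev_supp m n u x z : (m <= n)%N -> (forall k z, k \notin rng m -> u k z = 0) ->
  ev n u x z = ev m u x z.
Proof. by move=> mn u0; apply: sum_rng_supp => // k /u0->; rewrite mul0r. Qed.

Lemma evD n u v x z : ev n (fun k z => u k z + v k z) x z = ev n u x z + ev n v x z.
Proof. by rewrite /ev -big_split/=; apply: eq_bigr => k _; rewrite mulrDl. Qed.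

Lemma evN n u x z : ev n (fun k z => - u k z) x z = - ev n u x z.
Proof. by rewrite /ev -sumrN; apply: eq_bigr => k _; rewrite mulNr. Qed.

(** Solving for z1 and z2 gives $(1+c^2)\,\mathrm{null}=d(|x_1|^2+|x_2|^2)+P$ with [P] linear in the
    residuals l1, l2. Positivity of [d] alone makes the null form coercive, and [A] is a lower bound
    of $d/(1+c^2)$. *)
Lemma cr_coercive (kap D c d : R) (x1 x2 z1 z2 : C) : 0 < kap -> kap <= d ->
  `|c| <= D -> forall (A : R) (l1 l2 : C), A = kap / (1 + D ^+ 2) ->
  l1 = realC c * z1 + z2 - realC d * x1 -> l2 = realC c * z2 - z1 - realC d * x2 ->
  A * (sqmod x1 + sqmod x2) <= 2 * null_form x1 z1 x2 z2 + A^-1 * (sqmod l1 + sqmod l2).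
Proof.
move=> k0 kd cD A l1 l2 AD l1E l2E.
have D2 : c ^+ 2 <= D ^+ 2.
  by rewrite -[c ^+ 2]real_normK ?num_real// ler_pXn2r// ?nnegrE// (le_trans _ cD).
have dd : 0 < 1 + D ^+ 2 by rewrite ltr_wpDr ?sqr_ge0.
have cc : 0 < 1 + c ^+ 2 by rewrite ltr_wpDr ?sqr_ge0.
have A0 : 0 < A by rewrite AD divr_gt0.
have AE : A * (1 + c ^+ 2) <= d.
  rewrite AD mulrAC ler_pdivrMr//; apply: (@le_trans _ _ (kap * (1 + D ^+ 2))).
    by rewrite ler_wpM2l ?(ltW k0)// lerD2l.
  by rewrite ler_wpM2r// ltW.
pose X := sqmod x1 + sqmod x2; pose L := sqmod l1 + sqmod l2; pose N := null_form x1 z1 x2 z2.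
pose P := Re (conjc x1 * (l1 + realC c * l2) - conjc x2 * (realC c * l1 - l2)).
have NE : (1 + c ^+ 2) * N = d * X + P.
  rewrite /N /P /X l1E l2E ?null_formE ?sqmodE; case: x1 x2 z1 z2 {l1E l2E N P X} => a1 b1 [a2 b2] [a3 b3] [a4 b4] /=.
  ring.
have X0 : 0 <= X by rewrite addr_ge0 ?sqmod_ge0.
have L0 : 0 <= L by rewrite addr_ge0 ?sqmod_ge0.
(* AM-GM with weight A *)
have hP : - P <= (1 + c ^+ 2) * (A / 2 * X + A^-1 / 2 * L).
  have sq : 0 <= sqmod (A *: x1 + (1 + c ^+ 2)^-1 *: (l1 + realC c * l2)) +
      sqmod (A *: x2 - (1 + c ^+ 2)^-1 *: (realC c * l1 - l2)) by rewrite addr_ge0 ?sqmod_ge0.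
  have E : sqmod (A *: x1 + (1 + c ^+ 2)^-1 *: (l1 + realC c * l2)) +
      sqmod (A *: x2 - (1 + c ^+ 2)^-1 *: (realC c * l1 - l2)) =
      A ^+ 2 * X + 2 * A * (1 + c ^+ 2)^-1 * P + (1 + c ^+ 2)^-1 * L.
    rewrite /P /X /L ?sqmodE /realC !ReImE /=; field; exact: lt0r_neq0.
  rewrite E in sq.
  have i1 : (1 + c ^+ 2)^-1 <= 1 by rewrite invf_le1// lerDl sqr_ge0.
  have c1 : 1 <= 1 + c ^+ 2 by rewrite lerDl sqr_ge0.
  have s2 : 0 <= (1 + c ^+ 2) / (2 * A) * (A ^+ 2 * X + 2 * A * (1 + c ^+ 2)^-1 * P +
      (1 + c ^+ 2)^-1 * L).
    by rewrite mulr_ge0// divr_ge0 ?mulr_ge0// ?ltW// mulr_gt0.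
  have E2 : (1 + c ^+ 2) / (2 * A) * (A ^+ 2 * X + 2 * A * (1 + c ^+ 2)^-1 * P +
      (1 + c ^+ 2)^-1 * L) = (1 + c ^+ 2) * (A / 2 * X) + P + A^-1 / 2 * L.
    by field; apply/andP; split; exact: lt0r_neq0.
  have l3 : A^-1 / 2 * L <= (1 + c ^+ 2) * (A^-1 / 2 * L).
    by rewrite ler_peMl// mulr_ge0// divr_ge0// invr_ge0 ltW.
  rewrite E2 in s2; rewrite mulrDr; lra.
have h1 : (1 + c ^+ 2) * (A * X) <= d * X by rewrite mulrA ler_wpM2r// mulrC.
have h2 : (1 + c ^+ 2) * (A * X) <= (1 + c ^+ 2) * (N + (A / 2 * X + A^-1 / 2 * L)).
  by rewrite [leRHS]mulrDr NE; lra.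
by move: h2; rewrite ler_pM2l// -/X -/L -/N; lra.
Qed.

(** The map (z1, z2) to (c z1 + z2, c z2 - z1) is a similarity of ratio $\sqrt{1+c^2}\ge 1$. *)
Lemma cr_z_bound (D c d : R) (x1 x2 z1 z2 : C) : `|d| <= D -> forall (l1 l2 : C),
  l1 = realC c * z1 + z2 - realC d * x1 -> l2 = realC c * z2 - z1 - realC d * x2 ->
  sqmod z1 + sqmod z2 <= 2 * (D ^+ 2 * (sqmod x1 + sqmod x2) + (sqmod l1 + sqmod l2)).
Proof.
move=> dD l1 l2 l1E l2E.
have D2 : d ^+ 2 <= D ^+ 2.
  by rewrite -[d ^+ 2]real_normK ?num_real// ler_pXn2r// ?nnegrE// (le_trans _ dD).
have E : (1 + c ^+ 2) * (sqmod z1 + sqmod z2) =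
    sqmod (l1 + realC d * x1) + sqmod (l2 + realC d * x2).
  rewrite l1E l2E ?sqmodE /realC !ReImE /=; ring.
have h1 := sqmodD l1 (realC d * x1); have h2 := sqmodD l2 (realC d * x2).
have sd (x : C) : sqmod (realC d * x) <= D ^+ 2 * sqmod x.
  rewrite sqmodM; apply: ler_pM; rewrite ?sqmod_ge0//.
  by rewrite ?sqmodE /= expr0n addr0.
have := sd x1; have := sd x2.
have : sqmod z1 + sqmod z2 <= (1 + c ^+ 2) * (sqmod z1 + sqmod z2).
  by apply: ler_peMl; [rewrite addr_ge0 ?sqmod_ge0|rewrite lerDl sqr_ge0].
rewrite E; lra.
Qed.

End TrigPolynomials.

(** * Weighted energy estimates for finitely many modes *)

Section FiniteEstimate.
Context {R : realType}.
Notation C := (Rcomplex R).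
Implicit Types (k l : int) (x z : R) (u v c d : int -> R -> C) (n : nat).

(** What the estimate uses of a truncated solution. The boundary conditions enter only through the
    last three fields, which are stated mode by mode and so are compatible with Fourier
    multipliers. *)
Record cr_data (sg kap D M : R) n c d (X1 X2 Z1 Z2 : int -> R -> C) : Prop := CRData {
  crd_c : forall k, continuousC (c k);
  crd_d : forall k, continuousC (d k);
  crd_X1 : forall k, continuousC (X1 k);
  crd_X2 : forall k, continuousC (X2 k);
  crd_Z1 : forall k, continuousC (Z1 k);
  crd_Z2 : forall k, continuousC (Z2 k);
  crd_sX1 : forall k z, k \notin rng n -> X1 k z = 0;
  crd_sX2 : forall k z, k \notin rng n -> X2 k z = 0;
  crd_sZ1 : forall k z, k \notin rng n -> Z1 k z = 0;
  crd_sZ2 : forall k z, k \notin rng n -> Z2 k z = 0;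
  crd_rc : forall x z, Im (ev n c x z) = 0;
  crd_rd : forall x z, Im (ev n d x z) = 0;
  crd_kap : forall x z, kap <= Re (ev n d x z);
  crd_Dc : forall x z, `|Re (ev n c x z)| <= D;
  crd_Dd : forall x z, `|Re (ev n d x z)| <= D;
  crd_Mc : forall m z, sqn sg m z c <= M;
  crd_Md : forall m z, sqn sg m z d <= M;
  crd_null : forall k, J (fun z => null_form (X1 k z) (Z1 k z) (X2 k z) (Z2 k z)) = 0;
  crd_sup1 : forall k z, 0 <= z <= 1 -> sqmod (X1 k z) <= jb k * (sqJ (X1 k) + sqJ (Z1 k));
  crd_sup2 : forall k z, 0 <= z <= 1 -> sqmod (X2 k z) <= jb k * (sqJ (X2 k) + sqJ (Z2 k))
}.

Definition cr1 n c d (X1 Z1 Z2 : int -> R -> C) : int -> R -> C :=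
  fun k z => conv n c Z1 k z + Z2 k z - conv n d X1 k z.
Definition cr2 n c d (X2 Z1 Z2 : int -> R -> C) : int -> R -> C :=
  fun k z => conv n c Z2 k z - Z1 k z - conv n d X2 k z.

Definition smul (m : int -> R) u : int -> R -> C := fun k z => m k *: u k z.

Lemma null_formZ (a : R) (x1 z1 x2 z2 : C) :
  null_form (a *: x1) (a *: z1) (a *: x2) (a *: z2) = a ^+ 2 * null_form x1 z1 x2 z2.
Proof. by rewrite ?null_formE !ReImE; ring. Qed.

Lemma sqmod3 (x y w : C) : sqmod (x + y - w) <= 3 * (sqmod x + sqmod y + sqmod w).
Proof.
rewrite ?sqmodE !ReImE.
have := sqr_ge0 (Re x - Re y); have := sqr_ge0 (Im x - Im y).
have := sqr_ge0 (Re x + Re w); have := sqr_ge0 (Im x + Im w).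
have := sqr_ge0 (Re y + Re w); have := sqr_ge0 (Im y + Im w); nra.
Qed.

Section Multiplier.
Variables (sg kap D M : R) (n : nat) (c d X1 X2 Z1 Z2 : int -> R -> C).
Hypotheses (k0 : 0 < kap) (H : cr_data sg kap D M n c d X1 X2 Z1 Z2).
Variable m : int -> R.

Let L1 := cr1 n c d (smul m X1) (smul m Z1) (smul m Z2).
Let L2 := cr2 n c d (smul m X2) (smul m Z1) (smul m Z2).

Lemma smul_supp u : (forall k z, k \notin rng n -> u k z = 0) ->
  forall k z, k \notin rng n -> smul m u k z = 0.
Proof. by move=> u0 k z kn; rewrite /smul u0// scaler0. Qed.

Let nn : (n <= n + n)%N. Proof. exact: leq_addr. Qed.

Lemma real_evE u x z : Im (ev n u x z) = 0 -> ev n u x z = realC (Re (ev n u x z)).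
Proof. by move=> h; apply: C_eq. Qed.

Lemma ev_cr1 x z : ev (n + n) L1 x z = realC (Re (ev n c x z)) * ev n (smul m Z1) x z +
  ev n (smul m Z2) x z - realC (Re (ev n d x z)) * ev n (smul m X1) x z.
Proof.
rewrite -(real_evE (crd_rc H x z)) -(real_evE (crd_rd H x z)) -!ev_conv.
rewrite -(@ev_supp _ n (n + n) (smul m Z2))//; last exact: smul_supp (crd_sZ2 H).
by rewrite -evN -evD -evD.
Qed.

Lemma ev_cr2 x z : ev (n + n) L2 x z = realC (Re (ev n c x z)) * ev n (smul m Z2) x z -
  ev n (smul m Z1) x z - realC (Re (ev n d x z)) * ev n (smul m X2) x z.
Proof.
rewrite -(real_evE (crd_rc H x z)) -(real_evE (crd_rd H x z)) -!ev_conv.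
rewrite -(@ev_supp _ n (n + n) (smul m Z1))//; last exact: smul_supp (crd_sZ1 H).
by rewrite -!evN -!evD.
Qed.

(** The residuals have degree 2n, so Parseval's identity for them takes more than 4n nodes. *)
Let N := (n + n + (n + n)).+1.

Let nN : (n + n < N)%N. Proof. by rewrite /N ltnS leq_addr. Qed.
Let n2N : (n + n + (n + n) < N)%N. Proof. by rewrite /N. Qed.
Let N0 : (0 : R) < N%:R. Proof. by rewrite ltr0n. Qed.

Lemma sum_smul u v z : \sum_(k <- rng n) sqmod (smul m u k z) + \sum_(k <- rng n) sqmod (smul m v k z)
  = \sum_(k <- rng n) m k ^+ 2 * (sqmod (u k z) + sqmod (v k z)).
Proof. by rewrite -big_split/=; apply: eq_bigr => k _; rewrite /smul !sqmodZ mulrDr. Qed.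

(** [cr_coercive] holds at each node for the fields multiplied by [m]; summation by Parseval turns
    their null form into the null forms of the single modes with weights m(k)^2. *)
Lemma mult_energy z : kap / (1 + D ^+ 2) *
    \sum_(k <- rng n) m k ^+ 2 * (sqmod (X1 k z) + sqmod (X2 k z)) <=
  2 * \sum_(k <- rng n) m k ^+ 2 * null_form (X1 k z) (Z1 k z) (X2 k z) (Z2 k z) +
  (kap / (1 + D ^+ 2))^-1 * \sum_(k <- rng (n + n)) (sqmod (L1 k z) + sqmod (L2 k z)).
Proof.
set A := kap / _.
have pt j := @cr_coercive R kap D _ _ (ev n (smul m X1) (grid N j) z)
  (ev n (smul m X2) (grid N j) z) (ev n (smul m Z1) (grid N j) z) (ev n (smul m Z2) (grid N j) z)
  k0 (crd_kap H _ z) (crd_Dc H _ z) A _ _ erefl (ev_cr1 (grid N j) z) (ev_cr2 (grid N j) z).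
have : \sum_(j < N) A * (sqmod (ev n (smul m X1) (grid N j) z) +
      sqmod (ev n (smul m X2) (grid N j) z)) <=
    \sum_(j < N) (2 * null_form (ev n (smul m X1) (grid N j) z) (ev n (smul m Z1) (grid N j) z)
      (ev n (smul m X2) (grid N j) z) (ev n (smul m Z2) (grid N j) z) +
      A^-1 * (sqmod (ev (n + n) L1 (grid N j) z) + sqmod (ev (n + n) L2 (grid N j) z))).
  by apply: ler_sum => j _; exact: pt.
rewrite -mulr_sumr !big_split/= -!mulr_sumr !big_split/=.
rewrite !(parseval_sqmod _ _ nN) !(parseval_sqmod _ _ n2N) (parseval_null _ _ _ _ _ nN).
rewrite -!mulrDr sum_smul.
have -> : \sum_(k <- rng n) null_form (smul m X1 k z) (smul m Z1 k z) (smul m X2 k z)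
    (smul m Z2 k z) = \sum_(k <- rng n) m k ^+ 2 * null_form (X1 k z) (Z1 k z) (X2 k z) (Z2 k z).
  by apply: eq_bigr => k _; rewrite null_formZ.
rewrite mulrCA [X in _ <= X + _]mulrCA [X in _ <= _ + X]mulrCA -mulrDr.
by rewrite ler_pM2l.
Qed.

Lemma mult_z z : \sum_(k <- rng n) m k ^+ 2 * (sqmod (Z1 k z) + sqmod (Z2 k z)) <=
  2 * (D ^+ 2 * \sum_(k <- rng n) m k ^+ 2 * (sqmod (X1 k z) + sqmod (X2 k z)) +
   \sum_(k <- rng (n + n)) (sqmod (L1 k z) + sqmod (L2 k z))).
Proof.
have pt j := @cr_z_bound R D _ _ (ev n (smul m X1) (grid N j) z)
  (ev n (smul m X2) (grid N j) z) (ev n (smul m Z1) (grid N j) z) (ev n (smul m Z2) (grid N j) z)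
  (crd_Dd H _ z) _ _ (ev_cr1 (grid N j) z) (ev_cr2 (grid N j) z).
have : \sum_(j < N) (sqmod (ev n (smul m Z1) (grid N j) z) +
      sqmod (ev n (smul m Z2) (grid N j) z)) <=
    \sum_(j < N) 2 * (D ^+ 2 * (sqmod (ev n (smul m X1) (grid N j) z) +
      sqmod (ev n (smul m X2) (grid N j) z)) +
      (sqmod (ev (n + n) L1 (grid N j) z) + sqmod (ev (n + n) L2 (grid N j) z))).
  by apply: ler_sum => j _; exact: pt.
rewrite -mulr_sumr !big_split/= -!mulr_sumr !big_split/=.
rewrite !(parseval_sqmod _ _ nN) !(parseval_sqmod _ _ n2N).
rewrite -!mulrDr !sum_smul [X in _ <= _ * (X + _)]mulrCA -mulrDr mulrCA.
by rewrite ler_pM2l.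
Qed.

(** Moving [m] across the multiplications by [c] and [d] leaves sums with kernel m(l) - m(k). *)
Lemma cr_commutator k z :
  sqmod (L1 k z) + sqmod (L2 k z) <=
  3 * (m k ^+ 2 * (sqmod (cr1 n c d X1 Z1 Z2 k z) + sqmod (cr2 n c d X2 Z1 Z2 k z)) +
   (sqmod (\sum_(l <- rng n) (m l - m k) *: (trunc n c (k - l) z * Z1 l z)) +
    sqmod (\sum_(l <- rng n) (m l - m k) *: (trunc n c (k - l) z * Z2 l z)) +
    sqmod (\sum_(l <- rng n) (m l - m k) *: (trunc n d (k - l) z * X1 l z)) +
    sqmod (\sum_(l <- rng n) (m l - m k) *: (trunc n d (k - l) z * X2 l z)))).
Proof.
have E e u : conv n e (smul m u) k z =
    m k *: conv n e u k z + \sum_(l <- rng n) (m l - m k) *: (trunc n e (k - l) z * u l z).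
  rewrite /conv scaler_sumr -big_split/=; apply: eq_bigr => l _.
  by rewrite /smul -scaleCAr -scalerDl; congr (_ *: _); rewrite addrC subrK.
have E1 : L1 k z = m k *: cr1 n c d X1 Z1 Z2 k z +
   \sum_(l <- rng n) (m l - m k) *: (trunc n c (k - l) z * Z1 l z) -
   \sum_(l <- rng n) (m l - m k) *: (trunc n d (k - l) z * X1 l z).
  rewrite /L1 /cr1 !E /smul; apply: C_eq; rewrite !ReImE; ring.
have E2 : L2 k z = m k *: cr2 n c d X2 Z1 Z2 k z +
   \sum_(l <- rng n) (m l - m k) *: (trunc n c (k - l) z * Z2 l z) -
   \sum_(l <- rng n) (m l - m k) *: (trunc n d (k - l) z * X2 l z).
  rewrite /L2 /cr2 !E /smul; apply: C_eq; rewrite !ReImE; ring.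
have h1 := sqmod3 (m k *: cr1 n c d X1 Z1 Z2 k z)
   (\sum_(l <- rng n) (m l - m k) *: (trunc n c (k - l) z * Z1 l z))
   (\sum_(l <- rng n) (m l - m k) *: (trunc n d (k - l) z * X1 l z)).
have h2 := sqmod3 (m k *: cr2 n c d X2 Z1 Z2 k z)
   (\sum_(l <- rng n) (m l - m k) *: (trunc n c (k - l) z * Z2 l z))
   (\sum_(l <- rng n) (m l - m k) *: (trunc n d (k - l) z * X2 l z)).
by rewrite E1 E2; move: h1 h2; rewrite !sqmodZ; lra.
Qed.

End Multiplier.

Definition hsn2 p n z u v := hsn p n z u + hsn p n z v.

Lemma hsn2E p n z u v : hsn2 p n z u v =
  \sum_(k <- rng n) W p k ^+ 2 * (sqmod (u k z) + sqmod (v k z)).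
Proof.
by rewrite /hsn2 /hsn -big_split/=; apply: eq_bigr => k _; rewrite W_sqr mulrDr.
Qed.

Lemma hsn_supp p n u z : (forall k z, k \notin rng n -> u k z = 0) ->
  forall m, hsn p m z u <= hsn p n z u.
Proof.
move=> u0 m; apply: le_trans (hsn_trunc p n m z u).
rewrite le_eqVlt; apply/orP; left; apply/eqP; apply: eq_bigr => k _.
by rewrite /trunc; case: ifPn => // /u0->.
Qed.

(** In the commutators the unknown fields occur either [sg - rho] derivatives below the level [t],
    or at the low level [rho] when the coefficients take all [t] derivatives. Neither occurrence
    reaches the level being estimated. *)
Lemma weighted_rhs_bound (sg rho : R) : 1 < 2 * rho -> rho < sg -> sg - rho <= 1 ->
  forall t, sg <= t -> exists2 K : R, 0 <= K &
  forall kap D M n c d X1 X2 Z1 Z2, cr_data sg kap D M n c d X1 X2 Z1 Z2 -> forall z,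
  \sum_(k <- rng (n + n)) (sqmod (cr1 n c d (smul (W t) X1) (smul (W t) Z1) (smul (W t) Z2) k z)
    + sqmod (cr2 n c d (smul (W t) X2) (smul (W t) Z1) (smul (W t) Z2) k z)) <=
  3 * hsn2 t (n + n) z (cr1 n c d X1 Z1 Z2) (cr2 n c d X2 Z1 Z2) +
  K * (hsn2 t n z c d * (hsn2 rho n z X1 X2 + hsn2 rho n z Z1 Z2) +
       M * (hsn2 (t - (sg - rho)) n z X1 X2 + hsn2 (t - (sg - rho)) n z Z1 Z2)).
Proof.
move=> r1 rs sr1 t st; pose e := sg - rho.
have e0 : 0 < e by rewrite /e subr_gt0.
have [t0 et] : 0 < t /\ e <= t by split; [lra|rewrite /e; lra].
have [K0 K00 hK0] := W_commutator t0 (ltW e0) sr1 et.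
have se : 1 < 2 * (sg - e) by rewrite /e opprB addrCA subrr addr0.
have [K K_ge0 hK] := kernel_bound r1 se.
exists (3 * (K0 ^+ 2 * K)); first by rewrite !mulr_ge0 ?sqr_ge0.
move=> kap D M n c d X1 X2 Z1 Z2 H z.
have ker a u (Ct : R) : (forall k, continuousC (a k)) -> (forall m z, sqn sg m z a <= M) ->
    (forall k z, k \notin rng n -> u k z = 0) ->
    \sum_(k <- rng (n + n)) sqmod (\sum_(l <- rng n) (W t l - W t k) *:
      (trunc n a (k - l) z * u l z)) <=
    K0 ^+ 2 * (K * (hsn t n z a * hsn rho n z u + M * hsn (t - e) n z u)).
  move=> ca hM u0; apply: (hK t K0 (fun k l => W t l - W t k)) => //.
  - by move=> m; exact: hsn_trunc.
  - move=> m; apply: le_trans (hsn_trunc _ _ _ _ _) _; apply: le_trans (hM n z).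
    by rewrite sqnE// lerDl; apply: J_ge0 => y _; exact: hsn_ge0.
  - exact: hsn_supp.
  - exact: hsn_supp.
have k1 := ker c Z1 0 (crd_c H) (crd_Mc H) (crd_sZ1 H).
have k2 := ker c Z2 0 (crd_c H) (crd_Mc H) (crd_sZ2 H).
have k3 := ker d X1 0 (crd_d H) (crd_Md H) (crd_sX1 H).
have k4 := ker d X2 0 (crd_d H) (crd_Md H) (crd_sX2 H).
apply: le_trans; first by apply: ler_sum => k _; exact: cr_commutator.
rewrite -mulr_sumr !big_split/= -hsn2E -/e.
apply: le_trans (_ : 3 * hsn2 t (n + n) z (cr1 n c d X1 Z1 Z2) (cr2 n c d X2 Z1 Z2) +
  3 * (K0 ^+ 2 * K * ((hsn t n z c * hsn rho n z Z1 + M * hsn (t - e) n z Z1) +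
   (hsn t n z c * hsn rho n z Z2 + M * hsn (t - e) n z Z2) +
   (hsn t n z d * hsn rho n z X1 + M * hsn (t - e) n z X1) +
   (hsn t n z d * hsn rho n z X2 + M * hsn (t - e) n z X2))) <= _).
  by rewrite -mulrDr ler_wpM2l// lerD2l; move: k1 k2 k3 k4; rewrite !mulrA; lra.
rewrite lerD2l -[X in _ <= X]mulrA; apply: ler_wpM2l => //.
apply: ler_wpM2l; first by rewrite mulr_ge0 ?sqr_ge0.
rewrite /hsn2.
have c0 := hsn_ge0 t n z c; have d0 := hsn_ge0 t n z d.
have m1 := mulr_ge0 c0 (hsn_ge0 rho n z X1); have m2 := mulr_ge0 c0 (hsn_ge0 rho n z X2).
have m3 := mulr_ge0 d0 (hsn_ge0 rho n z Z1); have m4 := mulr_ge0 d0 (hsn_ge0 rho n z Z2).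
nra.
Qed.

End FiniteEstimate.

(** * Absorption of the commutators and the finite-dimensional a priori bound *)

Section FiniteApriori.
Context {R : realType}.
Notation C := (Rcomplex R).
Implicit Types (k l : int) (x z : R) (u v c d : int -> R -> C) (n : nat).

(** Arithmetic at a fixed height. [T] and [P] stand for the integrated energies at the top level and
    at an intermediate one, [F] for the data, [ys], [yr], [y0] and [xs], [xr], [x0] for the z- and
    x-derivatives at levels sg, rho, 0. The constant [b] is found before [e]; only [K] depends on
    [e]. *)
Lemma absorb_slice (D Q : R) (Ki : R -> R) : 0 <= D -> 0 <= Q ->
  (forall e, 0 < e -> 0 <= Ki e) ->
  exists2 b : R, 0 < b & forall e : R, 0 < e -> exists2 K : R, 0 <= K &
  forall T F P ys yr y0 xs xr x0 : R,
    0 <= T -> 0 <= F -> 0 <= P -> 0 <= yr ->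
    xs <= T -> xr <= P -> x0 <= xr ->
    ys <= 2 * (D ^+ 2 * xs + (3 * F + Q * (xr + yr))) ->
    y0 <= 2 * (D ^+ 2 * x0 + F) ->
    (forall e, 0 < e -> yr <= e * ys + Ki e * y0) ->
    ys <= b * (T + F + P) /\ yr <= e * (T + F + P) + K * (F + P).
Proof.
move=> D0 Q0 Ki0.
(* With this parameter of interpolation the term 2 Q yr returns at most half of [ys], which moves to
   the left. *)
pose e1 := (4 * (Q + 1))^-1; have e10 : 0 < e1 by rewrite invr_gt0 mulr_gt0// ltr_wpDl.
pose K1 := Ki e1; have K10 : 0 <= K1 by exact: Ki0.
have D2 : 0 <= D ^+ 2 := sqr_ge0 D.
pose b := 4 * D ^+ 2 + 12 + 4 * Q * (1 + 2 * K1 * (D ^+ 2 + 1)).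
have b0 : 0 < b.
  rewrite /b; have := mulr_ge0 Q0 (mulr_ge0 K10 (addr_ge0 D2 ler01)); nra.
exists b => // e e0; pose e2 := e / b; have e20 : 0 < e2 by rewrite divr_gt0.
have K20 := Ki0 _ e20.
exists (Ki e2 * (2 * (D ^+ 2 + 1))).
  by rewrite !mulr_ge0// addr_ge0.
move=> T F P ys yr y0 xs xr x0 T0 F0 P0 yr0 hxs hxr hx0 hys hy0 hyr.
have D2T : D ^+ 2 * xs <= D ^+ 2 * T by rewrite ler_wpM2l.
have D2P : D ^+ 2 * x0 <= D ^+ 2 * P by rewrite ler_wpM2l// (le_trans hx0).
have hy0' : y0 <= 2 * (D ^+ 2 + 1) * (F + P).
  have := mulr_ge0 D2 F0; nra.
have QP : Q * xr <= Q * P by rewrite ler_wpM2l.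
have h1 := hyr _ e10; rewrite -/K1 in h1.
have h2 : K1 * y0 <= K1 * (2 * (D ^+ 2 + 1) * (F + P)) by rewrite ler_wpM2l.
have h3 : Q * yr <= 4^-1 * ys + Q * (K1 * (2 * (D ^+ 2 + 1) * (F + P))) \/ ys < 0.
  have [ys0|ys0] := leP 0 ys; [left|by right].
  have q1 : Q * yr <= Q * (e1 * ys + K1 * (2 * (D ^+ 2 + 1) * (F + P))).
    by rewrite ler_wpM2l//; lra.
  have q2 : Q * (e1 * ys) <= 4^-1 * ys.
    rewrite mulrA ler_wpM2r// /e1 ler_pdivrMr ?mulr_gt0 ?ltr_wpDl//; lra.
  by rewrite mulrDr in q1; lra.
have R0 : 0 <= Q * (K1 * (2 * (D ^+ 2 + 1) * (F + P))).
  by rewrite !mulr_ge0// ?addr_ge0.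
have ysb : ys <= b * (T + F + P).
  case: h3 => h3; last first.
    by apply: le_trans (ltW h3) _; rewrite mulr_ge0 ?(ltW b0)// !addr_ge0.
  have : ys <= 4 * D ^+ 2 * T + 12 * F + 4 * Q * P +
      4 * (Q * (K1 * (2 * (D ^+ 2 + 1) * (F + P)))) by lra.
  move=> /le_trans; apply; rewrite /b.
  have -> : (4 * D ^+ 2 + 12 + 4 * Q * (1 + 2 * K1 * (D ^+ 2 + 1))) * (T + F + P) =
    4 * D ^+ 2 * T + 12 * F + 4 * Q * P + 4 * (Q * (K1 * (2 * (D ^+ 2 + 1) * (F + P)))) +
    (4 * D ^+ 2 * (F + P) + 12 * (T + P) + 4 * Q * (T + F) +
     4 * Q * (2 * K1 * (D ^+ 2 + 1)) * T) by ring.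
  by rewrite lerDl !addr_ge0// !mulr_ge0// ?addr_ge0// ?mulr_ge0// ?addr_ge0.
split => //; apply: le_trans (hyr _ e20) _.
apply: lerD.
  have -> : e * (T + F + P) = e2 * (b * (T + F + P)) by rewrite /e2 mulrA divfK ?gt_eqF.
  by rewrite ler_wpM2l// ltW.
by rewrite -mulrA ler_wpM2l.
Qed.

(** The quantifiers follow the order in which the constants become available: [e] from [a] and [Q],
    then [K], which was built from [e], and finally the bound [t]. [S] is a bound, uniform in
    height, of the fields at level rho, and [B] is the energy at level 0. *)
Lemma absorb_top (a Q : R) (Ki : R -> R) : 0 <= a -> 0 <= Q ->
  (forall e, 0 < e -> 0 <= Ki e) -> exists2 e : R, 0 < e & forall K : R, 0 <= K ->
  exists2 t : R, 0 <= t & forall T F P B S : R, 0 <= T -> 0 <= F -> 0 <= P ->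
    T <= a * (3 * F + Q * (2 * S + P)) -> B <= a * F ->
    S <= P + (e * (T + F + P) + K * (F + P)) ->
    (forall e, 0 < e -> P <= e * T + Ki e * B) ->
    T <= t * F /\ P <= t * F.
Proof.
move=> a0 Q0 Ki0.
pose e := (8 * (a * Q + 1))^-1.
have aQ0 : 0 <= a * Q by rewrite mulr_ge0.
have e0 : 0 < e by rewrite invr_gt0 mulr_gt0// ltr_wpDl.
exists e => // K K0.
pose q := 3 * a + a * Q * (3 + 2 * K) + 1.
have q0 : 0 < q by rewrite /q ltr_wpDl// addr_ge0// ?mulr_ge0// ?addr_ge0// mulr_ge0.
(* The interpolation parameter for which q P returns at most T / 4; together with the earlier T / 4,
   half of [T] is absorbed. *)
pose e3 := (4 * q)^-1; have e30 : 0 < e3 by rewrite invr_gt0 mulr_gt0.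
have K30 := Ki0 _ e30; pose K3 := Ki e3.
have K3a : 0 <= K3 * a by exact: mulr_ge0 K30 a0.
have qa0 : 0 <= 2 * q * (1 + K3 * a).
  by rewrite mulr_ge0// ?addr_ge0// mulr_ge0// ltW.
have eqa : 0 <= e3 * (2 * q * (1 + K3 * a)) by rewrite mulr_ge0// ltW.
exists (2 * q * (1 + K3 * a) + (e3 * (2 * q * (1 + K3 * a)) + K3 * a)).
  by rewrite !addr_ge0.
move=> T F P B S T0 F0 P0 hT hB hS hP.
have hP3 := hP _ e30; rewrite -/K3 in hP3.
have KB : K3 * B <= K3 * (a * F) by rewrite ler_wpM2l.
have ae : a * Q * e <= 8^-1.
  by rewrite /e ler_pdivrMr ?mulr_gt0 ?ltr_wpDl//; lra.
have hT2 : T <= 4^-1 * (T + F + P) + (q - 1) * (F + P).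
  apply: (le_trans hT).
  have h1 : a * Q * (2 * S) <= a * Q * (2 * (P + (e * (T + F + P) + K * (F + P)))).
    by rewrite ler_wpM2l// ler_wpM2l.
  have h2 : a * Q * e * (T + F + P) <= 8^-1 * (T + F + P).
    by rewrite ler_wpM2r// !addr_ge0.
  have h3 := mulr_ge0 aQ0 F0; have h4 := mulr_ge0 a0 P0.
  have E1 : a * (3 * F + Q * (2 * S + P)) = 3 * a * F + a * Q * (2 * S) + a * Q * P by ring.
  have E2 : a * Q * (2 * (P + (e * (T + F + P) + K * (F + P)))) =
    2 * (a * Q * P) + 2 * (a * Q * e * (T + F + P)) + a * Q * (2 * K) * (F + P) by ring.
  have E3 : (q - 1) * (F + P) = 3 * a * F + 3 * (a * P) + 3 * (a * Q * F) + 3 * (a * Q * P) +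
    a * Q * (2 * K) * (F + P) by rewrite /q; ring.
  rewrite E1 E3; rewrite E2 in h1; lra.
have hT3 : T <= 2^-1 * T + q * (1 + K3 * a) * F.
  have p1 : q * P <= q * (e3 * T + K3 * (a * F)) by rewrite ler_wpM2l ?(ltW q0)//; lra.
  have p2 : q * (e3 * T) = 4^-1 * T.
    by rewrite /e3; field; exact: lt0r_neq0.
  have E : q * (1 + K3 * a) * F = q * F + q * (K3 * (a * F)) by ring.
  rewrite E; rewrite mulrDr p2 in p1; lra.
have T1 : T <= 2 * q * (1 + K3 * a) * F by lra.
have T2 : e3 * T <= e3 * (2 * q * (1 + K3 * a) * F) by rewrite ler_wpM2l// ltW.
have p0 : 0 <= e3 * (2 * q * (1 + K3 * a)) * F + K3 * a * F.
  by rewrite addr_ge0// mulr_ge0.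
have p1 : 0 <= 2 * q * (1 + K3 * a) * F.
  by rewrite mulr_ge0.
rewrite mulrDl mulrDl; split; lra.
Qed.

Lemma continuous_hsn2 p n u v : (forall k, continuousC (u k)) -> (forall k, continuousC (v k)) ->
  continuous (fun z => hsn2 p n z u v).
Proof. by move=> cu cv; apply: continuous_addR; exact: continuous_hsn. Qed.

Lemma hsn2_ge0 p n z u v : 0 <= hsn2 p n z u v.
Proof. by rewrite addr_ge0// hsn_ge0. Qed.

Lemma hsn2_le p q n z u v : p <= q -> hsn2 p n z u v <= hsn2 q n z u v.
Proof. by move=> pq; apply: lerD; exact: hsn_le. Qed.

Lemma hsn2_interp (Ke e p q r : R) : (forall k, W (2 * p) k <= e * W (2 * q) k + Ke * W (2 * r) k) ->
  forall n z u v, hsn2 p n z u v <= e * hsn2 q n z u v + Ke * hsn2 r n z u v.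
Proof.
move=> h n z u v.
have one w : hsn p n z w <= e * hsn q n z w + Ke * hsn r n z w.
  rewrite /hsn !mulr_sumr -big_split/=; apply: ler_sum => k _.
  by rewrite !mulrA -mulrDl ler_wpM2r ?sqmod_ge0.
have := one u; have := one v; rewrite /hsn2; lra.
Qed.

Lemma smulW0 u : smul (W 0) u = u.
Proof. by apply/funext => k; apply/funext => z; rewrite /smul W0 scale1r. Qed.

Lemma J_ge0' (f : R -> R) : (forall z, 0 <= f z) -> 0 <= J f.
Proof. by move=> f0; apply: J_ge0. Qed.

Lemma continuousC_smul m u : (forall k, continuousC (u k)) -> forall k, continuousC (smul m u k).
Proof. by move=> cu k; apply: (@continuousCZ _ (cst (m k))) => //; exact: cst_continuous. Qed.

Lemma continuousC_cr1 n c d X1 Z1 Z2 : (forall k, continuousC (c k)) ->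
  (forall k, continuousC (d k)) -> (forall k, continuousC (X1 k)) ->
  (forall k, continuousC (Z1 k)) -> (forall k, continuousC (Z2 k)) ->
  forall k, continuousC (cr1 n c d X1 Z1 Z2 k).
Proof.
move=> cc cd c1 c2 c3 k; apply: continuousCB; last exact: continuousC_conv.
by apply: continuousCD => //; exact: continuousC_conv.
Qed.

Lemma continuousC_cr2 n c d X2 Z1 Z2 : (forall k, continuousC (c k)) ->
  (forall k, continuousC (d k)) -> (forall k, continuousC (X2 k)) ->
  (forall k, continuousC (Z1 k)) -> (forall k, continuousC (Z2 k)) ->
  forall k, continuousC (cr2 n c d X2 Z1 Z2 k).
Proof.
move=> cc cd c1 c2 c3 k; apply: continuousCB; last exact: continuousC_conv.
by apply: continuousCB => //; exact: continuousC_conv.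
Qed.

(** The integrated energy is estimated at level th = sg + 1/2, where the multiplier [W th] produces
    commutators. They are controlled by levels around [rho], and these by a small part of level [th]
    and by level 0, where the data give a bound directly. Suprema in z come back from the integrals
    through the fields [crd_sup1] and [crd_sup2]. *)
Lemma finite_apriori (sg kap D M : R) : 1 < 2 * sg -> 0 < kap -> 0 <= D -> 0 <= M ->
  exists2 K : R, 0 <= K & forall n c d X1 X2 Z1 Z2, cr_data sg kap D M n c d X1 X2 Z1 Z2 ->
  forall F, (forall z, 0 <= z <= 1 ->
       hsn2 sg (n + n) z (cr1 n c d X1 Z1 Z2) (cr2 n c d X2 Z1 Z2) <= F) ->
    J (fun z => hsn2 (sg + 2^-1) (n + n) z (cr1 n c d X1 Z1 Z2) (cr2 n c d X2 Z1 Z2)) <= F ->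
    (forall z, 0 <= z <= 1 -> hsn2 sg n z X1 X2 <= K * F /\ hsn2 sg n z Z1 Z2 <= K * F) /\
    J (fun z => hsn2 (sg + 2^-1) n z X1 X2) <= K * F /\
    J (fun z => hsn2 (sg + 2^-1) n z Z1 Z2) <= K * F.
Proof.
move=> sg1 k0 D0 M0.
(* At most half of the room sg - 1/2, so that rho stays above 1/2, and at most 1, as the commutator
   estimate requires. *)
pose e := Num.min 1 ((sg - 2^-1) / 2); pose rho := sg - e; pose th := sg + 2^-1.
have e0 : 0 < e by rewrite /e lt_min ltr01/= divr_gt0// subr_gt0; lra.
have e1 : e <= 1 by rewrite /e ge_min lexx.
have e2 : e <= (sg - 2^-1) / 2 by rewrite /e ge_min lexx orbT.
have r1 : 1 < 2 * rho by rewrite /rho; lra.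
have rs : rho < sg by rewrite /rho; lra.
have sr : sg - rho = e by rewrite /rho; ring.
have sr1 : sg - rho <= 1 by rewrite sr.
have [Kt Kt0 hKt] := weighted_rhs_bound r1 rs sr1 (t := th) (ltac:(rewrite /th; lra)).
have [Ks Ks0 hKs] := weighted_rhs_bound r1 rs sr1 (lexx sg).
rewrite sr in hKt hKs.
have the : th - e = rho + 2^-1 by rewrite /th /rho; ring.
have sge : sg - e = rho by [].
rewrite the in hKt; rewrite sge in hKs.
have interp (p q : R) : p < q -> {Ki : R -> R | (forall x, 0 < x -> 0 <= Ki x) /\
    forall x, 0 < x -> forall k, W p k <= x * W q k + Ki x * W 0 k}.
  move=> pq.
  have h x : exists K : R, 0 < x -> 0 <= K /\ forall k, W p k <= x * W q k + K * W 0 k.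
    have [x0|x0] := ltP 0 x; last by exists 0.
    have [K K0 hK] := W_interp pq x0; exists K => _; split => // k.
    by rewrite W0 mulr1.
  exists (fun x => projT1 (cid (h x))); split => x x0;
    by have [h1 h2] := projT2 (cid (h x)) x0.
have [Ka [Ka0 hKa]] := interp (2 * rho) (2 * sg) (ltac:(lra)).
have [Kb [Kb0 hKb]] := interp (2 * (rho + 2^-1)) (2 * th) (ltac:(rewrite /th; lra)).
pose A := kap / (1 + D ^+ 2).
have A0 : 0 < A by rewrite divr_gt0// ltr_wpDr ?sqr_ge0.
pose a := A^-1 ^+ 2 + 2 * (D ^+ 2 * A^-1 ^+ 2 + 1).
have i0 : 0 <= A^-1 ^+ 2 := sqr_ge0 _.
have D20 : 0 <= D ^+ 2 := sqr_ge0 _.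
have a0 : 0 <= a by rewrite addr_ge0// mulr_ge0// addr_ge0// mulr_ge0.
(* The 3 M arises at level sg: 2 M from the two coefficients at a fixed height and M from the
   lower-order term. *)
have Qs0 : 0 <= Ks * (3 * M) by rewrite mulr_ge0// mulr_ge0.
have Qt0 : 0 <= Kt * M by rewrite mulr_ge0.
(* First [b], then [ee], then [K2] depending on [ee], then [t] depending on [K2]: there is no
   circularity. *)
have [b b0 hb] := absorb_slice D0 Qs0 Ka0.
have [ee ee0 hee] := absorb_top a0 Qt0 Kb0.
have [K2 K20 hK2] := hb _ ee0.
have [t t0 ht] := hee _ K20.
exists (t + b * (t + 1 + t)).
  by rewrite addr_ge0// mulr_ge0 ?addr_ge0// ltW.
move=> n c d X1 X2 Z1 Z2 H F hF hJF.
have [cX1 cX2 cZ1 cZ2] := And4 (crd_X1 H) (crd_X2 H) (crd_Z1 H) (crd_Z2 H).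
have [cc cd] := conj (crd_c H) (crd_d H).
set f1 := cr1 n c d X1 Z1 Z2; set f2 := cr2 n c d X2 Z1 Z2.
have cf1 : forall k, continuousC (f1 k) by exact: continuousC_cr1.
have cf2 : forall k, continuousC (f2 k) by exact: continuousC_cr2.
pose x p z := hsn2 p n z X1 X2; pose y p z := hsn2 p n z Z1 Z2.
pose f p z := hsn2 p (n + n) z f1 f2; pose cd' p z := hsn2 p n z c d.
pose L p z := \sum_(k <- rng (n + n))
  (sqmod (cr1 n c d (smul (W p) X1) (smul (W p) Z1) (smul (W p) Z2) k z)
    + sqmod (cr2 n c d (smul (W p) X2) (smul (W p) Z1) (smul (W p) Z2) k z)).
have cx p : continuous (x p) by exact: continuous_hsn2.
have cy p : continuous (y p) by exact: continuous_hsn2.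
have cf p : continuous (f p) by exact: continuous_hsn2.
have ccd p : continuous (cd' p) by exact: continuous_hsn2.
have cL p : continuous (L p).
  apply: continuous_sumR => k; apply: continuous_addR; apply: continuous_sqmod.
    by apply: continuousC_cr1 => //; exact: continuousC_smul.
  by apply: continuousC_cr2 => //; exact: continuousC_smul.
have cZ (r : R) (h : R -> R) : continuous h -> continuous (fun z => r * h z).
  by move=> ch; apply: continuous_mulR => //; exact: cst_continuous.
have x0 p z : 0 <= x p z by exact: hsn2_ge0.
have y0 p z : 0 <= y p z by exact: hsn2_ge0.
have f0 p z : 0 <= f p z by exact: hsn2_ge0.
have cd0 p z : 0 <= cd' p z by exact: hsn2_ge0.
(* At level 0 the multiplier is the identity, so there are no commutators and the energy is bounded
   by the data alone. This anchors the interpolation. *)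
have L0E z : L 0 z = f 0 z.
  rewrite /L /f hsn2E !smulW0; apply: eq_bigr => k _.
  by rewrite W0 expr1n mul1r.
have F0 : 0 <= F by apply: le_trans (f0 sg 0) (hF 0 _); rewrite lexx ler01.
have energy p : J (x p) <= A^-1 ^+ 2 * J (L p).
  pose N z := \sum_(k <- rng n) W p k ^+ 2 * null_form (X1 k z) (Z1 k z) (X2 k z) (Z2 k z).
  have cnk k : continuous (fun z => null_form (X1 k z) (Z1 k z) (X2 k z) (Z2 k z)).
    exact: continuous_null_form.
  have cN : continuous N by apply: continuous_sumR => k; exact: cZ.
  have JN : J N = 0.
    rewrite /N J_sum; last by move=> k; exact: cZ.
    by rewrite big1// => k _; rewrite JZ// (crd_null H) mulr0.
  have h : J (fun z => A * x p z) <= J (fun z => 2 * N z + A^-1 * L p z).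
    apply: J_le; [exact: cZ|by apply: continuous_addR; exact: cZ|move=> z _].
    by rewrite /x hsn2E; exact: (mult_energy k0 H (W p) z).
  rewrite (JZ _ (cx p)) (JD (cZ 2 _ cN) (cZ A^-1 _ (cL p))) in h.
  rewrite (JZ _ cN) (JZ _ (cL p)) JN mulr0 add0r in h.
  have : A^-1 * (A * J (x p)) <= A^-1 * (A^-1 * J (L p)).
    by rewrite ler_wpM2l// invr_ge0 ltW.
  by rewrite (mulKf (lt0r_neq0 A0)) mulrA -expr2.
have zest p z : y p z <= 2 * (D ^+ 2 * x p z + L p z).
  by rewrite /y /x !hsn2E; exact: (mult_z H (W p) z).
have Jy p : J (y p) <= 2 * (D ^+ 2 * J (x p) + J (L p)).
  have : J (y p) <= J (fun z => 2 * (D ^+ 2 * x p z + L p z)).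
    apply: (J_le (cy p) (cZ _ _ (continuous_addR (cZ _ _ (cx p)) (cL p)))) => z _.
    exact: zest.
  have c1 := cZ (D ^+ 2) _ (cx p).
  by rewrite (JZ _ (continuous_addR c1 (cL p))) (JD c1 (cL p)) (JZ _ (cx p)).
have Jtot p : J (x p) + J (y p) <= a * J (L p).
  have := energy p; have := Jy p.
  have : D ^+ 2 * J (x p) <= D ^+ 2 * (A^-1 ^+ 2 * J (L p)) by rewrite ler_wpM2l.
  by rewrite /a; clear; nra.
have fle p z : p <= sg -> 0 <= z <= 1 -> f p z <= F.
  by move=> ps z01; apply: le_trans (hF z z01); exact: hsn2_le.
have JB : J (x 0) + J (y 0) <= a * F.
  apply: le_trans (Jtot 0) _; rewrite ler_wpM2l//.
  rewrite -[F]J_cst; apply: J_le => //; first exact: cst_continuous.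
  by move=> z z01; rewrite L0E; apply: fle => //; clear - sg1; lra.
(* A supremum at level p is paid for by integrals at level p + 1/2, the weight [jb k] being absorbed
   by [W_half]. *)
have sup p z : 0 <= z <= 1 -> x p z <= J (x (p + 2^-1)) + J (y (p + 2^-1)).
  move=> z01; have JE u v : (forall k, continuousC (u k)) -> (forall k, continuousC (v k)) ->
      J (fun z => hsn2 (p + 2^-1) n z u v) =
      \sum_(k <- rng n) W (2 * p) k * (jb k * sqJ (u k)) +
      \sum_(k <- rng n) W (2 * p) k * (jb k * sqJ (v k)).
    move=> cu cv; rewrite JD; [|exact: continuous_hsn|exact: continuous_hsn].
    rewrite !J_hsn//; congr (_ + _); apply: eq_bigr => k _; by rewrite mulrA W_half.
  rewrite !JE// /x /hsn2 /hsn.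
  have h1 : \sum_(k <- rng n) W (2 * p) k * sqmod (X1 k z) <=
     \sum_(k <- rng n) W (2 * p) k * (jb k * (sqJ (X1 k) + sqJ (Z1 k))).
    by apply: ler_sum => k _; rewrite ler_wpM2l ?W_ge0//; exact: (crd_sup1 H).
  have h2 : \sum_(k <- rng n) W (2 * p) k * sqmod (X2 k z) <=
     \sum_(k <- rng n) W (2 * p) k * (jb k * (sqJ (X2 k) + sqJ (Z2 k))).
    by apply: ler_sum => k _; rewrite ler_wpM2l ?W_ge0//; exact: (crd_sup2 H).
  have spl (g h : int -> R) : \sum_(k <- rng n) W (2 * p) k * (jb k * (g k + h k)) =
    \sum_(k <- rng n) W (2 * p) k * (jb k * g k) + \sum_(k <- rng n) W (2 * p) k * (jb k * h k).
    by rewrite -big_split/=; apply: eq_bigr => k _; ring.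
  by rewrite !spl in h1 h2; clear - h1 h2; lra.
have cdM z : cd' sg z <= 2 * M.
  have h w : (forall k, continuousC (w k)) -> (forall m z, sqn sg m z w <= M) -> hsn sg n z w <= M.
    move=> cw hw; apply: le_trans (hw n z); rewrite sqnE// lerDl.
    by apply: J_ge0' => s; exact: hsn_ge0.
  have := h c cc (crd_Mc H); have := h d cd (crd_Md H); rewrite /cd' /hsn2; clear; lra.
have JcdM : J (cd' th) <= 2 * M.
  have h w : (forall k, continuousC (w k)) -> (forall m z, sqn sg m z w <= M) ->
      J (fun z => hsn th n z w) <= M.
    by move=> cw hw; apply: le_trans (hw n 0); rewrite sqnE// lerDr hsn_ge0.
  rewrite /cd' /hsn2 JD; [|exact: continuous_hsn|exact: continuous_hsn].
  have := h c cc (crd_Mc H); have := h d cd (crd_Md H); clear; lra.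
have lth z : L th z <= 3 * f th z + Kt * (cd' th z * (x rho z + y rho z) +
    M * (x (rho + 2^-1) z + y (rho + 2^-1) z)) by exact: (hKt _ _ _ _ _ _ _ _ _ _ H z).
have lsg z : L sg z <= 3 * f sg z + Ks * (cd' sg z * (x rho z + y rho z) +
    M * (x rho z + y rho z)) by exact: (hKs _ _ _ _ _ _ _ _ _ _ H z).
have mono z : x 0 z <= x rho z by apply: hsn2_le; clear - r1; lra.
have ya z q : 0 < q -> y rho z <= q * y sg z + Ka q * y 0 z.
  by move=> q0; apply: (@hsn2_interp (Ka q) q rho sg 0) => k; rewrite mulr0; exact: hKa.
have hI u v m z q : 0 < q ->
    hsn2 (rho + 2^-1) m z u v <= q * hsn2 th m z u v + Kb q * hsn2 0 m z u v.
  by move=> q0; apply: hsn2_interp => k; rewrite mulr0; exact: hKb.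
have xb z q : 0 < q -> x (rho + 2^-1) z <= q * x th z + Kb q * x 0 z := hI _ _ _ _ _.
have yb z q : 0 < q -> y (rho + 2^-1) z <= q * y th z + Kb q * y 0 z := hI _ _ _ _ _.
have fF z : 0 <= z <= 1 -> f sg z <= F := hF z.
have f0F z : 0 <= z <= 1 -> f 0 z <= F by move=> z01; apply: (fle 0 z _ z01); clear - sg1; lra.
have JfF : J (f th) <= F := hJF.
have supsg z : 0 <= z <= 1 -> x sg z <= J (x th) + J (y th) := sup sg z.
suff : (forall z, 0 <= z <= 1 -> x sg z <= (t + b * (t + 1 + t)) * F /\
      y sg z <= (t + b * (t + 1 + t)) * F) /\
    J (x th) <= (t + b * (t + 1 + t)) * F /\ J (y th) <= (t + b * (t + 1 + t)) * F by [].
clear hKt hKs sr1 r1 rs sr hF hJF hI interp energy fle.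
have Jx0 p : 0 <= J (x p) by exact: J_ge0'.
have Jy0 p : 0 <= J (y p) by exact: J_ge0'.
move: Jtot JB {e2 the sge hKa hKb i0}; clearbody x y f cd' L a th rho; clear A A0 e e0 e1 => Jtot JB.
have [T TE] : exists T, T = J (x th) + J (y th) by exists (J (x th) + J (y th)).
have [P PE] : exists P, P = J (x (rho + 2^-1)) + J (y (rho + 2^-1)) by eexists.
have T0 : 0 <= T by rewrite TE; exact: addr_ge0.
have P0 : 0 <= P by rewrite PE; exact: addr_ge0.
have slice z : 0 <= z <= 1 -> y sg z <= b * (T + F + P) /\
    y rho z <= ee * (T + F + P) + K2 * (F + P).
  move=> z01.
  have h1 : x sg z <= T by rewrite TE; exact: supsg.
  have h2 : x rho z <= P by rewrite PE; exact: sup.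
  have h4 : y sg z <= 2 * (D ^+ 2 * x sg z + (3 * F + Ks * (3 * M) * (x rho z + y rho z))).
    apply: le_trans (zest sg z) _; rewrite ler_wpM2l// lerD2l.
    apply: le_trans (lsg z) _.
    have l1 : 3 * f sg z <= 3 * F by rewrite ler_wpM2l// fF.
    apply: (lerD l1); rewrite -mulrA ler_wpM2l// -mulrDl.
    apply: ler_wpM2r; first exact: addr_ge0 (x0 rho z) (y0 rho z).
    by rewrite (_ : (3 : R) * M = 2 * M + M) ?lerD2r//; ring.
  have h5 : y 0 z <= 2 * (D ^+ 2 * x 0 z + F).
    by apply: le_trans (zest 0 z) _; rewrite ler_wpM2l// lerD2l L0E; exact: f0F.
  exact: (hK2 T F P _ _ _ _ _ _ T0 F0 P0 (y0 rho z) h1 h2 (mono z) h4 h5 (ya z)).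
(* Bounds the fields at level rho uniformly in z. It is taken out of the integral, where the
   coefficients at level [th] are only integrable. *)
have [S SE] : exists S, S = P + (ee * (T + F + P) + K2 * (F + P)) by eexists.
have S0 : 0 <= S.
  by rewrite SE; apply: addr_ge0 P0 (addr_ge0 (mulr_ge0 (ltW ee0) (addr_ge0 (addr_ge0 T0 F0) P0))
    (mulr_ge0 K20 (addr_ge0 F0 P0))).
have c1 := cZ 3 _ (cf th).
have c2 : continuous (fun z => cd' th z * S).
  by apply: continuous_mulR; [exact: ccd|exact: cst_continuous].
have c3 := continuous_addR (cx (rho + 2^-1)) (cy (rho + 2^-1)).
have c4 := cZ M _ c3.
have c5 := continuous_addR c2 c4.
have JL : J (L th) <= 3 * F + Kt * M * (2 * S + P).
  apply: (@le_trans _ _ (J (fun z => 3 * f th z + Kt * (cd' th z * S + M * (x (rho + 2^-1) z + y (rho + 2^-1) z))))).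
    apply: (J_le (cL th) (continuous_addR c1 (cZ _ _ c5))) => z z01.
    apply: le_trans (lth z) _.
    rewrite lerD2l ler_wpM2l// lerD2r; apply: ler_wpM2l; first exact: cd0.
    by rewrite SE; apply: lerD; [rewrite PE; exact: (sup rho z z01)|exact: (slice z z01).2].
  rewrite (JD c1 (cZ _ _ c5)) (JZ _ (cf th)) (JZ _ c5) (JD c2 c4) (JZ _ c3) (JD (cx _) (cy _)) -PE.
  have -> : J (fun z => cd' th z * S) = S * J (cd' th).
    by rewrite -(JZ _ (ccd th)); apply: eq_J => z _; rewrite mulrC.
  have -> : Kt * M * (2 * S + P) = Kt * (S * (2 * M) + M * P) by ring.
  apply: lerD; first by rewrite ler_wpM2l.
  by rewrite ler_wpM2l// lerD2r ler_wpM2l.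
have JI (g1 g2 g3 : R -> R) q : continuous g1 -> continuous g2 -> continuous g3 ->
    (forall z, g1 z <= q * g2 z + Kb q * g3 z) -> J g1 <= q * J g2 + Kb q * J g3.
  move=> d1 d2 d3 hg; rewrite -(JZ q d2) -(JZ (Kb q) d3) -(JD (cZ q _ d2) (cZ (Kb q) _ d3)).
  by apply: (J_le d1 (continuous_addR (cZ q _ d2) (cZ (Kb q) _ d3))) => z _; exact: hg.
have PI q : 0 < q -> P <= q * T + Kb q * (J (x 0) + J (y 0)).
  move=> q0; rewrite PE TE !mulrDr [leRHS]addrACA; apply: lerD.
    by apply: JI (cx _) (cx _) (cx _) _ => z; exact: xb.
  by apply: JI (cy _) (cy _) (cy _) _ => z; exact: yb.
have [] := ht T F P (J (x 0) + J (y 0)) S T0 F0 P0 _ JB _ PI.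
- by rewrite TE; apply: le_trans (Jtot th) _; rewrite ler_wpM2l.
- by rewrite SE.
move=> TF PF.
have JxT : J (x th) <= T by rewrite TE lerDl.
have JyT : J (y th) <= T by rewrite TE lerDr.
have bb : 0 <= b * (t + 1 + t) * F.
  by apply: mulr_ge0 F0; apply: mulr_ge0 (ltW b0) (addr_ge0 (addr_ge0 t0 ler01) t0).
have tF : 0 <= t * F := mulr_ge0 t0 F0.
have TK : T <= (t + b * (t + 1 + t)) * F.
  by apply: le_trans TF _; rewrite mulrDl lerDl.
split; last by split; [exact: le_trans JxT TK|exact: le_trans JyT TK].
move=> z z01; split; first by apply: le_trans TK; rewrite TE; exact: supsg.
have [h _] := slice z z01; apply: le_trans h _.
rewrite mulrDl -[leLHS]add0r; apply: lerD => //; rewrite -mulrA ler_wpM2l ?(ltW b0)//.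
by rewrite !mulrDl mul1r; apply: lerD => //; apply: lerD.
Qed.

End FiniteApriori.

(** * Pointwise evaluation *)

Section UniformLimits.
Context {R : realType} {T : topologicalType}.

Lemma continuous_unif_limit (f : nat -> T -> R) (g : T -> R) :
  (forall n, continuous (f n)) ->
  (forall e : R, 0 < e -> exists n, forall z, `|f n z - g z| <= e) -> continuous g.
Proof.
move=> cf fg z; apply/cvgrPdist_le => e e0.
have e3 : 0 < e / 3 by rewrite divr_gt0.
have [n hn] := fg _ e3.
have /cvgrPdist_le/(_ _ e3) := cf n z.
apply: filterS => t h3; have h1 := hn z; have h2 := hn t.
have -> : g z - g t = (f n z - f n t) - (f n z - g z) + (f n t - g t) by ring.
apply: le_trans (ler_normD _ _) _.
have := ler_normB (f n z - f n t) (f n z - g z); lra.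
Qed.

Lemma continuous_sum_seq (I : Type) (r : seq I) (f : I -> T -> R) :
  (forall i, continuous (f i)) -> continuous (fun z => \sum_(i <- r) f i z).
Proof.
move=> cf; elim: r => [|i r ih] z.
  by rewrite (_ : (fun _ => _) = cst 0); [exact: cvg_cst|apply/funext => t; rewrite big_nil].
rewrite (_ : (fun _ => _) = (fun t => f i t + \sum_(j <- r) f j t)); last first.
  by apply/funext => t; rewrite big_cons.
by apply: cvgD; [exact: cf|exact: ih].
Qed.

End UniformLimits.

Lemma seq_lim_unique {R : realType} (u : nat -> R) (a b : R) :
  u @ \oo --> a -> u @ \oo --> b -> a = b.
Proof. by move=> ha hb; rewrite -(cvg_lim _ ha)// -(cvg_lim _ hb). Qed.

Section CoefficientSymmetry.
Context {R : realType}.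
Notation C := (Rcomplex R).

Lemma ReB_le (a b : C) : `|Re a - Re b| <= cmod (a - b).
Proof. by rewrite -ReN -ReD; exact: Re_le_cmod. Qed.

Lemma ImB_le (a b : C) : `|Im a - Im b| <= cmod (a - b).
Proof. by rewrite -ImN -ImD; exact: Im_le_cmod. Qed.
Implicit Types u v : int -> R -> C.

Definition herm u := forall k z, u (- k) z = conjc (u k z).

Lemma sum_rng_opp (V : zmodType) n (f : int -> V) :
  \sum_(k <- rng n) f (- k) = \sum_(k <- rng n) f k.
Proof.
rewrite -(big_map -%R xpredT f); apply: perm_big; apply: uniq_perm.
- by rewrite map_inj_uniq ?rng_uniq//; exact: oppr_inj.
- exact: rng_uniq.
move=> k; apply/mapP/idP => [[j]|kn].
  by rewrite !mem_rng => + ->; rewrite abszN.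
by exists (- k); rewrite ?opprK// mem_rng abszN -mem_rng.
Qed.

Lemma herm_ev u n x z : herm u -> Im (ev n u x z) = 0.
Proof.
move=> hu; have E : ev n u x z = conjc (ev n u x z).
  rewrite {1}/ev -sum_rng_opp /ev conj_sum; apply: eq_bigr => k _.
  by rewrite hu ekN; apply: C_eq; rewrite !ReImE; ring.
by have := congr1 (@complex.Im R) E; rewrite Im_conj; lra.
Qed.

End CoefficientSymmetry.

(** * Functions on the strip as uniform limits of their Fourier sums *)

Section Evaluation.
Context {R : realType} (s : R) (s_gt : 1 < 2 * s).
Notation C := (Rcomplex R).
Notation mul := (mulS s_gt).
Implicit Types (u v c : strip s) (n : nat) (x z : R) (k : int).

Lemma cmod_ek k x : cmod (ek k x : C) = 1.
Proof. by rewrite /cmod sqmod_expi sqrtr1. Qed.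

Lemma ev_bound_exists : exists2 K : R, 0 <= K &
  forall u n x z, \sum_(k <- rng n) cmod (u k z) <= K * `|u|.
Proof.
have [K K0 hK] := l1_le_weighted s_gt.
exists (Num.sqrt K); first exact: sqrtr_ge0.
move=> u n x z.
rewrite -[`|u|](@ger0_norm _ `|u|)// -sqrtr_sqr -sqrtrM//.
apply: hK => [k|m]; first exact: cmod_ge0.
apply: le_trans (sqn_le_normr u m z); apply: ler_sum => k _.
by rewrite cmod2 ler_wpM2l ?W_ge0// lerDl mulr_ge0 ?jb_ge0 ?sqJ_ge0.
Qed.

Definition evb : R := s2val (cid2 ev_bound_exists).

Lemma evb_ge0 : 0 <= evb. Proof. exact: s2valP (cid2 ev_bound_exists). Qed.

Lemma sum_cmod_le u n z : \sum_(k <- rng n) cmod (u k z) <= evb * `|u|.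
Proof. exact: s2valP' (cid2 ev_bound_exists) _ _ 0 _. Qed.

Lemma cmod_ev u n x z : cmod (ev n u x z) <= evb * `|u|.
Proof.
apply: le_trans (sum_cmod_le u n z); apply: le_trans (cmod_sum _ _ _) _.
by apply: ler_sum => k _; rewrite cmodM cmod_ek mulr1.
Qed.

Lemma ev_truncA u m n x z : (n <= m)%N -> ev m (truncA n u) x z = ev n u x z.
Proof.
move=> nm; rewrite (@ev_supp _ n m)//; last by move=> k t; exact: trunc_out.
by rewrite /ev big_seq [RHS]big_seq; apply: eq_bigr => k kn; rewrite /= trunc_in.
Qed.

Lemma ev_cauchy u m n x z : (n <= m)%N ->
  cmod (ev m u x z - ev n u x z) <= evb * `|u - truncA n u|.
Proof.
move=> nm; rewrite -(ev_truncA u x z nm) -evN -evD.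
have -> : ev m (fun k z => u k z + - truncA n u k z) x z = ev m (u - truncA n u) x z by [].
exact: cmod_ev.
Qed.

(** The coefficients are absolutely summable since s > 1/2, hence the partial sums are uniformly
    Cauchy in (x, z), with the norm of the tail as rate. The factor 2 comes from treating real and
    imaginary parts apart. *)
Lemma ev_limit u : exists E : R -> R -> C, forall n x z,
  cmod (E x z - ev n u x z) <= 2 * evb * `|u - truncA n u|.
Proof.
have tail (e : R) : 0 < e -> exists N, forall n, (N <= n)%N -> evb * `|u - truncA n u| <= e.
  move=> e0; have [|N hN] := @truncA_cvg _ _ u (e / (evb + 1)).
    by rewrite divr_gt0// ltr_wpDl// evb_ge0.
  exists N => n Nn; apply: (@le_trans _ _ ((evb + 1) * `|u - truncA n u|)).
    by rewrite ler_wpM2r// lerDl.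
  by rewrite mulrC -ler_pdivlMr ?ltr_wpDl ?evb_ge0//; exact: hN.
have one (F : C -> R) x z : (forall a b, `|F a - F b| <= cmod (a - b)) ->
    exists l, forall n, `|l - F (ev n u x z)| <= evb * `|u - truncA n u|.
  move=> hF; have cau (e : R) : 0 < e -> exists N, forall m n, (N <= m)%N -> (N <= n)%N ->
      `|F (ev m u x z) - F (ev n u x z)| <= e.
    move=> /tail[N hN]; exists N => m n Nm Nn.
    have [nm|/ltnW mn] := leqP n m.
      by apply: le_trans (hF _ _) _; apply: le_trans (ev_cauchy _ _ _ nm) _; exact: hN.
    rewrite distrC; apply: le_trans (hF _ _) _.
    by apply: le_trans (ev_cauchy _ _ _ mn) _; exact: hN.
  have [l hl] := cauchy_real_cvg cau; exists l => n.
  apply/ler_addgt0Pr => e /hl[N hN].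
  have h1 := hN _ (leq_maxl N n).
  have h2 := le_trans (hF _ _) (ev_cauchy u x z (leq_maxr N n)).
  have := ler_distD (F (ev (maxn N n) u x z)) l (F (ev n u x z)).
  rewrite [`|l - _|]distrC in h1 *; move: h1 h2; rewrite [`|l - F (ev (maxn N n) u x z)|]distrC; lra.
have hRe x z := one _ x z (@ReB_le R).
have hIm x z := one _ x z (@ImB_le R).
exists (fun x z => Complex (projT1 (cid (hRe x z))) (projT1 (cid (hIm x z)))) => n x z.
apply: le_trans (cmod_le_ReIm _) _; rewrite !ReImE/=.
have := projT2 (cid (hRe x z)) n; have := projT2 (cid (hIm x z)) n; lra.
Qed.

Definition evS u : R -> R -> C := projT1 (cid (ev_limit u)).

Lemma evSP u n x z : cmod (evS u x z - ev n u x z) <= 2 * evb * `|u - truncA n u|.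
Proof. exact (projT2 (cid (ev_limit u)) n x z). Qed.

Lemma evS_unif u (e : R) : 0 < e -> exists N, forall n, (N <= n)%N -> forall x z,
  cmod (evS u x z - ev n u x z) <= e.
Proof.
move=> e0; have [|N hN] := @truncA_cvg _ _ u (e / (2 * evb + 1)).
  by rewrite divr_gt0// ltr_wpDl// mulr_ge0 ?evb_ge0.
exists N => n Nn x z; apply: le_trans (evSP _ _ _ _) _.
apply: (@le_trans _ _ ((2 * evb + 1) * `|u - truncA n u|)).
  by rewrite ler_wpM2r// lerDl.
by rewrite mulrC -ler_pdivlMr ?ltr_wpDl ?mulr_ge0 ?evb_ge0//; exact: hN.
Qed.

Lemma evS_cvgRe u x z : (fun n => Re (ev n u x z)) @ \oo --> Re (evS u x z).
Proof.
apply/cvgrPdist_le => e /(evS_unif u)[N hN]; exists N => // n /= Nn.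
by apply: le_trans (hN n Nn x z); exact: ReB_le.
Qed.

Lemma evS_cvgIm u x z : (fun n => Im (ev n u x z)) @ \oo --> Im (evS u x z).
Proof.
apply/cvgrPdist_le => e /(evS_unif u)[N hN]; exists N => // n /= Nn.
by apply: le_trans (hN n Nn x z); exact: ImB_le.
Qed.

Lemma evS_eq u x z (w : C) : (fun n => Re (ev n u x z)) @ \oo --> Re w ->
  (fun n => Im (ev n u x z)) @ \oo --> Im w -> evS u x z = w.
Proof.
move=> hr hi; apply: C_eq.
  exact: seq_lim_unique (@evS_cvgRe u x z) hr.
exact: seq_lim_unique (@evS_cvgIm u x z) hi.
Qed.

Lemma ev_lin a u v n x z : ev n (a *: u + v) x z = a *: ev n u x z + ev n v x z.
Proof.
rewrite /ev scaler_sumr -big_split/=; apply: eq_bigr => k _.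
by rewrite mulrDl -scalerAl.
Qed.

Lemma evS_lin a u v x z : evS (a *: u + v) x z = a *: evS u x z + evS v x z.
Proof.
apply: evS_eq; under eq_fun do rewrite ev_lin !ReImE; rewrite !ReImE; apply: cvgD.
- by apply: cvgMr; exact: evS_cvgRe.
- exact: evS_cvgRe.
- by apply: cvgMr; exact: evS_cvgIm.
- exact: evS_cvgIm.
Qed.

Lemma evSD u v x z : evS (u + v) x z = evS u x z + evS v x z.
Proof. by rewrite -[u]scale1r evS_lin !scale1r. Qed.

Lemma evS0 x z : evS 0 x z = 0.
Proof. by have := evS_lin (-1) 0 0 x z; rewrite scaleN1r addNr scaleN1r addNr. Qed.

Lemma evSZ a u x z : evS (a *: u) x z = a *: evS u x z.
Proof. by have := evS_lin a u 0 x z; rewrite evS0 !addr0. Qed.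

Lemma evSN u x z : evS (- u) x z = - evS u x z.
Proof. by rewrite -scaleN1r evSZ scaleN1r. Qed.

Lemma evSB u v x z : evS (u - v) x z = evS u x z - evS v x z.
Proof. by rewrite evSD evSN. Qed.

Lemma evS_supp u n x z : (forall k z, k \notin rng n -> u k z = 0) -> evS u x z = ev n u x z.
Proof.
move=> u0; apply: evS_eq; apply: cvg_near_cst; near=> m; rewrite (@ev_supp _ n m)//;
  near: m; exact: nbhs_infty_ge.
Unshelve. all: by end_near. Qed.

Lemma cmod_evS u x z : cmod (evS u x z) <= evb * `|u|.
Proof.
apply/ler_addgt0Pr => e /(evS_unif u)[N hN].
have -> : evS u x z = (evS u x z - ev N u x z) + ev N u x z by rewrite subrK.
apply: le_trans (cmodD _ _) _; rewrite addrC lerD//; first exact: cmod_ev.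
exact: hN.
Qed.

(** Identifies the abstract product with the pointwise one. At finite stage [ev_conv] makes it
    exact, and evaluation is continuous for the norm. *)
Lemma evS_mul c u x z : evS (mul c u) x z = evS c x z * evS u x z.
Proof.
have near0 (e : R) : 0 < e -> \forall n \near \oo,
    cmod (evS (mul c u) x z - ev n c x z * ev n u x z) <= e.
  move=> e0; have /cvgrPdist_le/(_ (e / (evb + 1))) := @mulS_cvg _ _ s_gt c u.
  have e1 : 0 < e / (evb + 1) by rewrite divr_gt0// ltr_wpDl// evb_ge0.
  move=> /(_ e1); apply: filterS => n hn.
  rewrite -ev_conv -[X in _ - X](@evS_supp (convA s_gt n c u)); last first.
    by move=> k t; exact: conv_supp.
  rewrite -evSB; apply: le_trans (cmod_evS _ _ _) _.
  apply: (@le_trans _ _ ((evb + 1) * `|mul c u - convA s_gt n c u|)).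
    by rewrite ler_wpM2r// lerDl.
  by rewrite mulrC -ler_pdivlMr ?ltr_wpDl ?evb_ge0.
have hr : (fun n => Re (ev n c x z * ev n u x z)) @ \oo --> Re (evS (mul c u) x z).
  apply/cvgrPdist_le => e /near0; apply: filterS => n; apply: le_trans.
  exact: ReB_le.
have hi : (fun n => Im (ev n c x z * ev n u x z)) @ \oo --> Im (evS (mul c u) x z).
  apply/cvgrPdist_le => e /near0; apply: filterS => n; apply: le_trans.
  exact: ImB_le.
have [r1 r2] := (@evS_cvgRe c x z, @evS_cvgRe u x z).
have [i1 i2] := (@evS_cvgIm c x z, @evS_cvgIm u x z).
apply: C_eq.
  apply: (seq_lim_unique hr); under eq_fun do rewrite ReM; rewrite ReM.
  exact: cvgB (cvgM r1 r2) (cvgM i1 i2).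
apply: (seq_lim_unique hi); under eq_fun do rewrite ImM; rewrite ImM.
exact: cvgD (cvgM r1 i2) (cvgM i1 r2).
Qed.

Lemma evS_continuous_aux (F : C -> R) u : (forall a b, `|F a - F b| <= cmod (a - b)) ->
  (forall n, continuous (fun p : R * R => F (ev n u p.1 p.2))) ->
  continuous (fun p : R * R => F (evS u p.1 p.2)).
Proof.
move=> hF cF; apply: (continuous_unif_limit cF) => e /(evS_unif u)[N hN].
exists N => p; rewrite distrC; apply: le_trans (hF _ _) _; exact: hN.
Qed.

Lemma continuous_cosk2 (a : R) : continuous (fun p : R * R => cos (a * p.1)).
Proof.
move=> p; apply: (@continuous_comp _ _ _ (@fst R R) (fun x => cos (a * x))); first exact: cvg_fst.
exact: continuous_cosk.
Qed.

Lemma continuous_sink2 (a : R) : continuous (fun p : R * R => sin (a * p.1)).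
Proof.
move=> p; apply: (@continuous_comp _ _ _ (@fst R R) (fun x => sin (a * x))); first exact: cvg_fst.
exact: continuous_sink.
Qed.

Lemma continuous_on_snd (f : R -> R) : continuous f -> continuous (fun p : R * R => f p.2).
Proof.
move=> cf p; apply: (@continuous_comp _ _ _ (@snd R R) f); first exact: cvg_snd.
exact: cf.
Qed.

Lemma continuous_evS u : continuous (fun p : R * R => Re (evS u p.1 p.2)).
Proof.
apply: (evS_continuous_aux (F := @complex.Re R)) => [a b|n].
  exact: ReB_le.
under eq_fun do rewrite /ev Re_sum.
apply: continuous_sum_seq => k; under eq_fun do rewrite ReM /=.
have [cr ci] := strip_continuous u k.
move=> p; apply: cvgB; apply: cvgM.
- exact: (continuous_on_snd cr).
- exact: continuous_cosk2.
- exact: (continuous_on_snd ci).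
- exact: continuous_sink2.
Qed.

Lemma ev_2pi (w : int -> R -> C) n x z : ev n w (x + pi *+ 2) z = ev n w x z.
Proof.
apply: eq_bigr => k _; congr (_ * _).
by rewrite /ek mulrDr expiD expi_2pi_int mulr1.
Qed.

Lemma evS_2pi u x z : evS u (x + pi *+ 2) z = evS u x z.
Proof.
by apply: evS_eq; under eq_fun do rewrite ev_2pi; [exact: evS_cvgRe|exact: evS_cvgIm].
Qed.

Lemma herm_evS u x z : herm u -> Im (evS u x z) = 0.
Proof.
move=> hu; apply: (seq_lim_unique (@evS_cvgIm u x z)).
by under eq_fun do rewrite herm_ev//; exact: cvg_cst.
Qed.

Lemma hermZ a u : herm u -> herm (a *: u : strip s).
Proof. by move=> hu k z; rewrite -[LHS]/(a *: u (- k) z) hu; apply: C_eq; rewrite !ReImE; ring. Qed.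

Lemma hermD u v : herm u -> herm v -> herm (u + v : strip s).
Proof.
move=> hu hv k z; rewrite -[LHS]/(u (- k) z + v (- k) z) hu hv.
by apply: C_eq; rewrite !ReImE; ring.
Qed.

Lemma hermN u : herm u -> herm (- u : strip s).
Proof. by move=> hu; rewrite -scaleN1r; exact: hermZ. Qed.

(** A function of z alone, carried by mode 0. *)
Definition vert (f : R -> R) : int -> R -> C :=
  fun k z => if k == 0 then realC (f (clampz z)) else 0.

Lemma vert_strip f : continuous f -> vert f \in strip_fun s.
Proof.
move=> cf; have cv k : continuousC (vert f k).
  rewrite /vert; case: (k == 0); last exact: continuousC0.
  split; last exact: cst_continuous.
  move=> z; apply: (@continuous_comp _ _ _ clampz f); [exact: continuous_clampz|exact: cf].
have kv k z : vert f k (clampz z) = vert f k z by rewrite /vert clampzK.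
have s0 k z : k \notin rng 0 -> vert f k z = 0.
  by rewrite mem_rng leqn0 absz_eq0 /vert => /negbTE->.
have tail n m z : sqn s n z (tailz m (vert f)) = 0.
  rewrite /sqn big1// => k _.
  have E x : tailz m (vert f) k x = 0.
    rewrite /tailz; case: ifPn => // km; apply: s0; apply: contra km.
    by rewrite !mem_rng leqn0 => /eqP->.
  by rewrite E sqmod0 (eq_sqJ E) sqJ0 mulr0 addr0 mulr0.
apply/mem_set; split => //; last by move=> e e0; exists 0%N => n z; rewrite tail ltW.
have [M hM] : exists M, forall z : R, 0 <= z <= 1 -> `|f z| <= M.
  have cn : {within `[0, 1], continuous (fun z => `|f z|)}.
    by apply: continuous_subspaceT => z; apply: cvg_norm; exact: cf.
  have [c _ hc] := EVT_max (@ler01 R) cn.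
  by exists `|f c| => z z01; apply: hc; rewrite in_itv.
exists (M ^+ 2 + sqJ (vert f 0)) => n z.
rewrite /sqn (@sum_rng_supp _ 0 n)//; last first.
  move=> k k0; rewrite (eq_sqJ (s0 k ^~ k0)) (s0 k z k0) sqmod0 sqJ0.
  by rewrite mulr0 addr0 mulr0.
have jb1 : jb 0 = 1 :> R by rewrite /jb absz0 addr0.
rewrite rng0 /W jb1 powR1 !mul1r lerD2r /vert eqxx sqmodE /= expr0n/= addr0.
rewrite -[leLHS]real_normK ?num_real// ler_pXn2r ?nnegrE//; first exact: hM _ (clampz_itv z).
by apply: le_trans (hM _ (clampz_itv z)).
Qed.

End Evaluation.

(** * Solvability of the straightened system *)

Section ContinuityMethod.
Context {R : realType}.

Lemma cvg_dist_le (V : normedModType R) (f : nat -> V) (l : V) (g : nat -> R) :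
  (forall n, `|l - f n| <= g n) -> g @ \oo --> (0 : R) -> f @ \oo --> l.
Proof.
move=> fg g0; apply/cvgrPdist_le => e e0.
have /cvgrPdist_le/(_ _ e0) := g0; apply: filterS => n; rewrite sub0r normrN => h.
by apply: le_trans (fg n) _; apply: le_trans (ler_norm _) h.
Qed.

Lemma normed_lim_unique (V : normedModType R) (u : nat -> V) (a b : V) :
  u @ \oo --> a -> u @ \oo --> b -> a = b.
Proof.
move=> ha hb; apply/eqP; rewrite -subr_eq0 -normr_eq0; apply/eqP.
have h : (fun n => `|u n - u n|) @ \oo --> `|a - b| by apply: cvg_norm; exact: cvgB.
apply: (seq_lim_unique h); under eq_fun do rewrite subrr normr0; exact: cvg_cst.
Qed.

Lemma cauchy_of_contraction (V : normedModType R) (u : nat -> V) :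
  (forall n, `|u n.+2 - u n.+1| <= 2^-1 * `|u n.+1 - u n|) ->
  forall e : R, 0 < e -> exists N, forall m n, (N <= m)%N -> (N <= n)%N -> `|u m - u n| <= e.
Proof.
move=> hu; pose D := `|u 1%N - u 0%N|; have D0 : 0 <= D := normr_ge0 _.
have h1 n : `|u n.+1 - u n| <= 2^-1 ^+ n * D.
  elim: n => [|n ih]; first by rewrite expr0 mul1r.
  by apply: le_trans (hu n) _; rewrite exprS -mulrA ler_wpM2l.
have h2 n k : `|u (n + k)%N - u n| <= 2 * (2^-1 ^+ n * D) * (1 - 2^-1 ^+ k).
  elim: k => [|k ih]; first by rewrite addn0 subrr normr0 expr0 subrr mulr0.
  have -> : u (n + k.+1)%N - u n = (u (n + k).+1 - u (n + k)%N) + (u (n + k)%N - u n).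
    by rewrite addnS addrA subrK.
  apply: le_trans (ler_normD _ _) _; apply: le_trans (lerD (h1 _) ih) _.
  by rewrite exprS exprD le_eqVlt; apply/orP; left; apply/eqP; field.
have p0 n : 0 <= (2^-1 : R) ^+ n by rewrite exprn_ge0.
have h3 n m : (n <= m)%N -> `|u m - u n| <= 2 * (2^-1 ^+ n * D).
  move=> nm; rewrite -(subnKC nm); apply: le_trans (h2 _ _) _.
  rewrite ler_piMr ?mulr_ge0//; have := p0 (m - n)%N; lra.
move=> e e0.
have /cvgrPdist_le/(_ (e / (4 * D + 1))) : (fun n => (2^-1 : R) ^+ n) @ \oo --> (0 : R).
  by apply: cvg_expr; rewrite ger0_norm//; lra.
have D1 : 0 < 4 * D + 1 by lra.
move=> /(_ (divr_gt0 e0 D1))[N _ hN]; exists N => m n Nm Nn.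
have hN' : 4 * (2^-1 ^+ N * D) <= e.
  have := hN N (leqnn N); rewrite sub0r normrN ger0_norm// ler_pdivlMr//.
  by have := p0 N; lra.
have -> : u m - u n = (u m - u N) - (u n - u N) by rewrite opprB addrA subrK.
apply: le_trans (ler_normB _ _) _; have := h3 _ _ Nm; have := h3 _ _ Nn; lra.
Qed.

(** The a priori bound is the same for all [t], so one step length works throughout and finitely
    many steps lead from t = 0 to t = 1. *)
Lemma continuity_method (V : normedModType R) (B : V -> V) (K b : R) :
  (forall u : nat -> V,
    (forall e : R, 0 < e -> exists N, forall m n, (N <= m)%N -> (N <= n)%N -> `|u m - u n| <= e) ->
    exists l : V, u @ \oo --> l) ->
  (forall a x y, B (a *: x + y) = a *: B x + B y) -> 0 <= b ->
  (forall x, `|B x| <= b * `|x|) -> 0 <= K ->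
  (forall t : R, 0 <= t <= 1 -> forall x, `|x| <= K * `|x + t *: B x|) ->
  forall y, exists x, x + B x = y.
Proof.
move=> complete lin b0 hB K0 hK.
have BB x y : B (x - y) = B x - B y.
  by rewrite addrC -scaleN1r lin scaleN1r addrC.
pose surj (t : R) := forall y, exists x, x + t *: B x = y.
have step (t e : R) : 0 <= t -> 0 <= e -> t + e <= 1 -> K * e * b <= 2^-1 -> surj t -> surj (t + e).
  move=> t0 e0 te1 small sur y.
  pose I w := projT1 (cid (sur w)).
  have hI w : I w + t *: B (I w) = w := projT2 (cid (sur w)).
  have t01 : 0 <= t <= 1 by rewrite t0 (le_trans _ te1)// lerDl.
  have lip w w' : `|I w - I w'| <= K * `|w - w'|.
    apply: le_trans (hK t t01 _) _; rewrite ler_wpM2l//.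
    by rewrite BB scalerBr addrACA -opprD !hI.
  (* A fixed point of [F] solves the equation at parameter t + e; the smallness of [e] makes [F] a
     contraction of ratio 1/2. *)
  pose F x := I (y - e *: B x).
  have lipF x x' : `|F x - F x'| <= 2^-1 * `|x - x'|.
    apply: le_trans (lip _ _) _.
    have -> : y - e *: B x - (y - e *: B x') = - (e *: B (x - x')).
      by rewrite BB scalerBr !opprB addrC -addrA addKr -opprB opprD opprK addrC || (rewrite BB scalerBr !opprB addrC addrA subrK).
    rewrite normrN normrZ ger0_norm//; apply: (@le_trans _ _ (K * e * b * `|x - x'|)).
      by rewrite -!mulrA ler_wpM2l// ler_wpM2l.
    by rewrite ler_wpM2r.
  pose u := fix u n := if n is m.+1 then F (u m) else 0.
  have [|l hl] := complete u; first by apply: cauchy_of_contraction => n; exact: lipF.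
  have hF : (fun n => u n.+1) @ \oo --> F l.
    apply: (@cvg_dist_le _ _ _ (fun n => 2^-1 * `|l - u n|)).
      by move=> n; exact: lipF.
    rewrite -[X in _ --> X](mulr0 2^-1); apply: cvgMr.
    rewrite -(@normr0 _ V) -(subrr l); apply: cvg_norm; apply: cvgB => //; exact: cvg_cst.
  have hl1 : (fun n => u n.+1) @ \oo --> l by move: hl; rewrite -cvg_shiftS.
  have E : l = F l.
    exact: normed_lim_unique hl1 hF.
  exists l; have := hI (y - e *: B l); rewrite -/(F l) -E => h.
  by rewrite scalerDl addrA h subrK.
pose N := (Num.bound (2 * (K * b))).+1.
have Nb : 2 * (K * b) < N%:R.
  have := archi_boundP (mulr_ge0 (@ler0n R 2) (mulr_ge0 K0 b0)).
  by move=> /lt_trans; apply; rewrite ltr_nat.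
have N0 : 0 < N%:R :> R by rewrite ltr0n.
have ind i : (i <= N)%N -> surj (i%:R / N%:R).
  elim: i => [_ y|i ih iN]; first by exists y; rewrite mul0r scale0r addr0.
  have -> : i.+1%:R / N%:R = i%:R / N%:R + N%:R^-1 :> R by rewrite -natr1 mulrDl mul1r.
  apply: (step _ _ _ _ _ _ (ih (ltnW iN))).
  - by rewrite divr_ge0.
  - by rewrite invr_ge0 ltW.
  - rewrite -[X in _ + X]mul1r -mulrDl ler_pdivrMr// mul1r natr1 ler_nat//.
  - rewrite mulrAC ler_pdivrMr//; lra.
move=> y; have [x hx] := ind N (leqnn N) y; exists x.
by rewrite -hx divff ?scale1r// gt_eqF.
Qed.

End ContinuityMethod.

Section RealHelpers.
Context {R : realType}.
Implicit Types a b m : R.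

Lemma le_add2 a b m : a <= m -> b <= m -> a + b <= 2 * m.
Proof. by lra. Qed.
Lemma le_of_addl a b m : 0 <= b -> a + b <= m -> a <= m.
Proof. by lra. Qed.
Lemma le_of_addr a b m : 0 <= a -> a + b <= m -> b <= m.
Proof. by lra. Qed.

Lemma normB_le2 (V : normedModType R) (x y : V) m : `|x| <= m -> `|y| <= m -> `|x - y| <= 2 * m.
Proof. by move=> hx hy; apply: le_trans (ler_normB _ _) (le_add2 hx hy). Qed.

Lemma pair_norm_le (V V' : normedModType R) (x : V * V') m :
  `|x.1| <= m -> `|x.2| <= m -> `|x| <= m.
Proof. by move=> h1 h2; rewrite prod_normE ge_max h1. Qed.

Lemma pair_norm_le_sum (V V' : normedModType R) (x : V * V') : `|x| <= `|x.1| + `|x.2|.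
Proof. by apply: pair_norm_le; rewrite ?lerDl ?lerDr. Qed.

Lemma convex_norm_le (V : normedModType R) (t : R) (x y : V) : 0 <= t <= 1 ->
  `|y + t *: (x - y)| <= `|x| + `|y|.
Proof.
move=> /andP[t0 t1]; have -> : y + t *: (x - y) = (1 - t) *: y + t *: x.
  by rewrite scalerBr scalerBl scale1r addrCA [RHS]addrC addrA.
apply: le_trans (ler_normD _ _) _; rewrite !normrZ (ger0_norm t0) ger0_norm ?subr_ge0//.
by rewrite addrC; apply: lerD; rewrite ler_piMl// gerBl.
Qed.

End RealHelpers.

(** * The a priori bound in the full space and invertibility *)

Section Apriori.
Context {R : realType} (s : R) (s_gt : 1 < 2 * s).
Notation C := (Rcomplex R).
Notation mul := (mulS s_gt).
Notation evb := (evb s_gt).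
Notation evS := (evS s_gt).
Implicit Types (u v c d : strip s) (g : strip s * strip s) (n : nat) (x z : R) (k : int).

Lemma stripDE u v k z : (u + v) k z = u k z + v k z. Proof. by []. Qed.
Lemma stripNE u k z : (- u) k z = - u k z. Proof. by []. Qed.
Lemma stripZE (a : R) u k z : (a *: u) k z = a *: u k z. Proof. by []. Qed.
Lemma strip0E k z : (0 : strip s) k z = 0. Proof. by []. Qed.
Definition stripE := (stripDE, stripNE, stripZE, strip0E).

(** The left-hand sides of the straightened equations for the fields generated by the flat residual
    [g]. For c = 0, d = 1 they reduce to SZ2 - SX1 and - SZ1 - SX2, which is [g] itself. *)
Definition crT c d g : strip s * strip s :=
  (mul c (SZ1 g) + SZ2 g - mul d (SX1 g), mul c (SZ2 g) - SZ1 g - mul d (SX2 g)).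

Definition truncP n g : strip s * strip s := (truncA n g.1, truncA n g.2).

(** The flat problem is solved mode by mode, so truncated data yield truncated fields. *)
Lemma SX_supp n g k z : k \notin rng n ->
  SX1 (truncP n g) k z = 0 /\ SX2 (truncP n g) k z = 0.
Proof.
move=> kn.
have h := flat_term_bound (strip_continuous (truncP n g).1 k)
  (strip_continuous (truncP n g).2 k) (flat_solP (truncP n g) k) (clampz_itv z).
have E1 : sqJ ((truncP n g).1 k) = 0.
  by rewrite (eq_sqJ (g := fun=> 0)) ?sqJ0// => t; exact: trunc_out.
have E2 : sqJ ((truncP n g).2 k) = 0.
  by rewrite (eq_sqJ (g := fun=> 0)) ?sqJ0// => t; exact: trunc_out.
rewrite E1 E2 addr0 !mulr0 !clampzK in h; case: h => h1 h2.
have zero (w : C) (j : R) : 0 <= j -> sqmod w + j <= 0 -> w = 0.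
  move=> j0 h; have /eqP : sqmod w = 0.
    by apply/eqP; rewrite eq_le sqmod_ge0 andbT (le_trans _ h)// lerDl.
  rewrite sqmodE paddr_eq0 ?sqr_ge0// !sqrf_eq0 => /andP[/eqP r0 /eqP i0].
  by apply: C_eq; rewrite ?r0 ?i0 ?Re0 ?Im0.
by split; [apply: zero h1|apply: zero h2]; rewrite mulr_ge0 ?jb_ge0 ?sqJ_ge0.
Qed.

Lemma SZ_supp n g k z : k \notin rng n ->
  SZ1 (truncP n g) k z = 0 /\ SZ2 (truncP n g) k z = 0.
Proof.
move=> kn; have [h1 h2] := SX_supp g z kn.
have g1 : (truncP n g).1 k z = 0 by exact: trunc_out.
have g2 : (truncP n g).2 k z = 0 by exact: trunc_out.
split; first by rewrite /SZ1 !stripE h2 g2 oppr0 addr0.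
by rewrite /SZ2 !stripE h1 g1 addr0.
Qed.

Lemma truncA_supp n u : (forall k z, k \notin rng n -> u k z = 0) -> truncA n u = u.
Proof.
by move=> u0; apply: strip_eq => k z /=; rewrite /trunc; case: ifPn => // /u0->.
Qed.

Lemma norm_supp_le n u (M : R) : 0 <= M -> (forall k z, k \notin rng n -> u k z = 0) ->
  (forall z, 0 <= z <= 1 -> hsn s n z u <= M) -> J (fun z => hsn (s + 2^-1) n z u) <= M ->
  `|u| <= Num.sqrt (2 * M).
Proof.
move=> M0 u0 h1 h2; apply: strip_clamp_norm_le; first exact: sqrtr_ge0.
move=> m z z01; rewrite sqr_sqrtr ?mulr_ge0//.
apply: (@le_trans _ _ (sqn s n z u)).
  apply: le_trans (sqn_mono s z u (leq_maxl m n)) _.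
  rewrite /sqn (@sum_rng_supp _ n (maxn m n)) ?leq_maxr// => k kn.
  by rewrite (eq_sqJ (g := fun=> 0)) ?u0 ?sqJ0 ?sqmod0 ?mulr0 ?addr0 ?mulr0// => t; exact: u0.
rewrite sqnE; last by move=> k; exact: strip_continuous.
have := h1 z z01; lra.
Qed.

(** The four fields of truncated data form a [cr_data], whose null form and suprema are those of the
    flat problem in each mode. *)
Lemma apriori_trunc (kap M : R) : 0 < kap -> 0 <= M -> exists2 K : R, 0 <= K &
  forall n c d g, herm c -> herm d -> `|c| <= M -> `|d| <= M ->
  (forall x z, kap <= Re (ev n d x z)) ->
  `|truncP n g| <= K * `|crT (truncA n c) (truncA n d) (truncP n g)|.
Proof.
move=> k0 M0.
have eM : 0 <= evb * M by rewrite mulr_ge0 ?evb_ge0.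
have [K K0 hK] := finite_apriori s_gt k0 eM (sqr_ge0 M).
exists (4 * Num.sqrt K); first by rewrite mulr_ge0 ?sqrtr_ge0.
move=> n c d g hc hd cM dM hkap.
set h := truncP n g; set f := crT _ _ _.
have sX k z : k \notin rng n -> SX1 h k z = 0 by move=> kn; exact: (SX_supp g z kn).1.
have sX2 k z : k \notin rng n -> SX2 h k z = 0 by move=> kn; exact: (SX_supp g z kn).2.
have sZ k z : k \notin rng n -> SZ1 h k z = 0 by move=> kn; exact: (SZ_supp g z kn).1.
have sZ2 k z : k \notin rng n -> SZ2 h k z = 0 by move=> kn; exact: (SZ_supp g z kn).2.
have M2 u : `|u| <= M -> `|u| ^+ 2 <= M ^+ 2 by move=> uM; rewrite ler_pXn2r ?nnegrE.
have evM u x z : `|u| <= M -> `|Re (ev n u x z)| <= evb * M.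
  move=> uM; apply: le_trans (Re_le_cmod _) _; apply: le_trans (cmod_ev s_gt u n x z) _.
  by rewrite ler_wpM2l ?evb_ge0.
have H : cr_data s kap (evb * M) (M ^+ 2) n c d (SX1 h) (SX2 h) (SZ1 h) (SZ2 h).
  split.
  - exact: strip_continuous.
  - exact: strip_continuous.
  - exact: strip_continuous.
  - exact: strip_continuous.
  - exact: strip_continuous.
  - exact: strip_continuous.
  - exact: sX.
  - exact: sX2.
  - exact: sZ.
  - exact: sZ2.
  - by move=> x z; exact: herm_ev.
  - by move=> x z; exact: herm_ev.
  - exact: hkap.
  - by move=> x z; exact: evM.
  - by move=> x z; exact: evM.
  - by move=> m z; apply: le_trans (sqn_le_normr c m z) (M2 _ cM).
  - by move=> m z; apply: le_trans (sqn_le_normr d m z) (M2 _ dM).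
  - by move=> k; exact: (flat_null_form (strip_continuous h.1 k) (strip_continuous h.2 k)
      (flat_solP h k)).
  - move=> k z z01; exact: (flat_sup1 (strip_continuous h.2 k) (flat_solP h k) z01).
  - move=> k z z01; exact: (flat_sup2 (strip_continuous h.1 k) (flat_solP h k) z01).
have mT v u : (forall k z, k \notin rng n -> u k z = 0) ->
    mul (truncA n v) u = convA s_gt n v u.
  by move=> u0; rewrite -{1}(truncA_supp u0) mulS_trunc.
have E1 k z : cr1 n c d (SX1 h) (SZ1 h) (SZ2 h) k z = f.1 k z.
  by rewrite /f /crT (mT _ _ sX) (mT _ _ sZ).
have E2 k z : cr2 n c d (SX2 h) (SZ1 h) (SZ2 h) k z = f.2 k z.
  by rewrite /f /crT (mT _ _ sX2) (mT _ _ sZ2).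
have E1' : cr1 n c d (SX1 h) (SZ1 h) (SZ2 h) = f.1 by do 2 apply/funext => ?; exact: E1.
have E2' : cr2 n c d (SX2 h) (SZ1 h) (SZ2 h) = f.2 by do 2 apply/funext => ?; exact: E2.
have nsq u m z : hsn s m z u <= `|u| ^+ 2 /\ J (fun z => hsn (s + 2^-1) m z u) <= `|u| ^+ 2.
  have := sqn_le_normr u m z; rewrite sqnE; last by move=> k; exact: strip_continuous.
  have h0 := hsn_ge0 s m z u; have h1 : 0 <= J (fun z => hsn (s + 2^-1) m z u).
    by apply: J_ge0 => t _; exact: hsn_ge0.
  by move=> hs; split; apply: le_trans hs; rewrite ?lerDl ?lerDr.
have f1 : `|f.1| ^+ 2 <= `|f| ^+ 2 by rewrite ler_pXn2r ?nnegrE// norm_fst_le.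
have f2 : `|f.2| ^+ 2 <= `|f| ^+ 2 by rewrite ler_pXn2r ?nnegrE// norm_snd_le.
have cst u m p : continuous (fun z => hsn p m z u).
  by apply: continuous_hsn => k; exact: strip_continuous.
have [||hS [hJX hJZ]] := hK n c d _ _ _ _ H (2 * `|f| ^+ 2).
- move=> z z01; rewrite E1' E2' /hsn2.
  exact: le_add2 (le_trans (nsq _ _ _).1 f1) (le_trans (nsq _ _ _).1 f2).
- rewrite E1' E2' /hsn2 JD; [|exact: cst|exact: cst].
  exact: le_add2 (le_trans (nsq _ _ 0).2 f1) (le_trans (nsq _ _ 0).2 f2).
have B0 : 0 <= K * (2 * `|f| ^+ 2) by rewrite mulr_ge0// mulr_ge0// sqr_ge0.
have sq : Num.sqrt (2 * (K * (2 * `|f| ^+ 2))) = 2 * Num.sqrt K * `|f|.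
  have -> : 2 * (K * (2 * `|f| ^+ 2)) = K * (2 * `|f|) ^+ 2 by ring.
  by rewrite sqrtrM// sqrtr_sqr ger0_norm ?mulr_ge0//; ring.
have part u v : (forall k z, k \notin rng n -> u k z = 0) ->
    (forall k z, k \notin rng n -> v k z = 0) ->
    (forall z, 0 <= z <= 1 -> hsn2 s n z u v <= K * (2 * `|f| ^+ 2)) ->
    J (fun z => hsn2 (s + 2^-1) n z u v) <= K * (2 * `|f| ^+ 2) ->
    `|u| <= 2 * Num.sqrt K * `|f| /\ `|v| <= 2 * Num.sqrt K * `|f|.
  move=> u0 v0 h1 h2; rewrite -sq; move: h2; rewrite /hsn2 JD; [|exact: cst|exact: cst].
  have j1 : 0 <= J (fun z => hsn (s + 2^-1) n z u) by apply: J_ge0 => t _; exact: hsn_ge0.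
  have j2 : 0 <= J (fun z => hsn (s + 2^-1) n z v) by apply: J_ge0 => t _; exact: hsn_ge0.
  move=> h2; split; apply: (@norm_supp_le n) => //.
  - by move=> z z01; apply: le_of_addl (h1 z z01); exact: hsn_ge0.
  - exact: le_of_addl h2.
  - by move=> z z01; apply: le_of_addr (h1 z z01); exact: hsn_ge0.
  - exact: le_of_addr h2.
have [nX1 nX2] := part _ _ sX sX2 (fun z z01 => (hS z z01).1) hJX.
have [nZ1 nZ2] := part _ _ sZ sZ2 (fun z z01 => (hS z z01).2) hJZ.
have eK : 4 * Num.sqrt K * `|f| = 2 * (2 * Num.sqrt K * `|f|) by ring.
(* The residual is an algebraic combination of the four fields: bounding them bounds [g] without
   loss of derivatives. *)
have g1 : h.1 = SZ2 h - SX1 h by rewrite /SZ2 addrAC subrr add0r.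
have g2 : h.2 = - SX2 h - SZ1 h by rewrite /SZ1 opprD !opprK addrA addNr add0r.
rewrite eK; apply: pair_norm_le; first by rewrite g1; exact: normB_le2 nZ2 nX1.
by rewrite g2; apply: normB_le2 nZ1; rewrite normrN; exact: nX2.
Qed.

Lemma SX1B g g' : SX1 (g - g') = SX1 g - SX1 g'.
Proof. by rewrite addrC -scaleN1r (SX_lin _ _ _).1 scaleN1r addrC. Qed.
Lemma SX2B g g' : SX2 (g - g') = SX2 g - SX2 g'.
Proof. by rewrite addrC -scaleN1r (SX_lin _ _ _).2 scaleN1r addrC. Qed.

Lemma truncA_cvgn u : truncA n u @[n --> \oo] --> u.
Proof.
by apply/cvgrPdist_le => e /(truncA_cvg u)[N hN]; exists N => // n /= /hN.
Qed.

Lemma cvg_mulS (c_ u_ : nat -> strip s) c u : c_ @ \oo --> c -> u_ @ \oo --> u ->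
  (fun n => mul (c_ n) (u_ n)) @ \oo --> mul c u.
Proof.
move=> hc hu; have [K K0 hK] := mulS_norm s_gt.
apply: (@cvg_dist_le _ _ _ _ (fun n => K * (`|c - c_ n| * `|u_ n|) + K * (`|c| * `|u - u_ n|))).
  move=> n; have -> : mul c u - mul (c_ n) (u_ n) = mul (c - c_ n) (u_ n) + mul c (u - u_ n).
    rewrite -[- c_ n]scaleN1r -[- u_ n]scaleN1r mulSDl mulSDr mulSZl mulSZr !scaleN1r.
    by rewrite [RHS]addrC addrA subrK.
  by apply: le_trans (ler_normD _ _) _; rewrite lerD.
have z (f_ : nat -> strip s) f : f_ @ \oo --> f -> (fun n => `|f - f_ n|) @ \oo --> (0 : R).
  move=> hf; rewrite -(@normr0 _ (strip s)) -(subrr f); apply: cvg_norm.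
  by apply: cvgB => //; exact: cvg_cst.
have -> : 0 = K * (0 * `|u|) + K * (`|c| * 0) :> R by rewrite mul0r !mulr0 addr0.
apply: cvgD; apply: cvgMr; first exact: cvgM (z _ _ hc) (cvg_norm hu).
by apply: cvgMr; exact: z.
Qed.

Lemma cvg_SX g : SX1 (truncP n g) @[n --> \oo] --> SX1 g /\
  SX2 (truncP n g) @[n --> \oo] --> SX2 g.
Proof.
have z : (fun n => 4 * (`|g.1 - truncA n g.1| + `|g.2 - truncA n g.2|)) @ \oo --> (0 : R).
  have z1 u : (fun n => `|u - truncA n u|) @ \oo --> (0 : R).
    rewrite -(@normr0 _ (strip s)) -(subrr u); apply: cvg_norm.
    by apply: cvgB; [exact: cvg_cst|exact: truncA_cvgn].
  have -> : 0 = 4 * (0 + 0) :> R by rewrite addr0 mulr0.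
  by apply: cvgMr; apply: cvgD; exact: z1.
have b n : `|g - truncP n g| <= `|g.1 - truncA n g.1| + `|g.2 - truncA n g.2|.
  exact: (pair_norm_le_sum (g - truncP n g)).
split; apply: (cvg_dist_le _ z) => n.
  by rewrite -SX1B; apply: le_trans (SX1_norm _) _; rewrite ler_wpM2l.
by rewrite -SX2B; apply: le_trans (SX2_norm _) _; rewrite ler_wpM2l.
Qed.

(** Truncation of [d] is uniformly close to [d], hence keeps the lower bound kap / 2 from some
    degree on. The truncated estimates then pass to the limit. *)
Lemma apriori (kap M : R) : 0 < kap -> 0 <= M -> exists2 K : R, 0 <= K &
  forall c d, herm c -> herm d -> `|c| <= M -> `|d| <= M ->
  (forall x z, kap <= Re (evS d x z)) -> forall g, `|g| <= K * `|crT c d g|.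
Proof.
move=> k0 M0; have k20 : 0 < kap / 2 by rewrite divr_gt0.
have [K K0 hK] := apriori_trunc k20 M0.
exists (2 * K); first by rewrite mulr_ge0.
move=> c d hc hd cM dM hkap g.
have [N hN] := evS_unif s_gt d k20.
have key n : (N <= n)%N -> `|truncP n g| <= K * `|crT (truncA n c) (truncA n d) (truncP n g)|.
  move=> Nn; apply: hK => // x z; have := hN n Nn x z; have := hkap x z.
  have := ler_norm (Re (evS d x z) - Re (ev n d x z)).
  have := ReB_le (evS d x z) (ev n d x z); lra.
pose f n := crT (truncA n c) (truncA n d) (truncP n g).
have [cX1 cX2] := cvg_SX g.
have cZ1 : SZ1 (truncP n g) @[n --> \oo] --> SZ1 g.
  by rewrite /SZ1; apply: cvgB; [exact: cvgN|exact: truncA_cvgn].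
have cZ2 : SZ2 (truncP n g) @[n --> \oo] --> SZ2 g.
  by rewrite /SZ2; apply: cvgD; [exact: cX1|exact: truncA_cvgn].
have cc := @truncA_cvgn c; have cd := @truncA_cvgn d.
have cf1 : (fun n => (f n).1) @ \oo --> (crT c d g).1.
  rewrite /f /crT /=; apply: cvgB; last exact: cvg_mulS.
  by apply: cvgD => //; exact: cvg_mulS.
have cf2 : (fun n => (f n).2) @ \oo --> (crT c d g).2.
  rewrite /f /crT /=; apply: cvgB; last exact: cvg_mulS.
  by apply: cvgB => //; exact: cvg_mulS.
have cF : (fun n => K * (`|(f n).1| + `|(f n).2|)) @ \oo -->
    K * (`|(crT c d g).1| + `|(crT c d g).2|).
  by apply: cvgMr; apply: cvgD; exact: cvg_norm.
have comp (p : strip s * strip s -> strip s) : (forall h, `|p h| <= `|h|) ->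
    (p (truncP n g) @[n --> \oo] --> p g) -> `|p g| <= 2 * K * `|crT c d g|.
  move=> hp cp; apply: (@le_trans _ _ (K * (`|(crT c d g).1| + `|(crT c d g).2|))).
    apply: (ler_cvg_to (cvg_norm cp) cF); near=> n.
    apply: le_trans (hp _) _; apply: le_trans (key n _) _.
      by near: n; exact: nbhs_infty_ge.
    by rewrite ler_wpM2l// -/(f n); exact: pair_norm_le_sum.
  have -> : 2 * K * `|crT c d g| = K * (2 * `|crT c d g|) by ring.
  by rewrite ler_wpM2l//; apply: le_add2; [exact: norm_fst_le|exact: norm_snd_le].
apply: pair_norm_le.
  by apply: (comp fst); [exact: norm_fst_le|exact: truncA_cvgn].
by apply: (comp snd); [exact: norm_snd_le|exact: truncA_cvgn].
Unshelve. all: by end_near. Qed.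

Definition oneS : strip s := Strip (vert_strip s (@cst_continuous R R 1)).

Lemma herm_one : herm oneS.
Proof.
by move=> k z; rewrite /= /vert oppr_eq0; case: (k == 0); apply: C_eq; rewrite !ReImE ?oppr0.
Qed.

Lemma evS_one x z : evS oneS x z = 1.
Proof.
rewrite (@evS_supp _ _ _ _ 0%N).
  by rewrite /ev rng0 /= /vert eqxx /ek mul0r expi0; apply: C_eq; rewrite !ReImE /=; ring.
move=> k t; rewrite mem_rng leqn0 absz_eq0 /= /vert => /negbTE->//.
Qed.

Lemma mulS_one u : mul oneS u = u.
Proof.
apply: mulS_eq; rewrite (_ : (fun n => _) = (fun n => truncA n u)); last first.
  apply/funext => n; apply: strip_eq => k z /=; rewrite /conv /trunc.
  have vE l : (if k - l \in rng n then vert (cst 1) (k - l) z else 0) = (k == l)%:R :> C.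
    rewrite /vert subr_eq0; case: (altP (k =P l)) => [->|_]; last by case: ifP.
    by rewrite subrr mem_rng.
  under eq_bigr do rewrite vE.
  case: ifPn => kn; last first.
    rewrite big_seq big1// => l ln; case: (altP (k =P l)) => [kl|]; last by rewrite mul0r.
    by move: kn; rewrite kl ln.
  rewrite (bigD1_seq k) ?rng_uniq//= eqxx mul1r big1 ?addr0// => l lk.
  by rewrite eq_sym (negbTE lk) mul0r.
exact: truncA_cvgn.
Qed.

Lemma strip2_complete (u : nat -> strip s * strip s) :
  (forall e : R, 0 < e -> exists N, forall m n, (N <= m)%N -> (N <= n)%N -> `|u m - u n| <= e) ->
  exists l : strip s * strip s, u @ \oo --> l.
Proof.
move=> cu.
have [|l1 h1] := @strip_complete _ _ (fun n => (u n).1).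
  move=> e /cu[N hN]; exists N => m n Nm Nn.
  by apply: le_trans (hN m n Nm Nn); exact: (norm_fst_le (u m - u n)).
have [|l2 h2] := @strip_complete _ _ (fun n => (u n).2).
  move=> e /cu[N hN]; exists N => m n Nm Nn.
  by apply: le_trans (hN m n Nm Nn); exact: (norm_snd_le (u m - u n)).
exists (l1, l2); apply/cvgrPdist_le => e e0.
have [N1 k1] := h1 e e0; have [N2 k2] := h2 e e0.
exists (maxn N1 N2) => // n /=; rewrite geq_max => /andP[n1 n2].
rewrite distrC; apply: pair_norm_le; [exact: k1|exact: k2].
Qed.

(** The segment from the identity to the operator consists of operators of the same kind, with
    coefficients t c and 1 + t (d - 1), so the a priori bound applies along it. *)
Lemma crT_homotopy (t : R) c d g :
  crT (t *: c) (oneS + t *: (d - oneS)) g = g + t *: (crT c d g - g).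
Proof.
have E1 : g.1 = SZ2 g - SX1 g by rewrite /SZ2 addrAC subrr add0r.
have E2 : g.2 = - SX2 g - SZ1 g by rewrite /SZ1 opprD !opprK addrA addNr add0r.
have mulB w : mul (d - oneS) w = mul d w - w.
  by rewrite mulSDl -[- oneS]scaleN1r mulSZl mulS_one scaleN1r.
rewrite /crT !mulSDl !mulSZl !mulB !mulS_one [RHS]surjective_pairing; congr (_, _).
  rewrite -[RHS]/(g.1 + t *: (mul c (SZ1 g) + SZ2 g - mul d (SX1 g) - g.1)) E1.
  move: (mul c (SZ1 g)) (mul d (SX1 g)) (SZ2 g) (SX1 g) => m1 m2 m3 m4.
  by apply: strip_eq => k z; rewrite !stripE; apply: C_eq; rewrite !ReImE; ring.
rewrite -[RHS]/(g.2 + t *: (mul c (SZ2 g) - SZ1 g - mul d (SX2 g) - g.2)) E2.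
move: (mul c (SZ2 g)) (mul d (SX2 g)) (SZ1 g) (SX2 g) => m1 m2 m3 m4.
by apply: strip_eq => k z; rewrite !stripE; apply: C_eq; rewrite !ReImE; ring.
Qed.

Lemma SZ_lin (a : R) g g' : SZ1 (a *: g + g') = a *: SZ1 g + SZ1 g' /\
  SZ2 (a *: g + g') = a *: SZ2 g + SZ2 g'.
Proof.
rewrite /SZ1 /SZ2 !(SX_lin _ _ _).1 !(SX_lin _ _ _).2.
have -> : (a *: g + g').1 = a *: g.1 + g'.1 by [].
have -> : (a *: g + g').2 = a *: g.2 + g'.2 by [].
by split; apply: strip_eq => k z; rewrite !stripE; apply: C_eq; rewrite !ReImE; ring.
Qed.

Lemma crT_lin (a : R) c d g g' : crT c d (a *: g + g') = a *: crT c d g + crT c d g'.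
Proof.
have [X1 X2] := SX_lin a g g'; have [Y1 Y2] := SZ_lin a g g'.
have mulP e u v : mul e (a *: u + v) = a *: mul e u + mul e v.
  by rewrite mulSDr mulSZr.
rewrite /crT X1 X2 Y1 Y2 !mulP; congr (_, _).
  by rewrite opprD (addrACA (a *: mul c (SZ1 g))) (addrACA (a *: _ + _)) -scalerDr -scalerBr.
by rewrite (opprD (a *: SZ1 g)) (opprD (a *: mul d (SX2 g))) (addrACA (a *: mul c (SZ2 g)))
  (addrACA (a *: mul c (SZ2 g) - a *: SZ1 g)) -!scalerBr.
Qed.

Lemma SZ1_norm g : `|SZ1 g| <= 5 * `|g|.
Proof.
apply: le_trans (ler_normB _ _) _; rewrite normrN.
have -> : 5 * `|g| = 4 * `|g| + `|g| by ring.
exact: lerD (SX2_norm g) (norm_snd_le g).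
Qed.

Lemma SZ2_norm g : `|SZ2 g| <= 5 * `|g|.
Proof.
apply: le_trans (ler_normD _ _) _; have -> : 5 * `|g| = 4 * `|g| + `|g| by ring.
exact: lerD (SX1_norm g) (norm_fst_le g).
Qed.

Lemma crT_bounded c d : exists2 b : R, 0 <= b & forall g, `|crT c d g| <= b * `|g|.
Proof.
have [K K0 hK] := mulS_norm s_gt.
have B (e : strip s) w (r : R) g : `|w| <= r * `|g| -> `|mul e w| <= K * `|e| * r * `|g|.
  move=> hw; apply: le_trans (hK _ _) _; rewrite -!mulrA ler_wpM2l// ler_wpM2l//.
pose A := K * `|c| * 5 + 5 + K * `|d| * 4.
have A0 : 0 <= A by rewrite /A !addr_ge0// !mulr_ge0.
exists A => // g.
have -> : A * `|g| = K * `|c| * 5 * `|g| + 5 * `|g| + K * `|d| * 4 * `|g| by rewrite /A !mulrDl.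
apply: pair_norm_le.
  apply: le_trans (ler_normB _ _) _; apply: lerD; last exact: B (SX1_norm g).
  by apply: le_trans (ler_normD _ _) _; apply: lerD; [exact: B (SZ1_norm g)|exact: SZ2_norm].
apply: le_trans (ler_normB _ _) _; apply: lerD; last exact: B (SX2_norm g).
by apply: le_trans (ler_normB _ _) _; apply: lerD; [exact: B (SZ2_norm g)|exact: SZ1_norm].
Qed.

Lemma crT_bijective (kap : R) c d : 0 < kap -> herm c -> herm d ->
  (forall x z, kap <= Re (evS d x z)) ->
  (exists2 K : R, 0 <= K & forall g, `|g| <= K * `|crT c d g|) /\
  forall y, exists g, crT c d g = y.
Proof.
move=> k0 hc hd hkap.
pose M := `|c| + `|d| + `|oneS|.
have M0 : 0 <= M by rewrite !addr_ge0.
(* Along the segment the second coefficient is a convex combination of 1 and [d], so it stays above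
   this minimum. *)
have k1 : 0 < Num.min kap 1 by rewrite lt_min k0 ltr01.
have [K K0 hK] := apriori k1 M0.
have min1 (t r : R) : 0 <= t <= 1 -> kap <= r -> Num.min kap 1 <= 1 + t * (r - 1).
  move=> /andP[t0 t1] kr.
  have : Num.min kap 1 <= kap by rewrite ge_min lexx.
  have : Num.min kap 1 <= 1 by rewrite ge_min lexx orbT.
  set m := Num.min kap 1; nra.
have hT (t : R) : 0 <= t <= 1 -> forall g, `|g| <= K * `|g + t *: (crT c d g - g)|.
  move=> t01; have /andP[t0 t1] := t01; move=> g; rewrite -crT_homotopy; apply: hK.
  - exact: hermZ.
  - apply: hermD; first exact: herm_one.
    by apply: hermZ; apply: hermD => //; apply: hermN; exact: herm_one.
  - rewrite normrZ ger0_norm// /M -addrA; apply: (@le_trans _ _ (1 * `|c|)).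
      by rewrite ler_wpM2r.
    by rewrite mul1r lerDl addr_ge0.
  - apply: le_trans (convex_norm_le d oneS t01) _; rewrite /M -addrA lerDr; exact: normr_ge0.
  - move=> x z; rewrite evSD evSZ evSB !evS_one !ReImE; exact: min1.
split.
  exists K => // g; have := hT 1; rewrite lexx ler01 => /(_ isT g).
  by rewrite scale1r addrC subrK.
have [b b0 hb] := crT_bounded c d.
have cm := @continuity_method R (strip s * strip s)%type (fun g => crT c d g - g) K (b + 1).
suff h : forall y, exists g, g + (crT c d g - g) = y.
  by move=> y; have [g hg] := h y; exists g; rewrite -hg addrC subrK.
apply: cm.
- exact: strip2_complete.
- by move=> a x y; rewrite crT_lin scalerBr opprD addrACA.
- by rewrite addr_ge0.
- by move=> g; apply: le_trans (ler_normB _ _) _; rewrite mulrDl mul1r lerD2r.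
- exact: K0.
- exact: hT.
Qed.

End Apriori.

(** * Fourier coefficients and traces *)

Section CircleIntegral.
Context {R : realType}.
Notation C := (Rcomplex R).
Notation mu := (@lebesgue_measure R).
Implicit Types (f g : R -> R) (k m : int).

Definition circ f : R := \int[mu]_(x in `[0, pi *+ 2]) f x.

Lemma circD f g : continuous f -> continuous g -> circ (fun x => f x + g x) = circ f + circ g.
Proof. by move=> cf cg; rewrite /circ RintegralD//; exact: continuous_segment_integrable. Qed.

Lemma circZ (a : R) f : continuous f -> circ (fun x => a * f x) = a * circ f.
Proof. by move=> cf; rewrite /circ RintegralZl//; exact: continuous_segment_integrable. Qed.

Lemma circB f g : continuous f -> continuous g -> circ (fun x => f x - g x) = circ f - circ g.
Proof.
move=> cf cg; rewrite (_ : (fun x => _) = (fun x => f x + -1 * g x)); last first.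
  by apply/funext => x; rewrite mulN1r.
rewrite circD ?circZ ?mulN1r//.
by apply: continuous_mulR => //; exact: cst_continuous.
Qed.

Lemma circ_cst (a : R) : circ (fun=> a) = a * (pi *+ 2).
Proof.
rewrite /circ Rintegral_cst//; congr (_ * _).
have muD : mu `[0, pi *+ 2] = (pi *+ 2)%:E.
  by rewrite lebesgue_measure_itv/= lte_fin twopi_gt0 oppr0 adde0.
exact: (congr1 fine muD).
Qed.

Lemma circ_le f g : continuous f -> continuous g ->
  (forall x : R, f x <= g x) -> circ f <= circ g.
Proof.
move=> cf cg fg; apply: le_Rintegral => //; first exact: continuous_segment_integrable.
exact: continuous_segment_integrable.
Qed.

Lemma circ_norm f (e : R) : continuous f -> (forall x, `|f x| <= e) ->
  `|circ f| <= e * (pi *+ 2).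
Proof.
move=> cf fe; rewrite ler_norml -circ_cst; apply/andP; split; last first.
  apply: circ_le => //; first exact: cst_continuous.
  by move=> x; apply: le_trans (fe x); exact: ler_norm.
have -> : - circ (fun=> e) = circ (fun=> - e) by rewrite !circ_cst mulNr.
apply: circ_le => //; first exact: cst_continuous.
by move=> x; have := fe x; rewrite ler_norml => /andP[].
Qed.

Lemma circ_FTC (F f : R -> R) : continuous f ->
  (forall x : R, is_derive x 1 F (f x)) -> circ f = F (pi *+ 2) - F 0.
Proof.
move=> cf dF; have ctF (z : R) : {for z, continuous F} by exact: is_derive1_continuous (dF z).
rewrite /circ /Rintegral (@continuous_FTC2 _ f F)//.
- exact: twopi_gt0.
- exact: continuous_subspaceT.
- split; [by move=> z _; case: (dF z)|exact/cvg_at_right_filter/ctF|exact/cvg_at_left_filter/ctF].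
- by move=> z _; rewrite derive1E; apply: derive_val; exact: dF.
Qed.

Lemma is_derive_sinM (a x : R) : is_derive x 1 (fun t => sin (a * t)) (a * cos (a * x)).
Proof.
have h1 : is_derive x 1 ( *%R a) (a * 1).
  exact: (is_deriveZf a (@is_derive_id _ _ x 1)).
have h := @is_derive1_comp R sin ( *%R a) x _ _ (is_derive_sin (a * x)) h1.
by apply: is_derive_eq h _; rewrite mulr1 mulrC.
Qed.

Lemma is_derive_cosM (a x : R) : is_derive x 1 (fun t => cos (a * t)) (- a * sin (a * x)).
Proof.
have h1 : is_derive x 1 ( *%R a) (a * 1).
  exact: (is_deriveZf a (@is_derive_id _ _ x 1)).
have h := @is_derive1_comp R cos ( *%R a) x _ _ (is_derive_cos (a * x)) h1.
by apply: is_derive_eq h _; rewrite mulr1 mulrC mulrN mulNr.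
Qed.

Definition cI (f : R -> C) : C := Complex (circ (fun x => Re (f x))) (circ (fun x => Im (f x))).

Lemma cI_lin (a : C) (f g : R -> C) : continuousC f -> continuousC g ->
  cI (fun x => a * f x + g x) = a * cI f + cI g.
Proof.
move=> [rf jf] [rg ig].
have cz (r : R) (h : R -> R) : continuous h -> continuous (fun x => r * h x).
  by move=> ch; apply: continuous_mulR => //; exact: cst_continuous.
apply: C_eq; rewrite !ReImE/=.
  under eq_fun do rewrite !ReImE.
  rewrite circD ?circB ?circZ//; [exact: cz|exact: cz|].
  by move=> x; apply: cvgB; exact: cz.
under eq_fun do rewrite !ReImE.
rewrite circD ?circD ?circZ//; [exact: cz|exact: cz|].
by move=> x; apply: cvgD; exact: cz.
Qed.

Lemma cI_conj (f : R -> C) : continuousC f -> cI (fun x => conjc (f x)) = conjc (cI f).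
Proof.
move=> [rf jf]; apply: C_eq; rewrite !ReImE/=; first by under eq_fun do rewrite Re_conj.
under eq_fun do rewrite Im_conj -mulN1r.
by rewrite circZ// mulN1r.
Qed.

Lemma continuousC_ek k : continuousC (ek k : R -> C).
Proof. by split; [exact: continuous_cosk|exact: continuous_sink]. Qed.

Lemma cI_ek m : cI (ek m) = if m == 0 then realC (pi *+ 2) else 0.
Proof.
have [->|m0] := eqVneq m 0.
  have -> : ek 0 = (fun=> 1) :> (R -> C) by apply/funext => x; rewrite /ek mul0r expi0.
  by rewrite /cI /= !circ_cst mul1r mul0r.
have r0 : (m%:~R : R) != 0 by rewrite intr_eq0.
have := @expi_2pi_int R m; rewrite /expi => -[c1 s0].
have cE : circ (fun x => cos (m%:~R * x)) = 0.
  have := @circ_FTC (fun x => (m%:~R)^-1 * sin (m%:~R * x)) (fun x => cos (m%:~R * x))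
    (@continuous_cosk _ _); rewrite s0 !mulr0 sin0 mulr0 subrr; apply => x.
  apply: is_derive_eq (is_deriveZf _ (is_derive_sinM _ _)) _.
  by rewrite mulrA mulVf// mul1r.
have sE : circ (fun x => sin (m%:~R * x)) = 0.
  have := @circ_FTC (fun x => - (m%:~R)^-1 * cos (m%:~R * x)) (fun x => sin (m%:~R * x))
    (@continuous_sink _ _); rewrite c1 mulr0 cos0 subrr; apply => x.
  apply: is_derive_eq (is_deriveZf _ (is_derive_cosM _ _)) _.
  by rewrite mulrA mulrNN mulVf// mul1r.
by apply: C_eq; rewrite /cI /= ?cE ?sE.
Qed.

Definition fc f k : C := Complex (fourier_cos f k) (- fourier_sin f k).

Lemma sqmod_fc f k : sqmod (fc f k) = fourier_sqnorm f k.
Proof. by rewrite sqmodE /fc /= sqrrN. Qed.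

Lemma fc_lin (a : R) f g k : continuous f -> continuous g ->
  fc (a *: f + g) k = a *: fc f k + fc g k.
Proof.
by move=> cf cg; apply: C_eq; rewrite !ReImE /= ?fourier_cosP// fourier_sinP//; ring.
Qed.

Lemma fcE f k : continuous f ->
  fc f k = (pi *+ 2)^-1 *: cI (fun x => realC (f x) * ek (- k) x).
Proof.
move=> cf; apply: C_eq; rewrite ReZ ImZ || rewrite ?ReZ ?ImZ; rewrite /fc /cI /=.
  rewrite /fourier_cos -/(circ _); congr (_ * circ _); apply/funext => x.
  by rewrite mulrNz mulNr cosN mul0r subr0.
rewrite /fourier_sin -/(circ _) -mulrN; congr (_ * _); rewrite -mulN1r -circZ; last first.
  by apply: continuous_mulR => //; exact: continuous_sink.
congr circ; apply/funext => x; have -> : (- k)%:~R * x = - (k%:~R * x) by rewrite mulrNz mulNr.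
by rewrite sinN mul0r addr0; ring.
Qed.

Lemma cIZ (a : C) (f : R -> C) : continuousC f -> cI (fun x => a * f x) = a * cI f.
Proof.
move=> cf; have := cI_lin a cf (@continuousC0 R); under eq_fun do rewrite addr0; move=> ->.
rewrite (_ : cI (fun=> 0) = 0) ?addr0//.
by apply: C_eq; rewrite /cI/=; under eq_fun do rewrite ?Re0 ?Im0; rewrite circ_cst mul0r.
Qed.

Lemma cI_sum_ek (r : seq int) (a : int -> C) k :
  cI (fun x => \sum_(l <- r) a l * ek (l - k) x) = \sum_(l <- r) a l * cI (ek (l - k)).
Proof.
elim: r => [|l r ih].
  under eq_fun do rewrite big_nil; rewrite big_nil.
  by apply: C_eq; rewrite /cI/=; under eq_fun do rewrite ?Re0 ?Im0; rewrite circ_cst mul0r.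
under eq_fun do rewrite big_cons; rewrite big_cons cI_lin ?ih//; first exact: continuousC_ek.
by apply: continuousC_sum => j; apply: continuousCM; [exact: continuousC_cst|exact: continuousC_ek].
Qed.

Definition coef (g : R -> C) k : C := (pi *+ 2)^-1 *: cI (fun x => g x * ek (- k) x).

Lemma fc_Re (g : R -> C) k : continuousC g ->
  fc (fun x => Re (g x)) k = 2^-1 *: (coef g k + conjc (coef g (- k))).
Proof.
move=> cg; rewrite fcE; last exact: cg.1.
have c1 : continuousC (fun x => g x * ek (- k) x) by apply: continuousCM => //; exact: continuousC_ek.
have c2 : continuousC (fun x => conjc (g x * ek k x)).
  by apply: continuousC_conj; apply: continuousCM => //; exact: continuousC_ek.
have c3 : continuousC (fun x => g x * ek k x) by apply: continuousCM => //; exact: continuousC_ek.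
have -> : (fun x => realC (Re (g x)) * ek (- k) x) =
    (fun x => realC 2^-1 * (g x * ek (- k) x) + realC 2^-1 * conjc (g x * ek k x)).
  apply/funext => x; rewrite ekN.
  by apply: C_eq; rewrite !ReImE /=; field.
rewrite cI_lin//; last by apply: continuousCM => //; exact: continuousC_cst.
rewrite cIZ// cI_conj// /coef opprK.
by apply: C_eq; rewrite !ReImE /=; ring.
Qed.

Lemma coef_ev n (u : int -> R -> C) z k : coef (fun x => ev n u x z) k = trunc n u k z.
Proof.
rewrite /coef; have -> : (fun x => ev n u x z * ek (- k) x) =
    (fun x => \sum_(l <- rng n) u l z * ek (l - k) x).
  by apply/funext => x; rewrite /ev mulr_suml; apply: eq_bigr => l _; rewrite ekD mulrA.
rewrite cI_sum_ek /trunc; case: ifPn => kn.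
  rewrite (bigD1_seq k) ?rng_uniq//= [X in _ + X]big1 ?addr0; last first.
    by move=> l lk; rewrite cI_ek subr_eq0 (negbTE lk) mulr0.
  rewrite cI_ek subrr eqxx; move: (pi *+ 2) (lt0r_neq0 (@twopi_gt0 R)) => p p0.
  by apply: C_eq; rewrite !ReImE /=; field.
rewrite big_seq big1 ?scaler0// => l ln; rewrite cI_ek subr_eq0.
by case: eqVneq => [lk|_]; [move: kn; rewrite -lk ln|rewrite mulr0].
Qed.

Lemma fourier_dist f g k (e : R) : continuous f -> continuous g -> (forall x, `|f x - g x| <= e) ->
  `|fourier_cos f k - fourier_cos g k| <= e /\ `|fourier_sin f k - fourier_sin g k| <= e.
Proof.
move=> cf cg fg.
have one (h : R -> R) : continuous h -> (forall x, `|h x| <= 1) ->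
    `|(pi *+ 2)^-1 * circ (fun x => f x * h x) - (pi *+ 2)^-1 * circ (fun x => g x * h x)| <= e.
  move=> ch h1; rewrite -mulrBr -circB; [|exact: continuous_mulR|exact: continuous_mulR].
  rewrite normrM [`|_^-1|]ger0_norm ?invr_ge0 ?(ltW (@twopi_gt0 R))// mulrC ler_pdivrMr ?twopi_gt0//.
  apply: circ_norm => [|x].
    by move=> x; apply: cvgB; apply: continuous_mulR.
  by rewrite -mulrBl normrM -[leRHS]mulr1; apply: ler_pM.
split; apply: one.
- exact: continuous_cosk.
- by move=> x; rewrite ler_norml cos_geN1 cos_le1.
- exact: continuous_sink.
- by move=> x; rewrite ler_norml sin_geN1 sin_le1.
Qed.

End CircleIntegral.

(** * Traces at fixed height as elements of the Sobolev space *)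

Section TraceOperator.
Context {R : realType} (s : R) (s_gt : 1 < 2 * s).
Notation C := (Rcomplex R).
Notation evS := (evS s_gt).
Implicit Types u v : strip s.

Lemma continuousC_evx n (u : int -> R -> C) z : continuousC (fun x => ev n u x z).
Proof.
by apply: continuousC_sum => k; apply: continuousCM; [exact: continuousC_cst|exact: continuousC_ek].
Qed.

Lemma continuous_evSx u z : continuous (fun x => Re (evS u x z)).
Proof.
move=> x; apply: (@continuous_comp _ _ _ (fun x => (x, z)) (fun p => Re (evS u p.1 p.2))).
  by apply: (@cvg_pair _ _ _ (nbhs x) (nbhs x) (nbhs z) _ _ _ id (cst z)); [exact: cvg_id|exact: cvg_cst].
exact: continuous_evS.
Qed.

(** Taking the real part symmetrises the coefficients. They are read off a partial sum of degree at
    least |k|, where nothing depends on the degree any more. *)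
Lemma fc_evS u z k : fc (fun x => Re (evS u x z)) k = 2^-1 *: (u k z + conjc (u (- k) z)).
Proof.
have key (e : R) : 0 < e ->
    `|Re (fc (fun x => Re (evS u x z)) k) - Re (2^-1 *: (u k z + conjc (u (- k) z)))| <= e /\
    `|Im (fc (fun x => Re (evS u x z)) k) - Im (2^-1 *: (u k z + conjc (u (- k) z)))| <= e.
  move=> /(evS_unif s_gt u)[N hN]; pose n := maxn N (absz k).
  have -> : 2^-1 *: (u k z + conjc (u (- k) z)) = fc (fun x => Re (ev n u x z)) k.
    rewrite fc_Re; last exact: continuousC_evx.
    by rewrite !coef_ev /trunc !mem_rng abszN leq_maxr.
  have h x : `|Re (evS u x z) - Re (ev n u x z)| <= e.
    by apply: le_trans (ReB_le _ _) _; exact: hN (leq_maxl _ _) _ _.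
  have [h1 h2] := fourier_dist k (@continuous_evSx u z) (continuousC_evx n u z).1 h.
  by split; [exact: h1|rewrite /= -opprD normrN; exact: h2].
have zero (a b : R) : (forall e, 0 < e -> `|a - b| <= e) -> a = b.
  move=> h; apply/eqP; rewrite -subr_eq0 -normr_le0; apply/ler_addgt0Pr => e /h.
  by rewrite add0r.
by apply: C_eq; apply: zero => e /key[].
Qed.

Lemma sobolev_weight_le k p : 0 <= p -> sobolev_weight p k <= W (2 * p) k :> R.
Proof.
move=> p0; rewrite /sobolev_weight /W powRrM ge0_ler_powR// ?nnegrE ?powR_ge0 ?addr_ge0 ?sqr_ge0//.
rewrite -[2]/(2%:R) powR_mulrn ?jb_ge0// /jb natr_absz intr_norm.
have := normr_ge0 (k%:~R : R); rewrite -[k%:~R ^+ 2]real_normK ?num_real//; nra.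
Qed.

Lemma le_sobolev_weight k p : 0 <= p -> W (2 * p) k <= 2 `^ p * sobolev_weight p k :> R.
Proof.
move=> p0; rewrite /sobolev_weight /W powRrM -powRM ?addr_ge0 ?sqr_ge0//.
rewrite ge0_ler_powR// ?nnegrE ?powR_ge0 ?mulr_ge0 ?addr_ge0 ?sqr_ge0//.
rewrite -[X in _ `^ X]/(2%:R) powR_mulrn ?jb_ge0// /jb natr_absz intr_norm.
have := normr_ge0 (k%:~R : R); rewrite -[k%:~R ^+ 2]real_normK ?num_real//.
have := sqr_ge0 (1 - `|k%:~R : R|); nra.
Qed.

Lemma esum_int_le (a : int -> R) (M : R) : (forall k, 0 <= a k) ->
  (forall n, \sum_(k <- rng n) a k <= M) -> (\esum_(k in [set: int]) (a k)%:E <= M%:E)%E.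
Proof.
move=> a0 hM; apply: ub_ereal_sup => _ [A [finA _] <-].
rewrite fsbig_finite//= sumEFin lee_fin.
pose n := \max_(k <- finmap.enum_fset (fset_set A)) absz k.
apply: le_trans (hM n); apply: ler_sum_subseq => //; first exact: finmap.fset_uniq.
by move=> k kA; rewrite mem_rng; apply: (leq_bigmax_seq k).
Qed.

Lemma esum_int_ge (a : int -> R) n : (forall k, 0 <= a k) ->
  ((\sum_(k <- rng n) a k)%:E <= \esum_(k in [set: int]) (a k)%:E)%E.
Proof.
move=> a0; apply: esum_ge; exists [set` rng n]; first by split => //; exact: finite_seq.
by rewrite -fsbig_seq ?rng_uniq//= sumEFin.
Qed.

Lemma sobolev_trace_sqnorm u z : (sobolev_sqnorm s (fun x => Re (evS u x z)) <= (`|u| ^+ 2)%:E)%E.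
Proof.
have s0 : 0 <= s by have := s_gt; lra.
apply: esum_int_le => [k|n]; first by rewrite -lee_fin; exact: sobolev_term_ge0.
pose b k := W (2 * s) k * sqmod (u k z).
apply: (@le_trans _ _ (\sum_(k <- rng n) (2^-1 * b k + 2^-1 * b (- k)))).
  apply: ler_sum => k _; rewrite -sqmod_fc fc_evS sqmodZ.
  have -> : 2^-1 * b k + 2^-1 * b (- k) =
    W (2 * s) k * (2^-1 * (sqmod (u k z) + sqmod (u (- k) z))) by rewrite /b W_opp; ring.
  apply: ler_pM; rewrite ?sobolev_weight_le ?(ltW (sobolev_weight_gt0 _ _))//.
    by rewrite mulr_ge0 ?sqr_ge0 ?sqmod_ge0.
  have := sqmodD (u k z) (conjc (u (- k) z)).
  have -> : sqmod (conjc (u (- k) z)) = sqmod (u (- k) z) by rewrite !sqmodE !ReImE; ring.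
  lra.
rewrite big_split/= -!mulr_sumr (sum_rng_opp n b) -mulrDl -[X in X * _]/(2^-1 + 2^-1 : R).
have -> : (2^-1 + 2^-1 : R) = 1 by field.
rewrite mul1r; apply: le_trans (sqn_le_normr u n z); apply: ler_sum => k _.
by rewrite /b ler_wpM2l ?W_ge0// lerDl mulr_ge0 ?jb_ge0 ?sqJ_ge0.
Qed.

Lemma trace_sobolev u z : (fun x => Re (evS u x z)) \in sobolev_fun s.
Proof.
apply/mem_set; split; first exact: continuous_evSx.
  by move=> x; rewrite evS_2pi.
exact: le_lt_trans (sobolev_trace_sqnorm u z) (ltry _).
Qed.

(** With the real part built in, the trace is linear on the whole space and no reality condition has
    to be carried along. *)
Definition trS z u : sobolev s := Sobolev (trace_sobolev u z).

Lemma trS_lin z (a : R) u v : trS z (a *: u + v) = a *: trS z u + trS z v.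
Proof. by apply/val_inj/funext => x /=; rewrite evS_lin !ReImE. Qed.

Lemma trS_norm z u : `|trS z u| <= `|u|.
Proof.
rewrite -[leLHS]/(sobolev_norm (trS z u)) -(@ler_pXn2r _ 2)// ?nnegrE ?sobolev_norm_ge0//.
by rewrite -lee_fin sobolev_normK; exact: sobolev_trace_sqnorm.
Qed.

End TraceOperator.

(** * Lifting the boundary data *)

Section SobolevCoefficients.
Context {R : realType} (s : R).
Notation C := (Rcomplex R).
Implicit Types (f : sobolev s) (k : int) (n : nat).

Lemma sobolev_continuous f : continuous f.
Proof. by have [] := sobolevP f. Qed.

Lemma sobolev_coef_sum f n : 0 <= s ->
  \sum_(k <- rng n) W (2 * s) k * sqmod (fc f k) <= 2 `^ s * `|f| ^+ 2.
Proof.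
move=> s0; apply: (@le_trans _ _ (2 `^ s * \sum_(k <- rng n) sobolev_weight s k * fourier_sqnorm f k)).
  rewrite mulr_sumr; apply: ler_sum => k _; rewrite sqmod_fc mulrA.
  by rewrite ler_wpM2r ?fourier_sqnorm_ge0// le_sobolev_weight.
rewrite ler_wpM2l ?powR_ge0// -lee_fin.
have -> : (`|f| ^+ 2)%:E = sobolev_sqnorm s f by rewrite -sobolev_normK.
apply: esum_int_ge => k; by rewrite mulr_ge0 ?fourier_sqnorm_ge0// ltW// sobolev_weight_gt0.
Qed.

Lemma fc_opp (g : R -> R) k : continuous g -> fc g (- k) = conjc (fc g k).
Proof.
move=> cg; rewrite !fcE// opprK; have cf : continuousC (fun x => realC (g x) * ek (- k) x).
  apply: continuousCM; last exact: continuousC_ek.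
  by split; [exact: cg|exact: cst_continuous].
have -> : conjc ((pi *+ 2)^-1 *: cI (fun x => realC (g x) * ek (- k) x)) =
    (pi *+ 2)^-1 *: cI (fun x => conjc (realC (g x) * ek (- k) x)).
  by rewrite cI_conj//; apply: C_eq; rewrite !ReImE; ring.
congr (_ *: cI _); apply/funext => x; rewrite ekN.
by apply: C_eq; rewrite !ReImE /=; ring.
Qed.

Lemma rng_sum_tail (a : int -> R) (M : R) : (forall k, 0 <= a k) ->
  (forall n, \sum_(k <- rng n) a k <= M) ->
  forall e : R, 0 < e -> exists m, forall n, \sum_(k <- rng n | k \notin rng m) a k <= e.
Proof.
move=> a0 hM e e0; pose A := [set \sum_(k <- rng n) a k | n in [set: nat]].
have hA : has_sup A.
  by split; [exists (\sum_(k <- rng 0) a k); exists 0%N|exists M => _ [n _ <-]].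
have [_ [m _ <-] hm] := sup_adherent e0 hA.
exists m => n; have h : \sum_(k <- rng (maxn n m)) a k <= sup A.
  by apply: sup_upper_bound => //; exists (maxn n m).
have -> : \sum_(k <- rng n | k \notin rng m) a k =
    \sum_(k <- rng n) (if k \in rng m then 0 else a k).
  by rewrite big_mkcond/=; apply: eq_bigr => k _; case: (k \in rng m).
apply: (@le_trans _ _ (\sum_(k <- rng (maxn n m)) (if k \in rng m then 0 else a k))).
  by apply: sum_rng_mono => [|k]; [exact: leq_maxl|case: (k \in rng m)].
have : \sum_(k <- rng (maxn n m)) (if k \in rng m then a k else 0) = \sum_(k <- rng m) a k.
  rewrite (@sum_rng_supp _ m (maxn n m)) ?leq_maxr//.
    by rewrite big_seq [RHS]big_seq; apply: eq_bigr => k ->.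
  by move=> k /negbTE->.
have : \sum_(k <- rng (maxn n m)) a k =
    \sum_(k <- rng (maxn n m)) (if k \in rng m then a k else 0) +
    \sum_(k <- rng (maxn n m)) (if k \in rng m then 0 else a k).
  by rewrite -big_split/=; apply: eq_bigr => k _; case: (k \in rng m); rewrite ?addr0 ?add0r.
move: hm h; lra.
Qed.

End SobolevCoefficients.

(** * Order-one multipliers and the smoothing lifts *)

Section Multipliers.
Context {R : realType} (s : R) (s_gt : 1 < 2 * (s - 1)).
Notation C := (Rcomplex R).
Notation sg := (s - 1).
Notation evS := (evS s_gt).
Implicit Types (f : sobolev s) (k : int) (n : nat) (m : int -> R -> C) (z : R).

(** Multipliers of order one in k, uniformly in z, that gain half a derivative in mean square over
    z. They take $H^s$ into both norms of the strip space at level s - 1. *)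
Record mult_ok (B : R) m : Prop := MultOk {
  mult_ge0 : 0 <= B;
  mult_cont : forall k, continuousC (m k);
  mult_clamp : forall k z, m k (clampz z) = m k z;
  mult_sup : forall k z, sqmod (m k z) <= B * jb k ^+ 2;
  mult_int : forall k, jb k * sqJ (m k) <= B * jb k ^+ 2
}.

Lemma W_shift k : W (2 * s) k = W (2 * sg) k * jb k ^+ 2 :> R.
Proof.
have -> : 2 * s = 2 * sg + (1 + 1) by ring.
by rewrite !WD W1 expr2.
Qed.

Let s0 : 0 <= s. Proof. by have := s_gt; lra. Qed.

Definition liftf m (f : R -> R) : int -> R -> C := fun k z => m k z * fc f k.

Lemma liftf_term (B : R) m f : mult_ok B m -> forall k z,
  W (2 * sg) k * (sqmod (liftf m f k z) + jb k * sqJ (liftf m f k)) <=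
  2 * B * (W (2 * s) k * sqmod (fc f k)).
Proof.
move=> h k z.
have -> : sqJ (liftf m f k) = sqmod (fc f k) * sqJ (m k).
  rewrite /sqJ -JZ; last by apply: continuous_sqmod; exact: mult_cont h k.
  by apply: eq_J => t _; rewrite /liftf sqmodM mulrC.
rewrite /liftf sqmodM W_shift.
have -> : 2 * B * (W (2 * sg) k * jb k ^+ 2 * sqmod (fc f k)) =
  W (2 * sg) k * ((B * jb k ^+ 2 + B * jb k ^+ 2) * sqmod (fc f k)) by ring.
rewrite ler_wpM2l ?W_ge0// [leRHS]mulrDl; apply: lerD.
  by rewrite ler_wpM2r ?sqmod_ge0//; exact: mult_sup h k z.
by rewrite mulrCA mulrC ler_wpM2r ?sqmod_ge0//; exact: mult_int h k.
Qed.

Lemma liftf_strip (B : R) m f : mult_ok B m -> liftf m f \in strip_fun sg /\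
  forall n z, sqn sg n z (liftf m f) <= 2 * B * (2 `^ s * `|f| ^+ 2).
Proof.
move=> h; have B0 := mult_ge0 h.
have cf k : continuousC (liftf m f k).
  by apply: continuousCM; [exact: mult_cont h k|exact: continuousC_cst].
have b n z : sqn sg n z (liftf m f) <= 2 * B * (2 `^ s * `|f| ^+ 2).
  apply: le_trans (ler_wpM2l _ (sobolev_coef_sum f n s0)); last by rewrite mulr_ge0.
  by rewrite mulr_sumr; apply: ler_sum => k _; exact: liftf_term.
split => //; apply/mem_set; split => //.
- by move=> k z; rewrite /liftf (mult_clamp h).
- by exists (2 * B * (2 `^ s * `|f| ^+ 2)).
move=> e e0; pose a k := 2 * B * (W (2 * s) k * sqmod (fc f k)).
have a0 k : 0 <= a k by rewrite /a !mulr_ge0 ?W_ge0 ?sqmod_ge0.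
have hM n : \sum_(k <- rng n) a k <= 2 * B * (2 `^ s * `|f| ^+ 2).
  by rewrite -mulr_sumr ler_wpM2l ?mulr_ge0// sobolev_coef_sum.
have [M hm] := rng_sum_tail a0 hM e0; exists M => n z.
apply: le_trans (hm n); rewrite big_mkcond/=; apply: ler_sum => k _.
case: ifPn => kM; last first.
  by rewrite (eq_sqJ (g := fun=> 0)) /tailz ?(negbNE kM) ?sqmod0 ?sqJ0 ?mulr0 ?addr0 ?mulr0// => t;
    rewrite (negbNE kM).
have -> : sqJ (tailz M (liftf m f) k) = sqJ (liftf m f k).
  by apply: eq_sqJ => t; rewrite /tailz (negbTE kM).
by rewrite {1}/tailz (negbTE kM); exact: liftf_term.
Qed.

Definition liftS (B : R) m (h : mult_ok B m) f : strip sg := Strip (liftf_strip f h).1.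

Lemma liftS_lin (B : R) m (h : mult_ok B m) (a : R) f g :
  liftS h (a *: f + g) = a *: liftS h f + liftS h g.
Proof.
apply: strip_eq => k z; rewrite !stripE /= /liftf.
have -> : fc (a *: f + g) k = a *: fc f k + fc g k.
  exact: (fc_lin a k (@sobolev_continuous _ _ f) (@sobolev_continuous _ _ g)).
by apply: C_eq; rewrite !ReImE; ring.
Qed.

Lemma liftS_norm (B : R) m (h : mult_ok B m) :
  forall f, `|liftS h f| <= Num.sqrt (2 * B * 2 `^ s) * `|f|.
Proof.
move=> f; have B0 := mult_ge0 h; apply: normr_strip_le; first by rewrite mulr_ge0 ?sqrtr_ge0.
move=> n z; rewrite exprMn sqr_sqrtr ?mulr_ge0 ?powR_ge0//.
by have := (liftf_strip f h).2 n z; rewrite !mulrA.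
Qed.

Lemma herm_liftS (B : R) m (h : mult_ok B m) f : herm m -> herm (liftS h f).
Proof.
move=> hm k z; rewrite /= /liftf hm fc_opp; last exact: sobolev_continuous.
by apply: C_eq; rewrite !ReImE; ring.
Qed.

Section Exponential.
Variables (dl : R) (r : R -> R).
Hypotheses (dl0 : 0 < dl) (cr : continuous r) (kr : forall z, r (clampz z) = r z)
  (r01 : forall z, 0 <= r z) (Jr : forall a : R, 0 <= a -> a * J (fun z => expR (- a * r z)) <= 1).

Definition mexp (P : int -> R -> C) k z : C := P k z * realC (expR (- dl * r z * (absz k)%:R)).

(** The polynomial factor supplies the order one and the exponential the gain: $|k|\int
    e^{-2\,dl\,r|k|}\le 1/(2\,dl)$. The summand 1 of the constant accounts for the 1 in [jb]. *)
Lemma mexp_ok (A : R) (P : int -> R -> C) : 0 <= A -> (forall k, continuousC (P k)) ->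
  (forall k z, P k (clampz z) = P k z) -> (forall k z, sqmod (P k z) <= A * jb k ^+ 2) ->
  mult_ok (A * (1 + (2 * dl)^-1)) (mexp P).
Proof.
move=> A0 cP kP hP.
have d1 : 0 <= (2 * dl)^-1 by rewrite invr_ge0 mulr_ge0// ltW.
pose e k z := expR (- dl * r z * (absz k)%:R).
have ce k : continuous (e k).
  move=> z; apply: (@continuous_comp _ _ _ (fun z => - dl * r z * (absz k)%:R) expR).
    by apply: cvgM; [apply: cvgM; [exact: cvg_cst|exact: cr]|exact: cvg_cst].
  exact: continuous_expR.
have e0 k z : 0 <= e k z by exact: expR_ge0.
have e1 k z : e k z <= 1.
  rewrite -expR0 ler_expR mulNr mulNr oppr_le0 !mulr_ge0//; exact: ltW.
have E k z : sqmod (mexp P k z) = sqmod (P k z) * e k z ^+ 2.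
  by rewrite /mexp sqmodM; congr (_ * _); rewrite sqmodE /= expr0n/= addr0.
have B1 : A <= A * (1 + (2 * dl)^-1) by rewrite ler_peMr// lerDl.
split.
- by rewrite mulr_ge0// addr_ge0.
- move=> k; apply: continuousCM => //; split; first exact: ce.
  exact: cst_continuous.
- by move=> k z; rewrite /mexp kP kr.
- move=> k z; rewrite E; apply: (@le_trans _ _ (A * jb k ^+ 2)).
    apply: le_trans (hP k z); rewrite ler_piMr ?sqmod_ge0//.
    by rewrite exprn_ile1.
  by rewrite ler_wpM2r ?exprn_ge0 ?jb_ge0.
- move=> k; have c2 : continuous (fun z => e k z ^+ 2).
    by under eq_fun do rewrite expr2; apply: continuous_mulR.
  have h1 : sqJ (mexp P k) <= A * jb k ^+ 2 * J (fun z => e k z ^+ 2).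
    rewrite -JZ//; apply: J_le.
    + apply: continuous_sqmod; apply: continuousCM => //; split; first exact: ce.
      exact: cst_continuous.
    + by apply: continuous_mulR => //; exact: cst_continuous.
    + by move=> z _; rewrite E ler_wpM2r ?exprn_ge0.
  have h2 : J (fun z => e k z ^+ 2) <= 1.
    rewrite -[leRHS]J_cst; apply: J_le => //; first exact: cst_continuous.
    by move=> z _; rewrite exprn_ile1.
  have h3 : (absz k)%:R * J (fun z => e k z ^+ 2) <= (2 * dl)^-1.
    have a0 : 0 <= 2 * dl * (absz k)%:R by rewrite !mulr_ge0// ltW.
    have := Jr a0; have -> : (fun z => expR (- (2 * dl * (absz k)%:R) * r z)) = (fun z => e k z ^+ 2).
      by apply/funext => z; rewrite /e expr2 -expRD; congr expR; ring.
    by rewrite -mulrA mulrC -ler_pdivlMr ?mulr_gt0// mul1r.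
  apply: le_trans (ler_wpM2l (jb_ge0 k) h1) _.
  have -> : A * (1 + (2 * dl)^-1) * jb k ^+ 2 = A * jb k ^+ 2 * (1 + (2 * dl)^-1) by ring.
  rewrite mulrCA ler_wpM2l ?mulr_ge0 ?exprn_ge0 ?jb_ge0//.
  by rewrite {1}/jb mulrDl mul1r; apply: lerD.
Qed.

End Exponential.

Section ConcreteLifts.
Variables (dl : R) (dl0 : 0 < dl).

(** The distances in z from the surface and from the bottom: the exponential is 1 exactly where
    boundary values have to be reproduced. *)
Definition rtop z : R := 1 - clampz z.
Definition rbot z : R := clampz z.

Lemma continuous_rtop : continuous rtop.
Proof. by move=> z; apply: cvgB; [exact: cvg_cst|exact: continuous_clampz]. Qed.

Lemma rtop_clamp z : rtop (clampz z) = rtop z. Proof. by rewrite /rtop clampzK. Qed.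
Lemma rtop_ge0 z : 0 <= rtop z.
Proof. by rewrite subr_ge0; have /andP[] := clampz_itv z. Qed.
Lemma rbot_ge0 z : 0 <= rbot z. Proof. by have /andP[] := clampz_itv z. Qed.

Lemma continuous_expM (a : R) : continuous (fun z => expR (a * z)).
Proof. by move=> z; exact: is_derive1_continuous (is_derive_expRM a z). Qed.

Lemma J_rbot (a : R) : 0 <= a -> a * J (fun z => expR (- a * rbot z)) <= 1.
Proof.
move=> a0; have -> : J (fun z => expR (- a * rbot z)) = J (fun z => expR (- a * z)).
  by apply: eq_J => z z01; rewrite /rbot clampz_id.
have c : continuous (fun z => - a * expR (- a * z)).
  by apply: continuous_mulR; [exact: cst_continuous|exact: continuous_expM].
have := J_FTC c (fun z _ => is_derive_expRM (- a) z).
rewrite JZ; last exact: continuous_expM.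
rewrite mulr0 expR0 mulr1; have := expR_ge0 (- a); lra.
Qed.

Lemma J_rtop (a : R) : 0 <= a -> a * J (fun z => expR (- a * rtop z)) <= 1.
Proof.
move=> a0; have -> : J (fun z => expR (- a * rtop z)) = J (fun z => expR (- a) * expR (a * z)).
  by apply: eq_J => z z01; rewrite /rtop clampz_id// -expRD; congr expR; ring.
have c : continuous (fun z => a * expR (a * z)).
  by apply: continuous_mulR; [exact: cst_continuous|exact: continuous_expM].
have := J_FTC c (fun z _ => is_derive_expRM a z).
rewrite !JZ; [|exact: continuous_expM|exact: continuous_expM].
rewrite mulr1 mulr0 expR0 mulrCA => ->; rewrite mulrBr mulr1 -expRD addNr expR0.
have := expR_ge0 (- a); lra.
Qed.

(** The flag tells whether d/dx is applied. If so, ik already has order one and [p] must be bounded;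
    otherwise [p] itself may have order one. *)
Definition emul (r : R -> R) (b : bool) (p : int -> R -> R) : int -> R -> C :=
  mexp dl r (fun k z => (if b then ikC k else 1) * realC (p k (clampz z))).

Lemma emul_ok (A : R) (r : R -> R) (b : bool) (p : int -> R -> R) :
  (forall k, continuous (p k)) -> (forall k z, 0 <= z <= 1 -> p k z ^+ 2 <= A * (if b then 1 else jb k ^+ 2)) ->
  0 <= A -> continuous r ->
  (forall z, r (clampz z) = r z) -> (forall z, 0 <= r z) ->
  (forall a : R, 0 <= a -> a * J (fun z => expR (- a * r z)) <= 1) ->
  mult_ok (A * (1 + (2 * dl)^-1)) (emul r b p).
Proof.
move=> cp hp A0 cr kr r0 Jr; apply: mexp_ok => //.
- move=> k; apply: continuousCM; first exact: continuousC_cst.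
  split; last exact: cst_continuous.
  move=> z; apply: (@continuous_comp _ _ _ clampz (p k)); first exact: continuous_clampz.
  exact: cp.
- by move=> k z; rewrite clampzK.
- move=> k z; have h := hp k (clampz z) (clampz_itv z); clear hp.
  have E : sqmod (realC (p k (clampz z)) : C) = p k (clampz z) ^+ 2.
    by rewrite sqmodE /= expr0n/= addr0.
  move: h; rewrite sqmodM E; case: b => h; last first.
    by rewrite sqmodE /= expr1n expr0n/= addr0 mul1r.
  rewrite mulr1 in h; rewrite mulrC; apply: ler_pM => //; rewrite ?sqr_ge0 ?sqmod_ge0//.
  rewrite sqmod_ikC -real_normK ?num_real// ler_pXn2r ?nnegrE ?jb_ge0//.
  exact: normr_int_jb.
Qed.

Lemma herm_emul r b (p : int -> R -> R) : (forall k z, p (- k) z = p k z) -> herm (emul r b p).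
Proof.
move=> hp k z; rewrite /emul /mexp abszN hp; case: b; apply: C_eq;
  by rewrite !ReImE /= ?mulrNz; ring.
Qed.

Definition okA : R := (1 + dl) ^+ 2 * (1 + (2 * dl)^-1).

Lemma emul_sq b k (x : R) : `|x| <= (1 + dl) * (if b then 1 else jb k) ->
  x ^+ 2 <= (1 + dl) ^+ 2 * (if b then 1 else jb k ^+ 2).
Proof.
have d1 : 0 <= 1 + dl by rewrite addr_ge0// ltW.
rewrite -[x ^+ 2]real_normK ?num_real// => h.
have -> : (1 + dl) ^+ 2 * (if b then 1 else jb k ^+ 2) = ((1 + dl) * (if b then 1 else jb k)) ^+ 2.
  by rewrite exprMn; case: b {h}; rewrite ?expr1n.
by rewrite ler_pXn2r ?nnegrE// mulr_ge0//; case: b {h}; rewrite ?jb_ge0.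
Qed.

Lemma ok_top b (p : int -> R -> R) : (forall k, continuous (p k)) ->
  (forall k z, 0 <= z <= 1 -> `|p k z| <= (1 + dl) * (if b then 1 else jb k)) ->
  mult_ok okA (emul rtop b p).
Proof.
move=> cp hp; apply: emul_ok => //.
- by move=> k z z01; have h := hp k z z01; exact (emul_sq h).
- exact: sqr_ge0.
- exact: continuous_rtop.
- exact: rtop_clamp.
- exact: rtop_ge0.
- exact: J_rtop.
Qed.

Lemma ok_bot b (p : int -> R -> R) : (forall k, continuous (p k)) ->
  (forall k z, 0 <= z <= 1 -> `|p k z| <= (1 + dl) * (if b then 1 else jb k)) ->
  mult_ok okA (emul rbot b p).
Proof.
move=> cp hp; apply: emul_ok => //.
- by move=> k z z01; have h := hp k z z01; exact (emul_sq h).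
- exact: sqr_ge0.
- exact: continuous_clampz.
- exact: clampzK.
- exact: rbot_ge0.
- exact: J_rbot.
Qed.

(* The Fourier multipliers of the straightening Y = -h + h z + z E_top eta + (1 - z) E_bot beta
   and of the lift E_top psi of the surface data. *)
Definition psiP k z : R := 1.
Definition psiZ k z : R := dl * (absz k)%:R.
Definition etaP k z : R := z.
Definition etaZ k z : R := 1 + z * (dl * (absz k)%:R).
Definition betaP k z : R := 1 - z.
Definition betaZ k z : R := - (1 + (1 - z) * (dl * (absz k)%:R)).

Lemma continuous_affine (a b : R) : continuous (fun z => a + z * b).
Proof. by move=> z; apply: cvgD; [exact: cvg_cst|apply: cvgMl; exact: cvg_id]. Qed.

Lemma absz_le_jb k : (absz k)%:R <= jb k :> R. Proof. by rewrite /jb lerDr. Qed.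

Lemma mult_bound b k (x : R) : `|x| <= 1 -> `|x| <= (1 + dl) * (if b then 1 else jb k).
Proof.
move=> x1; apply: le_trans x1 _; have := ltW dl0; have := @jb_ge1 R k.
by case: b; nra.
Qed.

Lemma affine_bound k z (t : R) : 0 <= t <= 1 -> `|1 + t * (dl * (absz k)%:R)| <= (1 + dl) * jb k.
Proof.
move=> /andP[t0 t1]; have := ltW dl0; have := absz_le_jb k; have := @jb_ge1 R k.
have n0 : 0 <= (absz k)%:R :> R by [].
move=> j1 kj d0; rewrite ger0_norm ?addr_ge0 ?mulr_ge0//.
apply: (@le_trans _ _ (1 + dl * (absz k)%:R)).
  by rewrite lerD2l ler_piMl// mulr_ge0.
by rewrite mulrDl mul1r lerD// ler_wpM2l.
Qed.

Lemma ok_psiP b : mult_ok okA (emul rtop b psiP).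
Proof.
apply: ok_top => [k|k z z01]; first exact: cst_continuous.
by apply: mult_bound; rewrite normr1.
Qed.

Lemma ok_psiZ : mult_ok okA (emul rtop false psiZ).
Proof.
apply: ok_top => [k|k z z01]; first exact: cst_continuous.
rewrite /psiZ ger0_norm ?mulr_ge0 ?(ltW dl0)//; apply: ler_pM => //; first exact: ltW.
  by rewrite lerDr.
exact: absz_le_jb.
Qed.

Lemma ok_etaP b : mult_ok okA (emul rtop b etaP).
Proof.
apply: ok_top => [k|k z /andP[z0 z1]]; first by move=> z; exact: cvg_id.
by apply: mult_bound; rewrite ger0_norm.
Qed.

Lemma ok_etaZ : mult_ok okA (emul rtop false etaZ).
Proof.
apply: ok_top => [k|k z z01]; first exact: continuous_affine.
exact: affine_bound.
Qed.

Lemma ok_betaP b : mult_ok okA (emul rbot b betaP).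
Proof.
apply: ok_bot => [k|k z /andP[z0 z1]].
  by move=> z; apply: cvgB; [exact: cvg_cst|exact: cvg_id].
by apply: mult_bound; rewrite ger0_norm ?subr_ge0// gerBl.
Qed.

Lemma ok_betaZ : mult_ok okA (emul rbot false betaZ).
Proof.
apply: ok_bot => [k|k z /andP[z0 z1]]; last first.
  by rewrite /betaZ normrN; apply: affine_bound => //; rewrite subr_ge0 z1 gerBl.
rewrite (_ : betaZ k = (fun z => - (1 + dl * (absz k)%:R) + z * (dl * (absz k)%:R))).
  exact: continuous_affine.
by apply/funext => z; rewrite /betaZ; ring.
Qed.

Notation V := (sobolev s * sobolev s)%type.
Implicit Types p : V.

(** The lift of the surface data with its derivatives in x and z, then the part of the straightening
    that is linear in (eta, beta) with its derivatives. The fixed part -h + hz is added in [YS] and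
    [dS]. *)
Definition LP f : strip sg := liftS (ok_psiP false) f.
Definition LPx f : strip sg := liftS (ok_psiP true) f.
Definition LPz f : strip sg := liftS ok_psiZ f.
Definition LY p : strip sg := liftS (ok_etaP false) p.1 + liftS (ok_betaP false) p.2.
Definition Lc p : strip sg := liftS (ok_etaP true) p.1 + liftS (ok_betaP true) p.2.
Definition Ld p : strip sg := liftS ok_etaZ p.1 + liftS ok_betaZ p.2.

Lemma lift2_lin (B B' : R) m m' (h : mult_ok B m) (h' : mult_ok B' m') (a : R) p q :
  liftS h (a *: p + q).1 + liftS h' (a *: p + q).2 =
  a *: (liftS h p.1 + liftS h' p.2) + (liftS h q.1 + liftS h' q.2).
Proof. by rewrite !liftS_lin scalerDr addrACA. Qed.

Lemma lift2_norm (B B' : R) m m' (h : mult_ok B m) (h' : mult_ok B' m') : exists2 K : R, 0 <= K &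
  forall p, `|liftS h p.1 + liftS h' p.2| <= K * `|p|.
Proof.
exists (Num.sqrt (2 * B * 2 `^ s) + Num.sqrt (2 * B' * 2 `^ s)); first by rewrite addr_ge0 ?sqrtr_ge0.
move=> p; apply: le_trans (ler_normD _ _) _; rewrite mulrDl; apply: lerD.
  apply: le_trans (liftS_norm h _) _; rewrite ler_wpM2l ?sqrtr_ge0//; exact: norm_fst_le.
apply: le_trans (liftS_norm h' _) _; rewrite ler_wpM2l ?sqrtr_ge0//; exact: norm_snd_le.
Qed.

Lemma herm_Lc p : herm (Lc p).
Proof. by apply: hermD; apply: herm_liftS; apply: herm_emul. Qed.

Lemma herm_Ld p : herm (Ld p).
Proof.
by apply: hermD; apply: herm_liftS; apply: herm_emul => k z; rewrite ?/etaZ ?/betaZ abszN.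
Qed.

Lemma herm_LY p : herm (LY p).
Proof. by apply: hermD; apply: herm_liftS; apply: herm_emul. Qed.

Lemma emul_ik r (p : int -> R -> R) k z : emul r true p k z = ikC k * emul r false p k z.
Proof. by rewrite /emul /mexp mul1r -mulrA. Qed.

Lemma Lc_ik p k z : Lc p k z = ikC k * LY p k z.
Proof. by rewrite /Lc /LY !stripE /= /liftf !emul_ik -!mulrA -mulrDr. Qed.

Lemma LPx_ik f k z : LPx f k z = ikC k * LP f k z.
Proof. by rewrite /LPx /LP /= /liftf emul_ik -mulrA. Qed.

Lemma emul_slice r b (p : int -> R -> R) k z (a : R) : r z = 0 -> p k (clampz z) = a ->
  emul r b p k z = (if b then ikC k else 1) * realC a.
Proof. by move=> r0 pa; rewrite /emul /mexp r0 pa mulr0 mul0r expR0 mulr1. Qed.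

Lemma clampz1 : clampz 1 = 1 :> R. Proof. by rewrite clampz_id// lexx ler01. Qed.
Lemma clampz0 : clampz 0 = 0 :> R. Proof. by rewrite clampz_id// lexx ler01. Qed.
Lemma realC1 : realC 1 = 1 :> C. Proof. by []. Qed.
Lemma realC0 : realC 0 = 0 :> C. Proof. by []. Qed.

Lemma LP_top f k : LP f k 1 = fc f k.
Proof.
rewrite /LP /= /liftf (@emul_slice _ _ _ _ _ 1)//; first by rewrite realC1 !mul1r.
by rewrite /rtop clampz1 subrr.
Qed.

Lemma LY_top p k : LY p k 1 = fc p.1 k.
Proof.
rewrite /LY !stripE /= /liftf (@emul_slice _ _ _ _ _ 1) ?/rtop ?clampz1 ?subrr//.
rewrite [X in _ + X](_ : _ = 0) ?realC1 ?mul1r ?addr0//.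
by rewrite /emul /mexp /betaP clampz1 subrr realC0 mulr0 !mul0r.
Qed.

Lemma LY_bot p k : LY p k 0 = fc p.2 k.
Proof.
rewrite /LY !stripE /= /liftf [X in _ + X * _](@emul_slice _ _ _ _ _ 1) ?/rbot ?/betaP ?clampz0 ?subr0//.
rewrite [X in X + _](_ : _ = 0) ?realC1 ?mul1r ?add0r//.
by rewrite /emul /mexp /etaP clampz0 realC0 mulr0 !mul0r.
Qed.

Lemma is_deriveC_near (f g : R -> C) z (d : C) : (\forall t \near z, f t = g t) ->
  is_deriveC f z d -> is_deriveC g z d.
Proof.
move=> fg [h1 h2]; split; [apply: near_eq_is_derive h1|apply: near_eq_is_derive h2];
  by near=> t; congr (_ _); near: t.
Unshelve. all: by end_near. Qed.

Lemma is_deriveC_realC (r : R -> R) z (d : R) (w : C) : is_derive z 1 r d ->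
  is_deriveC (fun t => realC (r t) * w) z (realC d * w).
Proof.
move=> h; split.
  have -> : (fun t => Re (realC (r t) * w)) = (fun t => Re w * r t).
    by apply/funext => t; rewrite !ReImE /=; ring.
  by apply: is_derive_eq (is_deriveZf _ h) _; rewrite !ReImE /=; ring.
have -> : (fun t => Im (realC (r t) * w)) = (fun t => Im w * r t).
  by apply/funext => t; rewrite !ReImE /=; ring.
by apply: is_derive_eq (is_deriveZf _ h) _; rewrite !ReImE /=; ring.
Qed.

Lemma clampz_near z : 0 < z < 1 -> \forall t \near z, clampz t = t.
Proof.
move=> /andP[z0 z1]; near=> t; apply: clampz_id; apply/andP; split; apply/ltW; near: t.
  exact: lt_nbhsr.
exact: lt_nbhsl.
Unshelve. all: by end_near. Qed.

Lemma emul_deriv r (p : int -> R -> R) (p' q : R) k z (w : C) : 0 < z < 1 ->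
  is_derive z 1 (fun t => p k t * expR (- dl * r t * (absz k)%:R)) (q * expR (- dl * r z * (absz k)%:R)) ->
  (forall t, r (clampz t) = r t) ->
  is_deriveC (fun t => emul r false p k t * w) z (realC (q * expR (- dl * r z * (absz k)%:R)) * w).
Proof.
move=> z01 h hr; apply: is_deriveC_near (is_deriveC_realC w h).
near=> t; rewrite /emul /mexp mul1r; have -> : clampz t = t by near: t; exact: clampz_near.
by apply: C_eq; rewrite !ReImE /=; ring.
Unshelve. all: by end_near. Qed.

Lemma is_derive_1m z : is_derive z 1 (fun t => 1 - t) (-1).
Proof.
have h := is_deriveBf (@is_derive_cst R R R 1 z 1) (@is_derive_id _ _ z 1).
by apply: is_derive_eq h _; rewrite sub0r.
Qed.

Lemma is_derive_rtop z : 0 < z < 1 -> is_derive z 1 rtop (-1).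
Proof.
move=> z01; apply: near_eq_is_derive (is_derive_1m z).
by near=> t; rewrite /rtop; congr (_ - _); apply: esym; near: t; exact: clampz_near.
Unshelve. all: by end_near. Qed.

Lemma is_derive_rbot z : 0 < z < 1 -> is_derive z 1 rbot 1.
Proof.
move=> z01; apply: near_eq_is_derive (@is_derive_id _ _ z 1).
by near=> t; apply: esym; near: t; exact: clampz_near.
Unshelve. all: by end_near. Qed.

Lemma is_derive_expr (r : R -> R) z (r' a : R) : is_derive z 1 r r' ->
  is_derive z 1 (fun t => expR (- dl * r t * a)) (- dl * r' * a * expR (- dl * r z * a)).
Proof.
move=> h; have h1 : is_derive z 1 (fun t => - dl * r t * a) (- dl * r' * a).
  have -> : (fun t => - dl * r t * a) = (fun t => (- dl * a) * r t).
    by apply/funext => t; ring.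
  by apply: is_derive_eq (is_deriveZf _ h) _; ring.
have := @is_derive1_comp R expR (fun t => - dl * r t * a) z _ _ (is_derive_expR _) h1.
by move=> h2; apply: is_derive_eq h2 _; rewrite mulrC.
Qed.

Lemma LP_deriv f k z : 0 < z < 1 -> is_deriveC (LP f k) z (LPz f k z).
Proof.
move=> z01; have h := is_derive_expr (absz k)%:R (is_derive_rtop z01).
have := @emul_deriv rtop psiP 0 (dl * (absz k)%:R) k z (fc f k) z01 _ rtop_clamp.
have -> : LPz f k z = realC (dl * (absz k)%:R * expR (- dl * rtop z * (absz k)%:R)) * fc f k.
  by rewrite /LPz /= /liftf /emul /mexp /psiZ; apply: C_eq; rewrite !ReImE /=; ring.
apply; have -> : (fun t => psiP k t * expR (- dl * rtop t * (absz k)%:R)) =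
  (fun t => expR (- dl * rtop t * (absz k)%:R)) by apply/funext => t; rewrite mul1r.
by apply: is_derive_eq h _; ring.
Qed.

Lemma LY_deriv p k z : 0 < z < 1 -> is_deriveC (LY p k) z (Ld p k z).
Proof.
move=> z01; have zc : clampz z = z by rewrite clampz_id//; case/andP: z01 => *; rewrite !ltW.
have h1 := is_derive_expr (absz k)%:R (is_derive_rtop z01).
have h2 := is_derive_expr (absz k)%:R (is_derive_rbot z01).
have := @emul_deriv rtop etaP 0 (1 + z * (dl * (absz k)%:R)) k z (fc p.1 k) z01 _ rtop_clamp.
have := @emul_deriv rbot betaP 0 (- (1 + (1 - z) * (dl * (absz k)%:R))) k z (fc p.2 k) z01 _ clampzK.
move=> d2 d1; have {}d1 := d1 _; have {}d2 := d2 _.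
have -> : Ld p k z = realC ((1 + z * (dl * (absz k)%:R)) * expR (- dl * rtop z * (absz k)%:R)) * fc p.1 k +
    realC (- (1 + (1 - z) * (dl * (absz k)%:R)) * expR (- dl * rbot z * (absz k)%:R)) * fc p.2 k.
  rewrite /Ld !stripE /= /liftf /emul /mexp /etaZ /betaZ zc.
  move: (expR (- dl * rtop z * (absz k)%:R)) (expR (- dl * rbot z * (absz k)%:R)) (fc p.1 k) (fc p.2 k) ((absz k)%:R : R) => e1 e2 f1 f2 b.
  by apply: C_eq; rewrite !ReImE /=; ring.
apply: (is_deriveCD (d1 _) (d2 _)).
  apply: is_derive_eq (is_deriveMf (is_derive_id _ _) h1) _.
  by rewrite mul1r; ring.
apply: is_derive_eq (is_deriveMf (is_derive_1m z) h2) _.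
by ring.
Qed.

End ConcreteLifts.

End Multipliers.

(** * Derivatives of limits by the mean value theorem *)

Section DifferenceQuotients.
Context {R : realType}.

Lemma is_derive_dir (V : normedModType R) (f : V -> R) (a v : V) (l : R) :
  (forall e : R, 0 < e -> exists2 d : R, 0 < d & forall h : R, `|h| < d ->
     `|f (h *: v + a) - f a - h * l| <= e * `|h|) -> is_derive a v f l.
Proof.
move=> H.
have cv : (fun h : R => h^-1 *: ((f \o shift a) (h *: v) - f a)) h @[h --> 0^'] --> l.
  apply/cvgrPdist_le => e e0; have [d d0 hd] := H e e0.
  near=> h; have h0 : h != 0 by near: h; exact: nbhs_dnbhs_neq.
  have hd' : `|h| < d by near: h; exact: dnbhs0_lt.
  have := hd h hd'; have hn : 0 < `|h| by rewrite normr_gt0.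
  rewrite /= => hl; rewrite -(ler_pM2r hn) -normrM mulrBl [_ *: _ * h]mulrAC.
  rewrite mulVf// mul1r distrC; apply: le_trans hl; rewrite le_eqVlt; apply/orP; left.
  by apply/eqP; congr `| _ |; rewrite [l * h]mulrC.
split; first by apply/cvg_ex; exists l.
exact: (cvg_lim _ cv).
Unshelve. all: by end_near. Qed.

Lemma mvt_between (f g : R -> R) (a b t u : R) :
  (forall x : R, a < x < b -> is_derive x 1 f (g x)) -> a < t < b -> a < u < b ->
  exists2 c : R, a < c < b /\ `|c - t| <= `|u - t| & f u - f t = g c * (u - t).
Proof.
move=> df /andP[at_ tb] /andP[au ub].
have main (x y : R) : a < x -> y < b -> x <= y -> exists2 c : R, x <= c <= y & f y - f x = g c * (y - x).
  move=> ax yb xy.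
  have d1 z : z \in `]x, y[ -> is_derive z 1 f (g z).
    by rewrite in_itv/= => /andP[z1 z2]; apply: df; rewrite (lt_trans ax z1) (lt_trans z2 yb).
  have c1 : {within `[x, y], continuous f}.
    apply: derivable_within_continuous => z; rewrite in_itv/= => /andP[z1 z2].
    by have [] := df z; rewrite ?(lt_le_trans ax z1) ?(le_lt_trans z2 yb).
  by have [c] := MVT_segment xy d1 c1; rewrite in_itv/= => h1 h2; exists c.
have [tu|/ltW ut] := leP t u.
  have [c /andP[c1 c2] hc] := main _ _ at_ ub tu; exists c => //; split.
    by rewrite (lt_le_trans at_ c1) (le_lt_trans c2 ub).
  by rewrite !ger0_norm ?subr_ge0// lerD2r.
have [c /andP[c1 c2] hc] := main _ _ au tb ut; exists c; last by lra.
split; first by rewrite (lt_le_trans au c1) (le_lt_trans c2 tb).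
by rewrite !ler0_norm ?subr_le0// lerN2 lerD2r.
Qed.

(** A difference quotient of [f_ n] is a value of [g_ n] at an intermediate point; uniform
    convergence and continuity of [g] bring it close to [g t] independently of n. *)
Lemma is_derive_unif_limit (f_ g_ : nat -> R -> R) (f g : R -> R) (a b : R) :
  (forall n (t : R), a < t < b -> is_derive t 1 (f_ n) (g_ n t)) ->
  (forall t : R, a < t < b -> (fun n => f_ n t) @ \oo --> f t) ->
  (forall e : R, 0 < e -> exists N, forall n, (N <= n)%N -> forall t : R, `|g_ n t - g t| <= e) ->
  continuous g -> forall t : R, a < t < b -> is_derive t 1 f (g t).
Proof.
move=> dfn cvf unif cg t tab; apply: is_derive_dir => e e0.
have e2 : 0 < e / 2 by rewrite divr_gt0.
have [N hN] := unif _ e2.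
have /cvgrPdist_le/(_ _ e2)/nbhs_ballP[d /= d0 hd] := cg t.
pose m := Num.min d (Num.min (t - a) (b - t)).
exists m; first by rewrite /m !lt_min d0 !subr_gt0; exact: tab.
move=> h; rewrite /m !lt_min => /and3P[hd1 hd2 hd3].
have htab : a < h + t < b.
  by move: hd2 hd3; rewrite !ltr_norml => /andP[? ?] /andP[? ?]; apply/andP; split; lra.
have -> : h *: (1 : R) + t = h + t by rewrite /GRing.scale/= mulr1.
have key n : (N <= n)%N -> `|f_ n (h + t) - f_ n t - h * g t| <= e * `|h|.
  move=> Nn; have [c [cab ct] ->] := mvt_between (dfn n) tab htab.
  have -> : g_ n c * (h + t - t) - h * g t = ((g_ n c - g c) - (g t - g c)) * h by ring.
  rewrite normrM ler_wpM2r//; apply: le_trans (ler_normB _ _) _.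
  have h1 := hN n Nn c; have h2 : `|g t - g c| <= e / 2.
    by apply: hd; rewrite /ball/= distrC; apply: le_lt_trans ct _; rewrite addrK.
  lra.
have cv : (fun n => `|f_ n (h + t) - f_ n t - h * g t|) @ \oo --> `|f (h + t) - f t - h * g t|.
  apply: cvg_norm; apply: cvgB; last exact: cvg_cst.
  by apply: cvgB; exact: cvf.
apply: (ler_cvg_to cv (cvg_cst _)); near=> n; apply: key; near: n; exact: nbhs_infty_ge.
Unshelve. all: by end_near. Qed.

End DifferenceQuotients.

(** * Termwise differentiation and the primitives phi and theta *)

Section TermwiseDerivatives.
Context {R : realType} (s : R) (s_gt : 1 < 2 * s).
Notation C := (Rcomplex R).
Notation evS := (evS s_gt).
Implicit Types (u v : strip s) (k : int) (n : nat) (x z : R).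

Lemma is_deriveC_Mr (f : R -> C) z (d w : C) : is_deriveC f z d ->
  is_deriveC (fun t => f t * w) z (d * w).
Proof.
move=> [h1 h2]; split.
  have -> : (fun t => Re (f t * w)) = (fun t => Re w * Re (f t) - Im w * Im (f t)).
    by apply/funext => t; rewrite !ReImE; ring.
  by apply: is_derive_eq (is_deriveBf (is_deriveZf _ h1) (is_deriveZf _ h2)) _; rewrite !ReImE; ring.
have -> : (fun t => Im (f t * w)) = (fun t => Im w * Re (f t) + Re w * Im (f t)).
  by apply/funext => t; rewrite !ReImE; ring.
by apply: is_derive_eq (is_deriveDf (is_deriveZf _ h1) (is_deriveZf _ h2)) _; rewrite !ReImE; ring.
Qed.

Lemma is_deriveC_sum (I : Type) (r : seq I) (f : I -> R -> C) z (d : I -> C) :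
  (forall i, is_deriveC (f i) z (d i)) ->
  is_deriveC (fun t => \sum_(i <- r) f i t) z (\sum_(i <- r) d i).
Proof.
move=> h; elim: r => [|i r ih].
  rewrite big_nil (_ : (fun _ => _) = (fun=> 0)); last by apply/funext => t; rewrite big_nil.
  by split; exact: is_derive_cst.
rewrite big_cons (_ : (fun _ => _) = (fun t => f i t + \sum_(j <- r) f j t)); last first.
  by apply/funext => t; rewrite big_cons.
exact: is_deriveCD.
Qed.

Lemma is_deriveC_ek k x : is_deriveC (ek k) x (ikC k * ek k x : C).
Proof.
split.
  by apply: is_derive_eq (is_derive_cosM _ _) _; rewrite !ReImE /=; ring.
by apply: is_derive_eq (is_derive_sinM _ _) _; rewrite !ReImE /=; ring.
Qed.

Lemma evS_slice u v x z z' : (forall k, u k z = v k z') -> evS u x z = evS v x z'.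
Proof.
move=> h; have E n : ev n u x z = ev n v x z' by apply: eq_bigr => k _; rewrite h.
by apply: evS_eq; under eq_fun do rewrite E; [exact: evS_cvgRe|exact: evS_cvgIm].
Qed.

Lemma continuous_evSz u x : continuous (fun z => Re (evS u x z)).
Proof.
move=> z; apply: (@continuous_comp _ _ _ (fun z => (x, z)) (fun p => Re (evS u p.1 p.2))).
  by apply: (@cvg_pair _ _ _ (nbhs z) (nbhs x) (nbhs z) _ _ _ (cst x) id); [exact: cvg_cst|exact: cvg_id].
exact: continuous_evS.
Qed.

Lemma evS_dx u v z : (forall k, v k z = ikC k * u k z) ->
  forall x, is_derive x 1 (fun x => Re (evS u x z)) (Re (evS v x z)).
Proof.
move=> uv x.
apply: (@is_derive_unif_limit _ (fun n x => Re (ev n u x z)) (fun n x => Re (ev n v x z)) _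
  (fun x => Re (evS v x z)) (x - 1) (x + 1)).
- move=> n t _.
  have h k : is_deriveC (fun x => u k z * ek k x) t (v k z * ek k t).
    have := is_deriveC_Mr (u k z) (is_deriveC_ek k t).
    have -> : (fun x => ek k x * u k z) = (fun x => u k z * ek k x).
      by apply/funext => y; rewrite mulrC.
    by rewrite uv; congr is_deriveC; rewrite mulrC mulrCA mulrA.
  exact: (is_deriveC_sum (rng n) h).1.
- by move=> t _; exact: evS_cvgRe.
- move=> e /(evS_unif s_gt v)[N hN]; exists N => n Nn t; rewrite distrC.
  by apply: le_trans (ReB_le _ _) _; exact: hN.
- exact: continuous_evSx.
- by apply/andP; split; lra.
Qed.

Lemma evS_dz u v x z : (forall k z, 0 < z < 1 -> is_deriveC (u k) z (v k z)) -> 0 < z < 1 ->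
  is_derive z 1 (fun z => Re (evS u x z)) (Re (evS v x z)).
Proof.
move=> uv.
apply: (@is_derive_unif_limit _ (fun n z => Re (ev n u x z)) (fun n z => Re (ev n v x z)) _
  (fun z => Re (evS v x z)) 0 1).
- move=> n t t01.
  exact: (is_deriveC_sum (rng n) (fun k => is_deriveC_Mr (ek k x) (uv k t t01))).1.
- by move=> t _; exact: evS_cvgRe.
- move=> e /(evS_unif s_gt v)[N hN]; exists N => n Nn t; rewrite distrC.
  by apply: le_trans (ReB_le _ _) _; exact: hN.
- exact: continuous_evSz.
Qed.

(** For k different from 0, [u] is dominated by ik u. Mode 0 is bounded by compactness of [0, 1],
    and it never belongs to a tail. *)
Lemma primitive_strip (u : int -> R -> C) v : (forall k, continuousC (u k)) ->
  (forall k z, u k (clampz z) = u k z) -> (forall k z, v k z = ikC k * u k z) ->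
  u \in strip_fun s.
Proof.
move=> cu ku uv.
have sq k z : k != 0 -> sqmod (u k z) <= sqmod (v k z).
  move=> k0; rewrite uv sqmodM ler_peMl ?sqmod_ge0// sqmod_ikC -rmorphXn/=.
  rewrite -[1]/(1%:~R) ler_int; move: k0; case: k => [[|k]|k]//= _; nia.
have sqj k : k != 0 -> sqJ (u k) <= sqJ (v k).
  move=> k0; apply: J_le => [| |z _]; last exact: sq.
    exact: continuous_sqmod.
  by apply: continuous_sqmod; exact: strip_continuous.
have term k z : k != 0 -> W (2 * s) k * (sqmod (u k z) + jb k * sqJ (u k)) <=
    W (2 * s) k * (sqmod (v k z) + jb k * sqJ (v k)).
  by move=> k0; rewrite ler_wpM2l ?W_ge0// lerD ?sq// ler_wpM2l ?jb_ge0// sqj.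
have [_ _ [M hM] tl] := stripP v.
apply/mem_set; split => //.
- have [B hB] : exists B, forall z : R, sqmod (u 0 z) <= B.
    have cn : {within `[0, 1], continuous (fun z => sqmod (u 0 z))}.
      by apply: continuous_subspaceT; exact: continuous_sqmod.
    have [c _ hc] := EVT_max (@ler01 R) cn.
    exists (sqmod (u 0 c)) => z; rewrite -ku; apply: hc; rewrite in_itv/=; exact: clampz_itv.
  exists (B + sqJ (u 0) + M) => n z; apply: le_trans (lerD (lexx _) (hM n z)).
  have n0 : 0 \in rng n by rewrite mem_rng.
  rewrite /sqn !(bigD1_seq 0 n0 (rng_uniq n))/=.
  have -> : W (2 * s) 0 = 1 :> R by rewrite /W /jb absz0 addr0 powR1.
  have -> : jb 0 = 1 :> R by rewrite /jb absz0 addr0.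
  rewrite !mul1r; apply: lerD; first by rewrite lerD2r.
  rewrite -[leLHS]add0r; apply: lerD; first by rewrite addr_ge0 ?sqmod_ge0 ?sqJ_ge0.
  by apply: ler_sum => k; exact: term.
- move=> e /tl[m hm]; exists m => n z; apply: le_trans (hm n z).
  apply: ler_sum => k _; rewrite /tailz; case: ifPn => km; first by [].
  by apply: term; apply: contraNneq km => ->; rewrite mem_rng.
Qed.

Definition flatPhi (g : strip s * strip s) : int -> R -> C := fun k z => flat_phi g k (clampz z).
Definition flatTheta (g : strip s * strip s) : int -> R -> C := fun k z => flat_theta g k (clampz z).

Lemma flatPhi_strip g : flatPhi g \in strip_fun s.
Proof.
apply: (@primitive_strip _ (SX1 g)) => //.
  by move=> k; have [_ _ _ dp] := flat_solP g k; exact: continuousC_clamp_deriv dp.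
by move=> k z; rewrite /flatPhi clampzK.
Qed.

Lemma flatTheta_strip g : flatTheta g \in strip_fun s.
Proof.
apply: (@primitive_strip _ (SX2 g)) => //.
  by move=> k; have [_ _ dt _] := flat_solP g k; exact: continuousC_clamp_deriv dt.
by move=> k z; rewrite /flatTheta clampzK.
Qed.

Definition SP g : strip s := Strip (flatPhi_strip g).
Definition ST g : strip s := Strip (flatTheta_strip g).

Lemma SP_top g k : SP g k 1 = 0.
Proof. by rewrite /= /flatPhi clampz_id ?lexx ?ler01//; have [] := flat_solP g k. Qed.

Lemma ST_bot g k : ST g k 0 = 0.
Proof. by rewrite /= /flatTheta clampz_id ?lexx ?ler01//; have [] := flat_solP g k. Qed.

Lemma SP_ik g k z : SX1 g k z = ikC k * SP g k z. Proof. by []. Qed.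
Lemma ST_ik g k z : SX2 g k z = ikC k * ST g k z. Proof. by []. Qed.

Lemma SP_deriv g k z : 0 < z < 1 -> is_deriveC (SP g k) z (SZ1 g k z).
Proof.
move=> z01; have z01' : 0 <= z <= 1 by case/andP: z01 => *; rewrite !ltW.
have [h _] := flat_derivs (flat_solP g k) z01'.
apply: is_deriveC_near h; near=> t; rewrite /= /flatPhi; congr flat_phi.
by apply: esym; near: t; exact: clampz_near.
Unshelve. all: by end_near. Qed.

Lemma ST_deriv g k z : 0 < z < 1 -> is_deriveC (ST g k) z (SZ2 g k z).
Proof.
move=> z01; have z01' : 0 <= z <= 1 by case/andP: z01 => *; rewrite !ltW.
have [_ h] := flat_derivs (flat_solP g k) z01'.
apply: is_deriveC_near h; near=> t; rewrite /= /flatTheta; congr flat_theta.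
by apply: esym; near: t; exact: clampz_near.
Unshelve. all: by end_near. Qed.

End TermwiseDerivatives.

(** * Recovery of boundary values and positivity of the vertical derivative *)

Section Inversion.
Context {R : realType} (s : R) (s_gt : 1 < 2 * (s - 1)).
Notation C := (Rcomplex R).
Notation sg := (s - 1).
Notation evS := (evS s_gt).
Implicit Types (f : sobolev s) (k : int) (n : nat) (x z : R).

(** The function and the trace of its lift have the same Fourier coefficients, so uniqueness for
    continuous periodic functions applies to their difference. *)
Lemma fourier_inversion dl (dl0 : 0 < dl) f x : Re (evS (LP s_gt dl0 f) x 1) = f x.
Proof.
pose h : R -> R := fun x => Re (evS (LP s_gt dl0 f) x 1).
have cf := @sobolev_continuous _ _ f; have ch : continuous h by exact: continuous_evSx.
have [_ pf _] := sobolevP f.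
have fh k : fc h k = fc f k.
  by rewrite fc_evS !LP_top fc_opp//; apply: C_eq; rewrite !ReImE; field.
have E : (-1 *: h + (f : R -> R)) = (fun x => f x - h x).
  by apply/funext => t; rewrite -[LHS]/(-1 * h t + f t); ring.
have c0 : continuous (-1 *: h + (f : R -> R)) by rewrite E => t; apply: cvgB; [exact: cf|exact: ch].
have p0 : periodic (-1 *: h + (f : R -> R)) (pi *+ 2).
  by rewrite E => t /=; rewrite pf /h evS_2pi.
have f0 k : fourier_sqnorm (-1 *: h + (f : R -> R)) k = 0.
  rewrite -sqmod_fc fc_lin// fh.
  by rewrite sqmodE !ReImE; ring.
have E0 := fourier_uniq c0 p0 f0.
by have := congr1 (fun F => F x) E0; rewrite E /= => /eqP; rewrite subr_eq0 => /eqP ->.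
Qed.

Lemma LY_top_val dl (dl0 : 0 < dl) p x : Re (evS (LY s_gt dl0 p) x 1) = p.1 x.
Proof.
have -> : evS (LY s_gt dl0 p) x 1 = evS (LP s_gt dl0 p.1) x 1.
  by apply: evS_slice => k; rewrite LY_top LP_top.
exact: fourier_inversion.
Qed.

Lemma LY_bot_val dl (dl0 : 0 < dl) p x : Re (evS (LY s_gt dl0 p) x 0) = p.2 x.
Proof.
have -> : evS (LY s_gt dl0 p) x 0 = evS (LP s_gt dl0 p.2) x 1.
  by apply: evS_slice => k; rewrite LY_bot LP_top.
exact: fourier_inversion.
Qed.

(** Both multipliers of the vertical derivative have this form up to sign, with a = dl |k|, and t =
    z for the surface, t = 1 - z for the bottom. *)
Lemma multiplier_near1 (a t : R) : 0 <= a -> 0 <= t <= 1 ->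
  `|(1 + t * a) * expR (- a * (1 - t)) - 1| <= a.
Proof.
move=> a0 /andP[t0 t1]; set e := expR _.
have e0 : 0 < e by exact: expR_gt0.
have ta : 0 <= t * a by rewrite mulr_ge0.
have e1 : e <= 1 by rewrite /e -[leRHS]expR0 ler_expR mulNr oppr_le0 mulr_ge0// subr_ge0.
have e2 : 1 - a * (1 - t) <= e.
  by have := expR_ge1Dx (- a * (1 - t)); rewrite -/e; lra.
rewrite ler_norml; apply/andP; split; nra.
Qed.

(** At dl = 0 the vertical derivative would be eta - beta exactly. The error in mode k is of size dl
    |k|, and |k| times the coefficients is summable because s - 1 > 1/2. *)
Lemma Ld_near : exists2 K : R, 0 <= K & forall dl (dl0 : 0 < dl) p x z,
  `|Re (evS (Ld s_gt dl0 p) x z) - (p.1 x - p.2 x)| <= dl * (K * `|p|).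
Proof.
have [K K0 hK] := l1_le_weighted s_gt.
have s0 : 0 <= s by have := s_gt; lra.
pose A f := Num.sqrt (K * (2 `^ s * `|f| ^+ 2)).
have sumf f n : \sum_(k <- rng n) (absz k)%:R * cmod (fc f k) <= A f.
  apply: hK => [k|m]; first by rewrite mulr_ge0 ?cmod_ge0.
  apply: le_trans (sobolev_coef_sum f m s0); apply: ler_sum => k _.
  rewrite (@W_shift _ s k) -mulrA ler_wpM2l ?W_ge0// exprMn cmod2 ler_wpM2r ?sqmod_ge0//.
  by rewrite ler_pXn2r ?nnegrE ?jb_ge0//; exact: absz_le_jb.
have AE f : A f = Num.sqrt (K * 2 `^ s) * `|f|.
  by rewrite /A mulrA sqrtrM ?mulr_ge0 ?powR_ge0// sqrtr_sqr ger0_norm.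
exists (2 * Num.sqrt (K * 2 `^ s)); first by rewrite mulr_ge0 ?sqrtr_ge0.
move=> dl dl0 p x z.
have key n : `|Re (ev n (Ld s_gt dl0 p) x z) -
    (Re (ev n (LP s_gt dl0 p.1) x 1) - Re (ev n (LP s_gt dl0 p.2) x 1))| <= dl * (A p.1 + A p.2).
  have -> : Re (ev n (Ld s_gt dl0 p) x z) -
    (Re (ev n (LP s_gt dl0 p.1) x 1) - Re (ev n (LP s_gt dl0 p.2) x 1)) =
    Re (\sum_(k <- rng n) (Ld s_gt dl0 p k z - (fc p.1 k - fc p.2 k)) * ek k x).
    rewrite /ev !Re_sum -!sumrB; apply: eq_bigr => k _; rewrite !LP_top.
    by move: (Ld _ _ _ _ _) (fc _ _) (fc _ _) (ek _ _) => a b c e; rewrite !ReImE; ring.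
  apply: le_trans (Re_le_cmod _) _; apply: le_trans (cmod_sum _ _ _) _.
  apply: le_trans (ler_wpM2l (ltW dl0) (lerD (sumf p.1 n) (sumf p.2 n))).
  rewrite -big_split/= mulr_sumr; apply: ler_sum => k _.
  rewrite cmodM cmod_ek mulr1.
  set t := clampz z; have t01 : 0 <= t <= 1 by exact: clampz_itv.
  have t01' : 0 <= 1 - t <= 1 by case/andP: t01 => *; apply/andP; split; lra.
  set a := dl * (absz k)%:R; have a0 : 0 <= a by rewrite mulr_ge0// ltW.
  have h1 := multiplier_near1 a0 t01; have h2 := multiplier_near1 a0 t01'.
  have -> : Ld s_gt dl0 p k z - (fc p.1 k - fc p.2 k) =
     ((1 + t * a) * expR (- a * (1 - t)) - 1) *: fc p.1 k -
     ((1 + (1 - t) * a) * expR (- a * (1 - (1 - t))) - 1) *: fc p.2 k.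
    rewrite /Ld !stripE /= /liftf /emul /mexp /etaZ /betaZ /rtop /rbot -/t -/a.
    have -> : - dl * (1 - t) * (absz k)%:R = - a * (1 - t) by rewrite /a; ring.
    have -> : - dl * t * (absz k)%:R = - a * (1 - (1 - t)) by rewrite /a; ring.
    move: (expR (- a * (1 - t))) (expR (- a * (1 - (1 - t)))) (fc p.1 k) (fc p.2 k) => e1 e2 f1 f2.
    by clear; clearbody a t; apply: C_eq; rewrite !ReImE /=; ring.
  have cZ (r : R) (w : C) : cmod (r *: w) = `|r| * cmod w.
    by rewrite /cmod sqmodZ sqrtrM ?sqr_ge0// sqrtr_sqr.
  have cN (w : C) : cmod (- w) = cmod w by rewrite /cmod sqmodN.
  apply: le_trans (cmodD _ _) _; rewrite cN !cZ.
  have -> : dl * ((absz k)%:R * cmod (fc p.1 k) + (absz k)%:R * cmod (fc p.2 k)) =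
    a * cmod (fc p.1 k) + a * cmod (fc p.2 k) by rewrite /a; ring.
  by apply: lerD; rewrite ler_wpM2r ?cmod_ge0.
have cv : (fun n => `|Re (ev n (Ld s_gt dl0 p) x z) -
    (Re (ev n (LP s_gt dl0 p.1) x 1) - Re (ev n (LP s_gt dl0 p.2) x 1))|) @ \oo -->
    `|Re (evS (Ld s_gt dl0 p) x z) - (p.1 x - p.2 x)|.
  rewrite -(fourier_inversion dl0 p.1 x) -(fourier_inversion dl0 p.2 x).
  apply: cvg_norm; apply: cvgB; first exact: evS_cvgRe.
  by apply: cvgB; exact: evS_cvgRe.
apply: le_trans (ler_cvg_to cv (cvg_cst (dl * (A p.1 + A p.2))) _) _.
  by near=> n; exact: key.
rewrite ler_wpM2l ?(ltW dl0)// !AE -mulrDr.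
have -> : 2 * Num.sqrt (K * 2 `^ s) * `|p| = Num.sqrt (K * 2 `^ s) * (2 * `|p|) by ring.
by rewrite ler_wpM2l ?sqrtr_ge0//; exact: le_add2 (norm_fst_le p) (norm_snd_le p).
Unshelve. all: by end_near. Qed.

End Inversion.

(** * Straightening the fluid domain *)

Section PlaneDifferentials.
Context {R : realType}.
Implicit Types (f : R * R -> R) (p q : R * R) (Om : set (R * R)).

Lemma cont2_eps f p : {for p, continuous f} <-> forall e : R, 0 < e -> exists2 d : R, 0 < d &
  forall q, `|q.1 - p.1| < d -> `|q.2 - p.2| < d -> `|f q - f p| <= e.
Proof.
split=> [cf e e0|H].
  have /cvgrPdist_le/(_ _ e0)/nbhs_ballP[d /= d0 hd] := cf.
  exists d => // q h1 h2; rewrite distrC; apply: hd; split; rewrite /ball/= distrC//.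
apply/cvgrPdist_le => e /H[d d0 hd]; have := nbhsx_ballx p d d0; apply: filterS => q [].
by rewrite /ball/= => h1 h2; rewrite distrC; apply: hd; rewrite distrC.
Qed.

(** Total differentiability with gradient (A, B), over square neighbourhoods, which suit estimates
    made one coordinate at a time. *)
Definition diff2 f p (A B : R) := forall e : R, 0 < e -> exists2 d : R, 0 < d &
  forall q, `|q.1 - p.1| < d -> `|q.2 - p.2| < d ->
    `|f q - f p - A * (q.1 - p.1) - B * (q.2 - p.2)| <= e * (`|q.1 - p.1| + `|q.2 - p.2|).

Lemma diff2_x f p A B : diff2 f p A B -> is_derive p ((1, 0) : R * R) f A.
Proof.
move=> H; apply: is_derive_dir => e e0; have [d d0 hd] := H e e0.
exists d => // t td; have E : t *: ((1, 0) : R * R) + p = (p.1 + t, p.2).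
  rewrite [LHS]surjective_pairing; congr (_, _).
    by rewrite -[LHS]/(t * 1 + p.1) mulr1 addrC.
  by rewrite -[LHS]/(t * 0 + p.2) mulr0 add0r.
have := hd (p.1 + t, p.2); rewrite /= addrAC subrr add0r subrr normr0 mulr0 subr0 addr0.
by rewrite E [t * A]mulrC; apply.
Qed.

Lemma diff2_y f p A B : diff2 f p A B -> is_derive p ((0, 1) : R * R) f B.
Proof.
move=> H; apply: is_derive_dir => e e0; have [d d0 hd] := H e e0.
exists d => // t td; have E : t *: ((0, 1) : R * R) + p = (p.1, p.2 + t).
  rewrite [LHS]surjective_pairing; congr (_, _).
    by rewrite -[LHS]/(t * 0 + p.1) mulr0 add0r.
  by rewrite -[LHS]/(t * 1 + p.2) mulr1 addrC.
have := hd (p.1, p.2 + t); rewrite /= subrr normr0 mulr0 subr0 addrAC subrr !add0r.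
by rewrite E [t * B]mulrC; apply.
Qed.

Lemma diff2_of_partials (F Fx Fz : R -> R -> R) (a b : R) :
  continuous (fun q : R * R => Fx q.1 q.2) -> continuous (fun q : R * R => Fz q.1 q.2) ->
  (forall x z : R, a < z < b -> is_derive x 1 (fun x => F x z) (Fx x z)) ->
  (forall x z : R, a < z < b -> is_derive z 1 (F x) (Fz x z)) ->
  forall p, a < p.2 < b -> diff2 (fun q => F q.1 q.2) p (Fx p.1 p.2) (Fz p.1 p.2).
Proof.
move=> cx cz dx dz p /andP[pa pb] e e0.
have [d1 d10 h1] := (cont2_eps _ p).1 (cx p) e e0.
have [d2 d20 h2] := (cont2_eps _ p).1 (cz p) e e0.
exists (Num.min (Num.min d1 d2) (Num.min (p.2 - a) (b - p.2))).
  by rewrite !lt_min d10 d20 !subr_gt0 pa.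
move=> q; rewrite !lt_min => /andP[/andP[x1 x2] /andP[x3 x4]] /andP[/andP[y1 y2] /andP[y3 y4]].
have qab : a < q.2 < b.
  by move: y3 y4; clear; rewrite !ltr_norml => /andP[? ?] /andP[? ?]; apply/andP; split; lra.
have [c1 [_ c1p] E1] := @mvt_between R (fun x => F x q.2) (fun x => Fx x q.2)
  (p.1 - (`|q.1 - p.1| + 1)) (p.1 + (`|q.1 - p.1| + 1)) p.1 q.1 (fun x _ => dx x q.2 qab)
  ltac:(clear; have := normr_ge0 (q.1 - p.1); by move=> ?; apply/andP; split; lra)
  ltac:(clear; have := ler_norm (q.1 - p.1); have := ler_norm (- (q.1 - p.1)); rewrite normrN; by move=> ? ?; apply/andP; split; lra).
have pab : a < p.2 < b by rewrite pa.
have [c2 [_ c2p] E2] := @mvt_between R (F p.1) (Fz p.1) a b p.2 q.2 (fun z h => dz p.1 z h) pab qab.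
have -> : F q.1 q.2 - F p.1 p.2 - Fx p.1 p.2 * (q.1 - p.1) - Fz p.1 p.2 * (q.2 - p.2) =
   (Fx c1 q.2 - Fx p.1 p.2) * (q.1 - p.1) + (Fz p.1 c2 - Fz p.1 p.2) * (q.2 - p.2).
  by rewrite !mulrBl -E1 -E2; ring.
apply: le_trans (ler_normD _ _) _; rewrite !normrM mulrDr; apply: lerD; rewrite ler_wpM2r//.
  by apply: (h1 (c1, q.2)) => //=; exact: le_lt_trans c1p _.
apply: (h2 (p.1, c2)) => /=; first by rewrite subrr normr0.
exact: le_lt_trans c2p _.
Qed.

End PlaneDifferentials.

(** * The inverse of the change of variables *)

Section Straightening.
Context {R : realType}.
Variables (Y c d : R -> R -> R) (kap L : R).
Hypotheses (kap0 : 0 < kap)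
  (cY : continuous (fun q : R * R => Y q.1 q.2))
  (cc : continuous (fun q : R * R => c q.1 q.2))
  (cd : continuous (fun q : R * R => d q.1 q.2))
  (dYx : forall x z : R, 0 <= z <= 1 -> is_derive x 1 (fun x => Y x z) (c x z))
  (dYz : forall x z : R, 0 < z < 1 -> is_derive z 1 (Y x) (d x z))
  (cL : forall x z : R, `|c x z| <= L) (dk : forall x z : R, kap <= d x z).

Let Yx x : continuous (Y x).
Proof.
move=> z; apply: (@continuous_comp _ _ _ (fun z => (x, z)) (fun q => Y q.1 q.2)); last exact: cY.
by apply: (@cvg_pair _ _ _ (nbhs z) (nbhs x) (nbhs z) _ _ _ (cst x) id); [exact: cvg_cst|exact: cvg_id].
Qed.

(** Beyond [0, 1] the map continues with slope [kap], so at each x it is an increasing bijection of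
    R and its inverse is defined on the whole plane. *)
Definition Yext x z : R := Y x (clampz z) + kap * (z - clampz z).

Lemma Y_mono x z z' : 0 <= z -> z <= z' -> z' <= 1 -> kap * (z' - z) <= Y x z' - Y x z.
Proof.
move=> z0 zz z1; have d1 t : t \in `]z, z'[ -> is_derive t 1 (Y x) (d x t).
  rewrite in_itv/= => /andP[t1 t2]; apply: dYz.
  by rewrite (le_lt_trans z0 t1) (lt_le_trans t2 z1).
have c1 : {within `[z, z'], continuous (Y x)} by apply: continuous_subspaceT; exact: Yx.
by have [t _ ->] := MVT_segment zz d1 c1; rewrite ler_wpM2r ?subr_ge0.
Qed.

Lemma clampz_mono z z' : z <= z' -> clampz z <= clampz z' :> R.
Proof.
move=> zz; rewrite /clampz; case: (leP z 1) => h1; case: (leP z' 1) => h2; rewrite /Num.max;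
  by repeat case: ifP => ?; lra.
Qed.

Lemma Yext_mono x z z' : z <= z' -> kap * (z' - z) <= Yext x z' - Yext x z.
Proof.
move=> zz; have /andP[a0 a1] := clampz_itv z; have /andP[b0 b1] := clampz_itv z'.
have := Y_mono x a0 (clampz_mono zz) b1; rewrite /Yext; lra.
Qed.

Lemma Yext_dist x z z' : kap * `|z' - z| <= `|Yext x z' - Yext x z|.
Proof.
have [zz|/ltW zz] := leP z z'.
  have h := Yext_mono x zz; rewrite [`|z' - z|]ger0_norm ?subr_ge0//.
  exact: le_trans h (ler_norm _).
have h := Yext_mono x zz; rewrite distrC [`|Yext _ _ - _|]distrC [`|z - z'|]ger0_norm ?subr_ge0//.
exact: le_trans h (ler_norm _).
Qed.

Lemma continuous_Yext x : continuous (Yext x).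
Proof.
move=> z; apply: cvgD.
  apply: (@continuous_comp _ _ _ clampz (Y x)); [exact: continuous_clampz|exact: Yx].
by apply: cvgMr; apply: cvgB; [exact: cvg_id|exact: continuous_clampz].
Qed.

Lemma Yext_surj x y : exists z, Yext x z = y.
Proof.
pose M := `|y - Yext x 0| / kap.
have M0 : 0 <= M by rewrite divr_ge0// ltW.
have kM : kap * M = `|y - Yext x 0| by rewrite /M mulrC divfK// gt_eqF.
have h1 : Yext x (- M) <= y.
  have := @Yext_mono x (- M) 0; rewrite oppr_le0 sub0r opprK => /(_ M0).
  rewrite kM; have := ler_norm (- (y - Yext x 0)); rewrite normrN; lra.
have h2 : y <= Yext x M.
  have := @Yext_mono x 0 M M0; rewrite subr0 kM; have := ler_norm (y - Yext x 0); lra.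
have MM : - M <= M by lra.
have cn : {within `[- M, M], continuous (Yext x)}.
  by apply: continuous_subspaceT; exact: continuous_Yext.
have [|z _ hz] := IVT MM cn (v := y); last by exists z.
by rewrite ge_min h1/= le_max h2 orbT.
Qed.

Definition Zinv (q : R * R) : R := projT1 (cid (Yext_surj q.1 q.2)).

Lemma ZinvK q : Yext q.1 (Zinv q) = q.2.
Proof. exact: projT2 (cid (Yext_surj q.1 q.2)). Qed.

Lemma Yext_inj x z z' : Yext x z = Yext x z' -> z = z'.
Proof.
move=> E; have := Yext_dist x z' z; rewrite E subrr normr0 pmulr_rle0// normr_le0.
by rewrite subr_eq0 => /eqP.
Qed.

Lemma Zinv_Y x z : 0 <= z <= 1 -> Zinv (x, Y x z) = z.
Proof.
move=> z01; apply: (@Yext_inj x); rewrite (ZinvK (x, Y x z))/= /Yext clampz_id//.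
by rewrite subrr mulr0 addr0.
Qed.

Lemma Y_lip x x' z : 0 <= z <= 1 -> `|Y x' z - Y x z| <= L * `|x' - x|.
Proof.
move=> z01; have [u [_ _] ->] := @mvt_between R (fun x => Y x z) (fun x => c x z)
  (x - (`|x' - x| + 1)) (x + (`|x' - x| + 1)) x x' (fun t _ => dYx t z01)
  ltac:(have := normr_ge0 (x' - x); by move=> ?; apply/andP; split; lra)
  ltac:(have := ler_norm (x' - x); have := ler_norm (- (x' - x)); rewrite normrN; by move=> ? ?; apply/andP; split; lra).
by rewrite normrM ler_wpM2r.
Qed.

Lemma Zinv_lip p q : kap * `|Zinv q - Zinv p| <= L * `|q.1 - p.1| + `|q.2 - p.2|.
Proof.
apply: le_trans (Yext_dist p.1 _ _) _; rewrite ZinvK.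
have -> : Yext p.1 (Zinv q) - p.2 = (Yext p.1 (Zinv q) - Yext q.1 (Zinv q)) + (q.2 - p.2).
  by rewrite ZinvK; ring.
apply: le_trans (ler_normD _ _) _; rewrite lerD2r distrC.
have -> : Yext q.1 (Zinv q) - Yext p.1 (Zinv q) =
  Y q.1 (clampz (Zinv q)) - Y p.1 (clampz (Zinv q)) by rewrite /Yext; ring.
exact: Y_lip (clampz_itv _).
Qed.

Let L0 : 0 <= L. Proof. exact: le_trans (normr_ge0 _) (cL 0 0). Qed.

Lemma Zinv_lip1 p q : `|Zinv q - Zinv p| <= (L + 1) / kap * (`|q.1 - p.1| + `|q.2 - p.2|).
Proof.
rewrite mulrAC ler_pdivlMr// mulrC; apply: le_trans (Zinv_lip p q) _.
have := mulr_ge0 L0 (normr_ge0 (q.2 - p.2)); have := normr_ge0 (q.1 - p.1); lra.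
Qed.

Lemma continuous_Zinv : continuous Zinv.
Proof.
move=> p; apply/cont2_eps => e e0.
pose K := (L + 1) / kap; have K0 : 0 < K by rewrite divr_gt0// ltr_wpDl.
exists (e / (2 * K)) => [|q h1 h2]; first by rewrite divr_gt0// mulr_gt0.
apply: le_trans (Zinv_lip1 p q) _; rewrite -/K.
have : K * (`|q.1 - p.1| + `|q.2 - p.2|) <= K * (e / (2 * K) + e / (2 * K)).
  by rewrite ler_wpM2l ?(ltW K0)// lerD// ltW.
move=> /le_trans; apply; rewrite le_eqVlt; apply/orP; left; apply/eqP; field; exact: lt0r_neq0.
Qed.

Lemma continuous_pull (F : R -> R -> R) : continuous (fun q : R * R => F q.1 q.2) ->
  continuous (fun q : R * R => F q.1 (Zinv q)).
Proof.
move=> cF p; apply: (@continuous_comp _ _ _ (fun q : R * R => (q.1, Zinv q)) (fun q => F q.1 q.2)).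
  by apply: (@cvg_pair _ _ _ (nbhs p) (nbhs p.1) (nbhs (Zinv p)) _ _ _ fst Zinv);
    [exact: cvg_fst|exact: continuous_Zinv].
exact: cF.
Qed.

Definition strip_domain : set (R * R) := [set q | Y q.1 0 < q.2 < Y q.1 1].

Lemma strip_domainP q : strip_domain q <-> 0 < Zinv q < 1.
Proof.
have E z : 0 <= z <= 1 -> Yext q.1 z = Y q.1 z.
  by move=> z01; rewrite /Yext clampz_id// subrr mulr0 addr0.
have e0 : Yext q.1 0 = Y q.1 0 by apply: E; rewrite lexx ler01.
have e1 : Yext q.1 1 = Y q.1 1 by apply: E; rewrite lexx ler01.
rewrite /strip_domain/= -e0 -e1 -{1 2}(ZinvK q).
have mono z z' : Yext q.1 z < Yext q.1 z' <-> z < z'.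
  split=> h; rewrite ltNge; apply/negP => h'.
    have h1 := Yext_mono q.1 h'.
    have h2 : 0 <= kap * (z - z') by rewrite mulr_ge0 ?subr_ge0 ?(ltW kap0).
    lra.
  have := Yext_mono q.1 (ltW h); have : 0 < kap * (z' - z) by rewrite mulr_gt0// subr_gt0.
  lra.
by split=> /andP[/mono h1 /mono h2]; apply/andP.
Qed.

Lemma strip_domain_nbhs p : strip_domain p -> exists2 r : R, 0 < r & forall q,
  `|q.1 - p.1| < r -> `|q.2 - p.2| < r -> strip_domain q.
Proof.
move=> /strip_domainP/andP[z0 z1].
pose e := Num.min (Zinv p) (1 - Zinv p) / 2.
have m0 : 0 < Num.min (Zinv p) (1 - Zinv p) by rewrite lt_min z0 subr_gt0.
have e0 : 0 < e by rewrite divr_gt0.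
have [r r0 hr] := (cont2_eps _ p).1 (@continuous_Zinv p) e e0.
exists r => // q h1 h2; apply/strip_domainP.
have := hr q h1 h2; rewrite ler_norml /e => /andP[g1 g2].
have : Num.min (Zinv p) (1 - Zinv p) <= Zinv p by rewrite ge_min lexx.
have : Num.min (Zinv p) (1 - Zinv p) <= 1 - Zinv p by rewrite ge_min lexx orbT.
by move=> ? ?; apply/andP; split; lra.
Qed.

(** The inverse is not differentiated separately: the first-order expansion of [Y], solved for the
    increment of z, is inserted into that of [F]. The Lipschitz bound of [Zinv] controls the
    remainders. *)
Lemma diff2_pull (F Fx Fz : R -> R -> R) :
  continuous (fun q : R * R => Fx q.1 q.2) -> continuous (fun q : R * R => Fz q.1 q.2) ->
  (forall x z : R, 0 < z < 1 -> is_derive x 1 (fun x => F x z) (Fx x z)) ->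
  (forall x z : R, 0 < z < 1 -> is_derive z 1 (F x) (Fz x z)) ->
  forall p, strip_domain p -> diff2 (fun q => F q.1 (Zinv q)) p
    (Fx p.1 (Zinv p) - Fz p.1 (Zinv p) * (c p.1 (Zinv p) / d p.1 (Zinv p)))
    (Fz p.1 (Zinv p) / d p.1 (Zinv p)).
Proof.
move=> cFx cFz dFx dFz p Op e e0.
have z01 := (strip_domainP p).1 Op.
set z := Zinv p in z01 *; set A := Fx _ _; set B := Fz _ _; set c0 := c _ _; set d0 := d _ _.
have d00 : 0 < d0 by exact: lt_le_trans (dk _ _).
have dFp := diff2_of_partials cFx cFz dFx dFz (p := (p.1, z)) z01.
have itvW (t : R) : 0 < t < 1 -> 0 <= t <= 1 by move=> /andP[/ltW-> /ltW->].
have dYp := diff2_of_partials cc cd (fun x t h => dYx x (itvW t h)) dYz (p := (p.1, z)) z01.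
rewrite /= -/A -/B -/c0 -/d0 in dFp dYp.
pose K := 1 + (L + 1) / kap.
have K0 : 0 < K by rewrite /K ltr_wpDr// divr_ge0 ?(ltW kap0)// addr_ge0.
pose M := K * (1 + `|B| / d0); have M0 : 0 < M by rewrite mulr_gt0// ltr_wpDr// divr_ge0// ltW.
have e'0 : 0 < e / M by rewrite divr_gt0.
have [r1 r10 h1] := dFp _ e'0; have [r2 r20 h2] := dYp _ e'0.
have [r3 r30 h3] := strip_domain_nbhs Op.
have r0 : 0 < Num.min r1 r2 by rewrite lt_min r10 r20.
have r02 : 0 < Num.min r1 r2 / 2 by rewrite divr_gt0.
have [r4 r40 h4] := (cont2_eps _ p).1 (@continuous_Zinv p) _ r02.
exists (Num.min (Num.min r1 r2) (Num.min r3 r4)).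
  by rewrite lt_min r0 lt_min r30 r40.
move=> q; rewrite !lt_min => /andP[/andP[x1 x2] /andP[x3 x4]] /andP[/andP[y1 y2] /andP[y3 y4]].
have q01 := (strip_domainP q).1 (h3 q x3 y3).
have Zr : `|Zinv q - z| < Num.min r1 r2.
  by apply: le_lt_trans (h4 q x4 y4) _; rewrite ltr_pdivrMr// ltr_pMr// ltr1n.
move: Zr; rewrite lt_min => /andP[Z1 Z2].
have Eq (w : R * R) : 0 < Zinv w < 1 -> w.2 = Y w.1 (Zinv w).
  move=> /andP[w0 w1]; rewrite -[LHS]ZinvK /Yext clampz_id ?(ltW w0) ?(ltW w1)//.
  by rewrite subrr mulr0 addr0.
have g1 := h1 (q.1, Zinv q) x1 Z1; have g2 := h2 (q.1, Zinv q) x2 Z2.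
rewrite /= -(Eq q q01) -(Eq p z01) in g1 g2.
have lipZ : `|q.1 - p.1| + `|Zinv q - z| <= K * (`|q.1 - p.1| + `|q.2 - p.2|).
  have := Zinv_lip1 p q; rewrite -/z /K mulrDl mul1r.
  have := normr_ge0 (q.2 - p.2); lra.
set dx := q.1 - p.1 in g1 g2 lipZ *; set dy := q.2 - p.2 in g2 lipZ *.
set dz := Zinv q - z in g1 g2 lipZ *; set S := `|dx| + `|dy| in lipZ *.
set dF := F q.1 (Zinv q) - F p.1 z in g1 *.
have -> : dF - (A - B * (c0 / d0)) * dx - B / d0 * dy =
    (dF - A * dx - B * dz) - B / d0 * (dy - c0 * dx - d0 * dz).
  by field; exact: lt0r_neq0.
have T : e / M * (`|dx| + `|dz|) <= e / M * (K * S) by rewrite ler_wpM2l// ltW.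
apply: le_trans (ler_normB _ _) _; rewrite normrM.
have b1 := le_trans g1 T; have b2 := le_trans g2 T.
have Bd : `|B / d0| = `|B| / d0 by rewrite normrM [`|d0^-1|]ger0_norm// invr_ge0 ltW.
rewrite Bd.
have b3 : `|B| / d0 * `|dy - c0 * dx - d0 * dz| <= `|B| / d0 * (e / M * (K * S)).
  by rewrite ler_wpM2l// divr_ge0// ltW.
apply: le_trans (lerD b1 b3) _.
have -> : e / M * (K * S) + `|B| / d0 * (e / M * (K * S)) = e / M * M * S by rewrite /M; ring.
by rewrite divfK// gt_eqF.
Qed.

End Straightening.

(** * Interior regularity of Cauchy-Riemann pairs *)

Section PowerSeries.
Context {R : realType}.
Notation C := (Rcomplex R).
Implicit Types (B : nat -> C) (w v : C) (n N : nat) (r rho sig : R).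

Definition psum r B := forall rho, 0 <= rho -> rho < r ->
  exists K : R, forall N, \sum_(n < N) cmod (B n) * rho ^+ n <= K.

Definition psD B n : C := n.+1%:R *: B n.+1.

(** If f is the real part of a power series, f_x is the real part of its derivative and f_y that of
    i times its derivative; both are again of the same kind. *)
Definition imul B n : C := imagC 1 * B n.

Lemma cmod1 : cmod (1 : C) = 1.
Proof. by rewrite /cmod sqmodE /= expr1n expr0n /= addr0 sqrtr1. Qed.

Lemma cmodX w n : cmod (w ^+ n) = cmod w ^+ n.
Proof. by elim: n => [|n ih]; rewrite ?expr0 ?cmod1// !exprS cmodM ih. Qed.

Lemma cmod_imul B n : cmod (imul B n) = cmod (B n).
Proof.
rewrite /imul cmodM (_ : cmod (imagC 1) = 1) ?mul1r//.
by rewrite /cmod sqmodE /= expr1n expr0n /= add0r sqrtr1.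
Qed.

Lemma psum_imul r B : psum r B -> psum r (imul B).
Proof.
by move=> h rho r0 rr; have [K hK] := h rho r0 rr; exists K => N; under eq_bigr do rewrite cmod_imul.
Qed.

(** The tangent to the n-th power at [rho] lies below its graph at [sig]; the factor n is thus
    traded for a slightly larger radius. *)
Lemma bernoulli_pow rho sig n : 0 <= rho -> rho < sig ->
  n%:R * rho ^+ n.-1 <= sig ^+ n / (sig - rho).
Proof.
move=> r0 rs; have d0 : 0 < sig - rho by rewrite subr_gt0.
rewrite ler_pdivlMr//; elim: n => [|n ih]; first by rewrite !mul0r expr0.
have s0 : 0 <= sig by rewrite (le_trans r0)// ltW.
have E : n.+1%:R * rho ^+ n * (sig - rho) =
    rho * (n%:R * rho ^+ n.-1 * (sig - rho)) + rho ^+ n * (sig - rho).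
  case: n {ih} => [|n]; first by rewrite !expr0 mul0r; ring.
  by rewrite -natr1 [n.+1.-1]/= exprS; ring.
rewrite [n.+1.-1]/= E exprS.
have h1 : rho * (n%:R * rho ^+ n.-1 * (sig - rho)) <= rho * sig ^+ n by rewrite ler_wpM2l.
have h2 : rho ^+ n * (sig - rho) <= sig ^+ n * (sig - rho).
  by rewrite ler_wpM2r ?(ltW d0)// lerXn2r ?nnegrE// ltW.
apply: le_trans (lerD h1 h2) _; rewrite le_eqVlt; apply/orP; left; apply/eqP; ring.
Qed.

Lemma psum_D r B : psum r B -> psum r (psD B).
Proof.
move=> h rho r0 rr; pose sig := (rho + r) / 2.
have rs : rho < sig by rewrite /sig; lra.
have sr : sig < r by rewrite /sig; lra.
have [K hK] := h sig (le_trans r0 (ltW rs)) sr.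
have d0 : 0 <= (sig - rho)^-1 by rewrite invr_ge0 subr_ge0 ltW.
exists ((sig - rho)^-1 * K) => N.
apply: le_trans (ler_wpM2l d0 (hK N.+1)).
rewrite big_ord_recl /= expr0 mulr1 mulrDr; apply: (@le_trans _ _ (0 +
  (sig - rho)^-1 * \sum_(i < N) cmod (B (bump 0 i)) * sig ^+ bump 0 i)); last first.
  by rewrite lerD2r mulr_ge0// cmod_ge0.
rewrite add0r mulr_sumr; apply: ler_sum => i _; rewrite /psD cmodZ ger0_norm//.
have := @bernoulli_pow rho sig i.+1 r0 rs; rewrite [i.+1.-1]/= => hb.
rewrite /bump /= add1n.
have -> : i.+1%:R * cmod (B i.+1) * rho ^+ i = cmod (B i.+1) * (i.+1%:R * rho ^+ i) by ring.
have -> : (sig - rho)^-1 * (cmod (B i.+1) * sig ^+ i.+1) =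
  cmod (B i.+1) * (sig ^+ i.+1 / (sig - rho)) by ring.
by rewrite ler_wpM2l ?cmod_ge0.
Qed.

Definition pps N B w : R := \sum_(n < N) Re (B n * w ^+ n).

Lemma partial_sum_gap (f g : nat -> R) M N : (forall n, `|f n| <= g n) -> (M <= N)%N ->
  `|\sum_(n < N) f n - \sum_(n < M) f n| <= \sum_(n < N) g n - \sum_(n < M) g n.
Proof.
move=> fg MN; rewrite -(subnKC MN); elim: (N - M)%N => [|k ih].
  by rewrite addn0 !subrr normr0.
rewrite addnS !big_ord_recr /=.
have E (x y z : R) : x + y - z = (x - z) + y by ring.
by rewrite !E; apply: le_trans (ler_normD _ _) _; exact: lerD.
Qed.

Lemma psum_tail r B rho : psum r B -> 0 <= rho -> rho < r ->
  forall e : R, 0 < e -> exists M, forall N w, (M <= N)%N -> cmod w <= rho ->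
    `|pps N B w - pps M B w| <= e.
Proof.
move=> h r0 rr e e0; have [K hK] := h rho r0 rr.
pose S N := \sum_(n < N) cmod (B n) * rho ^+ n.
pose A := [set S N | N in [set: nat]].
have hA : has_sup A by split; [exists (S 0%N); exists 0%N|exists K => _ [N _ <-]; exact: hK].
have [_ [M _ <-] hM] := sup_adherent e0 hA; exists M => N w MN wr.
have hN : S N <= sup A by apply: sup_upper_bound => //; exists N.
apply: (@le_trans _ _ (S N - S M)); last by lra.
apply: (@partial_sum_gap (fun n => Re (B n * w ^+ n)) (fun n => cmod (B n) * rho ^+ n) M N) => // n.
apply: le_trans (Re_le_cmod _) _; rewrite cmodM cmodX ler_wpM2l ?cmod_ge0//.
by rewrite lerXn2r ?nnegrE ?cmod_ge0.
Qed.

Lemma pps_limit r B : psum r B -> exists F : C -> R, forall rho, 0 <= rho -> rho < r ->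
  forall e : R, 0 < e -> exists M, forall N w, (M <= N)%N -> cmod w <= rho ->
    `|pps N B w - F w| <= e.
Proof.
move=> h.
have lim w : exists l, cmod w < r -> forall e : R, 0 < e -> exists M, forall N, (M <= N)%N ->
    `|pps N B w - l| <= e.
  have [wr|_] := ltP (cmod w) r; last by exists 0.
  have [|l hl] := @cauchy_real_cvg _ (fun N => pps N B w).
    move=> e e0; have e2 : 0 < e / 2 by rewrite divr_gt0.
    have [M hM] := psum_tail h (cmod_ge0 w) wr e2; exists M => m n Mm Mn.
    have -> : pps m B w - pps n B w = (pps m B w - pps M B w) - (pps n B w - pps M B w) by ring.
    apply: le_trans (ler_normB _ _) _; have := hM m w Mm (lexx _); have := hM n w Mn (lexx _); lra.
  by exists l.
exists (fun w => projT1 (cid (lim w))) => rho r0 rr e e0.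
have e2 : 0 < e / 2 by rewrite divr_gt0.
have [M hM] := psum_tail h r0 rr e2; exists M => N w MN wr.
apply/ler_addgt0Pr => d d0.
have [M' hM'] := projT2 (cid (lim w)) (le_lt_trans wr rr) d d0.
have h1 := hM' _ (leq_maxr M M').
have h2 := hM _ w (leq_maxl M M') wr; have h3 := hM N w MN wr.
set l := projT1 _ in h1 *; set Q := maxn M M' in h1 h2.
have -> : pps N B w - l = (pps N B w - pps M B w) - (pps Q B w - pps M B w) + (pps Q B w - l) by ring.
apply: le_trans (ler_normD _ _) _; apply: lerD => //.
by apply: le_trans (ler_normB _ _) _; lra.
Qed.

Definition psv r B (h : psum r B) : C -> R := projT1 (cid (pps_limit h)).

Lemma psvP r B (h : psum r B) rho : 0 <= rho -> rho < r ->
  forall e : R, 0 < e -> exists M, forall N w, (M <= N)%N -> cmod w <= rho ->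
    `|pps N B w - psv h w| <= e.
Proof. exact: projT2 (cid (pps_limit h)) rho. Qed.

Lemma psv_cvg r B (h : psum r B) w : cmod w < r -> pps N B w @[N --> \oo] --> psv h w.
Proof.
move=> wr; apply/cvgrPdist_le => e e0; have [M hM] := psvP h (cmod_ge0 w) wr e0.
by exists M => // N /= MN; rewrite distrC; exact: hM.
Qed.

Lemma pow_remainder rho sig w v n : 0 <= rho -> rho < sig -> cmod w <= rho -> cmod v <= rho ->
  cmod (v ^+ n - w ^+ n - (n%:R *: w ^+ n.-1) * (v - w)) <=
  sig ^+ n / (sig - rho) ^+ 2 * cmod (v - w) ^+ 2.
Proof.
move=> r0 rs wr vr; have d0 : 0 < sig - rho by rewrite subr_gt0.
have s0 : 0 <= sig by rewrite (le_trans r0)// ltW.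
elim: n => [|n ih].
  by rewrite !expr0 scale0r mul0r subrr subr0 cmod0 !mulr_ge0 ?invr_ge0 ?exprn_ge0 ?cmod_ge0// ltW.
(* The remainder of order n + 1 is v times that of order n, plus a term that already carries the
   square of v - w. *)
have -> : v ^+ n.+1 - w ^+ n.+1 - (n.+1%:R *: w ^+ n.+1.-1) * (v - w) =
    v * (v ^+ n - w ^+ n - (n%:R *: w ^+ n.-1) * (v - w)) + (n%:R *: w ^+ n.-1) * (v - w) ^+ 2.
  have ZE (a : nat) (x : C) : a%:R *: x = a%:R * x.
    by elim: a => [|a iha]; [rewrite scale0r mul0r|rewrite -!natr1 scalerDl mulrDl iha scale1r mul1r].
  rewrite !ZE; case: n {ih} => [|n]; first by rewrite !expr0 !expr1; ring.
  by rewrite [n.+2.-1]/= [n.+1.-1]/= -!natr1 !exprS; ring.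
apply: le_trans (cmodD _ _) _; rewrite cmodM [X in _ + X]cmodM.
have h1 : cmod v * cmod (v ^+ n - w ^+ n - (n%:R *: w ^+ n.-1) * (v - w)) <=
    rho * (sig ^+ n / (sig - rho) ^+ 2 * cmod (v - w) ^+ 2).
  by apply: ler_pM; rewrite ?cmod_ge0.
have h2 : cmod (n%:R *: w ^+ n.-1) * cmod ((v - w) ^+ 2) <=
    sig ^+ n / (sig - rho) * cmod (v - w) ^+ 2.
  rewrite [cmod (_ ^+ 2)]cmodX ler_wpM2r ?exprn_ge0 ?cmod_ge0//.
  apply: le_trans (@bernoulli_pow rho sig n r0 rs).
  by rewrite cmodZ ger0_norm// ler_wpM2l// cmodX lerXn2r ?nnegrE ?cmod_ge0.
apply: le_trans (lerD h1 h2) _; rewrite le_eqVlt; apply/orP; left; apply/eqP.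
move: (cmod (v - w) ^+ 2) => X; rewrite [sig ^+ n.+1]exprS; move: (sig ^+ n) => Y.
by field; exact: lt0r_neq0.
Qed.

(** A quadratic remainder, uniform on smaller discs, for partial sums and hence for the limit; it
    identifies the gradient at every point. *)
Lemma psv_diff r B (h : psum r B) (hD : psum r (psD B)) (hI : psum r (imul (psD B))) rho :
  0 <= rho -> rho < r -> exists K : R, 0 <= K /\ forall w v, cmod w <= rho -> cmod v <= rho ->
  `|psv h v - psv h w - psv hD w * Re (v - w) - psv hI w * Im (v - w)| <= K * cmod (v - w) ^+ 2.
Proof.
move=> r0 rr; pose sig := (rho + r) / 2.
have rs : rho < sig by rewrite /sig; lra.
have sr : sig < r by rewrite /sig; lra.
have d0 : 0 < sig - rho by rewrite subr_gt0.
have [K hK] := h sig (le_trans r0 (ltW rs)) sr.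
have K0 : 0 <= K by have := hK 0%N; rewrite big_ord0.
have i0 : 0 <= ((sig - rho) ^+ 2)^-1 by rewrite invr_ge0 exprn_ge0// ltW.
exists (K / (sig - rho) ^+ 2); split; first by rewrite mulr_ge0.
move=> w v wr vr.
(* The shift by one matches the sums: a partial sum with N + 1 terms has a derivative with N
   terms. *)
have key N : `|pps N.+1 B v - pps N.+1 B w - pps N (psD B) w * Re (v - w) -
    pps N (imul (psD B)) w * Im (v - w)| <= K / (sig - rho) ^+ 2 * cmod (v - w) ^+ 2.
  have -> : pps N.+1 B v - pps N.+1 B w - pps N (psD B) w * Re (v - w) -
      pps N (imul (psD B)) w * Im (v - w) =
      \sum_(n < N.+1) Re (B n * (v ^+ n - w ^+ n - (n%:R *: w ^+ n.-1) * (v - w))).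
    have Hs : pps N (psD B) w * Re (v - w) + pps N (imul (psD B)) w * Im (v - w) =
        \sum_(n < N.+1) Re (B n * ((n%:R *: w ^+ n.-1) * (v - w))).
      rewrite big_ord_recl /= scale0r mul0r mulr0 Re0 add0r /pps !mulr_suml -big_split/=.
      apply: eq_bigr => n _; rewrite /bump /= add1n add0n /imul /psD.
      by move: (v - w) (w ^+ n) (B n.+1) (n.+1%:R : R) => t x y a; rewrite !ReImE /=; ring.
    transitivity (pps N.+1 B v - pps N.+1 B w - (pps N (psD B) w * Re (v - w) +
      pps N (imul (psD B)) w * Im (v - w))); first by ring.
    rewrite Hs /pps -!sumrB; apply: eq_bigr => n _.
    rewrite !mulrBr; move: (B n * v ^+ n) (B n * w ^+ n) (B n * _) => a b c.
    by rewrite !ReImE /=; ring.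
  apply: le_trans (ler_norm_sum _ _ _) _.
  apply: (@le_trans _ _ (\sum_(n < N.+1) (cmod (B n) * sig ^+ n) *
      (((sig - rho) ^+ 2)^-1 * cmod (v - w) ^+ 2))).
    apply: ler_sum => n _; apply: le_trans (Re_le_cmod _) _.
    rewrite cmodM -!mulrA ler_wpM2l ?cmod_ge0// mulrA.
    exact: pow_remainder.
  rewrite -mulr_suml -mulrA; apply: ler_wpM2r; last exact: hK.
  by apply: mulr_ge0 => //; rewrite exprn_ge0// cmod_ge0.
have wr' := le_lt_trans wr rr; have vr' := le_lt_trans vr rr.
have shift (b : nat -> C) (hb : psum r b) u : cmod u < r -> pps N.+1 b u @[N --> \oo] --> psv hb u.
  by move=> ur; have := @psv_cvg _ b hb u ur; rewrite -cvg_shiftS.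
have cv : (fun N => `|pps N.+1 B v - pps N.+1 B w - pps N (psD B) w * Re (v - w) -
    pps N (imul (psD B)) w * Im (v - w)|) @ \oo -->
  `|psv h v - psv h w - psv hD w * Re (v - w) - psv hI w * Im (v - w)|.
  apply: cvg_norm; apply: cvgB; last by apply: cvgMl; exact: psv_cvg.
  apply: cvgB; last by apply: cvgMl; exact: psv_cvg.
  by apply: cvgB; exact: shift.
by apply: (ler_cvg_to cv (cvg_cst _)); near=> N; exact: key.
Unshelve. all: by end_near. Qed.

End PowerSeries.

(** * Chain rule, differentiation under the integral and radial differential equations *)

Section CalculusLemmas.
Context {R : realType}.

Lemma is_derive_eps (F : R -> R) (x l : R) : is_derive x 1 F l -> forall e : R, 0 < e ->
  exists2 d : R, 0 < d & forall y, `|y - x| < d -> `|F y - F x - l * (y - x)| <= e * `|y - x|.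
Proof.
move=> [dF lE] e e0.
have cv : (fun h : R => h^-1 *: ((F \o shift x) (h *: (1 : R)) - F x)) h @[h --> 0^'] --> l.
  by rewrite -lE; exact: dF.
move/cvgrPdist_le : cv => /(_ _ e0); rewrite near_withinE => /nbhs_ballP[d /= d0 hd].
exists d => // y yd; have [->|yx] := eqVneq y x; first by rewrite !subrr !mulr0 subr0 normr0 mulr0.
have h0 : y - x != 0 by rewrite subr_eq0.
have := hd (y - x); rewrite /ball /= sub0r normrN => /(_ yd h0).
rewrite /GRing.scale /= mulr1 subrK => H.
have -> : F y - F x - l * (y - x) = - ((l - (y - x)^-1 * (F y - F x)) * (y - x)) by field.
by rewrite normrN normrM ler_wpM2r.
Qed.

Lemma increment_bound (c w e t : R) : `|w - c * t| <= e * `|t| -> `|w| <= (`|c| + e) * `|t|.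
Proof.
move=> H; have -> : w = (w - c * t) + c * t by ring.
by apply: le_trans (ler_normD _ _) _; rewrite [`|c * t|]normrM; lra.
Qed.

Lemma chain_bound (A B da db e e1 e2 u v D t : R) : 0 <= e1 -> 0 <= e2 -> e2 <= 1 ->
  (`|A| + `|B|) * e2 <= e / 2 -> e1 * (`|da| + `|db| + 2) = e / 2 ->
  `|u - da * t| <= e2 * `|t| -> `|v - db * t| <= e2 * `|t| ->
  `|D - A * u - B * v| <= e1 * (`|u| + `|v|) -> `|D - t * (A * da + B * db)| <= e * `|t|.
Proof.
move=> e10 e20 e21 e2A e1A h1 h2 h; have t0 := normr_ge0 t.
have hu := increment_bound h1; have hv := increment_bound h2.
have et : e2 * `|t| <= `|t| by rewrite -[leRHS]mul1r ler_wpM2r.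
have -> : D - t * (A * da + B * db) =
   (D - A * u - B * v) + (A * (u - da * t) + B * (v - db * t)) by ring.
apply: le_trans (ler_normD _ _) _.
have h5 : `|A * (u - da * t) + B * (v - db * t)| <= (`|A| + `|B|) * e2 * `|t|.
  apply: le_trans (ler_normD _ _) _; rewrite !normrM mulrDl mulrDl.
  by rewrite -!mulrA; apply: lerD; apply: ler_wpM2l.
have h6 : e1 * (`|u| + `|v|) <= e1 * (`|da| + `|db| + 2) * `|t|.
  by rewrite -mulrA; apply: ler_wpM2l => //; lra.
have h7 := ler_wpM2r t0 e2A; rewrite e1A in h6; lra.
Qed.

Lemma half_quotient (c e : R) : 0 < c -> c * (e / (2 * c)) = e / 2.
Proof. by move=> c0; field; exact: lt0r_neq0. Qed.

Lemma diff2_path (f : R * R -> R) (a b : R -> R) (x A B da db : R) :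
  diff2 f (a x, b x) A B -> is_derive x 1 a da -> is_derive x 1 b db ->
  is_derive x 1 (fun t => f (a t, b t)) (A * da + B * db).
Proof.
move=> df ha hb; apply: is_derive_dir => e e0.
have D0 : 0 < `|da| + `|db| + 2 by rewrite ltr_wpDl// addr_ge0.
have S0 : 0 < `|A| + `|B| + 1 by rewrite ltr_wpDl// addr_ge0.
pose e1 := e / (2 * (`|da| + `|db| + 2)).
have e10 : 0 < e1 by rewrite divr_gt0// mulr_gt0.
pose e2 := Num.min 1 (e / (2 * (`|A| + `|B| + 1))).
have e20 : 0 < e2 by rewrite lt_min ltr01 divr_gt0// mulr_gt0.
have e21 : e2 <= 1 by rewrite ge_min lexx.
have e2A : (`|A| + `|B|) * e2 <= e / 2.
  rewrite -(half_quotient e S0); apply: ler_pM; [exact: addr_ge0|exact: ltW| |].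
    by rewrite lerDl.
  by rewrite ge_min lexx orbT.
have e1A : e1 * (`|da| + `|db| + 2) = e / 2 by rewrite mulrC half_quotient.
have [d d0 hd] := df _ e10.
have [d1 d10 hd1] := is_derive_eps ha e20.
have [d2 d20 hd2] := is_derive_eps hb e20.
clearbody e1 e2.
have da0 : 0 < `|da| + 1 by rewrite ltr_wpDl.
have db0 : 0 < `|db| + 1 by rewrite ltr_wpDl.
exists (Num.min (Num.min d1 d2) (Num.min (d / (`|da| + 1)) (d / (`|db| + 1)))).
  by rewrite !lt_min d10 d20 !divr_gt0.
move=> t; rewrite !lt_min -andbA => /and4P[t1 t2 t3 t4].
have -> : t *: (1 : R) + x = x + t by rewrite /GRing.scale /= mulr1 addrC.
have Et : x + t - x = t by rewrite addrAC subrr add0r.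
have h1 := hd1 (x + t); rewrite Et in h1; have {}h1 := h1 t1.
have h2 := hd2 (x + t); rewrite Et in h2; have {}h2 := h2 t2.
have h := hd (a (x + t), b (x + t)); rewrite /= in h.
rewrite ltr_pdivlMr// mulrC in t3; rewrite ltr_pdivlMr// mulrC in t4.
have close (c w : R) : `|w - c * t| <= e2 * `|t| -> (`|c| + 1) * `|t| < d -> `|w| < d.
  move=> /increment_bound hw; apply: le_lt_trans; apply: le_trans hw _.
  by apply: ler_wpM2r => //; rewrite lerD2l.
by apply: (chain_bound (ltW e10) (ltW e20) e21 e2A e1A h1 h2 (h _ _)); [exact: close h1 t3|exact: close h2 t4].
Qed.

Lemma circ_derive (F F' : R -> R -> R) (r0 r1 M : R) :
  (forall r, r0 < r < r1 -> continuous (F r)) ->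
  (forall r t : R, r0 < r < r1 -> is_derive r 1 (F ^~ t) (F' r t)) ->
  (forall r t, `|F' r t| <= M) ->
  forall r : R, r0 < r < r1 -> is_derive r 1 (fun r => circ (F r)) (circ (F' r)).
Proof.
move=> cF dF bF r rr.
have M0 : 0 <= M by exact: le_trans (bF r 0).
have Ir : `]r0, r1[%classic r by rewrite /= in_itv.
have H1 (x : R) : `]r0, r1[%classic x -> (@lebesgue_measure R).-integrable `[0, pi *+ 2] (EFin \o F x).
  by rewrite /= in_itv /= => h; apply: continuous_segment_integrable; exact: cF.
have H2 (x y : R) : `]r0, r1[%classic x -> `[0, pi *+ 2]%classic y -> derivable (F ^~ y) x 1.
  by rewrite /= in_itv /= => h _; have [] := dF x y h.
have H3 (x y : R) : `]r0, r1[%classic x -> `[0, pi *+ 2]%classic y -> `|partial1of2 F x y| <= (fun=> M) y.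
  by rewrite /= in_itv /= => h _; rewrite partial1of2E; have [_ ->] := dF x y h.
have H4 : (@lebesgue_measure R).-integrable `[0, pi *+ 2] (EFin \o (fun=> M)).
  by apply: continuous_segment_integrable; exact: cst_continuous.
have mB := @measurable_itv R `[0, pi *+ 2].
apply: DeriveDef; first by apply: (@derivable_under_integral _ _ _ (@lebesgue_measure R) F _ mB r r0 r1 Ir H1 H2 (fun=> M) (fun=> M0) H4 H3).
have E := @differentiation_under_integral _ _ _ (@lebesgue_measure R) F _ mB r r0 r1 Ir H1 H2 (fun=> M) (fun=> M0) H4 H3.
rewrite -derive1E; apply: etrans E _.
by apply: eq_Rintegral => t _; rewrite partial1of2E; have [_ ->] := dF r t rr.
Qed.

Lemma circ_ibp (u u' v v' : R -> R) : continuous u -> continuous u' -> continuous v -> continuous v' ->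
  (forall t : R, is_derive t 1 u (u' t)) -> (forall t : R, is_derive t 1 v (v' t)) ->
  u (pi *+ 2) * v (pi *+ 2) = u 0 * v 0 ->
  circ (fun t => u' t * v t) = - circ (fun t => u t * v' t).
Proof.
move=> cu cu' cv cv' du dv E; apply/eqP; rewrite -addr_eq0 -circD; try exact: continuous_mulR.
have cs : continuous (fun t => u' t * v t + u t * v' t).
  by apply: continuous_addR; exact: continuous_mulR.
have H := @circ_FTC R (fun t => u t * v t) _ cs (fun t => is_deriveMf (du t) (dv t)).
by rewrite H E subrr.
Qed.

Lemma derive0_const (u : R -> R) (a b : R) : (forall r : R, a < r < b -> is_derive r 1 u 0) ->
  exists al, forall r, a < r < b -> u r = al.
Proof.
move=> du; exists (u ((a + b) / 2)) => r rr.
have m : a < (a + b) / 2 < b by case/andP: rr => ? ?; apply/andP; split; lra.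
have [c _ E] := mvt_between du m rr.
by apply/eqP; rewrite -subr_eq0 E mul0r.
Qed.

Lemma power_ode (m : nat) (u : R -> R) (b : R) :
  (forall r : R, 0 < r < b -> is_derive r 1 u (m%:R / r * u r)) ->
  exists al, forall r, 0 < r < b -> u r = al * r ^+ m.
Proof.
elim: m u => [|m ih] u du.
  have [|al hal] := @derive0_const u 0 b.
    by move=> r rr; apply: is_derive_eq (du r rr) _; rewrite mul0r mul0r.
  by exists al => r rr; rewrite expr0 mulr1; exact: hal.
have [r rr|al hal] := ih (fun r => u r * r^-1).
  have r0 : r != 0 by rewrite gt_eqF//; case/andP: rr.
  have h1 : is_derive r 1 (fun r : R => r^-1) (- r ^- 2 *: 1).
    by exact: (@realfun.is_deriveV R id r 1 1 r0 (@is_derive_id _ _ r 1)).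
  have h := is_deriveMf (du r rr) h1; apply: is_derive_eq h _.
  by rewrite /GRing.scale/= -natr1; field.
exists al => r rr; have r0 : r != 0 by rewrite gt_eqF//; case/andP: rr.
by rewrite exprSr mulrA -(hal r rr) mulrVK// unitfE.
Qed.

(** Here r^m u is constant; as u is bounded and m > 0, letting r tend to 0 shows that the constant
    is 0. *)
Lemma neg_power_ode (m : nat) (u : R -> R) (b M : R) : (0 < m)%N -> 0 < b ->
  (forall r : R, 0 < r < b -> is_derive r 1 u (- (m%:R / r) * u r)) ->
  (forall r, 0 < r < b -> `|u r| <= M) ->
  forall r, 0 < r < b -> u r = 0.
Proof.
move=> m0 b0 du bu.
have [al hal] : exists al, forall r, 0 < r < b -> r ^+ m * u r = al.
  elim: m {m0 bu} u du => [|m ih] u du.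
    have [|al hal] := @derive0_const u 0 b.
      by move=> r rr; apply: is_derive_eq (du r rr) _; rewrite mul0r oppr0 mul0r.
    by exists al => r rr; rewrite expr0 mul1r; exact: hal.
  have [r rr|al hal] := ih (fun r => r * u r).
    have r0 : r != 0 by rewrite gt_eqF//; case/andP: rr.
    have h := is_deriveMf (@is_derive_id _ _ r 1) (du r rr); apply: is_derive_eq h _.
    by rewrite -natr1; field.
  by exists al => r rr; rewrite exprSr -mulrA; exact: hal.
suff a0 : al = 0.
  move=> r rr; have := hal r rr; rewrite a0 => /eqP; rewrite mulf_eq0 expf_eq0 m0 /=.
  by case/andP: rr => r0 _; rewrite (gt_eqF r0) /= => /eqP.
have M0 : 0 <= M by apply: le_trans (bu (b / 2) _) => //; apply/andP; split; lra.
apply/eqP; rewrite -normr_le0; apply/ler_addgt0Pr => e e0; rewrite add0r.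
pose r := Num.min (b / 2) (Num.min 1 (e / (M + 1))).
have r0 : 0 < r by rewrite !lt_min ltr01 !divr_gt0// ltr_wpDl.
have rb : r < b by rewrite (@le_lt_trans _ _ (b / 2))// ?ge_min ?lexx//; lra.
have r1 : r <= 1 by rewrite /r !ge_min lexx orbT.
have re : r <= e / (M + 1) by rewrite /r !ge_min lexx !orbT.
rewrite -(hal r) ?r0//= normrM ger0_norm ?exprn_ge0 ?(ltW r0)//.
have h1 : r ^+ m <= r.
  by case: m m0 {du hal} => // m _; rewrite exprS -[leRHS]mulr1 ler_wpM2l ?(ltW r0)// exprn_ile1// ltW.
apply: (@le_trans _ _ (r * M)).
  by apply: ler_pM; rewrite ?exprn_ge0 ?(ltW r0)//; apply: bu; rewrite r0.
apply: (@le_trans _ _ (e / (M + 1) * (M + 1))); last by rewrite divfK// gt_eqF// ltr_wpDl.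
by apply: ler_pM => //; [exact: ltW|lra].
Qed.

End CalculusLemmas.

(** * Fourier modes of a Cauchy-Riemann pair on circles *)

Section PolarFourier.
Context {R : realType}.
Notation C := (Rcomplex R).
Variables (f g P Q : R * R -> R) (p : R * R) (rho M : R).
Hypotheses (rho0 : 0 < rho) (cf : continuous f) (cg : continuous g)
  (cP : continuous P) (cQ : continuous Q)
  (bf : forall q, `|f q| <= M) (bg : forall q, `|g q| <= M)
  (bP : forall q, `|P q| <= M) (bQ : forall q, `|Q q| <= M)
  (df : forall q, `|q.1 - p.1| < rho -> `|q.2 - p.2| < rho -> diff2 f q (P q) (Q q))
  (dg : forall q, `|q.1 - p.1| < rho -> `|q.2 - p.2| < rho -> diff2 g q (- Q q) (P q)).

Definition circle (r t : R) : R * R := (p.1 + r * cos t, p.2 + r * sin t).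
(** By the Cauchy-Riemann equations, on circles inside the box [radial] is both f_r and g_t / r, and
    [angular] is both g_r and - f_t / r. *)
Definition radial r t := P (circle r t) * cos t + Q (circle r t) * sin t.
Definition angular r t := P (circle r t) * sin t - Q (circle r t) * cos t.

Lemma circle_box r t : 0 < r < rho ->
  `|(circle r t).1 - p.1| < rho /\ `|(circle r t).2 - p.2| < rho.
Proof.
move=> /andP[r0 rr]; have E (a b : R) : a + b - a = b by ring.
rewrite /circle /= !E !normrM (gtr0_norm r0).
have c1 : `|cos t| <= 1 by rewrite ler_norml cos_geN1 cos_le1.
have s1 : `|sin t| <= 1 by rewrite ler_norml sin_geN1 sin_le1.
by split; apply: le_lt_trans rr; rewrite -[leRHS]mulr1 ler_wpM2l// ltW.
Qed.

Lemma continuous_circle r : continuous (circle r).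
Proof.
move=> t; apply: (@cvg_pair _ _ _ (nbhs t) (nbhs (p.1 + r * cos t)) (nbhs (p.2 + r * sin t))
  _ _ _ (fun t => p.1 + r * cos t) (fun t => p.2 + r * sin t)).
  by apply: cvgD; [exact: cvg_cst|apply: cvgMr; exact: continuous_cos].
by apply: cvgD; [exact: cvg_cst|apply: cvgMr; exact: continuous_sin].
Qed.

Lemma continuous_on_circle (F : R * R -> R) r : continuous F -> continuous (fun t => F (circle r t)).
Proof. by move=> cF t; apply: (@continuous_comp _ _ _ (circle r) F); [exact: continuous_circle|exact: cF]. Qed.

Lemma continuous_radial r : continuous (radial r).
Proof.
by apply: continuous_addR; apply: continuous_mulR;
  [exact: continuous_on_circle|exact: continuous_cos|exact: continuous_on_circle|exact: continuous_sin].
Qed.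

Lemma continuous_angular r : continuous (angular r).
Proof.
apply: continuous_addR; last apply: continuous_oppR; apply: continuous_mulR;
  [exact: continuous_on_circle|exact: continuous_sin|exact: continuous_on_circle|exact: continuous_cos].
Qed.

Lemma is_derive_ray (a c r : R) : is_derive r 1 (fun r : R => a + r * c) c.
Proof.
have h := is_deriveDf (@is_derive_cst R R R a r 1)
  (is_deriveMf (@is_derive_id _ _ r 1) (@is_derive_cst R R R c r 1)).
by apply: is_derive_eq h _; rewrite /cst add0r mul1r mulr0 addr0.
Qed.

Lemma is_derive_trig (a r t dl : R) (tr : R -> R) : is_derive t 1 tr dl ->
  is_derive t 1 (fun t : R => a + r * tr t) (r * dl).
Proof.
move=> h; have h' := is_deriveDf (@is_derive_cst R R R a t 1) (is_deriveZf r h).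
by apply: is_derive_eq h' _; ring.
Qed.

Lemma derive_radial (r t : R) : 0 < r < rho ->
  is_derive r 1 (fun r => f (circle r t)) (radial r t) /\
  is_derive r 1 (fun r => g (circle r t)) (angular r t).
Proof.
move=> rr; have [b1 b2] := circle_box t rr; split.
  exact: (@diff2_path R f (fun r => p.1 + r * cos t) (fun r => p.2 + r * sin t) r _ _ _ _ (df b1 b2)
    (is_derive_ray _ _ _) (is_derive_ray _ _ _)).
have h := @diff2_path R g (fun r => p.1 + r * cos t) (fun r => p.2 + r * sin t) r _ _ _ _ (dg b1 b2)
  (is_derive_ray _ _ _) (is_derive_ray _ _ _).
by apply: is_derive_eq h _; rewrite /angular; ring.
Qed.

Lemma derive_angular (r t : R) : 0 < r < rho ->
  is_derive t 1 (fun t => f (circle r t)) (- r * angular r t) /\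
  is_derive t 1 (fun t => g (circle r t)) (r * radial r t).
Proof.
move=> rr; have [b1 b2] := circle_box t rr.
have hc := is_derive_trig p.1 r (is_derive_cos t); have hs := is_derive_trig p.2 r (is_derive_sin t).
split.
  by apply: is_derive_eq (@diff2_path R f (fun t => p.1 + r * cos t) (fun t => p.2 + r * sin t) t _ _ _ _ (df b1 b2) hc hs) _; rewrite /angular; ring.
by apply: is_derive_eq (@diff2_path R g (fun t => p.1 + r * cos t) (fun t => p.2 + r * sin t) t _ _ _ _ (dg b1 b2) hc hs) _; rewrite /radial; ring.
Qed.

Lemma circle_2pi r : circle r (pi *+ 2) = circle r 0.
Proof. by rewrite /circle cos2pi sin2pi cos0 sin0. Qed.

Lemma polar_mode_derive (tr : R -> R) r : continuous tr -> (forall t, `|tr t| <= 1) -> 0 < r < rho ->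
  is_derive r 1 (fun r => circ (fun t => f (circle r t) * tr t)) (circ (fun t => radial r t * tr t)) /\
  is_derive r 1 (fun r => circ (fun t => g (circle r t) * tr t)) (circ (fun t => angular r t * tr t)).
Proof.
move=> ctr tr1 rr.
have c1 t : `|cos t| <= 1 :> R by rewrite ler_norml cos_geN1 cos_le1.
have s1 t : `|sin t| <= 1 :> R by rewrite ler_norml sin_geN1 sin_le1.
have b2 (a b : R) : `|a| <= M -> `|b| <= 1 -> `|a * b| <= M.
  by move=> ha hb; rewrite normrM -[leRHS]mulr1; apply: ler_pM.
have b3 (a b t : R) : `|a| <= M -> `|b| <= M -> `|(a + b) * tr t| <= 2 * M.
  move=> ha hb; rewrite normrM -[leRHS]mulr1; apply: ler_pM => //.
  by apply: le_trans (ler_normD _ _) _; lra.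
split.
  apply: (@circ_derive R (fun r t => f (circle r t) * tr t) (fun r t => radial r t * tr t) 0 rho (2 * M)) => //.
  - by move=> r' _; apply: continuous_mulR => //; exact: continuous_on_circle.
  - move=> r' t rr'; have [h _] := derive_radial t rr'.
    by apply: is_derive_eq (is_deriveMf h (@is_derive_cst R R R (tr t) r' 1)) _; rewrite mulr0 addr0.
  - by move=> r' t; apply: b3; apply: b2.
apply: (@circ_derive R (fun r t => g (circle r t) * tr t) (fun r t => angular r t * tr t) 0 rho (2 * M)) => //.
- by move=> r' _; apply: continuous_mulR => //; exact: continuous_on_circle.
- move=> r' t rr'; have [_ h] := derive_radial t rr'.
  by apply: is_derive_eq (is_deriveMf h (@is_derive_cst R R R (tr t) r' 1)) _; rewrite mulr0 addr0.
- by move=> r' t; apply: b3; rewrite ?normrN; apply: b2.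
Qed.

(** Integration by parts in t gives A' = (m/r) V, V' = (m/r) A, B' = - (m/r) U, U' = - (m/r) B. The
    singular combinations A - V and B + U are bounded and therefore vanish, which leaves pure powers
    of r. *)
Lemma polar_modes (m : nat) : exists ab : R * R, forall r, 0 < r < rho ->
  circ (fun t => f (circle r t) * cos (m%:R * t)) = ab.1 * r ^+ m /\
  circ (fun t => f (circle r t) * sin (m%:R * t)) = ab.2 * r ^+ m.
Proof.
have cc : continuous (fun t : R => cos (m%:R * t)) by exact: continuous_cosk.
have cs : continuous (fun t : R => sin (m%:R * t)) by exact: continuous_sink.
have c1 t : `|cos (m%:R * t)| <= 1 :> R by rewrite ler_norml cos_geN1 cos_le1.
have s1 t : `|sin (m%:R * t)| <= 1 :> R by rewrite ler_norml sin_geN1 sin_le1.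
pose A r := circ (fun t => f (circle r t) * cos (m%:R * t)).
pose B r := circ (fun t => f (circle r t) * sin (m%:R * t)).
pose U r := circ (fun t => g (circle r t) * cos (m%:R * t)).
pose V r := circ (fun t => g (circle r t) * sin (m%:R * t)).
have [cosm sinm] : cos (m%:R * (pi *+ 2)) = 1 :> R /\ sin (m%:R * (pi *+ 2)) = 0 :> R.
  by have := @expi_2pi_int R m; rewrite /expi -pmulrn => -[-> ->].
have dc (t : R) : is_derive t 1 (fun t : R => cos (m%:R * t)) (- m%:R * sin (m%:R * t)) by exact: is_derive_cosM.
have ds (t : R) : is_derive t 1 (fun t : R => sin (m%:R * t)) (m%:R * cos (m%:R * t)) by exact: is_derive_sinM.
have cMr (a : R) (w : R -> R) : continuous w -> continuous (fun t => a * w t).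
  by move=> cw; apply: continuous_mulR => //; exact: cst_continuous.
have ibp (G Gr tr dtr : R -> R) (a b : R) : continuous G -> continuous Gr -> continuous tr -> continuous dtr ->
    (forall t : R, is_derive t 1 G (a * Gr t)) -> (forall t : R, is_derive t 1 tr (b * dtr t)) ->
    G (pi *+ 2) = G 0 -> tr (pi *+ 2) = tr 0 ->
    a * circ (fun t => Gr t * tr t) = - b * circ (fun t => G t * dtr t).
  move=> cG cGr ctr cdtr dG dtr' EG Etr.
  have := circ_ibp cG (cMr a _ cGr) ctr (cMr b _ cdtr) dG dtr'; rewrite EG Etr => /(_ erefl).
  rewrite (_ : (fun t => a * Gr t * tr t) = (fun t => a * (Gr t * tr t))); last by apply/funext => t; ring.
  rewrite (_ : (fun t => G t * (b * dtr t)) = (fun t => b * (G t * dtr t))); last by apply/funext => t; ring.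
  by rewrite circZ ?circZ; [rewrite mulNr|exact: continuous_mulR..].
have cof r := @continuous_on_circle _ r cf; have cog r := @continuous_on_circle _ r cg.
have der (r : R) : 0 < r < rho -> [/\ is_derive r 1 A (m%:R / r * V r), is_derive r 1 B (- (m%:R / r) * U r),
    is_derive r 1 U (- (m%:R / r) * B r) & is_derive r 1 V (m%:R / r * A r)].
  move=> rr; have r0 : r != 0 by case/andP: rr => /lt0r_neq0.
  have [dA dU] := polar_mode_derive cc c1 rr; have [dB dV] := polar_mode_derive cs s1 rr.
  have dfa t := (derive_angular t rr).1; have dga t := (derive_angular t rr).2.
  have cosm0 : cos (m%:R * (pi *+ 2)) = cos (m%:R * 0) :> R by rewrite mulr0 cos0.
  have sinm0 : sin (m%:R * (pi *+ 2)) = sin (m%:R * 0) :> R by rewrite mulr0 sin0.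
  have div (a x y : R) : a * x = y -> a != 0 -> x = a^-1 * y by move=> <- a0; rewrite mulKf.
  have rN0 : - r != 0 by rewrite oppr_eq0.
  have e1 := ibp _ _ _ _ _ _ (cog r) (continuous_radial (r:=r)) cc cs dga dc (congr1 g (circle_2pi r)) cosm0.
  have e2 := ibp _ _ _ _ _ _ (cog r) (continuous_radial (r:=r)) cs cc dga ds (congr1 g (circle_2pi r)) sinm0.
  have e3 := ibp _ _ _ _ _ _ (cof r) (continuous_angular (r:=r)) cc cs dfa dc (congr1 f (circle_2pi r)) cosm0.
  have e4 := ibp _ _ _ _ _ _ (cof r) (continuous_angular (r:=r)) cs cc dfa ds (congr1 f (circle_2pi r)) sinm0.
  split.
  - by apply: is_derive_eq dA _; rewrite (div _ _ _ e1 r0) -/(V r); field.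
  - by apply: is_derive_eq dB _; rewrite (div _ _ _ e2 r0) -/(U r); field.
  - by apply: is_derive_eq dU _; rewrite (div _ _ _ e3 rN0) -/(B r); field.
  - by apply: is_derive_eq dV _; rewrite (div _ _ _ e4 rN0) -/(A r); field.
(* The factor m covers m = 0, where A and V need not agree but both sides are 0. *)
suff [hV hU] : (forall r, 0 < r < rho -> m%:R * V r = m%:R * A r) /\
    (forall r, 0 < r < rho -> m%:R * U r = - (m%:R * B r)).
  have [|al hal] := @power_ode R m A rho.
    move=> r rr; have [dA _ _ _] := der r rr.
    by apply: is_derive_eq dA _; rewrite mulrAC (hV r rr) mulrAC.
  have [|be hbe] := @power_ode R m B rho.
    move=> r rr; have [_ dB _ _] := der r rr.
    by apply: is_derive_eq dB _; rewrite mulNr mulrAC (hU r rr) mulNr opprK mulrAC.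
  by exists (al, be) => r rr; rewrite /= -(hal r rr) -(hbe r rr).
have [m0|m0] := posnP m; first by rewrite m0; split=> r _; rewrite !mul0r ?oppr0.
have bnd (w tr : R -> R) : continuous w -> continuous tr -> (forall t, `|w t| <= M) -> (forall t, `|tr t| <= 1) ->
    `|circ (fun t => w t * tr t)| <= M * (pi *+ 2).
  move=> cw ctr bw btr; apply: circ_norm; first exact: continuous_mulR.
  by move=> t; rewrite normrM -[leRHS]mulr1; apply: ler_pM.
have bb (w z : R) : `|w| <= M * (pi *+ 2) -> `|z| <= M * (pi *+ 2) -> `|w + z| <= 2 * (M * (pi *+ 2)).
  by move=> hw hz; apply: le_trans (ler_normD _ _) _; lra.
have h1 := @neg_power_ode R m (fun r => A r - V r) rho (2 * (M * (pi *+ 2))) m0 rho0.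
have h2 := @neg_power_ode R m (fun r => B r + U r) rho (2 * (M * (pi *+ 2))) m0 rho0.
split=> r rr.
  congr (_ * _); apply/eqP; rewrite eq_sym -subr_eq0; apply/eqP; apply: h1 rr => s ss.
    have [dA _ _ dV] := der s ss; apply: is_derive_eq (is_deriveBf dA dV) _; ring.
  by apply: bb; rewrite ?normrN; apply: bnd.
rewrite -mulrN; congr (_ * _); apply/eqP; rewrite -addr_eq0 addrC; apply/eqP; apply: h2 rr => s ss.
  have [_ dB dU _] := der s ss; apply: is_derive_eq (is_deriveDf dB dU) _; ring.
by apply: bb; apply: bnd.
Qed.

End PolarFourier.

(** * The power series of a harmonic function off its centre *)

Section PolarSeries.
Context {R : realType}.
Notation C := (Rcomplex R).
Variables (f : R * R -> R) (p : R * R) (rho M : R).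
Hypotheses (rho0 : 0 < rho) (cf : continuous f) (bf : forall q, `|f q| <= M)
  (modes : forall m : nat, exists ab : R * R, forall r, 0 < r < rho ->
    circ (fun t => f (circle p r t) * cos (m%:R * t)) = ab.1 * r ^+ m /\
    circ (fun t => f (circle p r t) * sin (m%:R * t)) = ab.2 * r ^+ m).

Definition mode_coef (m : nat) : C := (pi *+ 2)^-1 *: (Complex (projT1 (cid (modes m))).1
  (- (projT1 (cid (modes m))).2) : C).

(** The factor 2 for m > 0 collects the modes m and -m of a real function under one real part. *)
Definition series_coef (m : nat) : C := (if m == 0%N then 1 else 2 : R) *: mode_coef m.

Lemma fc_circle (m : nat) r : 0 < r < rho -> fc (fun t => f (circle p r t)) m = r ^+ m *: mode_coef m.
Proof.
move=> rr; rewrite /mode_coef; have [hc hs] := projT2 (cid (modes m)) r rr.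
apply: C_eq; rewrite /fc /fourier_cos /fourier_sin -!/(circ _) !ReImE /=.
  by rewrite -pmulrn hc; ring.
by rewrite -pmulrn hs; ring.
Qed.

Lemma continuous_fcircle r : continuous (fun t => f (circle p r t)).
Proof. exact: continuous_on_circle. Qed.

(** The coefficients on an intermediate circle are bounded by the supremum of [f], so on a smaller
    disc the series is dominated by a geometric one. *)
Lemma psum_series_coef : psum rho series_coef.
Proof.
move=> sig sig0 sr; pose r := (sig + rho) / 2.
have rs : sig < r by rewrite /r; lra.
have rr : 0 < r < rho by apply/andP; rewrite /r; split; lra.
have r0 : 0 < r by case/andP: rr.
have M0 : 0 <= M by exact: le_trans (bf p).
have bc (a : R) k : 0 <= a -> `|fourier_cos (fun t => f (circle p r t)) k| <= M /\
    `|fourier_sin (fun t => f (circle p r t)) k| <= M.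
  move=> _; have [h1 h2] := @fourier_dist R (fun t => f (circle p r t)) (fun=> 0) k M
    (continuous_fcircle (r:=r)) (@cst_continuous _ _ 0) (fun x => ltac:(rewrite subr0; exact: bf)).
  have z1 : fourier_cos (fun=> 0 : R) k = 0.
    by rewrite /fourier_cos -/(circ _); under eq_fun do rewrite mul0r; rewrite circ_cst mul0r mulr0.
  have z2 : fourier_sin (fun=> 0 : R) k = 0.
    by rewrite /fourier_sin -/(circ _); under eq_fun do rewrite mul0r; rewrite circ_cst mul0r mulr0.
  by move: h1 h2; rewrite z1 z2 !subr0.
have bB n : cmod (series_coef n) * r ^+ n <= 4 * M.
  have -> : cmod (series_coef n) * r ^+ n = (if n == 0%N then 1 else 2) * cmod (fc (fun t => f (circle p r t)) n).
    rewrite fc_circle// !cmodZ ger0_norm; last by case: ifP.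
    by rewrite [`|r ^+ n|]ger0_norm ?exprn_ge0 ?(ltW r0)//; ring.
  have [h1 h2] := bc 0 n (lexx _).
  have h3 : cmod (fc (fun t => f (circle p r t)) n) <= 2 * M.
    by apply: le_trans (cmod_le_ReIm _) _; rewrite /fc /= normrN; lra.
  have h4 := cmod_ge0 (fc (fun t => f (circle p r t)) n).
  by case: ifP => _; lra.
pose x := sig / r.
have x0 : 0 <= x by rewrite divr_ge0 ?(ltW r0).
have x1 : 0 < 1 - x by rewrite subr_gt0 ltr_pdivrMr ?mul1r.
exists (4 * M / (1 - x)) => N.
apply: (@le_trans _ _ (4 * M * \sum_(n < N) x ^+ n)).
  rewrite mulr_sumr; apply: ler_sum => n _.
  have -> : cmod (series_coef n) * sig ^+ n = cmod (series_coef n) * r ^+ n * x ^+ n.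
    by rewrite -mulrA -exprMn /x mulrC [r * _]mulrC divfK ?gt_eqF// mulrC.
  by rewrite ler_wpM2r ?exprn_ge0.
rewrite ler_wpM2l ?mulr_ge0// -[leRHS]mul1r ler_pdivlMr//.
have := subrX1 x N => E; have xN := exprn_ge0 N x0; move: E; set S := \sum_(_ < _) _ => E.
by rewrite (_ : S * (1 - x) = 1 - x ^+ N); [lra|rewrite -[RHS]opprB E; ring].
Qed.

Definition circ_coef N r (k : int) : C :=
  if (0 <= k) && (absz k < N)%N then r ^+ absz k *: series_coef (absz k) else 0.

Lemma pps_circle N r t : pps N series_coef (r *: expi t) =
  Re (\sum_(i < N) (r ^+ i *: series_coef i) * ek i t).
Proof.
rewrite Re_sum; apply: eq_bigr => i _; congr (Re _).
have -> : (r *: expi t : C) ^+ i = r ^+ i *: ek i t.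
  elim: (i : nat) => [|n ih]; first by rewrite !expr0 scale1r /ek mul0r expi0.
  rewrite !exprS ih -[n.+1]add1n PoszD ekD /ek mul1r -/(ek n t).
  by apply: C_eq; rewrite !ReImE; ring.
by apply: C_eq; rewrite !ReImE; ring.
Qed.

Lemma coef_pps N r k :
  coef (fun t => \sum_(i < N) (r ^+ i *: series_coef i) * ek i t) k = circ_coef N r k.
Proof.
rewrite /coef; have -> : (fun x => (\sum_(i < N) (r ^+ i *: series_coef i) * ek i x) * ek (- k) x) =
    (fun x => \sum_(l <- map Posz (index_iota 0 N)) (r ^+ absz l *: series_coef (absz l)) * ek (l - k) x).
  apply/funext => x; rewrite mulr_suml big_map big_mkord; apply: eq_bigr => i _.
  by rewrite ekD mulrA.
rewrite cI_sum_ek big_map big_mkord /circ_coef.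
have tp := @twopi_gt0 R.
case: ifPn => [/andP[k0 kN]|kN].
  rewrite (bigD1 (Ordinal kN)) //= [X in _ + X]big1 ?addr0; last first.
    move=> i ik; rewrite cI_ek ifN ?mulr0// subr_eq0; apply: contra ik => /eqP E.
    by apply/eqP/val_inj; rewrite /= -E.
  rewrite cI_ek gez0_abs// subrr eqxx; apply: C_eq; rewrite !ReImE /=; field; lra.
rewrite big1 ?scaler0// => i _; rewrite cI_ek ifN ?mulr0// subr_eq0.
by apply: contra kN => /eqP <-; rewrite /= ltn_ord.
Qed.

Lemma fc_pps N r (m : nat) : 0 < r < rho -> (m < N)%N ->
  fc (fun t => pps N series_coef (r *: expi t)) m = fc (fun t => f (circle p r t)) m.
Proof.
move=> rr mN; rewrite fc_circle//.
have -> : (fun t => pps N series_coef (r *: expi t)) =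
    (fun t => Re (\sum_(i < N) (r ^+ i *: series_coef i) * ek i t)).
  by apply/funext => t; exact: pps_circle.
rewrite fc_Re; last first.
  apply: (@continuousC_sum R _ (index_enum 'I_N) predT (fun i t => (r ^+ i *: series_coef i) * ek i t)) => i.
  by apply: continuousCM; [exact: continuousC_cst|exact: continuousC_ek].
rewrite !coef_pps.
case: m mN => [|m] mN.
  have E0 : circ_coef N r 0 = mode_coef 0.
    by rewrite /circ_coef lexx absz0 mN /series_coef eqxx expr0 !scale1r.
  have hf := @fc_opp R (fun t => f (circle p r t)) 0 (continuous_fcircle (r:=r)).
  rewrite oppr0 (fc_circle 0 rr) expr0 scale1r in hf.
  rewrite oppr0 E0 -hf expr0 scale1r; move: (mode_coef 0) => w.
  by apply: C_eq; rewrite !ReImE; lra.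
have -> : circ_coef N r (- (m.+1 : int)) = 0 by rewrite /circ_coef oppr_ge0.
have -> : circ_coef N r m.+1 = r ^+ m.+1 *: (2 *: mode_coef m.+1).
  by rewrite /circ_coef [absz _]/= mN.
rewrite (_ : conjc (0 : C) = 0); last by apply: C_eq; rewrite !ReImE ?oppr0.
rewrite addr0; move: (r ^+ m.+1) (mode_coef m.+1) => a w.
by apply: C_eq; rewrite !ReImE; lra.
Qed.

(** On each circle both sides are continuous and periodic in the angle with equal Fourier
    coefficients. The centre itself, r = 0, is left out. *)
Lemma polar_series : exists (B : nat -> C) (h : psum rho B), forall r t, 0 < r < rho ->
  f (circle p r t) = psv h (r *: expi t).
Proof.
exists series_coef, psum_series_coef => r t rr.
have [r0 rrho] := andP rr.
pose h := psum_series_coef; pose F t := f (circle p r t).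
pose S t := psv h (r *: expi t).
have cF : continuous F by exact: continuous_fcircle.
have cmr u : cmod (r *: expi u : C) <= r.
  by rewrite cmodZ (gtr0_norm r0) /cmod sqmod_expi sqrtr1 mulr1.
have cpp N : continuous (fun t => pps N series_coef (r *: expi t)).
  rewrite (_ : (fun t => _) = (fun t => Re (\sum_(i < N) (r ^+ i *: series_coef i) * ek i t))).
    apply: (@continuousC_sum R _ (index_enum 'I_N) predT (fun i t => (r ^+ i *: series_coef i) * ek i t) _).1 => i.
    by apply: continuousCM; [exact: continuousC_cst|exact: continuousC_ek].
  by apply/funext => u; exact: pps_circle.
have unif (e : R) : 0 < e -> exists M0, forall N, (M0 <= N)%N -> forall u, `|pps N series_coef (r *: expi u) - S u| <= e.
  by move=> e0; have [M0 hM] := psvP h (ltW r0) rrho e0; exists M0 => N MN u; exact: hM.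
have cS : continuous S.
  apply: (@continuous_unif_limit _ _ (fun N t => pps N series_coef (r *: expi t))) => // e e0.
  by have [M0 hM] := unif e e0; exists M0; exact: hM.
have fcS (m : nat) : fc S m = fc F m.
  have key (e : R) : 0 < e -> `|fourier_cos S m - fourier_cos F m| <= 0 + e /\
      `|fourier_sin S m - fourier_sin F m| <= 0 + e.
    move=> e0; rewrite add0r; have [M0 hM] := unif e e0; pose N := maxn M0 m.+1.
    have E : fc (fun t => pps N series_coef (r *: expi t)) m = fc F m.
      by apply: fc_pps => //; exact: leq_maxr.
    have [E1 E2] : fourier_cos (fun t => pps N series_coef (r *: expi t)) m = fourier_cos F m /\
        fourier_sin (fun t => pps N series_coef (r *: expi t)) m = fourier_sin F m.
      by move: E; rewrite /fc => -[h1 /oppr_inj h2].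
    have [] := @fourier_dist R S (fun t => pps N series_coef (r *: expi t)) m e cS (cpp N).
      by move=> u; rewrite distrC; apply: hM; exact: leq_maxl.
    by rewrite E1 E2.
  have z (a b : R) : (forall e : R, 0 < e -> `|a - b| <= 0 + e) -> a = b.
    by move=> H; apply/eqP; rewrite -subr_eq0 -normr_le0; apply/ler_addgt0Pr.
  rewrite /fc; congr Complex; first by apply: z => e e0; have [] := key e e0.
  by congr (- _); apply: z => e e0; have [] := key e e0.
suff E : (-1 *: F + S) = cst 0.
  have := congr1 (fun H : R -> R => H t) E; rewrite /= -[LHS]/(-1 * F t + S t) /cst /F /S.
  by move=> /eqP; rewrite mulN1r addrC subr_eq0 => /eqP ->.
have cH : continuous (-1 *: F + S).
  by apply: continuous_addR => //; apply: continuous_mulR => //; exact: cst_continuous.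
have H0 (m : nat) : fc (-1 *: F + S) m = 0.
  by rewrite fc_lin// fcS; apply: C_eq; rewrite !ReImE; ring.
apply: fourier_uniq => // [u|k].
  rewrite -[LHS]/(-1 * F (u + pi *+ 2) + S (u + pi *+ 2)) -[RHS]/(-1 * F u + S u).
  by rewrite /F /S /circle /expi !cosD2pi !sinD2pi.
rewrite -sqmod_fc; case: k => m; first by rewrite H0 sqmod0.
by rewrite NegzE fc_opp// H0 sqmod_conj sqmod0.
Qed.

End PolarSeries.

(** * Smoothness and harmonicity from local power series *)

Section InteriorRegularity.
Context {R : realType}.
Notation C := (Rcomplex R).
Implicit Types (f g P Q : R * R -> R) (p q : R * R).

Definition rel p q : C := Complex (q.1 - p.1) (q.2 - p.2).

Lemma diff2_continuous f q A B : diff2 f q A B -> {for q, continuous f}.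
Proof.
move=> df; apply/cont2_eps => e e0; have [d d0 hd] := df 1 ltr01.
have A0 := normr_ge0 A; have B0 := normr_ge0 B.
pose K := `|A| + `|B| + 2; have K0 : 0 < K by rewrite /K; lra.
have KE : K = `|A| + `|B| + 2 by []; clearbody K.
have e2 : 0 < e / (2 * K) by rewrite divr_gt0 ?mulr_gt0.
exists (Num.min d (e / (2 * K))) => [|v]; first by rewrite lt_min d0.
rewrite !lt_min => /andP[v1 w1] /andP[v2 w2]; have := hd v v1 v2; rewrite mul1r.
move: v1 v2 w1 w2; set a := v.1 - q.1; set b := v.2 - q.2 => _ _ w1 w2 h.
have -> : f v - f q = (f v - f q - A * a - B * b) + (A * a + B * b) by ring.
apply: le_trans (ler_normD _ _) _.
have h1 : `|A * a + B * b| <= `|A| * `|a| + `|B| * `|b| by rewrite -!normrM; exact: ler_normD.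
have E : K * (e / (2 * K)) + K * (e / (2 * K)) = e by field; exact: lt0r_neq0.
have h2 := ler_wpM2l (ltW K0) (ltW w1); have h3 := ler_wpM2l (ltW K0) (ltW w2).
have := normr_ge0 a; have := normr_ge0 b => b0 a0.
have h4 : (`|A| + `|B| + 1) * (`|a| + `|b|) <= K * (`|a| + `|b|).
  by apply: ler_wpM2r; [exact: addr_ge0|rewrite KE; lra].
have := mulr_ge0 A0 b0; have := mulr_ge0 B0 a0; lra.
Qed.

Lemma diff2_local f F q A B (d : R) : 0 < d ->
  (forall v, `|v.1 - q.1| < d -> `|v.2 - q.2| < d -> f v = F v) -> diff2 F q A B -> diff2 f q A B.
Proof.
move=> d0 fF dF e e0; have [d1 d10 h] := dF e e0.
exists (Num.min d d1) => [|v]; first by rewrite lt_min d0.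
rewrite !lt_min => /andP[v1 w1] /andP[v2 w2]; rewrite fF// (fF q) ?subrr ?normr0//.
exact: h.
Qed.

Lemma psv_diff2 r (B : nat -> C) (h : psum r B) p q : cmod (rel p q) < r ->
  diff2 (fun v => psv h (rel p v)) q (psv (psum_D h) (rel p q)) (psv (psum_imul (psum_D h)) (rel p q)).
Proof.
move=> qr e e0; pose sig := (cmod (rel p q) + r) / 2.
have qs : cmod (rel p q) < sig by rewrite /sig; lra.
have sr : sig < r by rewrite /sig; lra.
have s0 : 0 <= sig by apply: le_trans (ltW qs); exact: cmod_ge0.
have [K [K0 hK]] := psv_diff h (psum_D h) (psum_imul (psum_D h)) s0 sr.
pose d := Num.min ((sig - cmod (rel p q)) / 2) (e / (2 * (K + 1))).
have K1 : 0 < K + 1 by lra.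
have d0 : 0 < d by rewrite lt_min !divr_gt0 ?mulr_gt0// subr_gt0.
have d1 : d <= (sig - cmod (rel p q)) / 2 by rewrite ge_min lexx.
have d2 : d <= e / (2 * (K + 1)) by rewrite ge_min lexx orbT.
exists d => // v v1 v2.
have Erel : rel p v - rel p q = rel q v.
  by apply: C_eq; rewrite !ReImE /=; ring.
have crel : cmod (rel q v) <= `|v.1 - q.1| + `|v.2 - q.2| by exact: cmod_le_ReIm.
have := hK (rel p q) (rel p v) (ltW qs); rewrite Erel /= => H.
apply: le_trans (H _) _.
  have -> : rel p v = rel p q + rel q v by rewrite -Erel addrC subrK.
  by apply: le_trans (cmodD _ _) _; lra.
move: crel v1 v2; set a := `|_|; set b := `|_| => crel v1 v2.
have a0 : 0 <= a by exact: normr_ge0.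
have b0 : 0 <= b by exact: normr_ge0.
have c0 := cmod_ge0 (rel q v).
apply: (@le_trans _ _ (K * (a + b) * (a + b))).
  by rewrite -mulrA; apply: ler_wpM2l => //; rewrite expr2; apply: ler_pM.
apply: ler_wpM2r; first exact: addr_ge0.
apply: (@le_trans _ _ ((K + 1) * (2 * (e / (2 * (K + 1)))))).
  by apply: ler_pM => //; [exact: addr_ge0|lra|lra].
by rewrite le_eqVlt; apply/orP; left; apply/eqP; field; exact: lt0r_neq0.
Qed.

(** The series is centred at [p], while the box is around [q0]: the two points differ, since the
    polar representation says nothing at its own centre. *)
Definition is_series q0 (e : R) p r (B : nat -> C) (h : psum r B) f := forall q,
  `|q.1 - q0.1| < e -> `|q.2 - q0.2| < e -> cmod (rel p q) < r /\ f q = psv h (rel p q).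

Lemma is_series_diff2 q0 e p r (B : nat -> C) (h : psum r B) f : is_series q0 e p h f ->
  forall q, `|q.1 - q0.1| < e -> `|q.2 - q0.2| < e ->
  diff2 f q (psv (psum_D h) (rel p q)) (psv (psum_imul (psum_D h)) (rel p q)).
Proof.
move=> fs q q1 q2; have [qr _] := fs q q1 q2.
pose d := Num.min (e - `|q.1 - q0.1|) (e - `|q.2 - q0.2|).
apply: (@diff2_local _ (fun v => psv h (rel p v)) _ _ _ d); last exact: psv_diff2.
  by rewrite lt_min !subr_gt0 q1.
move=> v; rewrite !lt_min => /andP[v1 _] /andP[_ v2].
have tr (a b c : R) : `|a - b| < e - `|b - c| -> `|a - c| < e.
  move=> ha; have -> : a - c = (a - b) + (b - c) by ring.
  by apply: le_lt_trans (ler_normD _ _) _; lra.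
by have [] := fs v (tr _ _ _ v1) (tr _ _ _ v2).
Qed.

Lemma is_series_x q0 e p r (B : nat -> C) (h : psum r B) f : is_series q0 e p h f ->
  is_series q0 e p (psum_D h) (partial_x f).
Proof.
move=> fs q q1 q2; have [qr _] := fs q q1 q2; split=> //.
by rewrite /partial_x; have [_ ->] := diff2_x (is_series_diff2 fs q1 q2).
Qed.

Lemma is_series_y q0 e p r (B : nat -> C) (h : psum r B) f : is_series q0 e p h f ->
  is_series q0 e p (psum_imul (psum_D h)) (partial_y f).
Proof.
move=> fs q q1 q2; have [qr _] := fs q q1 q2; split=> //.
by rewrite /partial_y; have [_ ->] := diff2_y (is_series_diff2 fs q1 q2).
Qed.

Lemma is_series_C1 q0 e p r (B : nat -> C) (h : psum r B) f : is_series q0 e p h f -> 0 < e ->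
  [/\ derivable f q0 ((1, 0) : R * R), derivable f q0 ((0, 1) : R * R),
      {for q0, continuous (partial_x f)} & {for q0, continuous (partial_y f)}].
Proof.
move=> fs e0; have z (x : R) : `|x - x| < e by rewrite subrr normr0.
have d0 := is_series_diff2 fs (z _) (z _).
have [dx _] := diff2_x d0; have [dy _] := diff2_y d0.
split; [exact: dx|exact: dy| |]; last first.
  exact: diff2_continuous (is_series_diff2 (is_series_y fs) (z _) (z _)).
exact: diff2_continuous (is_series_diff2 (is_series_x fs) (z _) (z _)).
Qed.

Lemma psvN r (B B' : nat -> C) (h : psum r B) (h' : psum r B') (w : C) :
  (forall n, B' n = - B n) -> cmod w < r -> psv h' w = - psv h w.
Proof.
move=> E wr; apply: (@seq_lim_unique R (fun N => pps N B' w)); first exact: psv_cvg.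
rewrite (_ : (fun N => _) = (fun N => - pps N B w)); first by apply: cvgN; exact: psv_cvg.
apply/funext => N; rewrite /pps -sumrN; apply: eq_bigr => n _.
by rewrite E mulNr ReN.
Qed.

Lemma polar_form (w : C) : exists t, w = cmod w *: expi t.
Proof.
have [w0|w0] := eqVneq (cmod w) 0.
  exists 0; rewrite w0 scale0r; have := Re_le_cmod w; have := Im_le_cmod w.
  by rewrite w0 !normr_le0 => /eqP i0 /eqP r0; apply: C_eq; rewrite ?Re0 ?Im0.
have cp : 0 < cmod w by rewrite lt_def w0 cmod_ge0.
pose c := Re w / cmod w; pose s := Im w / cmod w.
have cs : c ^+ 2 + s ^+ 2 = 1.
  by rewrite /c /s !exprMn -mulrDl -sqmodE -cmod2 -exprMn divff// expr1n.
have c1 : `|c| <= 1.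
  rewrite -(@ler_pXn2r _ 2)// ?nnegrE// expr1n real_normK ?num_real//.
  by rewrite -cs lerDl sqr_ge0.
have cc : -1 <= c <= 1 by rewrite -ler_norml.
have ss : Num.sqrt (1 - c ^+ 2) = `|s| by rewrite -cs addrAC subrr add0r sqrtr_sqr.
exists (if 0 <= s then acos c else - acos c); apply: C_eq; rewrite !ReImE /=.
  by case: ifP => _; rewrite ?cosN acosK ?in_itv//= /c mulrC divfK.
have sa : sin (acos c) = `|s| by rewrite sin_acos.
case: ifPn => hs; first by rewrite sa ger0_norm// /s mulrC divfK.
by rewrite sinN sa ltr0_norm ?ltNge// opprK /s mulrC divfK.
Qed.

Lemma cauchy_riemann_series f g P Q (M : R) q0 (dl : R) : 0 < dl ->
  continuous f -> continuous g -> continuous P -> continuous Q ->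
  (forall q, `|f q| <= M) -> (forall q, `|g q| <= M) ->
  (forall q, `|P q| <= M) -> (forall q, `|Q q| <= M) ->
  (forall q, `|q.1 - q0.1| < dl -> `|q.2 - q0.2| < dl -> diff2 f q (P q) (Q q) /\ diff2 g q (- Q q) (P q)) ->
  exists e p r (B : nat -> C) (h : psum r B), 0 < e /\ is_series q0 e p h f.
Proof.
move=> dl0 cf cg cP cQ bf bg bP bQ dfg.
(* Displaced by dl / 4, so that the box of half-side dl / 16 around [q0] avoids the centre and still
   lies in the disc of radius dl / 2. *)
pose p : R * R := (q0.1 - dl / 4, q0.2).
have rho0 : 0 < dl / 2 by lra.
have inb (q : R * R) : `|q.1 - p.1| < dl / 2 -> `|q.2 - p.2| < dl / 2 -> `|q.1 - q0.1| < dl /\ `|q.2 - q0.2| < dl.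
  by rewrite /p /= !ltr_norml => /andP[? ?] /andP[? ?]; split; apply/andP; split; lra.
have df q : `|q.1 - p.1| < dl / 2 -> `|q.2 - p.2| < dl / 2 -> diff2 f q (P q) (Q q).
  by move=> h1 h2; have [k1 k2] := inb q h1 h2; have [] := dfg q k1 k2.
have dg q : `|q.1 - p.1| < dl / 2 -> `|q.2 - p.2| < dl / 2 -> diff2 g q (- Q q) (P q).
  by move=> h1 h2; have [k1 k2] := inb q h1 h2; have [] := dfg q k1 k2.
have modes := polar_modes rho0 cf cg cP cQ bf bg bP bQ df dg.
have [B [h hB]] := polar_series cf bf modes.
exists (dl / 16), p, (dl / 2), B, h; split=> [|q]; first by lra.
rewrite !ltr_norml => /andP[a1 a2] /andP[b1 b2].
have w0 : 0 < cmod (rel p q).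
  by apply: lt_le_trans (Re_le_cmod _); rewrite normr_gt0 /= /p /=; apply: lt0r_neq0; lra.
have wr : cmod (rel p q) < dl / 2.
  apply: le_lt_trans (cmod_le_ReIm _) _; rewrite /= /p /=.
  have h1 : `|q.1 - (q0.1 - dl / 4)| <= 5 * dl / 16 by rewrite ler_norml; apply/andP; split; lra.
  have h2 : `|q.2 - q0.2| <= dl / 16 by rewrite ler_norml; apply/andP; split; lra.
  lra.
split=> //; have [t Et] := polar_form (rel p q).
have rr : 0 < cmod (rel p q) < dl / 2 by rewrite w0.
have := hB _ t rr; rewrite -Et => <-; congr f.
have := congr1 (fun w : C => Re w) Et; have := congr1 (fun w : C => Im w) Et.
rewrite !ReImE /= => Ei Er; rewrite /circle -Ei -Er [LHS]surjective_pairing.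
by rewrite /p /=; congr (_, _); ring.
Qed.

Theorem cauchy_riemann_harmonic f g P Q (Om : set (R * R)) (M : R) :
  continuous f -> continuous g -> continuous P -> continuous Q ->
  (forall q, `|f q| <= M) -> (forall q, `|g q| <= M) ->
  (forall q, `|P q| <= M) -> (forall q, `|Q q| <= M) ->
  (forall p, Om p -> exists2 d : R, 0 < d & forall q, `|q.1 - p.1| < d -> `|q.2 - p.2| < d -> Om q) ->
  (forall q, Om q -> diff2 f q (P q) (Q q) /\ diff2 g q (- Q q) (P q)) ->
  C2_on Om f /\ (forall q, Om q -> laplacian f q = 0).
Proof.
move=> cf cg cP cQ bf bg bP bQ opn dfg.
have H q0 : Om q0 -> exists e p r (B : nat -> C) (h : psum r B), 0 < e /\ is_series q0 e p h f.
  move=> Oq; have [d d0 hd] := opn q0 Oq.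
  by apply: (cauchy_riemann_series d0 cf cg cP cQ bf bg bP bQ) => q h1 h2; apply: dfg; exact: hd.
split.
  split=> q0 /H[e [p [r [B [h [e0 fs]]]]]].
  - exact: is_series_C1 fs e0.
  - exact: is_series_C1 (is_series_x fs) e0.
  - exact: is_series_C1 (is_series_y fs) e0.
move=> q0 /H[e [p [r [B [h [e0 fs]]]]]].
have z (x : R) : `|x - x| < e by rewrite subrr normr0.
have [qr Ex] := is_series_x (is_series_x fs) (z _) (z _).
have [_ Ey] := is_series_y (is_series_y fs) (z q0.1) (z q0.2).
rewrite /laplacian Ex Ey.
(* The series of f_xx and f_yy have opposite coefficients, because the factor i occurs twice in the
   second. *)
rewrite (@psvN r _ _ (psum_D (psum_D h)) (psum_imul (psum_D (psum_imul (psum_D h)))) (rel p q0) _ qr) ?subrr// => n.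
by rewrite /imul /psD; apply: C_eq; rewrite !ReImE /=; ring.
Qed.

End InteriorRegularity.

(** * The potential of a solution of the straightened system *)

Section StripPotential.
Context {R : realType}.
Variables (Y c d : R -> R -> R) (kap L : R).
Hypotheses (kap0 : 0 < kap)
  (cY : continuous (fun q : R * R => Y q.1 q.2))
  (cc : continuous (fun q : R * R => c q.1 q.2))
  (cd : continuous (fun q : R * R => d q.1 q.2))
  (dYx : forall x z : R, 0 <= z <= 1 -> is_derive x 1 (fun x => Y x z) (c x z))
  (dYz : forall x z : R, 0 < z < 1 -> is_derive z 1 (Y x) (d x z))
  (cL : forall x z : R, `|c x z| <= L) (dk : forall x z : R, kap <= d x z).
Variables (phi phix phiz the thex thez : R -> R -> R) (M : R).
Hypotheses (cphi : continuous (fun q : R * R => phi q.1 q.2))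
  (cphix : continuous (fun q : R * R => phix q.1 q.2))
  (cphiz : continuous (fun q : R * R => phiz q.1 q.2))
  (cthe : continuous (fun q : R * R => the q.1 q.2))
  (cthex : continuous (fun q : R * R => thex q.1 q.2))
  (cthez : continuous (fun q : R * R => thez q.1 q.2))
  (bphi : forall x z, `|phi x z| <= M) (bphix : forall x z, `|phix x z| <= M)
  (bphiz : forall x z, `|phiz x z| <= M) (bthe : forall x z, `|the x z| <= M)
  (dphix : forall x z : R, 0 < z < 1 -> is_derive x 1 (fun x => phi x z) (phix x z))
  (dphiz : forall x z : R, 0 < z < 1 -> is_derive z 1 (phi x) (phiz x z))
  (dthex : forall x z : R, 0 < z < 1 -> is_derive x 1 (fun x => the x z) (thex x z))
  (dthez : forall x z : R, 0 < z < 1 -> is_derive z 1 (the x) (thez x z))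
  (E1 : forall x z : R, c x z * phiz x z + thez x z - d x z * phix x z = 0)
  (E2 : forall x z : R, c x z * thez x z - phiz x z - d x z * thex x z = 0).

Let Z : R * R -> R := Zinv kap0 cY dYz dk.
Let Om := strip_domain Y.

Definition strip_pot (q : R * R) : R := phi q.1 (Z q).
Let pot := strip_pot.
Let slope x z : R := phix x z - phiz x z * (c x z / d x z).
Let rise x z : R := phiz x z / d x z.

Let d0 x z : 0 < d x z. Proof. exact: lt_le_trans kap0 (dk x z). Qed.
Let dn0 x z : d x z != 0. Proof. by rewrite gt_eqF. Qed.

Let cdiv (F : R -> R -> R) : continuous (fun q : R * R => F q.1 q.2) ->
  continuous (fun q : R * R => F q.1 q.2 / d q.1 q.2).
Proof.
move=> cF q; apply: (@cvgM _ _ (nbhs q) _ (fun q => F q.1 q.2) (fun q => (d q.1 q.2)^-1)); first exact: cF.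
by apply: (@cvgV _ _ (nbhs q) _ (fun q => d q.1 q.2)); [exact: dn0|exact: cd].
Qed.

Let cslope : continuous (fun q : R * R => slope q.1 q.2).
Proof.
move=> q; apply: (@cvgB _ _ _ (nbhs q) _ (fun q => phix q.1 q.2)); first exact: cphix.
by apply: (@cvgM _ _ (nbhs q) _ (fun q => phiz q.1 q.2)); [exact: cphiz|exact: (cdiv cc)].
Qed.

Let crise : continuous (fun q : R * R => rise q.1 q.2). Proof. exact: cdiv. Qed.

Let pull F (cF : continuous (fun q : R * R => F q.1 q.2)) : continuous (fun q => F q.1 (Z q)) :=
  @continuous_pull R Y c d kap L kap0 cY dYx dYz cL dk F cF.

(** The straightened equations in physical variables: [slope] and [rise] are phi_x and phi_y, and
    they equal theta_y and - theta_x. *)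
Let slopeE x z : slope x z = thez x z / d x z.
Proof.
rewrite /slope; have dd := dn0 x z; have e1 := E1 x z.
by have -> : thez x z = d x z * phix x z - c x z * phiz x z by [lra]; field.
Qed.

Let riseE x z : rise x z = c x z * thez x z / d x z - thex x z.
Proof.
rewrite /rise; have dd := dn0 x z; have e2 := E2 x z.
by have -> : phiz x z = c x z * thez x z - d x z * thex x z by [lra]; field.
Qed.

Let pot_diff2 p : Om p -> diff2 pot p (slope p.1 (Z p)) (rise p.1 (Z p)) /\
  diff2 (fun q => the q.1 (Z q)) p (- rise p.1 (Z p)) (slope p.1 (Z p)).
Proof.
move=> Op; split; first exact: (diff2_pull kap0 cY cc cd dYx dYz cL dk cphix cphiz dphix dphiz Op).
have := diff2_pull kap0 cY cc cd dYx dYz cL dk cthex cthez dthex dthez Op.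
rewrite -/Z; move: (p.1) (Z p) => x z.
have -> : thex x z - thez x z * (c x z / d x z) = - rise x z by rewrite riseE; ring.
by rewrite slopeE.
Qed.

Let pot_regular : C2_on Om pot /\ forall q, Om q -> laplacian pot q = 0.
Proof.
have M0 : 0 <= M by exact: le_trans (bphi 0 0).
have L0 : 0 <= L by exact: le_trans (cL 0 0).
have dinv x z : `|(d x z)^-1| <= kap^-1.
  by rewrite normfV (gtr0_norm (d0 x z)) lef_pV2 ?posrE.
have MLk : 0 <= M * (L / kap) by rewrite mulr_ge0// divr_ge0// ltW.
have Mk : 0 <= M / kap by rewrite divr_ge0// ltW.
apply: (@cauchy_riemann_harmonic R pot (fun q => the q.1 (Z q)) (fun q => slope q.1 (Z q))
  (fun q => rise q.1 (Z q)) Om (M + M * (L / kap) + M / kap)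
  (pull cphi) (pull cthe) (pull cslope) (pull crise)) => //.
- by move=> q; apply: le_trans (bphi _ _) _; lra.
- by move=> q; apply: le_trans (bthe _ _) _; lra.
- move=> q; apply: (@le_trans _ _ (M + M * (L / kap))); last by lra.
  apply: le_trans (ler_normB _ _) _; apply: lerD => //.
  by rewrite !normrM; apply: ler_pM => //; apply: ler_pM.
- move=> q; apply: (@le_trans _ _ (M / kap)); last by lra.
  by rewrite normrM; apply: ler_pM.
- by move=> p Op; exact: (strip_domain_nbhs kap0 cY dYx dYz cL dk Op).
Qed.

Let partials q : Om q -> partial_x pot q = slope q.1 (Z q) /\ partial_y pot q = rise q.1 (Z q).
Proof.
move=> Oq; have [h _] := pot_diff2 Oq; rewrite /partial_x /partial_y.
by have [_ ->] := diff2_x h; have [_ ->] := diff2_y h.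
Qed.

Lemma within_ext_cvg (D : set (R * R)) (F H : R * R -> R) z : (forall w, D w -> F w = H w) ->
  {for z, continuous H} -> F w @[w --> within D (nbhs z)] --> H z.
Proof.
move=> FH cH; have h : H w @[w --> within D (nbhs z)] --> H z by exact: cvg_within_filter cH.
apply: cvg_trans h; apply: near_eq_cvg; rewrite near_withinE; apply: nearW => w Dw.
by rewrite FH.
Qed.

Lemma strip_domain_closure x z : 0 <= z <= 1 -> closure Om (x, Y x z).
Proof.
move=> /andP[z0 z1] B nB.
have cz : {for z, continuous (fun t => (x, Y x t))}.
  apply: (@cvg_pair _ _ _ (nbhs z) (nbhs x) (nbhs (Y x z)) _ _ _ (cst x) (Y x)); first exact: cvg_cst.
  apply: (@continuous_comp _ _ _ (fun z => (x, z)) (fun q => Y q.1 q.2)); last exact: cY.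
  by apply: (@cvg_pair _ _ _ (nbhs z) (nbhs x) (nbhs z) _ _ _ (cst x) id); [exact: cvg_cst|exact: cvg_id].
have /nbhs_ballP[e /= e0 he] := cz _ nB.
pose t := Num.min 1 e; have t0 : 0 < t by rewrite lt_min ltr01.
have t1 : t <= 1 by rewrite ge_min lexx.
have te : t <= e by rewrite ge_min lexx orbT.
(* Moving z towards 1/2 by at most t / 2 enters the open interval and stays within distance e. *)
clearbody t; pose w := z + t * (1 / 2 - z).
have tz : 0 <= t * z by rewrite mulr_ge0// ltW.
have tz1 : t * z <= t by rewrite -[leRHS]mulr1 ler_wpM2l// ltW.
have zt : 0 <= (1 - t) * z by rewrite mulr_ge0// subr_ge0.
have zt1 : (1 - t) * z <= 1 - t by rewrite -[leRHS]mulr1 ler_wpM2l// subr_ge0.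
have w01 : 0 < w < 1 by rewrite /w; apply/andP; split; lra.
have w01' : 0 <= w <= 1 by case/andP: w01 => /ltW-> /ltW->.
exists (x, Y x w); split; last first.
  by apply: he; rewrite /ball/= /w ltr_norml; apply/andP; split; lra.
by apply/(strip_domainP kap0 cY dYz dk); rewrite Zinv_Y.
Qed.

Let trace_eq (F : R * R -> R) (H : R -> R -> R) x z : 0 <= z <= 1 ->
  (forall w, Om w -> F w = H w.1 (Z w)) -> continuous (fun q : R * R => H q.1 q.2) ->
  trace Om F (x, Y x z) = H x z.
Proof.
move=> z01 FH cH; have hc := @within_ext_cvg Om F (fun w => H w.1 (Z w)) (x, Y x z) FH (@pull H cH _).
have cl := @strip_domain_closure x z z01.
have pr : ProperFilter (within Om (nbhs (x, Y x z))) by exact: within_nbhs_proper.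
rewrite /trace; have -> := cvg_lim _ hc => //=.
by rewrite /Z Zinv_Y.
Qed.

Hypotheses (pY : forall x z, Y (x + pi *+ 2) z = Y x z) (pphi : forall x z, phi (x + pi *+ 2) z = phi x z).
Variables (h gamma : R) (eta beta psi : R -> R).
Hypotheses (Ytop : forall x, Y x 1 = eta x) (Ybot : forall x, Y x 0 = - h + beta x)
  (phitop : forall x, phi x 1 = psi x) (thebot : forall x, thex x 0 = gamma * Y x 0 * c x 0).

Let fluidE : fluid_domain h eta beta = Om.
Proof. by apply/funext => q; rewrite /fluid_domain /Om /strip_domain /mkset Ytop Ybot. Qed.

(** Multiplying [slope] by the boundary slope and subtracting it from [rise] cancels the terms with
    [thez] at both boundaries. Only the tangential derivative [thex] remains: it gives the flux at
    the top, and its prescribed value gives the condition at the bottom. *)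
Theorem strip_potential : is_potential h eta beta gamma psi strip_pot /\
  forall x, normal_trace h eta beta strip_pot x = - thex x 1.
Proof.
have i0 : 0 <= (0 : R) <= 1 by rewrite lexx ler01.
have i1 : 0 <= (1 : R) <= 1 by rewrite lexx ler01.
have tx := @trace_eq (partial_x pot) slope _ _ _ (fun w Ow => (partials Ow).1) cslope.
have ty := @trace_eq (partial_y pot) rise _ _ _ (fun w Ow => (partials Ow).2) crise.
have dbeta x : derive1 beta x = c x 0.
  have -> : beta = (fun x => h + Y x 0) by apply/funext => t; rewrite Ybot; ring.
  have hd := is_deriveDf (@is_derive_cst R R R h x 1) (dYx x i0).
  by rewrite derive1E; have [_ ->] := hd; rewrite add0r.
have deta x : derive1 eta x = c x 1.
  have -> : eta = (fun x => Y x 1) by apply/funext => t; rewrite Ytop.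
  by rewrite derive1E; have [_ ->] := dYx x i1.
have [reg lap] := pot_regular.
split; last first.
  move=> x; rewrite /normal_trace fluidE deta -Ytop tx// ty//.
  by rewrite slopeE riseE; ring.
split=> //; rewrite ?fluidE.
- move=> z Oz; rewrite /strip_pot /= pphi; congr (phi _ _).
  apply: (Yext_inj kap0 cY dYz dk (x := z.1)).
  have := ZinvK kap0 cY dYz dk (z.1 + pi *+ 2, z.2); rewrite /= {1}/Yext pY -/(Yext Y kap _ _) => ->.
  by rewrite ZinvK.
- exact: reg.
- by move=> z Oz; exact: lap.
- split=> z _.
  + by apply: cvgP; apply: (@within_ext_cvg Om pot pot z) => //; exact: (pull cphi).
  + by apply: cvgP; apply: (@within_ext_cvg Om _ (fun w => slope w.1 (Z w)) z (fun w Ow => (partials Ow).1)); exact: (pull cslope).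
  + by apply: cvgP; apply: (@within_ext_cvg Om _ (fun w => rise w.1 (Z w)) z (fun w Ow => (partials Ow).2)); exact: (pull crise).
- by move=> x; rewrite -Ytop (@trace_eq pot phi).
move=> x y; rewrite /y -Ybot tx// ty// dbeta.
by rewrite slopeE riseE thebot; ring.
Qed.

End StripPotential.

(** * Uniqueness of the potential *)

Section BoundaryLimits.
Context {R : realType}.
Implicit Types (D : set (R * R)) (V L : R * R -> R) (z w : R * R).

(** Boundary limits as an epsilon-delta statement, which can be combined linearly and evaluated
    along paths. *)
Definition has_limits D V L := forall z, closure D z -> forall e : R, 0 < e ->
  exists2 d : R, 0 < d & forall w, D w -> `|w.1 - z.1| < d -> `|w.2 - z.2| < d -> `|V w - L z| <= e.

Lemma has_limits_trace D V : extends_to_closure D V -> has_limits D V (trace D V).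
Proof.
move=> ext z cz e e0; have h : V w @[w --> within D (nbhs z)] --> trace D V z by exact: ext.
move/cvgrPdist_le : h => /(_ _ e0); rewrite near_withinE => /nbhs_ballP[d /= d0 hd].
by exists d => // w Dw w1 w2; rewrite distrC; apply: hd => //; split; rewrite /ball/= distrC.
Qed.

Lemma has_limits_continuous D V : continuous V -> has_limits D V V.
Proof.
move=> cV z _ e e0; have [d d0 hd] := (@cont2_eps R V z).1 (cV z) e e0.
by exists d => // w _; exact: hd.
Qed.

Lemma has_limits_lin D (a : R) V1 L1 V2 L2 : has_limits D V1 L1 -> has_limits D V2 L2 ->
  has_limits D (fun w => V1 w + a * V2 w) (fun w => L1 w + a * L2 w).
Proof.
move=> h1 h2 z cz e e0; have a0 : 0 < `|a| + 1 by rewrite ltr_wpDl.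
have [d1 d10 hd1] := h1 z cz (e / 2) ltac:(by rewrite divr_gt0).
have [d2 d20 hd2] := h2 z cz (e / 2 / (`|a| + 1)) ltac:(by rewrite !divr_gt0).
exists (Num.min d1 d2) => [|w Dw]; first by rewrite lt_min d10.
rewrite !lt_min => /andP[a1 a2] /andP[b1 b2].
have -> : V1 w + a * V2 w - (L1 z + a * L2 z) = (V1 w - L1 z) + a * (V2 w - L2 z) by ring.
apply: le_trans (ler_normD _ _) _.
have k1 := hd1 w Dw a1 b1; have := hd2 w Dw a2 b2; rewrite ler_pdivlMr// normrM => k2.
have := normr_ge0 (V2 w - L2 z); have := normr_ge0 a; nra.
Qed.

Lemma has_limits_inside D V L z : has_limits D V L -> D z -> L z = V z.
Proof.
move=> h Dz; apply/esym/eqP; rewrite -subr_eq0 -normr_le0; apply/ler_addgt0Pr => e e0; rewrite add0r.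
have [d d0 hd] := h z (subset_closure Dz) e e0.
by apply: hd => //; rewrite subrr normr0.
Qed.

Lemma has_limits_le0 D (F : R * R -> R) z : closure D z -> {for z, continuous F} -> (forall w, D w -> F w <= 0) -> F z <= 0.
Proof.
move=> cz cF Fle; rewrite leNgt; apply/negP => Fz.
have : \forall w \near z, 0 < F w by apply: (cvgr_gt _ cF).
by move=> /cz[w [Dw /=]]; rewrite ltNge (Fle _ Dw).
Qed.

(** [V] has values only inside the domain, so the maximum is sought as a cluster point of its
    superlevel sets; compactness comes from restricting to one period. *)
Lemma max_point D D' (K : set (R * R)) V L w0 : compact K -> D' `<=` K -> D' `<=` D -> D' w0 ->
  has_limits D V L -> exists2 z, K z /\ closure D z & forall w, D' w -> V w <= L z.
Proof.
move=> cK D'K D'D Dw0 hV.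
pose F := filter_from D' (fun w => [set v | D' v /\ V w <= V v]).
have fF : ProperFilter F.
  apply: filter_from_proper => [|w Dw]; last by exists w.
  apply: filter_from_filter; first by exists w0.
  move=> i j Di Dj; have [ij|/ltW ji] := leP (V i) (V j).
    by exists j => // v [Dv jv]; split; split=> //; exact: le_trans jv.
  by exists i => // v [Dv iv]; split; split=> //; exact: le_trans iv.
have [z [Kz clz]] : K `&` cluster F !=set0.
  by apply: cK; exists w0 => // v [Dv _]; exact: D'K.
have cDz : closure D z.
  move=> B nB; have [|v [[Dv _] Bv]] := clz [set v | D' v /\ V w0 <= V v] B _ nB; first by exists w0.
  by exists v; split => //; exact: D'D.
exists z => // w Dw; apply/ler_addgt0Pr => e e0; have [d d0 hd] := hV z cDz e e0.
have [||v [[Dv wv] bv]] := clz [set v | D' v /\ V w <= V v] (ball z d).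
- by exists w.
- exact: nbhsx_ballx.
case: bv => b1 b2; have := hd v (D'D _ Dv); rewrite /ball/= in b1 b2.
rewrite distrC in b1; rewrite distrC in b2 => /(_ b1 b2); rewrite ler_norml => /andP[_ h].
by move: h wv; lra.
Qed.

Lemma second_derivative_max (g g' : R -> R) (a l dl : R) : 0 < dl ->
  (forall t : R, `|t - a| < dl -> is_derive t 1 g (g' t)) -> is_derive a 1 g' l ->
  (forall t, `|t - a| < dl -> g t <= g a) -> l <= 0.
Proof.
move=> dl0 dg dg' mx; have aa : `|a - a| < dl by rewrite subrr normr0.
have half (d : R) (b : R) : 0 < d -> b = 1 \/ b = -1 -> exists t : R, [/\ `|t - a| < dl, `|t - a| < d, 0 < `|t - a| & t - a = b * `|t - a|].
  move=> d0 hb; pose m := Num.min d dl / 2; have m0 : 0 < m by rewrite divr_gt0// lt_min d0.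
  have md : m < d by rewrite ltr_pdivrMr// (@le_lt_trans _ _ d)// ?ge_min ?lexx//; lra.
  have ml : m < dl by rewrite ltr_pdivrMr// (@le_lt_trans _ _ dl)// ?ge_min ?lexx ?orbT//; lra.
  clearbody m; exists (a + b * m); have -> : a + b * m - a = b * m by ring.
  have -> : `|b * m| = m by case: hb => ->; rewrite ?mul1r ?mulN1r ?normrN gtr0_norm.
  by split.
have z0 : g' a = 0.
  apply/eqP; case: (ltgtP (g' a) 0) => // ga; exfalso.
  - have [d d0 hd] := is_derive_eps (dg a aa) (e := - g' a / 2) ltac:(lra).
    have [t [t1 t2 t3 t4]] := half d (-1) d0 (or_intror erefl).
    have := hd t t2; have := mx t t1; rewrite ler_norml => h1 /andP[h2 _].
    by move: t3 t4 h1 h2; move: (t - a) (`|t - a|) => x m m0 -> h1 h2; nra.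
  - have [d d0 hd] := is_derive_eps (dg a aa) (e := g' a / 2) ltac:(lra).
    have [t [t1 t2 t3 t4]] := half d 1 d0 (or_introl erefl).
    have := hd t t2; have := mx t t1; rewrite ler_norml => h1 /andP[h2 _].
    by move: t3 t4 h1 h2; move: (t - a) (`|t - a|) => x m m0 -> h1 h2; nra.
rewrite leNgt; apply/negP => l0.
have [d d0 hd] := is_derive_eps dg' (e := l / 2) ltac:(lra).
have [t [t1 t2 t3 t4]] := half d 1 d0 (or_introl erefl).
have inn (x : R) : a - dl < x < a + dl -> is_derive x 1 g (g' x).
  by move=> /andP[x1 x2]; apply: dg; rewrite ltr_norml; apply/andP; split; lra.
rewrite mul1r in t4; have ta : a < t by rewrite -subr_gt0 t4.
have tdl : t - a < dl by rewrite t4.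
have dct (x : R) : x \in `]a, t[ -> is_derive x 1 g (g' x).
  by rewrite in_itv /= => /andP[x1 x2]; apply: inn; clear - x1 x2 tdl dl0; apply/andP; split; lra.
have cg : {within `[a, t], continuous g}.
  apply: continuous_in_subspaceT => x; rewrite inE /= in_itv /= => /andP[x1 x2].
  by apply: is_derive1_continuous (inn x _); clear - x1 x2 tdl dl0; apply/andP; split; lra.
have [x] := MVT ta dct cg; rewrite in_itv /= => /andP[x1 x2] E.
have hx := hd x; rewrite z0 subr0 ger0_norm in hx; last by lra.
have := hx ltac:(clear - x2 t2 t4; lra); rewrite ler_norml => /andP[h2 _].
have xa : 0 < x - a by rewrite subr_gt0.
have gx : 0 < g' x by have := mulr_gt0 l0 xa; clear - h2; lra.
have ta0 : 0 < t - a by rewrite subr_gt0.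
by have := mulr_gt0 gx ta0; rewrite -E; have := mx t t1; clear; lra.
Qed.

Lemma is_derive_slice_x (F : R * R -> R) (a b : R) : derivable F (a, b) ((1, 0) : R * R) ->
  is_derive a 1 (fun t => F (t, b)) (partial_x F (a, b)).
Proof.
move=> dF; have E : (fun h : R => h^-1 *: ((F \o shift (a, b)) (h *: ((1, 0) : R * R)) - F (a, b))) =
    (fun h : R => h^-1 *: (((fun t => F (t, b)) \o shift a) (h *: (1 : R)) - F (a, b))).
  apply/funext => h; congr (_ *: (F _ - _)); rewrite [LHS]surjective_pairing; congr (_, _).
  by rewrite /= /GRing.scale /= mulr0 add0r.
by split; rewrite /partial_x /derivable /derive -E.
Qed.

Lemma is_derive_slice_y (F : R * R -> R) (a b : R) : derivable F (a, b) ((0, 1) : R * R) ->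
  is_derive b 1 (fun t => F (a, t)) (partial_y F (a, b)).
Proof.
move=> dF; have E : (fun h : R => h^-1 *: ((F \o shift (a, b)) (h *: ((0, 1) : R * R)) - F (a, b))) =
    (fun h : R => h^-1 *: (((fun t => F (a, t)) \o shift b) (h *: (1 : R)) - F (a, b))).
  apply/funext => h; congr (_ *: (F _ - _)); rewrite [LHS]surjective_pairing; congr (_, _).
  by rewrite /= /GRing.scale /= mulr0 add0r.
by split; rewrite /partial_y /derivable /derive -E.
Qed.

Lemma mean_split (f0 f1 f2 a b A B x y : R) : f0 - f1 = a * x -> f1 - f2 = b * y ->
  f0 - f2 - A * x - B * y = (a - A) * x + (b - B) * y.
Proof.
move=> E1 E2; have -> : f0 = f1 + a * x by rewrite -E1; ring.
by have -> : f1 = f2 + b * y by [rewrite -E2; ring]; ring.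
Qed.

Lemma C1_diff2 D (F : R * R -> R) p (r : R) : 0 < r -> C1_on D F ->
  (forall q, `|q.1 - p.1| < r -> `|q.2 - p.2| < r -> D q) ->
  diff2 F p (partial_x F p) (partial_y F p).
Proof.
move=> r0 dF hD e e0; have z0 (x : R) : `|x - x| < r by rewrite subrr normr0.
have [_ _ cx cy] := dF p (hD p (z0 _) (z0 _)).
have [d1 d10 h1] := (cont2_eps _ _).1 cx e e0; have [d2 d20 h2] := (cont2_eps _ _).1 cy e e0.
pose d := Num.min r (Num.min d1 d2); have d0 : 0 < d by rewrite !lt_min r0 d10.
exists d => // q q1 q2.
have [dr dd1 dd2] : [/\ d <= r, d <= d1 & d <= d2] by rewrite /d !ge_min !lexx ?orbT.
have itv (a x : R) : `|x - a| < d -> a - d < x < a + d.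
  by rewrite ltr_norml => /andP[? ?]; apply/andP; split; lra.
have nrm (a x : R) : a - d < x < a + d -> `|x - a| < d.
  by move=> /andP[? ?]; rewrite ltr_norml; apply/andP; split; lra.
have sx (x : R) : p.1 - d < x < p.1 + d -> is_derive x 1 (fun t => F (t, q.2)) (partial_x F (x, q.2)).
  move=> /nrm hx; have Dx : D (x, q.2) by apply: hD; [exact: lt_le_trans hx dr|exact: lt_le_trans q2 dr].
  by apply: is_derive_slice_x; have [h _ _ _] := dF _ Dx; exact: h.
have sy (y : R) : p.2 - d < y < p.2 + d -> is_derive y 1 (fun t => F (p.1, t)) (partial_y F (p.1, y)).
  move=> /nrm hy; have Dy : D (p.1, y) by apply: hD; [exact: z0|exact: lt_le_trans hy dr].
  by apply: is_derive_slice_y; have [_ h _ _] := dF _ Dy; exact: h.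
have pp (a : R) : a - d < a < a + d by apply/andP; split; lra.
have [u [u1 u2] Eu] := mvt_between sx (pp _) (itv _ _ q1).
have [v [v1 v2] Ev] := mvt_between sy (pp _) (itv _ _ q2).
have -> : F q - F p - partial_x F p * (q.1 - p.1) - partial_y F p * (q.2 - p.2) =
    (partial_x F (u, q.2) - partial_x F p) * (q.1 - p.1) + (partial_y F (p.1, v) - partial_y F p) * (q.2 - p.2).
  have {}Eu : F q - F (p.1, q.2) = partial_x F (u, q.2) * (q.1 - p.1) by rewrite -Eu -surjective_pairing.
  have {}Ev : F (p.1, q.2) - F p = partial_y F (p.1, v) * (q.2 - p.2) by rewrite -Ev -surjective_pairing.
  exact: mean_split Eu Ev.
apply: le_trans (ler_normD _ _) _; rewrite !normrM mulrDr; apply: lerD; apply: ler_wpM2r => //.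
  by apply: h1; rewrite /=; [exact: lt_le_trans (nrm _ _ u1) dd1|exact: lt_le_trans q2 dd1].
by apply: h2; rewrite /=; [rewrite subrr normr0|exact: lt_le_trans (nrm _ _ v1) dd2].
Qed.

(** Along a segment leaving [z] the function grows at rate at least [e], starting from its limit
    [lz]; it must exceed [lz]. *)
Lemma normal_growth D V W (z : R * R) (b lz e d r : R) : 0 < e -> 0 < d -> 0 < r ->
  (forall t, 0 < t < d -> D (z.1 - b * t, z.2 + t)) ->
  (forall t : R, 0 < t < d -> is_derive t 1 (fun t => V (z.1 - b * t, z.2 + t)) (W (z.1 - b * t, z.2 + t))) ->
  (forall w, D w -> `|w.1 - z.1| < r -> `|w.2 - z.2| < r -> e <= W w) ->
  (forall e : R, 0 < e -> exists2 d : R, 0 < d &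
     forall w, D w -> `|w.1 - z.1| < d -> `|w.2 - z.2| < d -> `|V w - lz| <= e) ->
  ~ (forall w, D w -> V w <= lz).
Proof.
move=> e0 d0 r0 Dg dg We lV mx; pose gam (t : R) : R * R := (z.1 - b * t, z.2 + t).
have b1 : 0 < `|b| + 1 by rewrite ltr_wpDl.
have sm (x t : R) : 0 < t -> t < x / (`|b| + 1) -> `|(gam t).1 - z.1| < x /\ `|(gam t).2 - z.2| < x.
  move=> t0; rewrite ltr_pdivlMr// => tx; have bt := mulr_ge0 (normr_ge0 b) (ltW t0).
  rewrite /gam /= [_ - b * t]addrC addrK normrN normrM (gtr0_norm t0) [z.2 + t]addrC addrK (gtr0_norm t0).
  by split; lra.
pose d' := Num.min d (r / (`|b| + 1)); have d'0 : 0 < d' by rewrite lt_min d0 divr_gt0.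
have d'd : d' <= d by rewrite ge_min lexx.
have d'r : d' <= r / (`|b| + 1) by rewrite ge_min lexx orbT.
clearbody d'.
have dg' (t : R) : 0 < t < d' -> is_derive t 1 (fun t => V (gam t)) (W (gam t)).
  by move=> /andP[t0 td]; apply: dg; rewrite t0 (lt_le_trans td).
have Dg' (t : R) : 0 < t < d' -> D (gam t) by move=> /andP[t0 td]; apply: Dg; rewrite t0 (lt_le_trans td).
have W' (t : R) : 0 < t < d' -> e <= W (gam t).
  move=> tt; have /andP[t0 td] := tt; have [s1 s2] := sm r t t0 (lt_le_trans td d'r).
  exact: We (Dg' t tt) s1 s2.
pose t := d' / 2; have tt : 0 < t < d' by rewrite /t; apply/andP; split; lra.
have t0 : 0 < t by case/andP: tt.
have et : 0 < e * t / 4 by rewrite divr_gt0// mulr_gt0.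
have [q q0 hq] := lV _ et.
(* At [s] the value is within e t / 4 of [lz], while the growth from s to t is at least e t / 2
   because s is at most t / 2. *)
pose s := Num.min (t / 2) (q / (`|b| + 1) / 2).
have s0 : 0 < s by rewrite lt_min !divr_gt0.
have st : s <= t / 2 by rewrite ge_min lexx.
have sq : s < q / (`|b| + 1).
  have : s <= q / (`|b| + 1) / 2 by rewrite ge_min lexx orbT.
  by have : 0 < q / (`|b| + 1) by [exact: divr_gt0]; clear; lra.
clearbody s; have ss : 0 < s < d' by case/andP: tt => _ t1; rewrite s0 /=; clear - st t0 t1; lra.
have [h1 h2] := sm q s s0 sq.
have := hq _ (Dg' s ss) h1 h2; rewrite ler_norml => /andP[gs _].
have gt := mx _ (Dg' t tt).
have [c [c1 _] Ec] := mvt_between dg' ss tt.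
have W0 := W' c c1.
have t20 : 0 <= t / 2 by exact: divr_ge0 (ltW t0) _.
have ts : t / 2 <= t - s by clear - st; lra.
have := ler_pM (ltW e0) t20 W0 ts.
by rewrite -Ec; have := mulr_gt0 e0 t0; clear - gs gt; lra.
Qed.

(** The two bottom conditions share their inhomogeneous term, so the normal derivatives of the two
    potentials cancel. The perturbation is left, of slope at least [e], and half of it pays for the
    error. *)
Lemma bottom_slope (e p1 q1 p2 q2 b c1 y w : R) : 0 < e -> 1 <= y ->
  - (e / 2) <= w - (q1 + -1 * q2 + - b * (p1 + -1 * p2) + e * y) ->
  c1 * b - p1 * b + q1 = 0 -> c1 * b - p2 * b + q2 = 0 -> e / 2 <= w.
Proof.
by move=> e0 y1 hw B1 B2; have ey : e * 1 <= e * y by [rewrite ler_wpM2l ?(ltW e0)]; lra.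
Qed.

Lemma bottom_ring (a e p1 q1 p2 q2 b y : R) :
  p1 * - b + q1 * 1 + -1 * (p2 * - b + q2 * 1) + e * (a * 1 + (1 * y + y * 1)) =
  q1 + -1 * q2 + - b * (p1 + -1 * p2) + e * (a + 2 * y).
Proof. ring. Qed.

Lemma laplacian_contra (p q p' q' e : R) : 0 < e -> p + q = 0 -> p' + q' = 0 ->
  p + -1 * p' <= 0 -> q + -1 * q' + e * 2 <= 0 -> False.
Proof. by move=> *; lra. Qed.

End BoundaryLimits.

(** * The maximum principle for two potentials of the same problem *)

Section Uniqueness.
Context {R : realType}.
Variables (h gamma M : R) (eta beta psi : R -> R).
Hypotheses (ceta : continuous eta) (cbeta : continuous beta)
  (peta : forall x, eta (x + pi *+ 2) = eta x) (pbeta : forall x, beta (x + pi *+ 2) = beta x)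
  (beta_bd : forall x, `|- h + beta x| <= M) (eta_bd : forall x, `|eta x| <= M)
  (sep : forall x, - h + beta x < eta x)
  (dbeta : forall x : R, is_derive x 1 beta (derive1 beta x)).

Let D := fluid_domain h eta beta.
Let tp : 0 < pi *+ 2 :> R := twopi_gt0.

Let cont1 (f : R -> R) : continuous f -> continuous (fun q : R * R => f q.1).
Proof. by move=> cf q; apply: (@continuous_comp _ _ _ fst f); [exact: cvg_fst|exact: cf]. Qed.

Let clow : continuous (fun q : R * R => (- h + beta q.1) - q.2).
Proof.
move=> q; apply: (@cvgB _ _ _ (nbhs q)); last exact: cvg_snd.
by apply: (@cvgD _ _ _ (nbhs q)); [exact: cvg_cst|exact: (cont1 cbeta)].
Qed.

Let cupp : continuous (fun q : R * R => q.2 - eta q.1).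
Proof. by move=> q; apply: (@cvgB _ _ _ (nbhs q)); [exact: cvg_snd|exact: (cont1 ceta)]. Qed.

Let fluid_bd w : D w -> `|w.2| <= M.
Proof.
rewrite /D /fluid_domain /= => /andP[w1 w2]; have := beta_bd w.1; have := eta_bd w.1.
by rewrite !ler_norml => /andP[_ h1] /andP[h2 _]; apply/andP; split; lra.
Qed.

Lemma fluid_closure z : closure D z -> - h + beta z.1 <= z.2 <= eta z.1.
Proof.
move=> cz; apply/andP; split; rewrite -subr_le0.
  apply: (@has_limits_le0 _ D (fun q => (- h + beta q.1) - q.2) z cz (clow (x:=z))) => w /andP[w1 _].
  by rewrite subr_le0 ltW.
apply: (@has_limits_le0 _ D (fun q => q.2 - eta q.1) z cz (cupp (x:=z))) => w /andP[_ w1].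
by rewrite subr_le0 ltW.
Qed.

Lemma fluid_nbhs p : D p -> exists2 d : R, 0 < d & forall q, `|q.1 - p.1| < d -> `|q.2 - p.2| < d -> D q.
Proof.
move=> /andP[p1 p2].
have [d1 d10 h1] := (cont2_eps _ _).1 (clow (x:=p)) ((p.2 - (- h + beta p.1)) / 2) ltac:(rewrite divr_gt0// subr_gt0//).
have [d2 d20 h2] := (cont2_eps _ _).1 (cupp (x:=p)) ((eta p.1 - p.2) / 2) ltac:(rewrite divr_gt0// subr_gt0//).
exists (Num.min d1 d2) => [|q]; first by rewrite lt_min d10.
rewrite !lt_min => /andP[a1 a2] /andP[b1 b2].
have := h1 q a1 b1; have := h2 q a2 b2; rewrite !ler_norml => /andP[_ k2] /andP[_ k1].
by apply/andP; split; lra.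
Qed.

Lemma fluid_closure_vert x y : - h + beta x <= y <= eta x -> closure D (x, y).
Proof.
move=> /andP[y1 y2] B /nbhs_ballP[e /= e0 he]; have := sep x => sx.
pose m := (- h + beta x + eta x) / 2.
pose t := Num.min 1 (e / (2 * (`|m - y| + 1))); have t0 : 0 < t by rewrite lt_min ltr01 divr_gt0// mulr_gt0// ltr_wpDl.
have t1 : t <= 1 by rewrite ge_min lexx.
have te : t * `|m - y| < e.
  apply: (@le_lt_trans _ _ (e / (2 * (`|m - y| + 1)) * (`|m - y| + 1))).
    by apply: ler_pM; [exact: ltW|by []|rewrite ge_min lexx orbT|lra].
  by rewrite invfM mulrA -mulrA mulVf ?mulr1; [lra|rewrite gt_eqF// ltr_wpDl].
clearbody t; have hm : - h + beta x < m < eta x by rewrite /m; apply/andP; split; lra.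
case/andP: hm => hm1 hm2.
have k1 : 0 <= (1 - t) * (y - (- h + beta x)) by rewrite mulr_ge0// subr_ge0.
have k2 : 0 < t * (m - (- h + beta x)) by rewrite mulr_gt0// subr_gt0.
have k3 : 0 <= (1 - t) * (eta x - y) by rewrite mulr_ge0// subr_ge0.
have k4 : 0 < t * (eta x - m) by rewrite mulr_gt0// subr_gt0.
exists (x, y + t * (m - y)); split; first by apply/andP; split => /=; lra.
apply: he; split; rewrite /ball /= ?subrr ?normr0//.
by rewrite opprD addrA subrr sub0r normrN normrM gtr0_norm.
Qed.

Let periodic_shift (V : R * R -> R) : (forall z, D z -> V (z.1 + pi *+ 2, z.2) = V z) ->
  forall w, D w -> exists2 v, D v /\ 0 <= v.1 <= pi *+ 2 & V v = V w /\ v.2 = w.2.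
Proof.
move=> pV; have Dp z : D (z.1 + pi *+ 2, z.2) <-> D z.
  by rewrite /D /fluid_domain /mkset /= peta pbeta.
have nat (n : nat) x y : (D (x + (pi *+ 2) *+ n, y) <-> D (x, y)) /\
    (D (x, y) -> V (x + (pi *+ 2) *+ n, y) = V (x, y)).
  elim: n => [|n [ih1 ih2]]; first by rewrite mulr0n addr0.
  have E : x + pi *+ 2 *+ n.+1 = (x + pi *+ 2 *+ n) + pi *+ 2 by rewrite mulrSr addrA.
  rewrite E; have Dn := Dp (x + pi *+ 2 *+ n, y); split.
    by split=> [/Dn/ih1|/ih1/Dn].
  by move=> Dxy; rewrite -(ih2 Dxy) -(pV (x + pi *+ 2 *+ n, y))//; exact/ih1.
move=> w Dw; pose k := Num.floor (w.1 / (pi *+ 2)).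
have /andP[k1 k2] := floor_itv (w.1 / (pi *+ 2)); rewrite -/k in k1 k2.
rewrite ler_pdivlMr// in k1; rewrite ltr_pdivrMr// intrD mulrDl mul1r in k2.
exists (w.1 - k%:~R * (pi *+ 2), w.2); last first.
  split=> //=; case: k {k1 k2} => n.
    have [n1 n2] := nat n (w.1 - n%:~R * (pi *+ 2)) w.2.
    have E : w.1 - n%:~R * (pi *+ 2) + pi *+ 2 *+ n = w.1.
      by rewrite -(mulr_natl (pi *+ 2) n) (_ : (n : int)%:~R = n%:R :> R)// subrK.
    by rewrite E -surjective_pairing in n1 n2; rewrite n2//; exact/n1.
  have [n1 n2] := nat n.+1 w.1 w.2.
  rewrite NegzE mulrNz mulNr opprK -pmulrn mulr_natl n2 -?surjective_pairing//.
split=> /=; last by apply/andP; split; lra.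
case: k {k1 k2} => n.
  have [n1 _] := nat n (w.1 - n%:~R * (pi *+ 2)) w.2.
  by apply/n1; rewrite -(mulr_natl (pi *+ 2) n) (_ : (n : int)%:~R = n%:R :> R)// subrK -surjective_pairing.
by rewrite NegzE mulrNz mulNr opprK -pmulrn mulr_natl; apply/(nat n.+1 w.1 w.2).1; rewrite -surjective_pairing.
Qed.

Lemma fluid_closure_bottom z : z.2 = - h + beta z.1 -> closure D z.
Proof.
by move=> zb; rewrite (surjective_pairing z); apply: fluid_closure_vert; rewrite zb lexx ltW// sep.
Qed.

(** In the direction (-b, 1) the height above the bottom grows like (1 + b^2) t; differentiability
    of [beta] at the foot keeps it positive for small t. *)
Lemma bottom_path z : z.2 = - h + beta z.1 -> exists2 d : R, 0 < d &
  forall t, 0 < t < d -> D (z.1 - derive1 beta z.1 * t, z.2 + t).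
Proof.
move=> zb; pose b := derive1 beta z.1; have sz := sep z.1.
have b1 : 0 < `|b| + 1 by rewrite ltr_wpDl.
have [d2 d20 hd2] := is_derive_eps (dbeta z.1) (e := 1 / (2 * (`|b| + 1)))
  ltac:(by rewrite divr_gt0// mulr_gt0// ltr_wpDl).
have [d3 d30 hd3] := (cont2_eps _ _).1 (cupp (x:=z)) ((eta z.1 - z.2) / 2) ltac:(rewrite divr_gt0// subr_gt0 zb//).
exists (Num.min d2 d3 / (`|b| + 1)) => [|t]; first by rewrite divr_gt0// lt_min d20.
move=> /andP[t0]; rewrite ltr_pdivlMr// lt_min -/b => /andP[E2 E3].
have b0 := normr_ge0 b; have bt := mulr_ge0 b0 (ltW t0).
have s1 : `|z.1 - b * t - z.1| = `|b| * t by rewrite addrAC subrr sub0r normrN normrM (gtr0_norm t0).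
have s2 : `|z.2 + t - z.2| = t by rewrite addrAC subrr add0r (gtr0_norm t0).
apply/andP; split => /=.
  have := hd2 (z.1 - b * t); rewrite s1 => /(_ ltac:(lra)).
  have -> : z.1 - b * t - z.1 = - (b * t) by ring.
  rewrite ler_norml -/b => /andP[_ k].
  have k2 : 1 / (2 * (`|b| + 1)) * (`|b| * t) <= t / 2.
    have -> : t / 2 = 1 / (2 * (`|b| + 1)) * ((`|b| + 1) * t) by field; exact: lt0r_neq0.
    by apply: ler_wpM2l; [rewrite divr_ge0// mulr_ge0// ltW|lra].
  have := mulr_ge0 (sqr_ge0 b) (ltW t0); rewrite zb; lra.
have := hd3 (z.1 - b * t, z.2 + t); rewrite /= s1 s2 => /(_ ltac:(lra) ltac:(lra)).
rewrite ler_norml => /andP[_ k]; move: sz; rewrite -zb; lra.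
Qed.

Section Comparison.
Variables (phi1 phi2 : R * R -> R).
Hypotheses (P1 : is_potential h eta beta gamma psi phi1) (P2 : is_potential h eta beta gamma psi phi2).
Variables (e : R) (e0 : 0 < e).

Let M0 : 0 <= M. Proof. exact: le_trans (eta_bd 0). Qed.
(** Chosen so that the derivative a + 2 y of [bump] is at least 1 wherever y >= - M. *)
Let a := 2 * M + 1.
Let bump (y : R) := a * y + y * y.
Let V w := phi1 w + -1 * phi2 w + e * bump w.2.
Let T phi := trace D phi.
Let L z := T phi1 z + -1 * T phi2 z + e * bump z.2.

Let cslopeb : continuous (fun w : R * R => a + 2 * w.2).
Proof. by move=> w; apply: cvgD; [exact: cvg_cst|apply: cvgMr; exact: cvg_snd]. Qed.

Let slope_bd z : z.2 = - h + beta z.1 -> 1 <= a + 2 * z.2.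
Proof. by move=> ->; have := beta_bd z.1; rewrite ler_norml /a => /andP[? _]; lra. Qed.

Let cbump : continuous (fun w : R * R => bump w.2).
Proof.
move=> w; apply: (@cvgD _ _ _ (nbhs w)); first by apply: cvgMr; exact: cvg_snd.
by apply: (@cvgM _ _ (nbhs w)); exact: cvg_snd.
Qed.

Let limV : has_limits D V L.
Proof.
have [h1 _ _] := potential_closure P1; have [h2 _ _] := potential_closure P2.
apply: (has_limits_lin e); last exact: has_limits_continuous cbump.
by apply: has_limits_lin; exact: has_limits_trace.
Qed.

Let bump_bd y : `|y| <= M -> `|bump y| <= (3 * M + 1) * M.
Proof.
move=> yM; apply: le_trans (ler_normD _ _) _; rewrite !normrM ger0_norm /a; last by have := M0; lra.
have := M0; have := normr_ge0 y; nra.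
Qed.

(* V has positive derivative e * (a + 2 y) in the limit along the inward normal (-b, 1). *)
Let bottom_not_max z : z.2 = - h + beta z.1 -> (forall w, D w -> V w <= L z) -> False.
Proof.
move=> zb mx; pose b := derive1 beta z.1.
have cz : closure D z by exact: fluid_closure_bottom.
have [_ x1 y1] := potential_closure P1; have [_ x2 y2] := potential_closure P2.
have B1 := potential_bottom P1 z.1; have B2 := potential_bottom P2 z.1.
rewrite /= -zb -(surjective_pairing z) -/b -/D in B1 B2.
have limW := has_limits_lin e (has_limits_lin (- b)
    (has_limits_lin (-1) (has_limits_trace y1) (has_limits_trace y2))
    (has_limits_lin (-1) (has_limits_trace x1) (has_limits_trace x2))) (has_limits_continuous (D := D) cslopeb).
have e2 : 0 < e / 2 by rewrite divr_gt0.
have [r r0 hr] := limW z cz _ e2.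
have [d d0 Dd] := bottom_path zb.
apply: (normal_growth e2 d0 r0 Dd _ _ (limV cz) mx); last first.
  move=> w Dw w1 w2; have := hr w Dw w1 w2; rewrite -/D ler_norml => /andP[k _].
  apply: le_trans (bottom_slope e0 (slope_bd zb) k B1 B2) _; exact: lexx.
move=> t tt; have [q q0 hq] := fluid_nbhs (Dd t tt).
have [C1 _ _] := potential_C2 P1; have [C2 _ _] := potential_C2 P2.
have f1 := C1_diff2 q0 C1 hq; have f2 := C1_diff2 q0 C2 hq.
have l1 : is_derive t 1 (fun t : R => z.1 - b * t) (- b).
  have := is_deriveBf (@is_derive_cst R R R z.1 t 1) (is_deriveZf b (@is_derive_id _ _ t 1)).
  by move=> hh; apply: is_derive_eq hh _; rewrite mulr1 sub0r.
have l2 : is_derive t 1 (fun t : R => z.2 + t) 1.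
  have := is_deriveDf (@is_derive_cst R R R z.2 t 1) (@is_derive_id _ _ t 1).
  by move=> hh; apply: is_derive_eq hh _; rewrite add0r.
have k1 := @diff2_path R phi1 (fun t => z.1 - b * t) (fun t => z.2 + t) t _ _ _ _ f1 l1 l2.
have k2 := @diff2_path R phi2 (fun t => z.1 - b * t) (fun t => z.2 + t) t _ _ _ _ f2 l1 l2.
have k3 := is_deriveZf e (is_deriveDf (is_deriveZf a l2) (is_deriveMf l2 l2)).
have k := is_deriveDf (is_deriveDf k1 (is_deriveZf (-1) k2)) k3.
exact: is_derive_eq k (bottom_ring a e _ _ _ _ _ _).
Qed.

(** At an interior maximum both second derivatives would be nonpositive, but their sum is 2 e, all
    of it from the quadratic part of the perturbation. *)
Let interior_not_max z : D z -> (forall w, D w -> V w <= V z) -> False.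
Proof.
move=> Dz mx; have [r r0 hr] := fluid_nbhs Dz; have z0 (x : R) : `|x - x| < r by rewrite subrr normr0.
have [C1 X1 Y1] := potential_C2 P1; have [C2 X2 Y2] := potential_C2 P2.
have lap1 := potential_harmonic P1 Dz; have lap2 := potential_harmonic P2 Dz.
have Dx t : `|t - z.1| < r -> D (t, z.2) by move=> ?; apply: hr.
have Dy t : `|t - z.2| < r -> D (z.1, t) by move=> ?; apply: hr.
have lin (f1 f2 : R -> R) (x l1 l2 : R) : is_derive x 1 f1 l1 -> is_derive x 1 f2 l2 ->
    is_derive x 1 (fun t => f1 t + -1 * f2 t) (l1 + -1 * l2).
  by move=> h1 h2; exact: is_deriveDf h1 (is_deriveZf (-1) h2).
have slx (F : R * R -> R) t : C1_on D F -> `|t - z.1| < r -> is_derive t 1 (fun t => F (t, z.2)) (partial_x F (t, z.2)).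
  by move=> CF /Dx/CF[k _ _ _]; exact: is_derive_slice_x.
have sly (F : R * R -> R) t : C1_on D F -> `|t - z.2| < r -> is_derive t 1 (fun t => F (z.1, t)) (partial_y F (z.1, t)).
  by move=> CF /Dy/CF[_ k _ _]; exact: is_derive_slice_y.
have hx : partial_x (partial_x phi1) z + -1 * partial_x (partial_x phi2) z <= 0.
  refine (@second_derivative_max _ (fun t => V (t, z.2))
    (fun t => partial_x phi1 (t, z.2) + -1 * partial_x phi2 (t, z.2)) z.1
    (partial_x (partial_x phi1) z + -1 * partial_x (partial_x phi2) z) r r0 _ _ _) => [t tr| |t tr].
  - have k := is_deriveDf (lin _ _ _ _ _ (slx _ _ C1 tr) (slx _ _ C2 tr)) (@is_derive_cst R R R (e * bump z.2) t 1).
    by apply: is_derive_eq k _; rewrite addr0.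
  - have k := lin _ _ _ _ _ (slx _ _ X1 (z0 z.1)) (slx _ _ X2 (z0 z.1)).
    by apply: is_derive_eq k _; rewrite -!surjective_pairing.
  - by rewrite -[X in _ <= V X]surjective_pairing; apply: mx; exact: Dx.
have hy : partial_y (partial_y phi1) z + -1 * partial_y (partial_y phi2) z + e * 2 <= 0.
  have lb (t : R) : is_derive t 1 (fun t => e * bump t) (e * (a + 2 * t)).
    have id := @is_derive_id _ _ t 1.
    have k := is_deriveZf e (is_deriveDf (is_deriveZf a id) (is_deriveMf id id)).
    by apply: is_derive_eq k _; ring.
  refine (@second_derivative_max _ (fun t => V (z.1, t))
    (fun t => (partial_y phi1 (z.1, t) + -1 * partial_y phi2 (z.1, t)) + e * (a + 2 * t)) z.2
    (partial_y (partial_y phi1) z + -1 * partial_y (partial_y phi2) z + e * 2) r r0 _ _ _) => [t tr| |t tr].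
  - exact: (is_deriveDf (lin _ _ _ _ _ (sly _ _ C1 tr) (sly _ _ C2 tr)) (lb t)).
  - have id := @is_derive_id _ _ z.2 1.
    have k := is_deriveDf (lin _ _ _ _ _ (sly _ _ Y1 (z0 z.2)) (sly _ _ Y2 (z0 z.2)))
      (is_deriveZf e (is_deriveDf (@is_derive_cst R R R a z.2 1) (is_deriveZf 2 id))).
    apply: is_derive_eq k _; rewrite -!surjective_pairing; congr (_ + e * _).
    by rewrite add0r mulr1.
  - by rewrite -[X in _ <= V X]surjective_pairing; apply: mx; exact: Dy.
exact: laplacian_contra e0 lap1 lap2 hx hy.
Qed.

(** The maximum can only lie on the surface, where the potentials coincide and just the perturbation
    is left. The perturbation is bounded by (3 M + 1) M, counted once there and once at [w]. *)
Lemma potential_gap w : D w -> phi1 w <= phi2 w + e * (2 * ((3 * M + 1) * M)).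
Proof.
move=> Dw; have pV z : D z -> V (z.1 + pi *+ 2, z.2) = V z.
  by move=> Dz; rewrite /V /= (potential_periodic P1 Dz) (potential_periodic P2 Dz).
pose K : set (R * R) := [set q | `[0, pi *+ 2]%classic q.1 /\ `[- M, M]%classic q.2].
have cK : compact K by apply: compact_setX; exact: segment_compact.
pose D' : set (R * R) := [set q | D q /\ 0 <= q.1 <= pi *+ 2].
have D'K : D' `<=` K.
  by move=> q [Dq q1]; split; rewrite /= in_itv //= -ler_norml; exact: fluid_bd.
have [w0 Dw0 _] := periodic_shift pV Dw.
have [z [Kz cz] mx] := max_point cK D'K (fun q => @proj1 _ _) Dw0 limV.
have {}mx v : D v -> V v <= L z.
  by move=> /(periodic_shift pV)[v' Dv' [<- _]]; exact: mx.
have key : L z <= e * ((3 * M + 1) * M).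
  have /andP[z1 z2] := fluid_closure cz.
  have zM : `|z.2| <= M.
    have := beta_bd z.1; have := eta_bd z.1; rewrite !ler_norml => /andP[_ k1] /andP[k2 _].
    by apply/andP; split; lra.
  have [Ez|nz] := eqVneq z.2 (eta z.1).
    have S1 := potential_surface P1 z.1; have S2 := potential_surface P2 z.1.
    rewrite -Ez -surjective_pairing -/D in S1 S2.
    rewrite /L /T S1 S2 mulN1r subrr add0r ler_wpM2l ?(ltW e0)//.
    by apply: le_trans (ler_norm _) _; exact: bump_bd.
  have [Eb|nb] := eqVneq z.2 (- h + beta z.1).
    by exfalso; exact: (bottom_not_max Eb mx).
  exfalso; have Dz : D z by apply/andP; split; rewrite lt_def ?z1 ?z2 andbT// eq_sym.
  by apply: (interior_not_max Dz) => v Dv; rewrite -(has_limits_inside limV Dz); exact: mx.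
have := mx w Dw; rewrite {1}/V.
have := bump_bd (fluid_bd Dw); rewrite ler_norml => /andP[k _].
have := ler_wpM2l (ltW e0) k; lra.
Qed.

End Comparison.

Lemma potential_unique phi1 phi2 : is_potential h eta beta gamma psi phi1 ->
  is_potential h eta beta gamma psi phi2 -> forall w, D w -> phi1 w = phi2 w.
Proof.
move=> P1 P2 w Dw; have M0 : 0 <= M by exact: le_trans (eta_bd 0).
pose C := 2 * ((3 * M + 1) * M); have C0 : 0 <= C by rewrite /C !mulr_ge0// addr_ge0// mulr_ge0.
have le (f1 f2 : R * R -> R) : is_potential h eta beta gamma psi f1 -> is_potential h eta beta gamma psi f2 ->
    f1 w <= f2 w.
  move=> Q1 Q2; apply/ler_addgt0Pr => e e0; have C1 : 0 < C + 1 by lra.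
  have k := potential_gap Q1 Q2 (divr_gt0 e0 C1) Dw; apply: le_trans k _; rewrite lerD2l -/C.
  by rewrite mulrAC ler_pdivrMr// ler_wpM2l ?(ltW e0)//; lra.
by apply/eqP; rewrite eq_le !le.
Qed.

(** Equality holds on the domain only. Its openness transfers equality to partial derivatives, and
    traces depend only on values inside. *)
Lemma normal_trace_unique phi1 phi2 : is_potential h eta beta gamma psi phi1 ->
  is_potential h eta beta gamma psi phi2 -> forall x, normal_trace h eta beta phi1 x = normal_trace h eta beta phi2 x.
Proof.
move=> P1 P2 x; have U := potential_unique P1 P2.
have tr (F1 F2 : R * R -> R) z : (forall w, D w -> F1 w = F2 w) -> trace D F1 z = trace D F2 z.
  move=> FF; rewrite /trace; congr lim; apply/funext => A; apply/propext; split=> hA.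
    have hA' : nbhs z (fun w => D w -> A (F1 w)) := hA.
    change (nbhs z (fun w => D w -> A (F2 w))).
    by apply: filterS hA' => w hw Dw; rewrite -FF//; exact: hw.
  have hA' : nbhs z (fun w => D w -> A (F2 w)) := hA.
  change (nbhs z (fun w => D w -> A (F1 w))).
  by apply: filterS hA' => w hw Dw; rewrite FF//; exact: hw.
have der (v : R * R) w : D w -> 'D_v phi1 w = 'D_v phi2 w.
  move=> Dw; apply: near_eq_derive; have [d d0 hd] := fluid_nbhs Dw.
  apply/nbhs_ballP; exists d => // q [q1 q2]; apply: U; apply: hd.
    by rewrite distrC.
  by rewrite distrC.
by rewrite /normal_trace (tr (partial_x phi1) (partial_x phi2)) ?(tr (partial_y phi1) (partial_y phi2))// => w Dw;
  exact: der.
Unshelve. all: by end_near. Qed.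

End Uniqueness.

(** * The normal trace of the solution *)

Section Solution.
Context {R : realType} (s : R) (s_gt : 1 < 2 * (s - 1)).
Notation C := (Rcomplex R).
Notation sg := (s - 1).
Notation V := (sobolev s * sobolev s)%type.
Notation mul := (mulS s_gt).
Notation ev2 := (evS s_gt).
Variables (h gamma : R) (psi : sobolev s) (dl : R) (dl0 : 0 < dl).

Lemma continuous_depth : continuous (fun z : R => - h + h * z).
Proof. by move=> z; apply: cvgD; [exact: cvg_cst|apply: cvgMr; exact: cvg_id]. Qed.

Definition flatY : strip sg := Strip (vert_strip sg continuous_depth).
Definition YS (p : V) : strip sg := flatY + LY s_gt dl0 p.
Definition cS (p : V) : strip sg := Lc s_gt dl0 p.
Definition dS (p : V) : strip sg := h *: oneS sg + Ld s_gt dl0 p.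
(** Obtained by inserting phi = lift of [psi] + flat part and theta = gamma Y^2 / 2 + flat part into
    the two equations. In the second one the gamma terms, c Y d and d Y c, cancel. *)
Definition rhs (p : V) : strip sg * strip sg :=
  (mul (dS p) (LPx s_gt dl0 psi) - mul (cS p) (LPz s_gt dl0 psi) - gamma *: mul (YS p) (dS p),
   LPz s_gt dl0 psi).
Definition DN_of (p : V) (g : strip sg * strip sg) : sobolev sg :=
  - trS s_gt 1 (gamma *: mul (YS p) (cS p) + SX2 g).

Lemma evS_flatY x z : ev2 flatY x z = realC (- h + h * clampz z).
Proof.
rewrite (@evS_supp _ _ _ _ 0%N).
  by rewrite /ev rng0 /= /vert eqxx /ek mul0r expi0; apply: C_eq; rewrite !ReImE /=; ring.
by move=> k t; rewrite mem_rng leqn0 absz_eq0 /= /vert => /negbTE->//.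
Qed.

Lemma herm_flatY : herm flatY.
Proof.
by move=> k z; rewrite /= /vert oppr_eq0; case: (k == 0); apply: C_eq; rewrite !ReImE ?oppr0.
Qed.

Lemma herm_YS p : herm (YS p).
Proof. by apply: hermD; [exact: herm_flatY|exact: herm_LY]. Qed.

Lemma herm_dS p : herm (dS p).
Proof. by apply: hermD; [apply: hermZ; exact: herm_one|exact: herm_Ld]. Qed.

Definition rv (u : strip sg) x z : R := Re (ev2 u x z).

Lemma rvD u v x z : rv (u + v) x z = rv u x z + rv v x z.
Proof. by rewrite /rv evSD ReD. Qed.

Lemma rvZ (a : R) u x z : rv (a *: u) x z = a * rv u x z.
Proof. by rewrite /rv evSZ ReZ. Qed.

Lemma rvB u v x z : rv (u - v) x z = rv u x z - rv v x z.
Proof. by rewrite /rv evSB ReD ReN. Qed.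

Lemma rv_mul (c u : strip sg) x z : herm c -> rv (mul c u) x z = rv c x z * rv u x z.
Proof. move=> hc; have := herm_evS s_gt x z hc; rewrite /rv (evS_mul s_gt c u x z).
by move: (ev2 c x z) (ev2 u x z) => a b a0; rewrite ReM a0 mul0r subr0. Qed.

Lemma rhs2 p : (rhs p).2 = LPz s_gt dl0 psi. Proof. by rewrite /rhs. Qed.

Lemma herm_cS p : herm (cS p). Proof. exact: herm_Lc. Qed.

Lemma rv_flatY x z : rv flatY x z = - h + h * clampz z.
Proof. by rewrite /rv evS_flatY. Qed.

Lemma rv_zero (u : strip sg) x z : (forall k, u k z = 0) -> rv u x z = 0.
Proof.
move=> u0; have E : ev2 u x z = ev2 (0 : strip sg) x z.
  by apply: evS_slice => k; rewrite u0 strip0E.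
by rewrite /rv E evS0 Re0.
Qed.

(** The part of [YS] that is not smoothed lives in mode 0, where ik vanishes. *)
Lemma cS_ik p k z : cS p k z = ikC k * YS p k z.
Proof.
have -> : YS p k z = flatY k z + LY s_gt dl0 p k z by rewrite /YS stripDE.
apply: etrans (Lc_ik s_gt dl0 p k z) _; rewrite [RHS]mulrDr -[LHS]add0r; congr (_ + _).
rewrite /= /vert; have [->|k0] := eqVneq k 0; last by rewrite mulr0.
by rewrite (_ : ikC 0 = 0) ?mul0r//; apply: C_eq.
Qed.

Lemma YS_deriv p k z : 0 < z < 1 -> is_deriveC (YS p k) z (dS p k z).
Proof.
move=> z01; have h1 : is_deriveC (flatY k) z (h *: oneS sg k z).
  have zc := clampz_near z01.
  rewrite /= /vert; case: ifP => _; last first.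
    by rewrite scaler0; split; exact: is_derive_cst.
  have h0 : is_deriveC (fun z => realC (- h + h * z)) z (h *: realC 1).
    split; rewrite /= ?mulr1 ?mulr0; last exact: is_derive_cst.
    have k1 := is_deriveDf (@is_derive_cst R R R (- h) z 1) (is_deriveZf h (@is_derive_id _ _ z 1)).
    by apply: is_derive_eq k1 _; rewrite add0r mulr1.
  apply: is_deriveC_near h0; near=> t; congr (realC (- h + h * _)).
  by apply: esym; near: t; exact: zc.
have E : dS p k z = h *: oneS sg k z + Ld s_gt dl0 p k z by rewrite /dS stripDE stripZE.
have E' : (YS p k : R -> C) = (fun z => flatY k z + LY s_gt dl0 p k z).
  by apply/funext => t; rewrite /YS stripDE.
by rewrite E E'; exact: is_deriveCD h1 (LY_deriv s_gt dl0 p k z01).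
Unshelve. all: by end_near. Qed.

Lemma rv_crT (c d : strip sg) g x z : herm c -> herm d ->
  rv (crT s_gt c d g).1 x z = rv c x z * rv (SZ1 g) x z + rv (SZ2 g) x z - rv d x z * rv (SX1 g) x z /\
  rv (crT s_gt c d g).2 x z = rv c x z * rv (SZ2 g) x z - rv (SZ1 g) x z - rv d x z * rv (SX2 g) x z.
Proof.
move=> hc hd; rewrite /crT /=; move: (SZ1 g) (SZ2 g) (SX1 g) (SX2 g) => a b u v.
rewrite (rvB (mul c a + b)) (rvD (mul c a)) (rv_mul a) // (rv_mul u) //.
by rewrite (rvB (mul c b - a)) (rvB (mul c b)) (rv_mul b) // (rv_mul v).
Qed.

Lemma rv_rhs (c d y u v : strip sg) x z : herm c -> herm d -> herm y ->
  rv (mul d u - mul c v - gamma *: mul y d) x z =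
  rv d x z * rv u x z - rv c x z * rv v x z - gamma * (rv y x z * rv d x z).
Proof.
move=> hc hd hy; rewrite (rvB (mul d u - mul c v)) (rvB (mul d u)) (rv_mul u) // (rv_mul v) //.
by rewrite (rvZ gamma) (rv_mul d).
Qed.

Lemma top_equation (c d y a1 a2 a3 px pz : R) :
  c * a1 + a2 - d * a3 = d * px - c * pz - gamma * (y * d) ->
  c * (pz + a1) + (gamma * (y * d) + a2) - d * (px + a3) = 0.
Proof. by move=> *; lra. Qed.

Lemma le_sum4 (x b1 b2 b3 b4 : R) : 0 <= b1 -> 0 <= b2 -> 0 <= b3 -> 0 <= b4 ->
  [\/ x <= b1, x <= b2, x <= b3 | x <= b4] -> x <= b1 + b2 + b3 + b4.
Proof. by move=> ? ? ? ? []; lra. Qed.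

Lemma bottom_equation (c d y a1 a2 a3 pz : R) : c * a2 - a1 - d * a3 = pz ->
  c * (gamma * (y * d) + a2) - (pz + a1) - d * (gamma * (y * c) + a3) = 0.
Proof. by move=> <-; ring. Qed.

Variables (p : V) (kap : R) (g : strip sg * strip sg).
Hypotheses (kap0 : 0 < kap) (kd : forall x z, kap <= rv (dS p) x z)
  (sep : forall x, 0 < h - p.2 x + p.1 x) (Hg : crT s_gt (cS p) (dS p) g = rhs p).

Let Y : R -> R -> R := rv (YS p).
Let c : R -> R -> R := rv (cS p).
Let d : R -> R -> R := rv (dS p).
Let phi : R -> R -> R := rv (LP s_gt dl0 psi + SP g).
Let phix : R -> R -> R := rv (LPx s_gt dl0 psi + SX1 g).
Let phiz : R -> R -> R := rv (LPz s_gt dl0 psi + SZ1 g).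
(** The summand gamma Y^2 / 2 takes up the bottom condition, so the flat part [ST g] can have zero
    values there. *)
Let the x z : R := gamma / 2 * (Y x z * Y x z) + rv (ST g) x z.
Let thex x z : R := gamma * (Y x z * c x z) + rv (SX2 g) x z.
Let thez x z : R := gamma * (Y x z * d x z) + rv (SZ2 g) x z.

Let cev u : continuous (fun q : R * R => rv u q.1 q.2).
Proof. exact: continuous_evS. Qed.

Let cprod (a : R) (F G : R -> R -> R) : continuous (fun q : R * R => F q.1 q.2) ->
  continuous (fun q : R * R => G q.1 q.2) -> continuous (fun q : R * R => a * (F q.1 q.2 * G q.1 q.2)).
Proof. by move=> cF cG q; apply: cvgMr; apply: (@cvgM _ _ (nbhs q)); [exact: cF|exact: cG]. Qed.

Let csum (F G : R -> R -> R) : continuous (fun q : R * R => F q.1 q.2) ->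
  continuous (fun q : R * R => G q.1 q.2) -> continuous (fun q : R * R => F q.1 q.2 + G q.1 q.2).
Proof. by move=> cF cG q; apply: (@cvgD _ _ _ (nbhs q)); [exact: cF|exact: cG]. Qed.

Let bev u x z : `|rv u x z| <= evb s_gt * `|u|.
Proof. by apply: le_trans (Re_le_cmod _) _; exact: cmod_evS. Qed.

Let dYx (x z : R) : is_derive x 1 (fun x => Y x z) (c x z).
Proof. by apply: evS_dx => k; exact: cS_ik. Qed.

Let dYz (x z : R) : 0 < z < 1 -> is_derive z 1 (Y x) (d x z).
Proof. by apply: evS_dz => k t; exact: YS_deriv. Qed.

Let squareD (F : R -> R) (t l : R) : is_derive t 1 F l ->
  is_derive t 1 (fun t => gamma / 2 * (F t * F t)) (gamma * (F t * l)).
Proof. by move=> hF; apply: is_derive_eq (is_deriveZf (gamma / 2) (is_deriveMf hF hF)) _; field. Qed.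

Let phizE x z : phiz x z = rv (LPz s_gt dl0 psi) x z + rv (SZ1 g) x z.
Proof. exact: rvD. Qed.

Let phixE x z : phix x z = rv (LPx s_gt dl0 psi) x z + rv (SX1 g) x z.
Proof. exact: rvD. Qed.

Let E1 x z : c x z * phiz x z + thez x z - d x z * phix x z = 0.
Proof.
rewrite phizE phixE; apply: top_equation.
have [h1 _] := rv_crT g x z (herm_cS p) (herm_dS p).
have h2 := congr1 (fun u => rv u.1 x z) Hg.
have h3 := rv_rhs (LPx s_gt dl0 psi) (LPz s_gt dl0 psi) x z (herm_cS p) (herm_dS p) (herm_YS p).
exact: etrans (etrans (esym h1) h2) h3.
Qed.

Let E2 x z : c x z * thez x z - phiz x z - d x z * thex x z = 0.
Proof.
rewrite phizE; apply: bottom_equation.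
have [_ h1] := rv_crT g x z (herm_cS p) (herm_dS p).
have h2 := congr1 (fun u => rv u.2 x z) Hg; rewrite rhs2 in h2.
exact (etrans (esym h1) h2).
Qed.

Let Ytop x : Y x 1 = p.1 x.
Proof.
apply: etrans (rvD flatY (LY s_gt dl0 p) x 1) _.
apply: etrans (congr2 +%R (rv_flatY x 1) (LY_top_val s_gt dl0 p x)) _.
by rewrite clampz1 mulr1 addNr add0r.
Qed.

Let Ybot x : Y x 0 = - h + p.2 x.
Proof.
apply: etrans (rvD flatY (LY s_gt dl0 p) x 0) _.
apply: etrans (congr2 +%R (rv_flatY x 0) (LY_bot_val s_gt dl0 p x)) _.
by rewrite clampz0 mulr0 addr0.
Qed.

Let phitop x : phi x 1 = psi x.
Proof.
apply: etrans (rvD (LP s_gt dl0 psi) (SP g) x 1) _.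
by apply: etrans (congr2 +%R (fourier_inversion s_gt dl0 psi x) (rv_zero x (SP_top g))) (addr0 _).
Qed.

Let thebot x : thex x 0 = gamma * Y x 0 * c x 0.
Proof.
have z0 k : SX2 g k 0 = 0 by rewrite ST_ik ST_bot mulr0.
by rewrite /thex (rv_zero x z0) addr0 mulrA.
Qed.

Let cs_continuous (f : sobolev s) : continuous f. Proof. exact: sobolev_continuous. Qed.

Let sepb x : - h + p.2 x < p.1 x. Proof. by have := sep x; lra. Qed.

Theorem solution_is_DN : is_DN h p.1 p.2 gamma psi (DN_of p g).
Proof.
pose M := evb s_gt * `|LP s_gt dl0 psi + SP g| + evb s_gt * `|LPx s_gt dl0 psi + SX1 g| +
  evb s_gt * `|LPz s_gt dl0 psi + SZ1 g| +
  (`|gamma / 2| * (evb s_gt * `|YS p| * (evb s_gt * `|YS p|)) + evb s_gt * `|ST g|).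
have e0 (u : strip sg) : 0 <= evb s_gt * `|u| by rewrite mulr_ge0 ?evb_ge0.
have g0 : 0 <= `|gamma / 2| * (evb s_gt * `|YS p| * (evb s_gt * `|YS p|)) by rewrite !mulr_ge0 ?evb_ge0.
have a1 := e0 (LP s_gt dl0 psi + SP g); have a2 := e0 (LPx s_gt dl0 psi + SX1 g).
have a3 := e0 (LPz s_gt dl0 psi + SZ1 g); have a4 := e0 (ST g).
have phi_ik k z : (LPx s_gt dl0 psi + SX1 g) k z = ikC k * (LP s_gt dl0 psi + SP g) k z.
  by rewrite [LHS]stripDE [X in _ * X]stripDE LPx_ik SP_ik mulrDr.
have pe u x z : rv u (x + pi *+ 2) z = rv u x z by rewrite /rv evS_2pi.
have b4 := addr_ge0 g0 a4.
have thebd x z : `|the x z| <= `|gamma / 2| * (evb s_gt * `|YS p| * (evb s_gt * `|YS p|)) + evb s_gt * `|ST g|.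
  apply: le_trans (ler_normD _ _) _; apply: lerD; last exact: bev.
  rewrite normrM; apply: ler_wpM2l; first exact: normr_ge0.
  by rewrite normrM; apply: ler_pM; [exact: normr_ge0|exact: normr_ge0|exact: bev|exact: bev].
have [pot trace] := @strip_potential R Y c d kap (evb s_gt * `|cS p|) kap0 (@cev _) (@cev _) (@cev _)
  (fun x z _ => dYx x z) dYz (bev _) kd phi phix phiz the thex thez M
  (@cev _) (@cev _) (@cev _)
  (@csum (fun x z => gamma / 2 * (Y x z * Y x z)) (rv (ST g)) (@cprod (gamma / 2) Y Y (@cev _) (@cev _)) (@cev _))
  (@csum (fun x z => gamma * (Y x z * c x z)) (rv (SX2 g)) (@cprod gamma Y c (@cev _) (@cev _)) (@cev _))
  (@csum (fun x z => gamma * (Y x z * d x z)) (rv (SZ2 g)) (@cprod gamma Y d (@cev _) (@cev _)) (@cev _))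
  (fun x z => le_sum4 a1 a2 a3 b4 (Or41 _ _ _ (bev _ x z)))
  (fun x z => le_sum4 a1 a2 a3 b4 (Or42 _ _ _ (bev _ x z)))
  (fun x z => le_sum4 a1 a2 a3 b4 (Or43 _ _ _ (bev _ x z)))
  (fun x z => le_sum4 a1 a2 a3 b4 (Or44 _ _ _ (thebd x z)))
  (fun x z _ => evS_dx s_gt (u := LP s_gt dl0 psi + SP g) (v := LPx s_gt dl0 psi + SX1 g) (z := z)
    (fun k => phi_ik k z) x)
  (fun x z => @evS_dz R _ s_gt (LP s_gt dl0 psi + SP g) (LPz s_gt dl0 psi + SZ1 g) x z
    (fun k z h => is_deriveCD (LP_deriv s_gt dl0 psi k h) (SP_deriv g k h)))
  (fun x z _ => is_deriveDf (squareD (dYx x z)) (evS_dx s_gt (fun k => ST_ik g k z) x))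
  (fun x z h => is_deriveDf (squareD (dYz x h)) (evS_dz s_gt x (fun k z => @ST_deriv R sg g k z) h))
  E1 E2 (fun x z => pe _ x z) (fun x z => pe _ x z) h gamma p.1 p.2 psi Ytop Ybot phitop thebot.
split; first by exists (strip_pot kap0 (@cev _) dYz kd phi).
move=> f Pf x.
have Ep (q : sobolev s) y : q (y + pi *+ 2) = q y by have [_ pf _] := sobolevP q; exact: pf.
have dbeta (y : R) : is_derive y 1 (p.2 : R -> R) (derive1 (p.2 : R -> R) y).
  have -> : (p.2 : R -> R) = (fun x => h + Y x 0) by apply/funext => t; rewrite Ybot; ring.
  have hd := is_deriveDf (@is_derive_cst R R R h y 1) (dYx y 0).
  by rewrite derive1E; have [k ->] := hd; exact: hd.
pose M' := evb s_gt * `|YS p|.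
have bb y : `|- h + p.2 y| <= M' by rewrite -Ybot; exact: bev.
have eb y : `|(p.1 : R -> R) y| <= M' by rewrite -Ytop; exact: bev.
rewrite (normal_trace_unique (@cs_continuous p.1) (@cs_continuous p.2) (Ep p.1) (Ep p.2) bb eb sepb dbeta Pf pot).
rewrite trace -[LHS]/(- rv (gamma *: mul (YS p) (cS p) + SX2 g) x 1).
by rewrite (rvD (gamma *: _)) rvZ (rv_mul (cS p))//; exact: herm_YS.
Qed.

End Solution.

(** * Analyticity *)

Section AnalyticResolvent.
Context {R : realType} {V X W : normedModType R}.
Variables (B : V -> X -> X) (l : X -> W) (X0 : X) (b cl : R).
Hypotheses (BVl : forall (a : R) v v' x, B (a *: v + v') x = a *: B v x + B v' x)
  (BXl : forall (a : R) v x x', B v (a *: x + x') = a *: B v x + B v x')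
  (b0 : 0 <= b) (Bb : forall v x, `|B v x| <= b * (`|v| * `|x|))
  (ll : forall (a : R) x y, l (a *: x + y) = a *: l x + l y)
  (cl0 : 0 <= cl) (lb : forall x, `|l x| <= cl * `|x|).

Definition fold_along k (v : 'I_k -> V) (r : seq 'I_k) : X := foldr (fun j x => B (v j) x) X0 r.

(** The operators [B v] for different [v] need not commute, so the composition is averaged over all
    orders to become symmetric. On the diagonal every order gives the same iterate. *)
Definition resolvent_coef k (v : 'I_k -> V) : W :=
  (k`!%:R)^-1 *: \sum_(sigma : 'S_k) l (fold_along v (map sigma (enum 'I_k))).

Lemma fold_along_notin k (v : 'I_k -> V) r i y : i \notin r ->
  fold_along [eta v with i |-> y] r = fold_along v r.
Proof.
elim: r => [//|j r ih]; rewrite inE negb_or => /andP[ij ir].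
by rewrite /= -!/(fold_along _ _) ih//= eq_sym (negbTE ij).
Qed.

Lemma fold_along_linear k (v : 'I_k -> V) r i (a : R) x y : uniq r -> i \in r ->
  fold_along [eta v with i |-> a *: x + y] r =
  a *: fold_along [eta v with i |-> x] r + fold_along [eta v with i |-> y] r.
Proof.
elim: r => [//|j r ih] /andP[jr ur]; rewrite inE /= -!/(fold_along _ _).
have [->|ij] := eqVneq i j.
  by rewrite !fold_along_notin// => _; exact: BVl.
by move=> /= ir; rewrite ih// BXl.
Qed.

Lemma fold_along_norm k (v : 'I_k -> V) r :
  `|fold_along v r| <= b ^+ size r * \prod_(j <- r) `|v j| * `|X0|.
Proof.
elim: r => [|j r ih]; first by rewrite big_nil expr0 !mul1r.
rewrite /= -/(fold_along v r) big_cons exprS; apply: le_trans (Bb _ _) _.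
have -> : b * b ^+ size r * (`|v j| * \prod_(j <- r) `|v j|) * `|X0| =
  b * (`|v j| * (b ^+ size r * \prod_(j <- r) `|v j| * `|X0|)) by ring.
by do 2! apply: ler_wpM2l => //.
Qed.

Lemma perm_map_enum k (sigma : 'S_k) : perm_eq (map sigma (enum 'I_k)) (enum 'I_k).
Proof.
apply: uniq_perm; [by rewrite map_inj_uniq ?enum_uniq//; exact: perm_inj|exact: enum_uniq|].
by move=> i; rewrite mem_enum -(permKV sigma i) map_f// mem_enum.
Qed.

Lemma l_sum I (r : seq I) (P : pred I) (F : I -> X) :
  l (\sum_(i <- r | P i) F i) = \sum_(i <- r | P i) l (F i).
Proof.
have l0 : l 0 = 0 by have := ll (-1) 0 0; rewrite scaler0 addr0 scaleN1r addNr.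
apply: (big_morph l _ l0) => x y; by have := ll 1 x y; rewrite !scale1r.
Qed.

Lemma resolvent_multilinear k : multilinear_map (@resolvent_coef k).
Proof.
move=> i v a x y; rewrite /resolvent_coef scalerA mulrC -scalerA -scalerDr; congr (_ *: _).
rewrite scaler_sumr -big_split /=; apply: eq_bigr => sigma _; rewrite -ll; congr l.
apply: fold_along_linear; first by rewrite map_inj_uniq ?enum_uniq//; exact: perm_inj.
by rewrite (perm_mem (perm_map_enum sigma)) mem_enum.
Qed.

Lemma resolvent_symmetric k : symmetric_map (@resolvent_coef k).
Proof.
move=> tau v; rewrite /resolvent_coef; congr (_ *: _).
rewrite [RHS](reindex_inj (mulIg tau)); apply: eq_bigr => sigma _; congr l.
elim: (enum 'I_k) => [//|j r ih]; by rewrite /= -!/(fold_along _ _) ih permM.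
Qed.

Lemma resolvent_norm k (v : 'I_k -> V) :
  `|resolvent_coef v| <= cl * `|X0| * b ^+ k * \prod_(i < k) `|v i|.
Proof.
have kf : 0 < (k`!%:R : R) by rewrite ltr0n fact_gt0.
rewrite normrZ ger0_norm ?invr_ge0 ?(ltW kf)// mulrC ler_pdivrMr//.
apply: le_trans (ler_norm_sum _ _ _) _.
apply: (@le_trans _ _ (\sum_(sigma : 'S_k) (cl * `|X0| * b ^+ k * \prod_(i < k) `|v i|))).
  apply: ler_sum => sigma _; apply: le_trans (lb _) _.
  have := fold_along_norm v (map sigma (enum 'I_k)).
  rewrite size_map size_enum_ord (perm_big _ (perm_map_enum sigma)) /= big_enum /= => h.
  have -> : cl * `|X0| * b ^+ k * \prod_(i < k) `|v i| = cl * (b ^+ k * \prod_(i < k) `|v i| * `|X0|) by ring.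
  exact: ler_wpM2l.
rewrite sumr_const (_ : #|_| = k`!); last exact: card_Sn.
by rewrite -[leLHS]mulr_natr.
Qed.

Lemma resolvent_diag k x : resolvent_coef (fun _ : 'I_k => x) = l (iter k (B x) X0).
Proof.
have E (r : seq 'I_k) : fold_along (fun=> x) r = iter (size r) (B x) X0 by elim: r => //= j r ->.
rewrite /resolvent_coef; under eq_bigr do rewrite E size_map size_enum_ord.
rewrite sumr_const (_ : #|_| = k`!); last exact: card_Sn.
by rewrite -[X in _ *: X]scaler_nat scalerA mulVf ?scale1r// pnatr_eq0 -lt0n fact_gt0.
Qed.

(** The equation satisfied by [Y] makes the partial sums telescope to Y - B(x)^n Y. The existence of
    [Y] is an assumption, so no inverse has to be constructed: it suffices that the remainder tends
    to 0. *)
Theorem analytic_resolvent (f : V -> W) (u : V) (d : R) : 0 < d ->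
  (forall x, `|x| < d -> exists2 Y, Y = X0 + B x Y & f (u + x) = l Y) -> analytic_at f u.
Proof.
move=> d0 hf; exists resolvent_coef, (cl * `|X0|), b; split.
- exact: resolvent_multilinear.
- exact: resolvent_symmetric.
- by move=> k v; exact: resolvent_norm.
(* On this radius b |x| is at most 1/2, so the remainder decays like 2^-n. *)
have e0 : 0 < Num.min d (1 / (2 * (b + 1))) by rewrite lt_min d0 divr_gt0// mulr_gt0// ltr_wpDl.
apply/nbhs_ballP; exists (Num.min d (1 / (2 * (b + 1)))) => // x.
rewrite -ball_normE /= sub0r normrN lt_min => /andP[xd xb].
have [Y YE ->] := hf x xd.
have bx0 : 0 <= b * `|x| by rewrite mulr_ge0.
have bx : b * `|x| <= 1 / 2.
  rewrite ltr_pdivlMr in xb; last by rewrite mulr_gt0// ltr_wpDl.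
  have := normr_ge0 x; lra.
have Bsum (y z : X) : B x (y + z) = B x y + B x z by have := BXl 1 x y z; rewrite !scale1r.
have part n : \sum_(k < n) iter k (B x) X0 = Y - iter n (B x) Y.
  have it m (y z : X) : iter m (B x) (y + z) = iter m (B x) y + iter m (B x) z.
    by elim: m => [//|m ih]; rewrite !iterS ih Bsum.
  elim: n => [|n ih]; first by rewrite big_ord0 subrr.
  rewrite big_ord_recr /= ih -iterS iterSr.
  have E : iter n (B x) Y = iter n (B x) X0 + iter n (B x) (B x Y) by rewrite -it -YE.
  move: (iter n (B x) Y) (iter n (B x) X0) (iter n (B x) (B x Y)) E => p q r ->.
  by rewrite opprD addrA addrAC subrK.
have nrm n : `|iter n (B x) Y| <= (b * `|x|) ^+ n * `|Y|.
  elim: n => [|n ih]; first by rewrite expr0 mul1r.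
  rewrite iterS exprS; apply: le_trans (Bb _ _) _; rewrite mulrA -[leRHS]mulrA.
  exact: ler_wpM2l.
have ser n : series (fun k => resolvent_coef (fun _ : 'I_k => x)) n = l (Y - iter n (B x) Y).
  rewrite /series /= big_mkord -part l_sum; apply: eq_bigr => k _; exact: resolvent_diag.
apply: (@cvg_dist_le _ _ _ _ (fun n => cl * `|Y| * (1 / 2) ^+ n)).
  move=> n; rewrite ser.
  have lB y z : l (y - z) = l y - l z.
    by have := ll (-1) z y; rewrite !scaleN1r addrC => ->; rewrite addrC.
  rewrite lB opprB addrC subrK; apply: le_trans (lb _) _; rewrite -mulrA ler_wpM2l//.
  apply: le_trans (nrm n) _; rewrite mulrC ler_wpM2l// lerXn2r ?nnegrE//.
rewrite -[X in _ --> X](mulr0 (cl * `|Y|)); apply: cvgMr.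
by apply: cvg_expr; rewrite ger0_norm//; lra.
Qed.

End AnalyticResolvent.

(** * Closure properties of bounded linear and bilinear maps *)

Section BoundedMaps.
Context {R : realType}.
Implicit Types (U V W X Y Z : normedModType R).

Definition blin V W (F : V -> W) := (forall (a : R) x y, F (a *: x + y) = a *: F x + F y) /\
  exists2 K : R, 0 <= K & forall x, `|F x| <= K * `|x|.

Definition bbil V X W (B : V -> X -> W) := [/\
  forall (a : R) v v' x, B (a *: v + v') x = a *: B v x + B v' x,
  forall (a : R) v x x', B v (a *: x + x') = a *: B v x + B v x' &
  exists2 K : R, 0 <= K & forall v x, `|B v x| <= K * (`|v| * `|x|)].

Lemma blin_fst V W : blin (fst : V * W -> V).
Proof. by split=> //; exists 1 => // x; rewrite mul1r norm_fst_le. Qed.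

Lemma blin_snd V W : blin (snd : V * W -> W).
Proof. by split=> //; exists 1 => // x; rewrite mul1r norm_snd_le. Qed.

Lemma blin_comp U V W (F : V -> W) (G : U -> V) : blin F -> blin G -> blin (fun x => F (G x)).
Proof.
move=> [Fl [K K0 hK]] [Gl [K' K'0 hK']]; split=> [a x y|]; first by rewrite Gl Fl.
exists (K * K') => [|x]; first exact: mulr_ge0.
by apply: le_trans (hK _) _; rewrite -mulrA ler_wpM2l.
Qed.

Lemma blin_D V W (F G : V -> W) : blin F -> blin G -> blin (fun x => F x + G x).
Proof.
move=> [Fl [K K0 hK]] [Gl [K' K'0 hK']]; split=> [a x y|]; first by rewrite Gl Fl scalerDr addrACA.
exists (K + K') => [|x]; first exact: addr_ge0.
by apply: le_trans (ler_normD _ _) _; rewrite mulrDl lerD.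
Qed.

Lemma blin_Z V W (c : R) (F : V -> W) : blin F -> blin (fun x => c *: F x).
Proof.
move=> [Fl [K K0 hK]]; split=> [a x y|]; first by rewrite Fl scalerDr !scalerA mulrC.
by exists (`|c| * K) => [|x]; [exact: mulr_ge0|rewrite normrZ -mulrA ler_wpM2l].
Qed.

Lemma blin_N V W (F : V -> W) : blin F -> blin (fun x => - F x).
Proof. by move=> /(blin_Z (-1)); under eq_fun do rewrite scaleN1r. Qed.

Lemma bbil_post V X W Z (L : W -> Z) (B : V -> X -> W) : blin L -> bbil B -> bbil (fun v x => L (B v x)).
Proof.
move=> [Ll [K K0 hK]] [B1 B2 [K' K'0 hK']]; split=> [a v v' x|a v x x'|].
- by rewrite B1 Ll.
- by rewrite B2 Ll.
exists (K * K') => [|v x]; first exact: mulr_ge0.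
by apply: le_trans (hK _) _; rewrite -mulrA ler_wpM2l.
Qed.

Lemma bbil_pre V X V' X' W (B : V -> X -> W) (F : V' -> V) (G : X' -> X) : bbil B -> blin F -> blin G ->
  bbil (fun v x => B (F v) (G x)).
Proof.
move=> [B1 B2 [K K0 hK]] [Fl [K' K'0 hK']] [Gl [K2 K20 hK2]]; split=> [a v v' x|a v x x'|].
- by rewrite Fl B1.
- by rewrite Gl B2.
exists (K * (K' * K2)) => [|v x]; first by rewrite !mulr_ge0.
apply: le_trans (hK _ _) _; rewrite -mulrA ler_wpM2l// -mulrA.
have -> : K' * (K2 * (`|v| * `|x|)) = (K' * `|v|) * (K2 * `|x|) by ring.
exact: ler_pM.
Qed.

Lemma bbil_flip V X W (B : V -> X -> W) : bbil B -> bbil (fun x v => B v x).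
Proof. by move=> [B1 B2 [K K0 hK]]; split=> //; exists K => // v x; rewrite [`|v| * _]mulrC. Qed.

Lemma bbil_D V X W (B B' : V -> X -> W) : bbil B -> bbil B' -> bbil (fun v x => B v x + B' v x).
Proof.
move=> [B1 B2 [K K0 hK]] [C1 C2 [K' K'0 hK']]; split=> [a v v' x|a v x x'|].
- by rewrite B1 C1 scalerDr addrACA.
- by rewrite B2 C2 scalerDr addrACA.
exists (K + K') => [|v x]; first exact: addr_ge0.
by apply: le_trans (ler_normD _ _) _; rewrite mulrDl lerD.
Qed.

Lemma bbil_pair V X W Z (B : V -> X -> W) (B' : V -> X -> Z) : bbil B -> bbil B' ->
  bbil (fun v x => (B v x, B' v x)).
Proof.
move=> [B1 B2 [K K0 hK]] [C1 C2 [K' K'0 hK']]; split=> [a v v' x|a v x x'|].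
- by rewrite B1 C1.
- by rewrite B2 C2.
exists (K + K') => [|v x]; first exact: addr_ge0.
by apply: le_trans (pair_norm_le_sum _) _; rewrite mulrDl /= lerD.
Qed.

Lemma blin_id V : blin (fun x : V => x).
Proof. by split=> //; exists 1 => // x; rewrite mul1r. Qed.

Lemma bbil_0 V X W : bbil (fun (_ : V) (_ : X) => 0 : W).
Proof.
split=> [a v v' x|a v x x'|]; rewrite ?scaler0 ?addr0//.
by exists 0 => // v x; rewrite normr0 mul0r.
Qed.

Lemma bbil_N V X W (B : V -> X -> W) : bbil B -> bbil (fun v x => - B v x).
Proof. by move=> hB; apply: (bbil_post (L := fun w => - w)) hB; exact: blin_N (blin_id _). Qed.

Lemma bbil_scale W : bbil (fun (v : W) (r : R) => r *: v).
Proof.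
split=> [a v v' x|a v x x'|].
- by rewrite scalerDr !scalerA mulrC.
- by rewrite scalerDl scalerA.
by exists 1 => // v x; rewrite normrZ mul1r mulrC.
Qed.

Lemma bbil_fixed V X W (B : V -> X -> W) x0 : bbil B -> blin (fun v => B v x0).
Proof.
move=> [B1 _ [K K0 hK]]; split=> [a v v'|]; first by rewrite B1.
by exists (K * `|x0|) => [|v]; [exact: mulr_ge0|rewrite -mulrA [`|x0| * _]mulrC].
Qed.

Lemma blin_add V W (F : V -> W) x y : blin F -> F (x + y) = F x + F y.
Proof. by move=> [Fl _]; have := Fl 1 x y; rewrite !scale1r. Qed.

Lemma blin_inverse V W (T : V -> W) (K : R) : (forall (a : R) x y, T (a *: x + y) = a *: T x + T y) ->
  0 <= K -> (forall g, `|g| <= K * `|T g|) -> (forall y, exists g, T g = y) ->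
  exists2 S : W -> V, blin S & forall g, S (T g) = g.
Proof.
move=> Tl K0 hK surj; pose S y := projT1 (cid (surj y)).
have SP y : T (S y) = y := projT2 (cid (surj y)).
have inj a b : T a = T b -> a = b.
  move=> E; apply/eqP; rewrite -subr_eq0 -normr_le0 addrC -scaleN1r; apply: le_trans (hK _) _.
  by rewrite Tl E scaleN1r addNr normr0 mulr0.
exists S => [|g]; last by apply: inj; rewrite SP.
split=> [a x y|]; last by exists K => // y; have := hK (S y); rewrite SP.
by apply: inj; rewrite Tl !SP.
Qed.

Lemma half_bound (h0 c : R) : 0 <= c -> 0 < h0 -> h0 / (2 * (c + 1)) * c <= h0 / 2.
Proof.
move=> c0 h00; have c1 : 0 < c + 1 by rewrite ltr_wpDl.
by rewrite mulrAC ler_pdivrMr ?mulr_gt0//; nra.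
Qed.

Lemma perturbed_depth (h0 h r1 r2 a b p1 p2 c K n : R) : `|r2 - (p1 - p2)| <= a -> `|r1| <= b ->
  b <= c * n -> n * (4 * (c + K + 1)) < h0 -> 0 <= K * n -> 0 <= n ->
  h0 <= h - p2 + p1 -> a <= h0 / 2 -> h0 / 4 <= h + (r2 + r1).
Proof. by rewrite !ler_norml => /andP[? _] /andP[? _] *; lra. Qed.

Lemma perturbed_gap (h0 g a b c K n : R) : `|a| + `|b| <= K * n -> n * (4 * (c + K + 1)) < h0 ->
  0 <= c * n -> 0 <= K * n -> 0 <= n -> h0 <= g -> 0 < g + (a - b).
Proof. by have := ler_norm (- a); have := ler_norm b; rewrite normrN => *; lra. Qed.

End BoundedMaps.

(** * The perturbed problem as a linear equation for an enlarged state *)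

Section Linearization.
Context {R : realType} (s : R) (s_gt : 1 < 2 * (s - 1)).
Notation sg := (s - 1).
Notation V := (sobolev s * sobolev s)%type.
Notation mul := (mulS s_gt).
Variables (h gamma : R) (psi : sobolev s) (dl : R) (dl0 : 0 < dl).

Lemma bbil_mul : bbil mul.
Proof.
split=> [a v v' x|a v x x'|]; first by rewrite mulSDl mulSZl.
  by rewrite mulSDr mulSZr.
exact: mulS_norm.
Qed.

Lemma blin_LY : blin (LY s_gt dl0 : V -> strip sg).
Proof. by split; [move=> a p q; exact: lift2_lin|exact: lift2_norm]. Qed.

Lemma blin_Lc : blin (Lc s_gt dl0 : V -> strip sg).
Proof. by split; [move=> a p q; exact: lift2_lin|exact: lift2_norm]. Qed.

Lemma blin_Ld : blin (Ld s_gt dl0 : V -> strip sg).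
Proof. by split; [move=> a p q; exact: lift2_lin|exact: lift2_norm]. Qed.

Lemma blin_SX1 : blin (@SX1 R sg).
Proof. by split; [move=> a g g'; exact: (SX_lin a g g').1|exists 4 => //; exact: SX1_norm]. Qed.

Lemma blin_SX2 : blin (@SX2 R sg).
Proof. by split; [move=> a g g'; exact: (SX_lin a g g').2|exists 4 => //; exact: SX2_norm]. Qed.

Lemma blin_SZ1 : blin (@SZ1 R sg).
Proof. by split; [move=> a g g'; exact: (SZ_lin a g g').1|exists 5 => //; exact: SZ1_norm]. Qed.

Lemma blin_SZ2 : blin (@SZ2 R sg).
Proof. by split; [move=> a g g'; exact: (SZ_lin a g g').2|exists 5 => //; exact: SZ2_norm]. Qed.

Lemma blin_trS z : blin (trS s_gt z).
Proof. by split; [move=> a u v; exact: trS_lin|exists 1 => // u; rewrite mul1r; exact: trS_norm]. Qed.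

(** The exact increment of [crT] under a perturbation of the domain, since [crT] is affine in its
    coefficients. *)
Definition varT (x : V) (g : strip sg * strip sg) : strip sg * strip sg :=
  (mul (Lc s_gt dl0 x) (SZ1 g) - mul (Ld s_gt dl0 x) (SX1 g),
   mul (Lc s_gt dl0 x) (SZ2 g) - mul (Ld s_gt dl0 x) (SX2 g)).

Lemma bbil_varT : bbil varT.
Proof.
have c L F := bbil_pre bbil_mul L F.
apply: bbil_pair; apply: bbil_D; [|apply: bbil_N| |apply: bbil_N].
- exact: c blin_Lc blin_SZ1.
- exact: c blin_Ld blin_SX1.
- exact: c blin_Lc blin_SZ2.
- exact: c blin_Ld blin_SX2.
Qed.

Variable u : V.

Definition varQ (x : V) : strip sg :=
  mul (Ld s_gt dl0 x) (LPx s_gt dl0 psi) - mul (Lc s_gt dl0 x) (LPz s_gt dl0 psi)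
  - gamma *: mul (LY s_gt dl0 x) (dS s_gt h dl0 u).

Lemma blin_varQ : blin varQ.
Proof.
apply: blin_D; last apply: blin_N; last apply: blin_Z.
  apply: blin_D; last apply: blin_N.
    exact: blin_comp (bbil_fixed _ bbil_mul) blin_Ld.
  exact: blin_comp (bbil_fixed _ bbil_mul) blin_Lc.
exact: blin_comp (bbil_fixed _ bbil_mul) blin_LY.
Qed.

(* Components: the solution g, the elevation Y, the product Y * c, and the constant 1. *)
Definition state : normedModType R := (((strip sg * strip sg) * strip sg) * strip sg * R)%type.

(** With primes for increments, (Y + Y')(d + d') = Y d + Y' d + (Y + Y') d'. The middle term belongs
    to [varQ], and the last takes Y + Y' from the state; so the quadratic dependence on the domain
    becomes linear in [x] and linear in the state. *)
Definition forcing (x : V) (X : state) : strip sg * strip sg :=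
  (X.2 *: varQ x - gamma *: mul X.1.1.2 (Ld s_gt dl0 x), 0) - varT x X.1.1.1.

Let p1 : blin (fun X : state => X.1) := blin_fst _ _.
Let p11 : blin (fun X : state => X.1.1) := blin_comp (blin_fst _ _) p1.
Let pg : blin (fun X : state => X.1.1.1) := blin_comp (blin_fst _ _) p11.
Let pY : blin (fun X : state => X.1.1.2) := blin_comp (blin_snd _ _) p11.
Let po : blin (fun X : state => X.1.2) := blin_comp (blin_snd _ _) p1.
Let pr : blin (fun X : state => X.2) := blin_snd _ _.

Lemma bbil_forcing : bbil forcing.
Proof.
apply: bbil_D; last by apply: bbil_N; exact: bbil_pre bbil_varT (blin_id _) pg.
apply: bbil_pair; last exact: bbil_0.
apply: bbil_D; first exact: bbil_pre (bbil_scale _) blin_varQ pr.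
apply: bbil_N; apply: (bbil_post (L := fun w => gamma *: w)); first exact: blin_Z (blin_id _).
exact: bbil_pre (bbil_flip bbil_mul) blin_Ld pY.
Qed.

Variable S : strip sg * strip sg -> strip sg * strip sg.
Hypothesis Sl : blin S.

(** The last component is 0 because the constant 1 is not perturbed; multiplying by it turns terms
    that do not contain the unknown into linear functions of the state. *)
Definition step (x : V) (X : state) : state :=
  (S (forcing x X), X.2 *: LY s_gt dl0 x,
   X.2 *: mul (LY s_gt dl0 x) (cS s_gt dl0 u) + mul X.1.1.2 (Lc s_gt dl0 x), 0).

Lemma bbil_step : bbil step.
Proof.
apply: bbil_pair; last exact: bbil_0.
apply: bbil_pair.
  apply: bbil_pair; first exact: bbil_post Sl bbil_forcing.
  exact: bbil_pre (bbil_scale _) blin_LY pr.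
apply: bbil_D; last exact: bbil_pre (bbil_flip bbil_mul) blin_Lc pY.
by apply: bbil_pre (bbil_scale _) _ pr; exact: blin_comp (bbil_fixed _ bbil_mul) blin_LY.
Qed.

Definition output (X : state) : sobolev sg := - trS s_gt 1 (gamma *: X.1.2 + SX2 X.1.1.1).

Lemma blin_output : blin output.
Proof.
apply: blin_N; apply: (blin_comp (blin_trS 1)); apply: blin_D; first exact: blin_Z po.
exact: blin_comp blin_SX2 pg.
Qed.

Definition base_state : state :=
  (S (rhs s_gt h gamma psi dl0 u), YS s_gt h dl0 u, mul (YS s_gt h dl0 u) (cS s_gt dl0 u), 1).

Definition solved_state (x : V) (g : strip sg * strip sg) : state :=
  (g, YS s_gt h dl0 (u + x), mul (YS s_gt h dl0 (u + x)) (cS s_gt dl0 (u + x)), 1).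

Lemma YS_add x : YS s_gt h dl0 (u + x) = YS s_gt h dl0 u + LY s_gt dl0 x.
Proof. by rewrite /YS (blin_add u x blin_LY) addrA. Qed.

Lemma cS_add x : cS s_gt dl0 (u + x) = cS s_gt dl0 u + Lc s_gt dl0 x.
Proof. exact: (blin_add u x blin_Lc). Qed.

Lemma dS_add x : dS s_gt h dl0 (u + x) = dS s_gt h dl0 u + Ld s_gt dl0 x.
Proof. by rewrite /dS (blin_add u x blin_Ld) addrA. Qed.

Lemma crT_add x g : crT s_gt (cS s_gt dl0 (u + x)) (dS s_gt h dl0 (u + x)) g =
  crT s_gt (cS s_gt dl0 u) (dS s_gt h dl0 u) g + varT x g.
Proof.
rewrite cS_add dS_add /crT /varT.
move: (cS s_gt dl0 u) (dS s_gt h dl0 u) (Lc s_gt dl0 x) (Ld s_gt dl0 x) => c d c' d'.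
have E (a b c0 e f : strip sg) : a + b + c0 - (e + f) = (a + c0 - e) + (b - f).
  by rewrite opprD (addrAC a) addrACA.
by rewrite !mulSDl !E.
Qed.

Lemma rhs_add x : rhs s_gt h gamma psi dl0 (u + x) = rhs s_gt h gamma psi dl0 u +
  (1 *: varQ x - gamma *: mul (YS s_gt h dl0 (u + x)) (Ld s_gt dl0 x), 0).
Proof.
rewrite /rhs /varQ dS_add cS_add YS_add scale1r.
move: (cS s_gt dl0 u) (dS s_gt h dl0 u) (YS s_gt h dl0 u) (Lc s_gt dl0 x) (Ld s_gt dl0 x) (LY s_gt dl0 x)
  (LPx s_gt dl0 psi) (LPz s_gt dl0 psi) => c d y c' d' y' v w.
have E (a a' b b' n1 n2 n3 : strip sg) : (a + a') - (b + b') - (n1 + n2 + n3) =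
    (a - b - n1) + ((a' - b' - n2) - n3).
  by rewrite (opprD b) (opprD (n1 + n2)) (opprD n1) (addrACA a) [LHS]addrA (addrACA (a - b)) -[LHS]addrA.
rewrite (mulSDr _ (y + y')) (mulSDl _ y y' d) !scalerDr (mulSDl _ d d') (mulSDl _ c c') E.
by apply: (congr2 pair); [|rewrite addr0].
Qed.

Hypothesis SK : forall g, S (crT s_gt (cS s_gt dl0 u) (dS s_gt h dl0 u) g) = g.

(** Applying the inverse at the base point to the perturbed equation, with the increments of
    operator and data on the right, gives the first component; the others are product expansions. *)
Lemma solved_state_step x g :
  crT s_gt (cS s_gt dl0 (u + x)) (dS s_gt h dl0 (u + x)) g = rhs s_gt h gamma psi dl0 (u + x) ->
  solved_state x g = base_state + step x (solved_state x g).
Proof.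
move=> Hg.
have Eg : g = S (rhs s_gt h gamma psi dl0 u) + S (forcing x (solved_state x g)).
  have SD a b : S (a + b) = S a + S b by exact: blin_add Sl.
  rewrite -SD -[LHS]SK; congr S; move: Hg; rewrite crT_add rhs_add /forcing /= => Hg.
  by rewrite addrA -Hg addrK.
have EY : YS s_gt h dl0 (u + x) = YS s_gt h dl0 u + 1 *: LY s_gt dl0 x by rewrite scale1r YS_add.
have Eo : mul (YS s_gt h dl0 (u + x)) (cS s_gt dl0 (u + x)) = mul (YS s_gt h dl0 u) (cS s_gt dl0 u) +
    (1 *: mul (LY s_gt dl0 x) (cS s_gt dl0 u) + mul (YS s_gt h dl0 (u + x)) (Lc s_gt dl0 x)).
  by rewrite cS_add scale1r (mulSDr _ (YS s_gt h dl0 (u + x))) {1}YS_add mulSDl addrA.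
have E1 : (1 : R) = 1 + 0 by rewrite addr0.
exact: (congr2 pair (congr2 pair (congr2 pair Eg EY) Eo) E1).
Qed.

End Linearization.

(** * Local uniformity of the straightening and the power series of G *)

Section Analyticity.
Context {R : realType} (h s : R) (s_gt : 1 < 2 * (s - 1)).
Notation sg := (s - 1).
Notation V := (sobolev s * sobolev s)%type.
Variables (gamma : R) (psi : sobolev s).

Lemma rv_bound (u : strip sg) x z : `|rv s_gt u x z| <= evb s_gt * `|u|.
Proof. by apply: le_trans (Re_le_cmod _) _; exact: cmod_evS. Qed.

Lemma rv_dS dl (dl0 : 0 < dl) (p : V) x z : rv s_gt (dS s_gt h dl0 p) x z = h + rv s_gt (Ld s_gt dl0 p) x z.
Proof. by rewrite /dS rvD rvZ /rv (evS_one s_gt x z) /= mulr1. Qed.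

(** Boundary values are evaluations of a lift, and evaluation is bounded on the strip space; the
    value 1 of the smoothing parameter is arbitrary. *)
Lemma sobolev_sup : exists2 K : R, 0 <= K & forall (p : V) x, `|p.1 x| + `|p.2 x| <= K * `|p|.
Proof.
have [_ [K K0 hK]] := blin_LY s_gt (@ltr01 R).
have e0 := evb_ge0 s_gt; exists (2 * (evb s_gt * K)) => [|p x]; first by rewrite !mulr_ge0.
have E1 := LY_top_val s_gt (@ltr01 R) p x; have E2 := LY_bot_val s_gt (@ltr01 R) p x.
have b z : `|rv s_gt (LY s_gt (@ltr01 R) p) x z| <= evb s_gt * K * `|p|.
  by apply: le_trans (rv_bound _ _ _) _; rewrite -mulrA ler_wpM2l.
have := lerD (b 1) (b 0); rewrite /rv E1 E2 => hb.
by rewrite (_ : 2 * (evb s_gt * K) * `|p| = evb s_gt * K * `|p| + evb s_gt * K * `|p|)//; ring.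
Qed.

Lemma near_base (p : V) (h0 : R) : 0 < h0 -> (forall x, h0 <= h - p.2 x + p.1 x) ->
  exists dl (dl0 : 0 < dl) (d : R), 0 < d /\ forall q : V, `|q| < d ->
    (forall x z, h0 / 4 <= rv s_gt (dS s_gt h dl0 (p + q)) x z) /\
    (forall x, 0 < h - (p + q).2 x + (p + q).1 x).
Proof.
move=> h00 hp; have [K K0 hK] := Ld_near s_gt.
have Kp0 : 0 < 2 * (K * `|p| + 1) by rewrite mulr_gt0// ltr_wpDl// mulr_ge0.
(* The error of [Ld_near] then takes at most h0 / 2 of the depth, the perturbation [q] at most h0 /
   4, and h0 / 4 remains. *)
pose dl := h0 / (2 * (K * `|p| + 1)); have dl0 : 0 < dl by rewrite divr_gt0.
have [_ [K1 K10 hK1]] := blin_Ld s_gt dl0; have [K2 K20 hK2] := sobolev_sup.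
have e0 := evb_ge0 s_gt; have e1 : 0 <= evb s_gt * K1 by exact: mulr_ge0.
have C0 : 0 < 4 * (evb s_gt * K1 + K2 + 1) by rewrite mulr_gt0// ltr_wpDl// addr_ge0.
exists dl, dl0, (h0 / (4 * (evb s_gt * K1 + K2 + 1))); split=> [|q qd]; first by rewrite divr_gt0.
rewrite ltr_pdivlMr// in qd.
have q0 := normr_ge0 q; have m1 := mulr_ge0 e1 q0; have m2 := mulr_ge0 K20 q0.
have Kp := mulr_ge0 K0 (normr_ge0 p).
split=> [x z|x].
  have b3 := ler_wpM2l e0 (hK1 q); rewrite mulrA in b3.
  rewrite rv_dS (blin_add p q (blin_Ld s_gt dl0)) rvD.
  exact: perturbed_depth (hK dl dl0 p x z) (rv_bound (Ld s_gt dl0 q) x z) b3 qd m2 q0 (hp x) (half_bound Kp h00).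
have -> : h - (p + q).2 x + (p + q).1 x = (h - p.2 x + p.1 x) + (q.1 x - q.2 x).
  by rewrite -[(p + q).2 x]/(p.2 x + q.2 x) -[(p + q).1 x]/(p.1 x + q.1 x); ring.
exact: perturbed_gap (hK2 q x) qd m1 m2 q0 (hp x).
Qed.

Lemma is_DN_unique (eta beta psi' : R -> R) (g1 g2 : sobolev sg) :
  is_DN h eta beta gamma psi' g1 -> is_DN h eta beta gamma psi' g2 -> g1 = g2.
Proof.
move=> [[phi P] H1] [_ H2]; apply/val_inj/funext => x.
exact: etrans (H1 phi P x) (esym (H2 phi P x)).
Qed.

(** The value 0 is taken only where the boundary value problem yields no element of the space, hence
    never on the admissible set. The definition does not mention [dl]. *)
Definition DN_map (p : V) : sobolev sg :=
  if pselect (exists g : sobolev sg, is_DN h p.1 p.2 gamma psi g) is left H then projT1 (cid H) else 0.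

Lemma DN_map_eq (p : V) (g : sobolev sg) : is_DN h p.1 p.2 gamma psi g -> DN_map p = g.
Proof.
move=> hg; rewrite /DN_map; case: pselect => [H|[]]; last by exists g.
exact: is_DN_unique (projT2 (cid H)) hg.
Qed.

(** The smoothing parameter depends on [p] but is the same for all nearby p + q: the coefficients
    are then affine in [q], which the expansion requires. *)
Lemma near_solution (p : V) : admissible h p -> exists dl (dl0 : 0 < dl) (d kap : R), [/\ 0 < d, 0 < kap,
  forall x z, kap <= rv s_gt (dS s_gt h dl0 p) x z &
  forall q : V, `|q| < d -> exists2 g,
    crT s_gt (cS s_gt dl0 (p + q)) (dS s_gt h dl0 (p + q)) g = rhs s_gt h gamma psi dl0 (p + q) &
    is_DN h (p + q).1 (p + q).2 gamma psi (DN_of s_gt h gamma dl0 (p + q) g)].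
Proof.
move=> [h0 h00 hp]; have [dl [dl0 [d [d0 hd]]]] := near_base h00 hp.
have k0 : 0 < h0 / 4 by rewrite divr_gt0.
exists dl, dl0, d, (h0 / 4); split=> //.
  by have [hk _] := hd 0 ltac:(by rewrite normr0); rewrite addr0 in hk.
move=> q /hd[hk sep].
have [_ surj] := crT_bijective k0 (herm_cS s_gt dl0 (p + q)) (herm_dS s_gt h dl0 (p + q)) hk.
have [g Hg] := surj (rhs s_gt h gamma psi dl0 (p + q)); exists g => //.
exact: solution_is_DN k0 hk sep Hg.
Qed.

Lemma DN_map_is_DN (p : V) : admissible h p -> is_DN h p.1 p.2 gamma psi (DN_map p).
Proof.
move=> /near_solution[dl [dl0 [d [kap [d0 _ _ hq]]]]].
have [g _] := hq 0 ltac:(by rewrite normr0); rewrite addr0 => hg.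
by rewrite (DN_map_eq hg).
Qed.

(** Each base point has its own straightening and its own series. Uniqueness of the normal trace
    shows that the series all represent the same map. *)
Lemma DN_map_analytic : analytic_on (@admissible R h s) DN_map.
Proof.
move=> u /near_solution[dl [dl0 [d [kap [d0 k0 hk hq]]]]].
have [[K K0 hK] surj] := crT_bijective k0 (herm_cS s_gt dl0 u) (herm_dS s_gt h dl0 u) hk.
have [S Sl SK] := blin_inverse (fun a x y => crT_lin s_gt a _ _ x y) K0 hK surj.
have [B1 B2 [b b0 Bb]] := bbil_step s_gt h gamma psi dl0 u Sl.
have [ll [cl cl0 lb]] := blin_output s_gt gamma.
apply: (@analytic_resolvent _ _ _ _ (step s_gt h gamma psi dl0 u S) (output s_gt gamma)
  (base_state s_gt h gamma psi dl0 u S) b cl B1 B2 b0 Bb ll cl0 lb DN_map u d d0) => x /hq[g Hg hg].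
exists (solved_state s_gt h dl0 u x g); first exact: solved_state_step Sl SK _ _ Hg.
exact: DN_map_eq.
Qed.

End Analyticity.

Theorem theorem1 (R : realType) (h : R) (h_gt0 : 0 < h)
    (s : R) (s_gt : 3 / 2 < s) (psi : sobolev s) (gamma : R) :
  exists G : sobolev s * sobolev s -> sobolev (s - 1),
    (forall p, admissible h p -> is_DN h p.1 p.2 gamma psi (G p)) /\
    analytic_on (@admissible R h s) G.
Proof.
have s_gt' : 1 < 2 * (s - 1) by lra.
by exists (DN_map h gamma psi); split; [move=> p; exact: DN_map_is_DN|exact: DN_map_analytic].
Qed.
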